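(* Let $\tau=(\tau_1,\dots,\tau_m)$ with $\tau_k\ge0$ be fixed (with $\tau_k>0$ and $\nu_k\neq0$ for at least one $k$), set $x=\frac1{\dim\mathfrak g}\sum_{k=1}^m\tau_kc_2(\nu_k)$, and let $u\in\mathfrak h_{\mathbb R}$ be a fixed regular element of the dominant Weyl chamber. As $\epsilon\to0$ with $N_k=\tau_k/\epsilon$ and $t=\sqrt{\frac{\epsilon}{x}}\,u$, the character measure $$p^{(N)}_\lambda(t)=\frac{m_\lambda(\{V_{\nu_k}\},\{N_k\})\,\chi_\lambda(e^t)}{\prod_k\chi_{\nu_k}(e^t)^{N_k}},$$ with $\lambda=\sqrt{\frac{x}{\epsilon}}\,b$, converges weakly to the measure $p(b,u)\,db_1\cdots db_r$ on the closed dominant Weyl chamber $\mathfrak h^*_{\ge0}$ with density $$p(b,u)=\frac{\sqrt{\det B}}{(2\pi)^{r/2}}\,\frac{\prod_{\alpha\in\Delta_+}(b,\alpha)}{\prod_{\alpha\in\Delta_+}(u,\alpha)}\sum_{w\in W}(-1)^{w}e^{(b,w(u))}\,e^{-\frac{(b,b)}2-\frac{(u,u)}2}.$$ That is, for every bounded continuous function $h$ on $\mathfrak h^*_{\ge0}$ and every sequence $\epsilon_n>0$, $\epsilon_n\to0$, such that $N_k=\tau_k/\epsilon_n$ are integers for all $k,n$, $$\sum_\lambda h\Big(\sqrt{\tfrac{\epsilon_n}{x}}\,\lambda\Big)\,p^{(N)}_\lambda\Big(\sqrt{\tfrac{\epsilon_n}{x}}\,u\Big)\ \longrightarrow\ \int_{\mathfrak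 h^*_{\ge0}}h(b)\,p(b,u)\,db_1\cdots db_r .$$
   Context: $\mathfrak g$ is a simple (complex, finite-dimensional) Lie algebra of rank $r$; $\mathfrak h_{\mathbb R}$ is the Cartan subalgebra of its split real form; $(\cdot,\cdot)$ is the Killing form, used to identify $\mathfrak h_{\mathbb R}$ with $\mathfrak h^*_{\mathbb R}$. $\alpha_1,\dots,\alpha_r$ are the simple roots, $\Delta_+$ the positive roots, $W$ the Weyl group, $(-1)^w=(-1)^{l(w)}$ with $l(w)$ the length of $w\in W$. Elements are written in the basis of simple roots, $b=\sum_ab_a\alpha_a$, and $db_1\cdots db_r$ is Lebesgue measure in these coordinates; $B_{ab}=(\alpha_a,\alpha_b)$. $\mathfrak h^*_{\ge0}=\{b:(b,\alpha_a)\ge0,\ a=1,\dots,r\}$ is the closed dominant Weyl chamber. An element is regular if its stabilizer in $W$ is trivial. $V_\lambda$ is the irreducible finite-dimensional module with highest weight $\lambda$, $\chi_\lambda(e^y)=\mathrm{tr}_{V_\lambda}(e^y)=\sum_\mu\dim V_\lambda(\mu)\,e^{(\mu,y)}$. $\nu_1,\dots,\nu_m$ are fixed dominant integral weights; $m_\lambda(\{V_{\nu_k}\},\{N_k\})$ is the multiplicity of $V_\lambda$ in $\bigotimes_{k=1}^mV_{\nu_k}^{\otimes N_k}$; the sum over $\lambda$ runs over highest weights of irreducible components of this tensor product. $c_2(\nu)$ is the scalar by which the Casimir element $c_2=\sum_{i,j}Q^{ij}e_ie_j$ acts on $V_\nu$, where $(e_i)$ is a basis of $\mathfrak g$, $Q_{ij}=\mathrm{tr}_{\mathrm{ad}}(e_ie_j)$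 is the Killing form and $(Q^{ij})$ is its inverse matrix. *)

(* Defs.v *)
(* Conventions (R is any realType and the complex numbers are R[i]).
   - The Cartan subalgebra h and its dual are identified by the Killing form
     (.,.): a weight or root mu is an element of h, acting by
     h |-> (mu, h).  After the choice of simple roots alpha_1, ..., alpha_r, an
     element b = sum_a b_a alpha_a of the real form h_R = h_R^* (the real span
     of the roots) is the row vector of its coordinates b_a.
   - A finite-dimensional module is a matrix representation acting on column
     vectors. *)
From HB Require Import structures.
From mathcomp Require Import all_boot all_order all_algebra.
From mathcomp Require Import complex mxtens ring.
From mathcomp Require Import all_classical all_reals all_analysis.

Set Implicit Arguments.
Unset Strict Implicit.
Unset Printing Implicit Defensive.

Import Order.TTheory GRing.Theory Num.Theory.
Import numFieldNormedType.Exports.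

Local Open Scope classical_set_scope.
Local Open Scope ring_scope.
Local Open Scope complex_scope.

HB.mixin Record Vector_isLieAlgebra (K : fieldType) L of Vector K L := {
  lie : L -> L -> L;
  lie_linearl : forall (c : K) (x y z : L),
    lie (c *: x + y) z = c *: lie x z + lie y z;
  lie_linearr : forall (c : K) (x y z : L),
    lie z (c *: x + y) = c *: lie z x + lie z y;
  liexx : forall x : L, lie x x = 0;
  lie_jacobi : forall x y z : L,
    lie x (lie y z) + lie y (lie z x) + lie z (lie x y) = 0
}.

#[short(type="lieAlgType")]
HB.structure Definition LieAlgebra (K : fieldType) :=
  {L of Vector K L & Vector_isLieAlgebra K L}.

Section LieAlgebras.
Variables (K : fieldType) (L : lieAlgType K).

Definition simple_lie : Prop :=
  (exists x y : L, lie x y != 0) /\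
  (forall I : {vspace L}, (forall x y : L, y \in I -> lie x y \in I) ->
     I = 0%VS \/ I = fullv).

Definition ad_mx (x : L) : 'M[K]_(\dim {:L}) :=
  \matrix_(i, j) coord (vbasis {:L}) i (lie x (vbasis {:L})`_j).

Definition killing (x y : L) : K := \tr (ad_mx x *m ad_mx y).

(* Cartan subalgebra of a semisimple Lie algebra: abelian, equal to its own
   centralizer, and acting diagonalizably in the adjoint representation. *)
Definition cartan_subalgebra (H : {vspace L}) : Prop :=
  [/\ {in H &, forall x y, lie x y = 0},
      (forall x, {in H, forall h, lie h x = 0} -> x \in H) &
      {in H, forall h, exists2 e : seq L, basis_of fullv e &
         {in e, forall v, exists c : K, lie h v = c *: v}}].

Definition in_root_space (H : {vspace L}) (al x : L) : Prop :=
  {in H, forall h, lie h x = killing al h *: x}.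

Definition is_root (H : {vspace L}) (al : L) : Prop :=
  [/\ al \in H, al != 0 & exists2 x, x != 0 & in_root_space H al x].

(* basis_of H a forces r to be the rank of the Lie algebra. *)
Definition simple_roots (H : {vspace L}) r (a : r.-tuple L) : Prop :=
  [/\ basis_of H a, (forall i : 'I_r, is_root H (tnth a i)) &
      forall al, is_root H al -> exists k : 'I_r -> nat,
        al = \sum_i tnth a i *+ k i \/ al = - \sum_i tnth a i *+ k i].

Record rep := Rep {
  rdim : nat;
  ract :> L -> 'M[K]_rdim;
  ract_linear : forall (c : K) (x y : L),
    ract (c *: x + y) = c *: ract x + ract y;
  ract_lie : forall x y : L,
    ract (lie x y) = ract x *m ract y - ract y *m ract x
}.

Definition irreducible_rep (M : rep) : Prop :=
  (0 < rdim M)%N /\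
  (forall U : {vspace 'cV[K]_(rdim M)},
     (forall x v, v \in U -> M x *m v \in U) -> U = 0%VS \/ U = fullv).

Definition rep_iso (M N : rep) : Prop :=
  exists (P : 'M[K]_(rdim M, rdim N)) (Q : 'M[K]_(rdim N, rdim M)),
    [/\ P *m Q = 1%:M, Q *m P = 1%:M & forall x, M x *m P = P *m N x].

Lemma trivial_act_linear n (c : K) (x y : L) :
  (0 : 'M[K]_n) = c *: (0 : 'M[K]_n) + 0.
Proof. by rewrite scaler0 addr0. Qed.

Lemma trivial_act_lie n (x y : L) :
  (0 : 'M[K]_n) = (0 : 'M[K]_n) *m 0 - 0 *m (0 : 'M[K]_n).
Proof. by rewrite mulmx0 subr0. Qed.

Definition trivial_rep (n : nat) : rep :=
  @Rep n (fun=> 0) (@trivial_act_linear n) (@trivial_act_lie n).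

Section TwoReps.
Variables M N : rep.

Definition dsum_act (x : L) : 'M[K]_(rdim M + rdim N) :=
  block_mx (M x) 0 0 (N x).

Lemma dsum_act_linear (c : K) (x y : L) :
  dsum_act (c *: x + y) = c *: dsum_act x + dsum_act y.
Proof.
by rewrite /dsum_act !ract_linear scale_block_mx add_block_mx !scaler0 !addr0.
Qed.

Lemma dsum_act_lie (x y : L) :
  dsum_act (lie x y) = dsum_act x *m dsum_act y - dsum_act y *m dsum_act x.
Proof.
rewrite /dsum_act !ract_lie !mulmx_block opp_block_mx add_block_mx.
by rewrite !mulmx0 !mul0mx !addr0 !add0r !oppr0.
Qed.

Definition dsum_rep : rep := Rep dsum_act_linear dsum_act_lie.

Definition tens_act (x : L) : 'M[K]_(rdim M * rdim N) :=
  tensmx (M x) 1%:M + tensmx 1%:M (N x).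

Lemma tens_act_linear (c : K) (x y : L) :
  tens_act (c *: x + y) = c *: tens_act x + tens_act y.
Proof.
rewrite /tens_act !ract_linear; apply/matrixP => i j; rewrite !mxE.
by ring.
Qed.

Lemma tens_act_lie (x y : L) :
  tens_act (lie x y) = tens_act x *m tens_act y - tens_act y *m tens_act x.
Proof.
have tDl m n (A B : 'M[K]_m) (C : 'M[K]_n) :
    tensmx (A - B) C = tensmx A C - tensmx B C.
  by apply/matrixP => i j; rewrite !mxE mulrBl.
have tDr m n (A B : 'M[K]_m) (C : 'M[K]_n) :
    tensmx C (A - B) = tensmx C A - tensmx C B.
  by apply/matrixP => i j; rewrite !mxE mulrBr.
rewrite /tens_act !ract_lie tDl tDr !mulmxDl !mulmxDr !tensmx_mul.
rewrite !mulmx1 !mul1mx; apply/matrixP => i j; rewrite !mxE.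
by ring.
Qed.

Definition tens_rep : rep := Rep tens_act_linear tens_act_lie.

End TwoReps.

Definition tens_pow (M : rep) (n : nat) : rep :=
  iter n (tens_rep M) (trivial_rep 1).

(* The number of summands isomorphic to V in a decomposition of M into a direct
   sum of irreducibles. *)
Definition is_multiplicity (V M : rep) (k : nat) : Prop :=
  exists s : seq rep,
    [/\ all (fun X => `[< irreducible_rep X >]) s,
        rep_iso M (\big[dsum_rep/trivial_rep 0]_(X <- s) X) &
        count (fun X => `[< rep_iso X V >]) s = k].

Definition multiplicity (V M : rep) : nat :=
  xget 0%N [set k | is_multiplicity V M k].

Definition casimir_mx (M : rep) : 'M[K]_(rdim M) :=
  let e := vbasis {:L} in
  let Q := \matrix_(i, j) killing e`_i e`_j : 'M[K]_(\dim {:L}) in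
  \sum_i \sum_j invmx Q i j *: (M e`_i *m M e`_j).

End LieAlgebras.

Arguments trivial_rep {K L} n.

Section ComplexLie.
Variables (R : realType) (g : lieAlgType R[i]) (H : {vspace g}).
Variables (r : nat) (a : r.-tuple g).

Definition rvec (b : 'rV[R]_r) : g := \sum_i (b 0 i)%:C *: tnth a i.

(* The Killing form is real-valued on the real span of the roots. *)
Definition ip (b c : 'rV[R]_r) : R := complex.Re (killing (rvec b) (rvec c)).

Definition sroot (i : 'I_r) : 'rV[R]_r := delta_mx 0 i.

Definition gram_mx : 'M[R]_r := \matrix_(i, j) ip (sroot i) (sroot j).

Definition pos_roots : set 'rV[R]_r :=
  [set al | is_root H (rvec al) /\ forall i, 0 <= al 0 i].

(* b |-> b - 2 (b, alpha_i) / (alpha_i, alpha_i) alpha_i; the Weyl group acts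
   on row vectors by right multiplication. *)
Definition srefl (i : 'I_r) : 'M[R]_r :=
  lin1_mx (fun b => b - (2 * ip b (sroot i) / ip (sroot i) (sroot i)) *: sroot i).

Definition weyl_word (s : seq 'I_r) : 'M[R]_r :=
  \big[mulmx/1%:M]_(i <- s) srefl i.

Definition weyl_group : set 'M[R]_r := range weyl_word.

Definition weyl_length (w : 'M[R]_r) : nat :=
  xget 0%N [set n | (exists2 s, weyl_word s = w & size s = n) /\
                    forall s, weyl_word s = w -> (n <= size s)%N].

Definition regular (b : 'rV[R]_r) : Prop :=
  forall w, weyl_group w -> b *m w = b -> w = 1%:M.

Definition dominant : set 'rV[R]_r := [set b | forall i, 0 <= ip b (sroot i)].

Definition dominant_integral : set 'rV[R]_r :=
  [set lam | forall i, exists k : nat,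
     2 * ip lam (sroot i) / ip (sroot i) (sroot i) = k%:R].

Definition irreducible_hw (V : rep g) (lam : 'rV[R]_r) : Prop :=
  irreducible_rep V /\
  exists v : 'cV[R[i]]_(rdim V),
    [/\ v != 0, {in H, forall h, V h *m v = killing (rvec lam) h *: v} &
        forall al x, pos_roots al -> in_root_space H (rvec al) x ->
          V x *m v = 0].

Definition weight_space (M : rep g) (mu : 'rV[R]_r)
    : {vspace 'cV[R[i]]_(rdim M)} :=
  (\bigcap_(h <- vbasis H)
     lker (linfun (mulmx (M h - (killing (rvec mu) h)%:M))))%VS.

Definition rchar (M : rep g) (y : 'rV[R]_r) : R :=
  \sum_(mu \in [set: 'rV[R]_r]) (\dim (weight_space M mu))%:R * expR (ip mu y).

Definition casimir_scalar (M : rep g) : R :=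
  xget 0 [set c : R | casimir_mx M = (c%:C)%:M].

Section Measures.
Variables (V : 'rV[R]_r -> rep g) (m : nat) (nu : 'I_m -> 'rV[R]_r).

Definition tensor_product (N : 'I_m -> nat) : rep g :=
  \big[@tens_rep _ g/trivial_rep 1]_(k < m) tens_pow (V (nu k)) (N k).

Definition components (N : 'I_m -> nat) : set 'rV[R]_r :=
  [set lam | dominant_integral lam /\
             multiplicity (V lam) (tensor_product N) != 0%N].

Definition char_measure (N : 'I_m -> nat) (lam t : 'rV[R]_r) : R :=
  (multiplicity (V lam) (tensor_product N))%:R * rchar (V lam) t
  / \prod_(k < m) rchar (V (nu k)) t ^+ N k.

Definition casimir_mean (tau : 'I_m -> R) : R :=
  (\dim {:g})%:R^-1 * \sum_(k < m) tau k * casimir_scalar (V (nu k)).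

End Measures.

Definition limit_density (b u : 'rV[R]_r) : R :=
  Num.sqrt (\det gram_mx) / (2 * pi) `^ (r%:R / 2)
  * ((\big[*%R/1]_(al \in pos_roots) ip b al)
     / (\big[*%R/1]_(al \in pos_roots) ip u al))
  * (\sum_(w \in weyl_group) (-1) ^+ weyl_length w * expR (ip b (u *m w)))
  * expR (- (ip b b / 2) - ip u u / 2).

End ComplexLie.

(* Lebesgue integral over R^r with respect to db_1 ... db_r, written as an
   iterated integral. *)
Fixpoint integral_rV (R : realType) (r : nat) :
    ('rV[R]_r -> \bar R) -> \bar R :=
  match r with
  | 0 => fun f => f 0
  | r'.+1 => fun f => (\int[@lebesgue_measure R]_x
      integral_rV (fun b : 'rV[R]_r' => f (row_mx (x%:M : 'M[R]_1) b)))%E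
  end.

(* Main.v *)
(* Since chi_lambda times the Weyl denominator is the alternating sum of the exponentials
   e^(w(lambda + rho)), the tensor product character times the Weyl denominator is the
   sum of these alternating sums over the irreducible components.  Hence the character
   measure, shifted by rho and symmetrized over W, has an explicit Laplace transform at
   s: a sum over w in W of the ratios, between the points t + s w^-1 and t, of the Weyl
   denominator times the tensor product character.  The denominators are asymptotic to
   products of roots.  The weights of V_nu have mean zero and, as the Killing form is up
   to scalars the only invariant form, covariance c_2(nu) / dim g times the Killing form,
   so the characters tend to Gaussians as in the central limit theorem.  The limit is the
   Laplace transform of the W-invariant extension of p(b, u).  Convergence of all
   exponential moments passes to trigonometric polynomials by power series, and these
   approximate the W-invariant extension of h, with an error controlled by hyperbolic
   cosines. *)
Require Import Defs.
From HB Require Import structures.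
From mathcomp Require Import all_boot all_order all_algebra.
From mathcomp Require Import complex mxtens ring lra zify.
From mathcomp Require Import all_classical all_reals all_analysis measurable_realfun.

Set Implicit Arguments.
Unset Strict Implicit.
Unset Printing Implicit Defensive.

Import Order.TTheory GRing.Theory Num.Theory.
Import numFieldNormedType.Exports.

Local Open Scope classical_set_scope.
Local Open Scope ring_scope.
Local Open Scope complex_scope.

(** * Lie algebras and their representations *)

(** Nothing is given beyond simplicity, a Cartan subalgebra and a base of roots, so the structure
    theory is rebuilt in the form that serves the limit. Two choices keep it short. Every module
    that occurs has a basis of weight vectors with real weights; for such modules complete
    reducibility follows by pairing a module with its dual, Casimir eigenvalues excluding proper
    submodules. And characters are not formal series: they are tested against arbitrary functions of
    the weight, and multiplication by the Weyl denominator becomes a difference operator. The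
    character formula is then an identity between finitely supported functionals, checked on
    indicators of points, and Freudenthal's recursion says that the numerator is supported on a
    sphere. On the analytic side the symmetrized measures are positive, but the limit density is
    treated as signed, so estimates on it go through its absolute value. *)

Section LieBasics.
Variables (K : fieldType) (g : lieAlgType K).
Implicit Types x y z : g.

Lemma lieDl x y z : lie (x + y) z = lie x z + lie y z.
Proof. by rewrite -[x in lie (x + _)]scale1r lie_linearl scale1r. Qed.

Lemma lieDr x y z : lie z (x + y) = lie z x + lie z y.
Proof. by rewrite -[x in lie _ (x + _)]scale1r lie_linearr scale1r. Qed.

Lemma lie0l x : lie 0 x = 0.
Proof. by have /(congr1 (fun u => u - lie 0 x)) := lieDl 0 0 x; rewrite addr0 addrK subrr. Qed.

Lemma lie0r x : lie x 0 = 0.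
Proof. by have /(congr1 (fun u => u - lie x 0)) := lieDr 0 0 x; rewrite addr0 addrK subrr. Qed.

Lemma lieZl c x y : lie (c *: x) y = c *: lie x y.
Proof. by rewrite -[c *: x]addr0 lie_linearl lie0l addr0. Qed.

Lemma lieZr c x y : lie y (c *: x) = c *: lie y x.
Proof. by rewrite -[c *: x]addr0 lie_linearr lie0r addr0. Qed.

Lemma lieNr x y : lie y (- x) = - lie y x.
Proof. by rewrite -scaleN1r lieZr scaleN1r. Qed.

Lemma lieC x y : lie x y = - lie y x.
Proof.
apply/eqP; rewrite -addr_eq0; apply/eqP.
by have := liexx (x + y); rewrite lieDl !lieDr !liexx add0r addr0.
Qed.

Lemma lie_sumr I (s : seq I) (P : pred I) (F : I -> g) y :
  lie y (\sum_(i <- s | P i) F i) = \sum_(i <- s | P i) lie y (F i).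
Proof. by apply: (big_morph (lie y) (fun u v => lieDr u v y) (lie0r y)). Qed.

Lemma lie_lie x y z : lie x (lie y z) = lie (lie x y) z + lie y (lie x z).
Proof.
have /eqP := lie_jacobi x y z; rewrite -addrA addr_eq0 => /eqP ->.
by rewrite opprD addrC -lieC (lieC z x) lieNr opprK.
Qed.

Definition ccol (y : g) : 'cV[K]_(\dim {:g}) := \col_i coord (vbasis {:g}) i y.

Lemma ccol_linear c x y : ccol (c *: x + y) = c *: ccol x + ccol y.
Proof. by apply/colP => i; rewrite !mxE linearP. Qed.

Lemma ccolD x y : ccol (x + y) = ccol x + ccol y.
Proof. by apply/colP => i; rewrite !mxE linearD. Qed.

Lemma ccolZ c x : ccol (c *: x) = c *: ccol x.
Proof. by apply/colP => i; rewrite !mxE linearZ. Qed.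

Definition ofcol (v : 'cV[K]_(\dim {:g})) : g := \sum_i v i 0 *: (vbasis {:g})`_i.

Lemma ccolK : cancel ccol ofcol.
Proof.
move=> y; rewrite /ofcol [RHS](coord_vbasis (memvf y)).
by apply: eq_bigr => i _; rewrite mxE.
Qed.

Lemma ofcolK : cancel ofcol ccol.
Proof.
move=> v; apply/colP => i; rewrite mxE /ofcol linear_sum /=.
rewrite (bigD1 i) //= linearZ /= coord_free ?(basis_free (vbasisP _)) //.
rewrite eqxx mulr1 big1 ?addr0 // => j ji.
by rewrite linearZ /= coord_free ?(basis_free (vbasisP _)) // (negPf ji) mulr0.
Qed.

Lemma ccol_inj : injective ccol. Proof. exact: can_inj ccolK. Qed.

Lemma ad_ccol x y : ad_mx x *m ccol y = ccol (lie x y).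
Proof.
apply/colP => i; rewrite !mxE [in RHS](coord_vbasis (memvf y)) lie_sumr linear_sum /=.
by apply: eq_bigr => j _; rewrite !mxE lieZr linearZ mulrC.
Qed.

Lemma mx_ccolP (A B : 'M[K]_(\dim {:g})) :
  (forall y, A *m ccol y = B *m ccol y) -> A = B.
Proof.
move=> AB; apply/matrixP => i j; have := AB (ofcol (delta_mx j 0)).
by rewrite ofcolK -!colE => /colP/(_ i); rewrite !mxE.
Qed.

Lemma ad_mx_linear c x y : ad_mx (c *: x + y) = c *: ad_mx x + ad_mx y.
Proof.
by apply: mx_ccolP => z; rewrite mulmxDl -scalemxAl !ad_ccol lie_linearl ccol_linear.
Qed.

Lemma ad_mx_lie x y : ad_mx (lie x y) = ad_mx x *m ad_mx y - ad_mx y *m ad_mx x.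
Proof.
apply: mx_ccolP => z; rewrite mulmxBl -!mulmxA !ad_ccol.
by rewrite (lie_lie x y z) ccolD addrK.
Qed.

Definition ad_rep : rep g := Rep ad_mx_linear ad_mx_lie.

Section RepBasics.
Variable M : rep g.

Lemma ractD x y : M (x + y) = M x + M y.
Proof. by rewrite -[x in LHS]scale1r ract_linear scale1r. Qed.
Lemma ract0 : M 0 = 0.
Proof. by have := ractD 0 0; rewrite addr0 => /eqP; rewrite addrC -subr_eq subrr => /eqP <-. Qed.
Lemma ractZ c x : M (c *: x) = c *: M x.
Proof. by rewrite -[c *: x]addr0 ract_linear ract0 addr0. Qed.
Lemma ractN x : M (- x) = - M x.
Proof. by rewrite -scaleN1r ractZ scaleN1r. Qed.
Lemma ract_sum I (s : seq I) (P : pred I) (F : I -> g) :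
  M (\sum_(i <- s | P i) F i) = \sum_(i <- s | P i) M (F i).
Proof. exact: (big_morph M ractD ract0). Qed.
End RepBasics.

Lemma ad_mxD x y : ad_mx (x + y) = ad_mx x + ad_mx y.
Proof. exact: (ractD ad_rep). Qed.
Lemma ad_mxZ c x : ad_mx (c *: x) = c *: ad_mx x.
Proof. exact: (ractZ ad_rep). Qed.
Lemma ad_mx_sum I (s : seq I) (P : pred I) (F : I -> g) :
  ad_mx (\sum_(i <- s | P i) F i) = \sum_(i <- s | P i) ad_mx (F i).
Proof. exact: (ract_sum ad_rep). Qed.

Lemma killingE x y : killing x y = \tr (ad_mx x *m ad_mx y).
Proof. by []. Qed.

Lemma killingC x y : killing x y = killing y x.
Proof. exact: mxtrace_mulC. Qed.

Lemma killingDl x y z : killing (x + y) z = killing x z + killing y z.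
Proof. by rewrite /killing ad_mxD mulmxDl mxtraceD. Qed.
Lemma killingZl c x y : killing (c *: x) y = c * killing x y.
Proof. by rewrite /killing ad_mxZ -scalemxAl mxtraceZ. Qed.
Lemma killingDr x y z : killing z (x + y) = killing z x + killing z y.
Proof. by rewrite killingC killingDl !(killingC z). Qed.
Lemma killingZr c x y : killing y (c *: x) = c * killing y x.
Proof. by rewrite killingC killingZl (killingC x). Qed.
Lemma killing0l x : killing 0 x = 0.
Proof. by rewrite -(scale0r 0) killingZl mul0r. Qed.
Lemma killing0r x : killing x 0 = 0.
Proof. by rewrite killingC killing0l. Qed.
Lemma killingNl x y : killing (- x) y = - killing x y.
Proof. by rewrite -scaleN1r killingZl mulN1r. Qed.
Lemma killingNr x y : killing y (- x) = - killing y x.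
Proof. by rewrite killingC killingNl killingC. Qed.
Lemma killing_suml I (s : seq I) (P : pred I) (F : I -> g) y :
  killing (\sum_(i <- s | P i) F i) y = \sum_(i <- s | P i) killing (F i) y.
Proof. by apply: (big_morph (fun u => killing u y)) => [u v|]; rewrite ?killingDl ?killing0l. Qed.
Lemma killing_sumr I (s : seq I) (P : pred I) (F : I -> g) y :
  killing y (\sum_(i <- s | P i) F i) = \sum_(i <- s | P i) killing y (F i).
Proof. by apply: (big_morph (killing y)) => [u v|]; rewrite ?killingDr ?killing0r. Qed.

Lemma trace_form_inv (M : rep g) x y z :
  \tr (M (lie x y) *m M z) = \tr (M x *m M (lie y z)).
Proof.
rewrite !ract_lie mulmxBl mulmxBr !raddfB /= -!mulmxA; congr (_ - _).
by rewrite mxtrace_mulC -mulmxA.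
Qed.

Lemma killing_inv x y z : killing (lie x y) z = killing x (lie y z).
Proof. exact: (trace_form_inv ad_rep). Qed.

End LieBasics.

(** * Representations of sl2 *)

Section Sl2.
Variables (K : numFieldType) (V : lmodType K) (e f : {linear V -> V}).
Let h v := e (f v) - f (e v).
Hypothesis he : forall v, h (e v) = e (h v) + 2 *: e v.
Hypothesis hf : forall v, h (f v) = f (h v) - 2 *: f v.

Lemma sl2_h_iterf c v k : h v = c *: v -> h (iter k f v) = (c - (2 * k)%:R) *: iter k f v.
Proof.
move=> hv; elim: k => [|k IH] /=; first by rewrite muln0 subr0.
rewrite hf IH linearZ /= -scalerBl; congr (_ *: _).
by rewrite mulnS natrD; ring.
Qed.

(** The ladder formula. The term [f^(k+1) (e v)] is kept because [v] need not be a highest weight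
    vector; [sl2_weight_lt] uses it below the top of the ladder. *)
Lemma sl2_e_iterf c v k : h v = c *: v ->
  e (iter k.+1 f v) = iter k.+1 f (e v) + (k.+1%:R * (c - k%:R)) *: iter k f v.
Proof.
move=> hv; elim: k => [|k IH].
  rewrite /= mul1r subr0 -hv /h; by rewrite addrC subrK.
rewrite iterS -[LHS](subrK (f (e (iter k.+1 f v)))) -/(h _) (sl2_h_iterf _ hv) IH.
rewrite linearD linearZ /= addrCA; congr (_ + _); rewrite -scalerDl; congr (_ *: _).
rewrite natrM -addn1 -addn2 !natrD; ring.
Qed.

(** Induction on the number of applications of [e] that kill [v]. If [e v = 0], the ladder formula
    at the last nonzero [f^n v] gives [c = n], and [n < N]. Otherwise [e v] has weight [c + 2] and
    is killed by one more power of [f], and the bound on [c + 2] gives the one on [c]. *)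
Lemma sl2_weight_lt c v N m : v != 0 -> h v = c *: v -> iter N f v = 0 ->
  iter m e v = 0 -> exists2 n : int, c = n%:~R & n < N%:Z.
Proof.
elim: m c v N => [|m IH] c v N v0 hv fN em; first by move: v0; rewrite [v]em eqxx.
have [ev0|ev0] := eqVneq (e v) 0.
  have exN : exists n, iter n f v == 0 by exists N; apply/eqP.
  have := ex_minnP exN; case=> -[|n] /eqP fn nmin; first by rewrite /= in fn; rewrite fn eqxx in v0.
  have := sl2_e_iterf n hv; rewrite fn ev0 !linear0.
  have -> : iter n.+1 f 0 = 0 by elim: n.+1 => //= k ->; rewrite linear0.
  rewrite add0r => /esym/eqP; rewrite scaler_eq0 => /orP[|/eqP fn0].
    rewrite mulf_eq0 pnatr_eq0 /= subr_eq0 => /eqP ->; exists n%:Z => //.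
    by rewrite ltz_nat nmin //; apply/eqP.
  by have := nmin n; rewrite fn0 eqxx ltnn => /(_ isT).
case: N fN => [|N] fN; first by rewrite /= in fN; rewrite fN eqxx in v0.
(* The ladder formula makes [f^(N+1) (e v)] a multiple of [f^N v], and one further [f] kills it. *)
have fe : iter N.+2 f (e v) = 0.
  have := sl2_e_iterf N hv; rewrite fN linear0 => /esym/eqP.
  rewrite addr_eq0 => /eqP fe; rewrite iterS fe linearN linearZ /= -iterS fN.
  by rewrite scaler0 oppr0.
have [] := IH (c + 2) (e v) N.+2 ev0 _ fe _.
- by rewrite he hv linearZ /= -scalerDl.
- by rewrite -iterSr.
move=> n cn nN; exists (n - 2); first by rewrite rmorphB /= -cn addrK.
by move: nN; lia.
Qed.

End Sl2.

(** A subspace of maximal dimension inside [P] is all of [P]. Radicals, eigenspaces and stabilizers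
    given by a condition on vectors thus become subspaces, to which simplicity or irreducibility
    applies. *)
Lemma vspace_of_predicate (K : fieldType) (V : vectType K) (P : V -> Prop) :
  P 0 -> (forall c x y, P x -> P y -> P (c *: x + y)) ->
  exists U : {vspace V}, forall x, x \in U <-> P x.
Proof.
move=> P0 PL.
pose Q n := `[< exists U : {vspace V}, (forall x, x \in U -> P x) /\ \dim U = n >].
have exQ : exists n, Q n.
  exists 0%N; apply/asboolP; exists 0%VS; split; last by rewrite dimv0.
  by move=> x; rewrite memv0 => /eqP ->.
have Qle n : Q n -> (n <= \dim {:V})%N.
  by move=> /asboolP[U [_ <-]]; apply: dimvS; apply: subvf.
have [n /asboolP[U [UP Un]] nmax] := ex_maxnP exQ Qle.
exists U => x; split; first exact: UP.
move=> Px; have /nmax : Q (\dim (U + <[x]>)%VS).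
  apply/asboolP; exists (U + <[x]>)%VS; split => // y /memv_addP[u uU [w /vlineP[c ->] ->]].
  by rewrite addrC; apply: PL => //; apply: UP.
rewrite -Un => dle.
have /eqP -> : (U == U + <[x]>)%VS by rewrite eqEdim addvSl.
by rewrite memvE addvSr.
Qed.

(** * The Cartan subalgebra and nondegeneracy of the Killing form *)

Section Cartan.
Variables (K : numFieldType) (g : lieAlgType K) (H : {vspace g}).
Variables (r : nat) (a : r.-tuple g).
Hypothesis simp : simple_lie g.
Hypothesis cart : cartan_subalgebra H.
Hypothesis sroots : simple_roots H a.
Local Notation n := (\dim {:g}).

Let aH i : tnth a i \in H.
Proof. by have [/basis_mem + _ _] := sroots; apply; apply: mem_tnth. Qed.

Let afree : free a.
Proof. by have [/basis_free ? _ _] := sroots. Qed.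

Lemma sroot_lin_inj (c d : 'I_r -> K) :
  \sum_i c i *: tnth a i = \sum_i d i *: tnth a i -> c =1 d.
Proof.
have E (f : 'I_r -> K) : \sum_i f i *: tnth a i = \sum_i f i *: a`_i.
  by apply: eq_bigr => i _; rewrite (tnth_nth 0).
rewrite !E => cd i; have := congr1 (coord a i) cd.
by rewrite !coord_sum_free.
Qed.

Lemma cartan_coord h : h \in H -> exists c : 'I_r -> K, h = \sum_i c i *: tnth a i.
Proof.
move=> hH; have [ab _ _] := sroots; exists (fun i => coord a i h).
rewrite [LHS](coord_basis ab) //.
by apply: eq_bigr => i _; rewrite (tnth_nth 0).
Qed.

Let lieHH : {in H &, forall x y, lie x y = 0}. Proof. by case: cart. Qed.
Let centH x : {in H, forall h, lie h x = 0} -> x \in H. Proof. by case: cart => _ /(_ x). Qed.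

(** In rank zero [H] would be 0; every element would centralize it, hence lie in it, and all
    brackets would vanish. *)
Lemma exists_sroot : exists i0 : 'I_r, true.
Proof.
case: r a sroots => [|k] b [bH _ _]; last by exists ord0.
have H0 h : h \in H -> h = 0.
  move=> hH; rewrite [LHS](coord_basis bH) //.
  by rewrite big_ord0.
have [[x [y xy]] _] := simp; move: xy.
have -> : x = 0 by apply/H0/centH => h /H0 ->; exact: lie0l.
by rewrite lie0l eqxx.
Qed.

(* If the Killing form vanished, every nonzero element of H would satisfy
   is_root, and half a simple root is not an integral combination. *)
Lemma killing_nondeg (x : g) : (forall y, killing x y = 0) -> x = 0.
Proof.
move=> x0.
have [I IP] : exists U : {vspace g}, forall x, x \in U <-> (forall y, killing x y = 0).
  apply: vspace_of_predicate => [y|c u v u0 v0 y]; first by rewrite killing0l.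
  by rewrite killingDl killingZl u0 v0 mulr0 addr0.
have [_ /(_ I)] := simp; case.
- by move=> u v vI; apply: ((IP _).2) => y; have v0 := (IP _).1 vI; rewrite lieC killingNl killing_inv v0 oppr0.
- by move=> I0; apply/eqP; rewrite -memv0 -I0; apply/IP.
move=> IT; exfalso.
have k0 (u v : g) : killing u v = 0 by apply: ((IP u).1); rewrite IT memvf.
have [i0 _] := exists_sroot.
have [ab _ ar] := sroots.
have a0 : tnth a i0 != 0.
  apply/eqP => a0; have := mem_tnth i0 a; rewrite a0 => /(free_not0 afree).
  by rewrite eqxx.
have aroot : is_root H ((2^-1 : K) *: tnth a i0).
  split; first exact: memvZ (aH i0).
    by rewrite scaler_eq0 (negPf a0) invr_eq0 pnatr_eq0.
  by exists (tnth a i0) => // h hH; rewrite k0 scale0r lieHH.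
have E (k : 'I_r -> nat) (s : K) : (2^-1 : K) *: tnth a i0 = s *: \sum_i tnth a i *+ k i ->
    2^-1 = s * (k i0)%:R.
  move=> /esym; rewrite scaler_sumr.
  under eq_bigr do rewrite -scaler_nat scalerA.
  have -> : (2^-1 : K) *: tnth a i0 = \sum_i (if i == i0 then 2^-1 else 0) *: tnth a i.
    by rewrite (bigD1 i0) //= eqxx big1 ?addr0 // => j /negPf ->; rewrite scale0r.
  by move=> /sroot_lin_inj /(_ i0); rewrite eqxx.
have h2 : 2^-1 * 2 = 1 :> K by rewrite mulVf // pnatr_eq0.
have [k [/esym|]] := ar _ aroot.
- rewrite -[\sum_i _]scale1r => /esym/E; rewrite mul1r => e.
  move: h2; rewrite e -natrM => /eqP; rewrite -[1]/(1%:R) eqr_nat muln2 => /eqP e2.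
  by have := odd_double (k i0); rewrite e2.
- rewrite -scaleN1r => /E; rewrite mulN1r => e.
  have : (0 : K) < - (k i0)%:R by rewrite -e invr_gt0 ltr0n.
  by rewrite oppr_gt0 ltrn0.
Qed.

(** The operators [ad h] commute by the Jacobi identity and are diagonalizable. The transposes are
    there because [codiagonalizable] works with row eigenvectors, whereas vectors of a module are
    columns. *)
Lemma ad_codiag : exists P : 'M[K]_n, P \in unitmx /\
  forall h, h \in H -> exists d : 'rV[K]_n, ad_mx h *m P = P *m diag_mx d.
Proof.
have [_ _ diagH] := cart.
pose As := [seq (ad_mx (tnth a i))^T | i <- enum 'I_r].
have : codiagonalizable As.
  apply/codiagonalizableP; split.
    move=> _ _ /mapP[i _ ->] /mapP[j _ ->]; rewrite /comm_mx -!trmx_mul.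
    congr (_^T); apply: mx_ccolP => z; rewrite -!mulmxA !ad_ccol; congr (ccol _).
    by rewrite [LHS]lie_lie (lieHH (aH _) (aH _)) lie0l add0r.
  move=> _ /mapP[i _ ->]; have [e eb ev] := diagH _ (aH i).
  have [/eqP eU /eqP ef] := andP eb.
  have es : size e = n by rewrite -ef eU.
  pose Q : 'M[K]_n := \matrix_j (ccol e`_j)^T.
  have Qf : Q \in unitmx.
    rewrite -row_free_unit -kermx_eq0; apply/rowV0P => v /sub_kermxP.
    rewrite mulmx_sum_row => /(congr1 trmx); rewrite trmx0 linear_sum /=.
    under eq_bigr do rewrite linearZ /= rowK trmxK.
    have -> : \sum_i v 0 i *: ccol e`_i = ccol (\sum_i v 0 i *: e`_i).
      by apply/colP => k; rewrite !mxE summxE linear_sum; apply: eq_bigr => j _; rewrite !mxE linearZ.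
    have e0 : ofcol 0 = 0 :> g by rewrite /ofcol big1 // => j _; rewrite mxE scale0r.
    move=> /(congr1 (@ofcol _ g)); rewrite ccolK e0 => ve; apply/rowP => j; rewrite mxE.
    have /freeP fe : free (in_tuple e) by have := basis_free eb.
    have := fe (fun k => v 0 (cast_ord es k)) _ (cast_ord (esym es) j).
    rewrite cast_ordKV; apply; rewrite -[RHS]ve (reindex (cast_ord es)) //=.
    by exists (cast_ord (esym es)) => ? _; rewrite ?cast_ordK ?cast_ordKV.
  exists Q => //; apply/diagonalizable_forPex.
  have ex_c (j : 'I_n) : exists c : K, lie (tnth a i) e`_j = c *: e`_j.
    by apply: ev; rewrite mem_nth // es.
  pose c j := xget 0 [set c : K | lie (tnth a i) e`_j = c *: e`_j].
  exists (\row_j c j); apply/(simmxP Qf)/row_matrixP => j.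
  rewrite row_mul rowK -trmx_mul ad_ccol row_mul row_diag_mx -scalemxAl -rowE rowK mxE.
  by rewrite (xgetPex 0 (ex_c j) : lie _ _ = _) -/(c j) ccolZ linearZ.
move=> [Q Qu /allP QD]; exists (Q^T); rewrite unitmx_tr; split => // h /cartan_coord[c ->].
have dE i : exists d : 'rV[K]_n, ad_mx (tnth a i) *m Q^T = Q^T *m diag_mx d.
  have /QD /= /diagonalizable_forPex [d /(simmxP Qu) Qd] : (ad_mx (tnth a i))^T \in As.
    by apply: map_f; rewrite mem_enum.
  by exists d; apply: (can_inj (@trmxK _ _ _)); rewrite !trmx_mul !trmxK Qd tr_diag_mx.
pose d i := xget 0 [set d : 'rV[K]_n | ad_mx (tnth a i) *m Q^T = Q^T *m diag_mx d].
have dP i : ad_mx (tnth a i) *m Q^T = Q^T *m diag_mx (d i) := xgetPex 0 (dE i).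
exists (\sum_i c i *: d i).
rewrite ad_mx_sum linear_sum mulmx_suml mulmx_sumr.
apply: eq_bigr => i _; rewrite ad_mxZ.
by rewrite -scalemxAl dP linearZ scalemxAr.
Qed.

End Cartan.

(* [rv] is the embedding b |-> sum_i b_i alpha_i of the real span of the simple
   roots.  Keeping it and the field K abstract, instead of [rvec] and R[i], spares
   the unifier the comparison of the many structures carried by R[i]. *)
Record cartan_data (R : realType) (K : numFieldType) (g : lieAlgType K) (H : {vspace g})
    (r : nat) (a : r.-tuple g) (iota : {rmorphism R -> K}) (rv : 'rV[R]_r -> g) : Prop := CartanData {
  cd_simple : simple_lie g;
  cd_cartan : cartan_subalgebra H;
  cd_roots : simple_roots H a;
  rvecD : forall b c, rv (b + c) = rv b + rv c;
  rvecZ : forall x b, rv (x *: b) = iota x *: rv b;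
  rvec_sroot : forall i, rv (sroot R i) = tnth a i
}.

Section RealEmbedding.
Variables (R : realType) (K : numFieldType) (g : lieAlgType K) (H : {vspace g}).
Variables (r : nat) (a : r.-tuple g) (iota : {rmorphism R -> K}) (rv : 'rV[R]_r -> g).
Hypothesis D : cartan_data H a iota rv.
Let sroots := cd_roots D.

Lemma rvec0 : rv 0 = 0.
Proof. by rewrite -(scale0r (0 : 'rV_r)) (rvecZ D) rmorph0 scale0r. Qed.
Lemma rvecN b : rv (- b) = - rv b.
Proof. by rewrite -scaleN1r (rvecZ D) rmorphN1 scaleN1r. Qed.
Lemma rvecB b c : rv (b - c) = rv b - rv c.
Proof. by rewrite (rvecD D) rvecN. Qed.
Lemma rvec_sum I (s : seq I) (P : pred I) F :
  rv (\sum_(i <- s | P i) F i) = \sum_(i <- s | P i) rv (F i).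
Proof. exact: (big_morph rv (rvecD D) rvec0). Qed.
Lemma rvecE b : rv b = \sum_i iota (b 0 i) *: tnth a i.
Proof.
rewrite [b in LHS]row_sum_delta rvec_sum; apply: eq_bigr => i _.
by rewrite (rvecZ D) -(rvec_sroot D).
Qed.
Lemma rvec_inj : injective rv.
Proof.
move=> b c; rewrite !rvecE => /(sroot_lin_inj sroots) bc; apply/rowP => i.
exact: (fmorph_inj iota (bc i)).
Qed.
Lemma rvec_in b : rv b \in H.
Proof.
rewrite rvecE; apply: memv_suml => i _; apply: memvZ.
by have [/basis_mem + _ _] := sroots; apply; apply: mem_tnth.
Qed.

End RealEmbedding.

Lemma col_mul_diag (K : comPzRingType) m n (P : 'M[K]_(m, n)) (d : 'rV[K]_n) i :
  col i (P *m diag_mx d) = d 0 i *: col i P.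
Proof. by apply/colP => k; rewrite mul_mx_diag !mxE mulrC. Qed.

Lemma col_mul (K : pzRingType) m n p (A : 'M[K]_(m, n)) (P : 'M[K]_(n, p)) i :
  A *m col i P = col i (A *m P).
Proof. by rewrite !colE mulmxA. Qed.

(* Unification must not compute traces when it compares two bilinear terms. *)
Opaque killing ad_mx.

(** * Weights and weight vectors *)

Section Weights.
Variables (R : realType) (K : numFieldType) (g : lieAlgType K) (H : {vspace g}).
Variables (r : nat) (a : r.-tuple g) (iota : {rmorphism R -> K}) (rv : 'rV[R]_r -> g).
Hypothesis D : cartan_data H a iota rv.
Let simp := cd_simple D.
Let cart := cd_cartan D.
Let sroots := cd_roots D.
Local Notation n := (\dim {:g}).

Let lieHH : {in H &, forall x y, lie x y = 0}. Proof. by case: cart. Qed.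
Let centH x : {in H, forall h, lie h x = 0} -> x \in H. Proof. by case: cart => _ /(_ x). Qed.
Let aH i : tnth a i \in H.
Proof. by have [/basis_mem + _ _] := sroots; apply; apply: mem_tnth. Qed.

Lemma ad_eigenbasis : exists (P : 'M[K]_n) (phi : 'I_n -> g -> K), P \in unitmx /\
  forall i h, h \in H -> lie h (ofcol (col i P)) = phi i h *: ofcol (col i P).
Proof.
have [P [Pu PD]] := ad_codiag cart sroots.
exists P, (fun i h => (xget 0 [set d : 'rV[K]_n | ad_mx h *m P = P *m diag_mx d]) 0 i).
split => // i h /PD ex.
apply: ccol_inj; rewrite ccolZ -ad_ccol ofcolK.
have := xgetPex 0 ex; set d := xget _ _ => /= dP.
by rewrite col_mul dP col_mul_diag.
Qed.

Lemma col_span (m : nat) (P : 'M[K]_m) (v : 'cV[K]_m) : P \in unitmx ->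
  v = \sum_i (invmx P *m v) i 0 *: col i P.
Proof.
move=> Pu; rewrite -[LHS]mul1mx -(mulmxV Pu) -mulmxA.
apply/colP => k; rewrite mxE summxE; apply: eq_bigr => j _.
by rewrite !mxE mulrC.
Qed.

Lemma col_unit_neq0 (m : nat) (P : 'M[K]_m) i : P \in unitmx -> col i P != 0.
Proof.
move=> Pu; apply/eqP => ci; have : invmx P *m col i P = 0 by rewrite ci mulmx0.
rewrite col_mul mulVmx // => /colP/(_ i); rewrite !mxE eqxx => /eqP.
by rewrite oner_eq0.
Qed.

Lemma ofcolD u v : ofcol (u + v) = ofcol u + ofcol v :> g.
Proof. by rewrite -big_split; apply: eq_bigr => i _; rewrite mxE scalerDl. Qed.
Lemma ofcolZ c u : ofcol (c *: u) = c *: ofcol u :> g.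
Proof. by rewrite scaler_sumr; apply: eq_bigr => i _; rewrite mxE scalerA. Qed.
Lemma ofcol0 : ofcol 0 = 0 :> g.
Proof. by rewrite -(scale0r 0) ofcolZ scale0r. Qed.
Lemma ofcol_sum I (s : seq I) (P : pred I) F :
  ofcol (\sum_(i <- s | P i) F i) = \sum_(i <- s | P i) ofcol (F i) :> g.
Proof. exact: (big_morph _ ofcolD ofcol0). Qed.
Lemma ofcol_eq0 v : ofcol v = 0 :> g -> v = 0.
Proof. by move=> v0; rewrite -(ofcolK v) v0; apply: (can_inj (@ofcolK _ g)); rewrite ccolK ofcol0. Qed.

(** For an eigenvector [z] of [ad H] outside [H] some [h'] has a nonzero eigenvalue, and by
    invariance that eigenvalue times [killing h z] is [killing (lie h h') z = 0]. So an [h]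
    orthogonal to [H] is orthogonal to everything. *)
Lemma cartan_killing_nondeg h : h \in H -> {in H, forall h', killing h h' = 0} -> h = 0.
Proof.
move=> hH h0; apply: (killing_nondeg simp cart sroots) => x.
have [P [phi [Pu PE]]] := ad_eigenbasis.
have z0 i : killing h (ofcol (col i P)) = 0.
  have [zH|/asboolPn zH] := asboolP (ofcol (col i P) \in H); first exact: h0.
  have [h' h'H ph] : exists2 h', h' \in H & phi i h' != 0.
    apply: contrapT => nex; move/asboolPn: zH; apply; apply: centH => h' h'H.
    rewrite PE //; have [->|p0] := eqVneq (phi i h') 0; first by rewrite scale0r.
    by exfalso; apply: nex; exists h'.
  have := killing_inv h h' (ofcol (col i P)).
  rewrite (lieHH hH h'H) killing0l PE // killingZr => /esym/eqP.
  by rewrite mulf_eq0 (negPf ph) /= => /eqP.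
rewrite -[x]ccolK [ccol x](col_span _ Pu) ofcol_sum killing_sumr big1 // => i _.
by rewrite ofcolZ killingZr z0 mulr0.
Qed.

Definition gram_aC : 'M[K]_r := \matrix_(i, j) killing (tnth a i) (tnth a j).

Lemma gram_aC_unit : gram_aC \in unitmx.
Proof.
rewrite -row_free_unit -kermx_eq0; apply/rowV0P => v /sub_kermxP vG.
have E : \sum_i v 0 i *: tnth a i = 0.
  apply: cartan_killing_nondeg; first by apply: memv_suml => i _; exact: memvZ (aH i).
  move=> _ /(cartan_coord sroots)[c ->].
  rewrite killing_sumr big1 // => j _; rewrite killingZr killing_suml.
  have /rowP/(_ j) := vG; rewrite !mxE => vj; rewrite (_ : \sum_i _ = 0) ?mulr0 //.
  by rewrite -[RHS]vj; apply: eq_bigr => i _; rewrite !mxE killingZl.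
apply/rowP => i; rewrite mxE.
have := @sroot_lin_inj _ _ _ _ _ sroots (fun i => v 0 i) (fun=> 0) _ i; apply.
by rewrite E big1 // => j _; rewrite scale0r.
Qed.

(** Linearity is asked on [H] only: the eigenvalue functionals of [ad_eigenbasis] are arbitrary
    outside [H]. *)
Lemma represent_functional (phi : g -> K) :
  (forall c x y, x \in H -> y \in H -> phi (c *: x + y) = c * phi x + phi y) ->
  exists2 t, t \in H & {in H, forall h, phi h = killing t h}.
Proof.
move=> phiL.
pose c := (\row_j phi (tnth a j)) *m invmx gram_aC.
exists (\sum_i c 0 i *: tnth a i); first by apply: memv_suml => i _; exact: memvZ (aH i).
have phi0 : phi 0 = 0.
  by have := phiL 1 0 0 (mem0v _) (mem0v _); rewrite scale1r addr0 mul1r => /eqP; rewrite addrC -subr_eq subrr => /eqP.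
have phis (d : 'I_r -> K) (s : seq 'I_r) :
    phi (\sum_(i <- s) d i *: tnth a i) = \sum_(i <- s) d i * phi (tnth a i).
  elim: s => [|i s IH]; first by rewrite !big_nil.
  by rewrite !big_cons phiL ?IH //; apply: memv_suml => j _; exact: memvZ (aH j).
move=> _ /(cartan_coord sroots)[d ->]; rewrite phis killing_sumr.
apply: eq_bigr => j _; rewrite killingZr killing_suml; congr (_ * _).
have : c *m gram_aC = \row_j phi (tnth a j) by rewrite mulmxKV ?gram_aC_unit.
move/rowP/(_ j); rewrite !mxE => <-.
by apply: eq_bigr => i _; rewrite !mxE killingZl.
Qed.

Lemma root_rvec t : is_root H t -> exists b : 'rV[R]_r, t = rv b /\
  exists k : 'I_r -> nat, b = \row_i (k i)%:R \/ b = - \row_i (k i)%:R.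
Proof.
have E (k : 'I_r -> nat) : rv (\row_i (k i)%:R) = \sum_i tnth a i *+ k i.
  by rewrite (rvecE D); apply: eq_bigr => i _; rewrite mxE rmorph_nat scaler_nat.
have [_ _ ar] := sroots.
move=> /ar[k [->|->]]; first by exists (\row_i (k i)%:R); split=> //; exists k; left.
by exists (- \row_i (k i)%:R); rewrite (rvecN D) E; split=> //; exists k; right.
Qed.

Lemma killing_rv_eq (b c : 'rV[R]_r) :
  {in H, forall h, killing (rv b) h = killing (rv c) h} -> b = c.
Proof.
move=> bc; apply/eqP; rewrite -subr_eq0; apply/eqP.
apply: (rvec_inj D); rewrite (rvec0 D) (rvecB D).
apply: cartan_killing_nondeg; first by apply: memvB; exact: (rvec_in D).
by move=> h hH; rewrite killingDl killingNl bc // subrr.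
Qed.

Section WeightVectors.
Variable M : rep g.

Definition wt_vec (mu : 'rV[R]_r) (v : 'cV[K]_(rdim M)) :=
  forall h, h \in H -> M h *m v = killing (rv mu) h *: v.

Definition wt_basis (P : 'M[K]_(rdim M)) (mu : 'I_(rdim M) -> 'rV[R]_r) :=
  P \in unitmx /\ forall i, wt_vec (mu i) (col i P).

Lemma wt_vec_root al x mu v : in_root_space H (rv al) x -> wt_vec mu v ->
  wt_vec (mu + al) (M x *m v).
Proof.
move=> xa vm h hH; rewrite (rvecD D) killingDl.
have := ract_lie M h x; rewrite xa // ractZ => /eqP.
rewrite eq_sym subr_eq => /eqP hx.
by rewrite mulmxA hx mulmxDl -scalemxAl -mulmxA (vm h hH) -scalemxAr -scalerDl addrC.
Qed.

Lemma wt_vecD mu u v : wt_vec mu u -> wt_vec mu v -> wt_vec mu (u + v).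
Proof. by move=> um vm h hH; rewrite mulmxDr um // vm // scalerDr. Qed.

Lemma wt_vecZ mu c v : wt_vec mu v -> wt_vec mu (c *: v).
Proof. by move=> vm h hH; rewrite -scalemxAr vm // !scalerA mulrC. Qed.

Lemma wt_vec_iter al x mu v k : in_root_space H (rv al) x -> wt_vec mu v ->
  wt_vec (mu + al *+ k) (iter k (mulmx (M x)) v).
Proof.
move=> xa vm; elim: k => [|k IH] /=; first by rewrite mulr0n addr0.
by rewrite mulrSr addrA; apply: wt_vec_root.
Qed.

Section Basis.
Variables (P : 'M[K]_(rdim M)) (mu : 'I_(rdim M) -> 'rV[R]_r).
Hypothesis Pmu : wt_basis P mu.

Let Pu : P \in unitmx. Proof. by case: Pmu. Qed.

Definition conj_act x := invmx P *m M x *m P.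

Lemma conj_act_H h i j : h \in H -> conj_act h i j = (i == j)%:R * killing (rv (mu j)) h.
Proof.
move=> hH; rewrite /conj_act -mulmxA.
have -> : (invmx P *m (M h *m P)) i j = (invmx P *m (M h *m col j P)) i 0.
  by rewrite col_mul col_mul [RHS]mxE.
have [_ /(_ j h hH) ->] := Pmu.
by rewrite -scalemxAr col_mul mulVmx // !mxE mulrC.
Qed.

Lemma conj_actM x y : invmx P *m (M x *m M y) *m P = conj_act x *m conj_act y.
Proof. by rewrite /conj_act !mulmxA mulmxK. Qed.

Lemma conj_act_lie x y :
  conj_act (lie x y) = conj_act x *m conj_act y - conj_act y *m conj_act x.
Proof. by rewrite /conj_act ract_lie mulmxBr mulmxBl !conj_actM. Qed.

Lemma conj_act_trace x y : \tr (M x *m M y) = \tr (conj_act x *m conj_act y).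
Proof.
by rewrite -conj_actM [RHS]mxtrace_mulC mulmxA mulmxV // mul1mx.
Qed.

Lemma conj_act_root al x i j : in_root_space H (rv al) x -> conj_act x i j != 0 ->
  mu i = mu j + al.
Proof.
move=> xa xij; apply: killing_rv_eq => h hH; rewrite (rvecD D) killingDl.
have := conj_act_lie h x; rewrite xa // {1}/conj_act ractZ -scalemxAr -scalemxAl -/(conj_act x).
move: (conj_act x) xij => X xij /matrixP/(_ i j); rewrite !mxE.
rewrite (bigD1 i) //= [X in _ = _ + _ - X](bigD1 j) //=.
rewrite !big1 => [|k kj|k ki]; last 2 first.
- by rewrite conj_act_H // (negPf kj) mul0r mulr0.
- by rewrite conj_act_H // eq_sym (negPf ki) mul0r mul0r.
rewrite !addr0 !conj_act_H // !eqxx !mul1r (mulrC _ (killing _ h)) -mulrBl.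
by move=> /(mulIf xij) ->; rewrite addrC subrK.
Qed.

(** The trace of the product of [x] and [y] on the module, weighted by a function of the weight.
    With [f] the indicator of a set of weights it is a trace over the corresponding weight
    spaces. *)
Definition wtrace x y (f : 'rV[R]_r -> K) : K :=
  \sum_i (conj_act x *m conj_act y) i i * f (mu i).

(** Cyclicity of the trace: a nonzero entry of [x] joins weights that differ by [al], so exchanging
    the factors shifts the argument of [f]. *)
Lemma wtrace_shift al x y f : in_root_space H (rv al) x ->
  wtrace y x f = wtrace x y (fun b => f (b - al)).
Proof.
move=> xa; rewrite /wtrace.
under eq_bigr do rewrite mxE mulr_suml.
rewrite exchange_big /=; apply: eq_bigr => j _; rewrite mxE mulr_suml.
apply: eq_bigr => i _; rewrite (mulrC (conj_act y _ _)).
have [->|x0] := eqVneq (conj_act x j i) 0; first by rewrite !mul0r.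
by rewrite (conj_act_root xa x0) addrK.
Qed.

(** Since [lie x y] acts diagonally its weighted trace is explicit; by cyclicity it is also a
    difference between a weighted trace and its shift. Both the lengths of roots and Freudenthal's
    formula come from this identity. *)
Lemma wtrace_comm al x y f : in_root_space H (rv al) x -> lie x y = rv al ->
  wtrace x y f - wtrace x y (fun b => f (b - al)) =
  \sum_i killing (rv (mu i)) (rv al) * f (mu i).
Proof.
move=> xa xy; rewrite -wtrace_shift // /wtrace -sumrB; apply: eq_bigr => i _.
rewrite -mulrBl; congr (_ * _).
have := conj_act_lie x y; rewrite xy => /matrixP/(_ i i).
by rewrite conj_act_H ?(rvec_in D) // eqxx mul1r !mxE => ->.
Qed.

(* A nonzero multiple of a root cannot be added indefinitely to finitely many weights. *)
Lemma root_vec_nilp (al : 'rV[R]_r) x : al != 0 -> in_root_space H (rv al) x ->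
  exists N, forall v : 'cV[K]_(rdim M), iter N (mulmx (M x)) v = 0.
Proof.
move=> al0 xa.
have [k alk] : exists k, al 0 k != 0.
  by apply: contrapT => nk; case/eqP: al0; apply/rowP => k; rewrite mxE; apply: contrapT => /eqP alk; apply: nk; exists k.
pose B := \sum_i `|mu i 0 k|.
(* The [k]-th coordinates of two weights differ by at most [B + B], while [N] steps along [al]
   change this coordinate by more. *)
have [N NB] : exists N : nat, (B + B) < `|al 0 k| *+ N.
  have := @archi_boundP R ((B + B) / `|al 0 k|).
  rewrite divr_ge0 ?addr_ge0 ?sumr_ge0 // => /(_ isT) lt.
  by exists (Num.bound ((B + B) / `|al 0 k|)); rewrite -mulr_natl -ltr_pdivrMr ?normr_gt0.
exists N => v.
have powE k' (u : 'cV[K]_(rdim M)) : iter k' (mulmx (M x)) (P *m u) = P *m iter k' (mulmx (conj_act x)) u.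
  elim: k' => //= k' ->; rewrite /conj_act !mulmxA mulmxV // mul1mx; congr (_ *m _).
have le_mu i : `|mu i 0 k| <= B by rewrite /B (bigD1 i) //= lerDl sumr_ge0.
have powN k' (u : 'cV_(rdim M)) i : iter k' (mulmx (conj_act x)) u i 0 != 0 ->
    exists j, mu i = mu j + al *+ k'.
  elim: k' i => [|k' IH] i; first by exists i; rewrite mulr0n addr0.
  rewrite /= mxE => s0.
  have [j] : exists j, conj_act x i j * iter k' (mulmx (conj_act x)) u j 0 != 0.
    apply: contrapT => nj; move/eqP: s0; apply; apply: big1 => j _.
    by apply: contrapT => /eqP sj; apply: nj; exists j.
  rewrite mulf_eq0 negb_or => /andP[xij /IH[l mul]].
  by exists l; rewrite (conj_act_root xa xij) mul mulrSr addrA.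
rewrite -[v]mul1mx -(mulmxV Pu) -mulmxA powE.
suff -> : iter N (mulmx (conj_act x)) (invmx P *m v) = 0 by rewrite mulmx0.
apply/colP => i; rewrite [RHS]mxE; apply: contrapT => /eqP /powN[j mij].
suff : `|al 0 k| *+ N <= B + B by rewrite leNgt NB.
rewrite -normrMn; have -> : al 0 k *+ N = mu i 0 k - mu j 0 k.
  by rewrite mij mxE mulmxnE addrAC subrr add0r.
by rewrite (le_trans (ler_normB _ _)) // lerD.
Qed.

End Basis.
End WeightVectors.
End Weights.

(** * Roots and the real form *)

Section Roots.
Variables (R : realType) (K : numFieldType) (g : lieAlgType K) (H : {vspace g}).
Variables (r : nat) (a : r.-tuple g) (iota : {rmorphism R -> K}) (rv : 'rV[R]_r -> g).
Hypothesis D : cartan_data H a iota rv.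
Let simp := cd_simple D.
Let cart := cd_cartan D.
Let sroots := cd_roots D.
Local Notation n := (\dim {:g}).
Local Notation kil b c := (killing (rv b) (rv c)).

Let centH x : {in H, forall h, lie h x = 0} -> x \in H. Proof. by case: cart => _ /(_ x). Qed.
Let rvH b : rv b \in H := rvec_in D b.

Lemma in_root_spaceD al x y : in_root_space H al x -> in_root_space H al y ->
  in_root_space H al (x + y).
Proof. by move=> xa ya h hH; rewrite lieDr (xa h hH) (ya h hH) scalerDr. Qed.

Lemma in_root_spaceZ al c x : in_root_space H al x -> in_root_space H al (c *: x).
Proof. by move=> xa h hH; rewrite lieZr xa // !scalerA mulrC. Qed.

Lemma in_root_space_lie al be x y : in_root_space H (rv al) x -> in_root_space H (rv be) y ->
  in_root_space H (rv (al + be)) (lie x y).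
Proof.
move=> xa yb h hH; rewrite lie_lie (xa h hH) (yb h hH) lieZl lieZr -scalerDl.
by rewrite (rvecD D) killingDl.
Qed.

Lemma in_root_space_ccol al x : in_root_space H (rv al) x <-> wt_vec H rv (M := ad_rep g) al (ccol x).
Proof.
split=> [xa h hH|xa h hH]; first by rewrite /= ad_ccol xa // ccolZ.
by have := xa h hH; rewrite /= ad_ccol -ccolZ => /ccol_inj.
Qed.

Lemma in_root_space0 x : in_root_space H (rv 0) x -> x \in H.
Proof. by move=> x0; apply: centH => h hH; rewrite x0 // (rvec0 D) killing0l scale0r. Qed.

Definition rootv (b : 'rV[R]_r) := is_root H (rv b).

(** A joint eigenvalue of [ad H] is represented through the Killing form by an element of [H]. If
    this is nonzero it is a root, and the base of simple roots gives it integral, hence real,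
    coordinates. *)
Lemma ad_wt_basis : exists P mu, wt_basis H rv (M := ad_rep g) P mu /\
  forall i, mu i != 0 -> rootv (mu i).
Proof.
have [P [phi [Pu PE]]] := ad_eigenbasis D.
have z0 i : ofcol (col i P) != 0 :> g.
  by apply: contraNN (col_unit_neq0 i Pu) => /eqP /ofcol_eq0 ->.
have ex i : exists b : 'rV[R]_r, {in H, forall h, phi i h = killing (rv b) h} /\
    (b != 0 -> rootv b).
  have [c x y xH yH|t tH tphi] := represent_functional D (phi := phi i).
    have : phi i (c *: x + y) *: ofcol (col i P) = (c * phi i x + phi i y) *: ofcol (col i P).
      have cH : c *: x + y \in H by rewrite memvD ?memvZ.
      by rewrite -(PE i _ cH) lieDl lieZl (PE i x) // (PE i y) // scalerA scalerDl.
    by move=> /eqP; rewrite -subr_eq0 -scalerBl scaler_eq0 (negPf (z0 i)) orbF subr_eq0 => /eqP.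
  have [t0|t0] := eqVneq t 0.
    by exists 0; rewrite eqxx; split=> // h /tphi ->; rewrite t0 (rvec0 D).
  have tr : is_root H t.
    by split=> //; exists (ofcol (col i P)) => // h hH; rewrite PE // tphi.
  by have [b [tb _]] := root_rvec D tr; exists b; rewrite /rootv -tb.
pose mu i := xget 0 [set b : 'rV[R]_r | {in H, forall h, phi i h = killing (rv b) h} /\
    (b != 0 -> rootv b)].
have muP i := xgetPex 0 (ex i).
exists P, mu; split; last by move=> i; apply: (muP i).2.
split=> // i h hH; rewrite -[col i P]ofcolK /= ad_ccol PE // -ccolZ.
by rewrite (muP i).1.
Qed.

Lemma killing_root_orth al be x y : in_root_space H (rv al) x -> in_root_space H (rv be) y ->
  killing x y != 0 -> be = - al.
Proof.
move=> xa yb xy; apply: (killing_rv_eq D) => h hH.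
rewrite (rvecN D) killingNl; have := killing_inv h x y.
have := killing_inv x h y; rewrite lieC (xa h hH) (yb h hH) killingNl killingZl killingZr.
by rewrite -mulNr => /(mulIf xy).
Qed.

Lemma lie_opposite al x y : in_root_space H (rv al) x -> in_root_space H (rv (- al)) y ->
  lie x y = killing x y *: rv al.
Proof.
move=> xa ya.
have xyH : lie x y \in H by apply: in_root_space0; rewrite -(subrr al); apply: in_root_space_lie.
apply/eqP; rewrite -subr_eq0; apply/eqP.
apply: (cartan_killing_nondeg D) => [|h hH]; first by rewrite memvB ?memvZ.
rewrite killingDl killingNl killingZl killing_inv lieC ya //.
by rewrite -scaleNr killingZr (rvecN D) killingNl opprK mulrC subrr.
Qed.

(** By nondegeneracy some vector of a weight basis pairs nontrivially with [x], and invariance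
    forces its weight to be [- al]. *)
Lemma opposite_root_vec al x : in_root_space H (rv al) x -> x != 0 ->
  exists2 y, in_root_space H (rv (- al)) y & killing x y = 1.
Proof.
move=> xa x0; have [P [mu [Pmu _]]] := ad_wt_basis; have [Pu Pw] := Pmu.
have [i ki] : exists i, killing x (ofcol (col i P)) != 0.
  apply: contrapT => nex; case/eqP: x0; apply: (killing_nondeg simp cart sroots) => z.
  rewrite -[z]ccolK [ccol z](col_span _ Pu) ofcol_sum killing_sumr big1 // => i _.
  rewrite ofcolZ killingZr; have [->|k0] := eqVneq (killing x (ofcol (col i P))) 0; first by rewrite mulr0.
  by exfalso; apply: nex; exists i.
have yb : in_root_space H (rv (mu i)) (ofcol (col i P)).
  by apply/in_root_space_ccol; rewrite ofcolK.
have mui := killing_root_orth xa yb ki.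
exists ((killing x (ofcol (col i P)))^-1 *: ofcol (col i P)).
  by rewrite -mui; apply: in_root_spaceZ.
by rewrite killingZr mulVf.
Qed.

Lemma rootvN al : rootv al -> rootv (- al).
Proof.
move=> [_ al0 [x x0 xa]]; have [y ya xy] := opposite_root_vec xa x0.
split=> //; first by rewrite (rvecN D) oppr_eq0.
by exists y => //; apply: contra_eq_neq xy => ->; rewrite killing0r eq_sym oner_neq0.
Qed.

Lemma rootv_neq0 al : rootv al -> al != 0.
Proof. by move=> [_ + _]; apply: contraNN => /eqP ->; rewrite (rvec0 D). Qed.

Lemma rootvP al x : al != 0 -> x != 0 -> in_root_space H (rv al) x -> rootv al.
Proof.
move=> al0 x0 xa; split=> //; last by exists x.
by apply: contraNN al0 => /eqP; rewrite -(rvec0 D) => /(rvec_inj D) ->.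
Qed.

Lemma sum_bool_neq0 (I : finType) (i : I) (f : I -> bool) : f i ->
  \sum_i (f i)%:R != 0 :> K.
Proof.
move=> fi; rewrite (bigD1 i) //= fi gt_eqF // ltr_pwDl ?ltr01 //.
by apply: sumr_ge0 => j _; rewrite ler0n.
Qed.

(* Sum the commutator trace over the al-string through be: it is shift invariant. *)
Lemma root_sqnorm_neq0 al : rootv al -> kil al al != 0.
Proof.
move=> alr; have [_ al0 [x x0 xa]] := alr; have [y ya xy] := opposite_root_vec xa x0.
have [P [mu [Pmu _]]] := ad_wt_basis; have [Pu Pw] := Pmu.
apply/eqP => kal.
have xyE : lie x y = rv al by rewrite (lie_opposite xa) // xy scale1r.
have mu_al j : kil (mu j) al = 0.
  pose s b := `[< exists k : int, b = mu j + al *~ k >].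
  have := wtrace_comm D Pmu (fun b => (s b)%:R) xa xyE.
  have -> : (fun b => (s (b - al))%:R) = (fun b => (s b)%:R : K).
    apply: funext => b; congr (_%:R); apply: congr1; apply/asboolP/asboolP => -[k kb].
      by exists (k + 1); rewrite mulrzDr addrA -kb mulr1z subrK.
    by exists (k - 1); rewrite mulrzBr addrA -kb mulr1z.
  rewrite subrr => /esym.
  (* With [(al, al) = 0] the pairing with [al] is constant along the string. *)
  have -> : \sum_i kil (mu i) al * (s (mu i))%:R = kil (mu j) al * \sum_i (s (mu i))%:R.
    rewrite mulr_sumr; apply: eq_bigr => i _; case: (boolP (s (mu i))) => [/asboolP[k ->]|_]; last by rewrite !mulr0.
    rewrite (rvecD D) killingDl.
    have -> : rv (al *~ k) = iota (k%:~R) *: rv al by rewrite -(rvecZ D) scaler_int.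
    by rewrite killingZl kal mulr0 addr0.
  move/eqP; rewrite mulf_eq0 => /orP[/eqP //|/eqP sm0]; exfalso.
  have sj : s (mu j) by apply/asboolP; exists 0; rewrite mulr0z addr0.
  by have := sum_bool_neq0 (f := fun i => s (mu i)) sj; rewrite sm0 eqxx.
(* Now [al] pairs to 0 with every weight of the adjoint representation, so [ad al = 0] and [al] lies
   in the radical. *)
case/eqP: al0; apply: (killing_nondeg simp cart sroots) => z.
rewrite killingE (_ : ad_mx (rv al) = 0) ?mul0mx ?mxtrace0 //.
rewrite -[LHS]mulmx1 -(mulmxV Pu) mulmxA (_ : ad_mx _ *m P = 0) ?mul0mx //.
apply/matrixP => i j; have := Pw j (rv al) (rvH _).
by rewrite mu_al scale0r /= col_mul => /colP/(_ i); rewrite !mxE.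
Qed.

Section Sl2Rep.
Variables (M : rep g) (P : 'M[K]_(rdim M)) (mu : 'I_(rdim M) -> 'rV[R]_r).
Hypothesis Pmu : wt_basis H rv P mu.
Variables (al : 'rV[R]_r) (x y : g).
Hypotheses (alr : rootv al) (xa : in_root_space H (rv al) x).
Hypotheses (ya : in_root_space H (rv (- al)) y) (xy : killing x y = 1).

(** Rescaling [y] by [2 / (al, al)] gives an sl2 pair in the sense of [sl2_weight_lt]; [x] is
    nilpotent by [root_vec_nilp], and the nilpotency of [y] on [v] bounds the weight. *)
Lemma wt_vec_sl2 b (v : 'cV[K]_(rdim M)) N : v != 0 -> wt_vec H rv b v ->
  iter N (mulmx (M y)) v = 0 ->
  exists2 m : int, 2 * kil b al / kil al al = m%:~R & m < N%:Z.
Proof.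
move=> v0 vb yN; have cal := root_sqnorm_neq0 alr; set c := kil al al in cal *.
have xyE : lie x y = rv al by rewrite (lie_opposite xa) // xy scale1r.
pose f := (2 / c) *: y.
have fE : forall u : 'cV[K]_(rdim M), mulmx (M f) u = (2 / c) *: (M y *m u).
  by move=> u; rewrite /f ractZ -scalemxAl.
have hE (u : 'cV[K]_(rdim M)) : mulmx (M x) (mulmx (M f) u) - mulmx (M f) (mulmx (M x) u) =
    (2 / c) *: (M (rv al) *m u).
  rewrite !fE -scalemxAr -scalerBr; congr (_ *: _).
  by rewrite !mulmxA -mulmxBl -ract_lie xyE.
have cE : 2 / c * c = 2 by rewrite mulfVK.
have [N' xN] := root_vec_nilp D Pmu (rootv_neq0 alr) xa.
have := @sl2_weight_lt _ _ (mulmx (M x)) (mulmx (M f)) _ _ (2 * kil b al / c) v N N' v0.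
apply => //.
- move=> u /=; rewrite !hE.
  have -> : M (rv al) *m (M x *m u) = M x *m (M (rv al) *m u) + c *: (M x *m u).
    rewrite !mulmxA -[LHS](subrK (M x *m M (rv al) *m u)) -mulmxBl -ract_lie xa //.
    by rewrite ractZ -scalemxAl addrC.
  by rewrite scalerDr scalerA cE -scalemxAr.
- move=> u /=; rewrite !hE !fE.
  have -> : M (rv al) *m (2 / c *: (M y *m u)) = 2 / c *: (M y *m (M (rv al) *m u) - c *: (M y *m u)).
    rewrite -scalemxAr; congr (_ *: _).
    rewrite !mulmxA -[LHS](subrK (M y *m M (rv al) *m u)) -mulmxBl -ract_lie ya //.
    by rewrite ractZ -scalemxAl addrC (rvecN D) killingNl scaleNr.
  rewrite -scalemxAr !scalerBr !scalerA; congr (_ - _ *: _).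
  by rewrite -mulrA cE mulrC.
- by rewrite hE vb // scalerA mulrAC.
- have itE k : iter k (mulmx (M f)) v = (2 / c) ^+ k *: iter k (mulmx (M y)) v.
    elim: k => [|k IH]; first by rewrite expr0 scale1r.
    by rewrite !iterS IH fE -scalemxAr scalerA exprS.
  by rewrite itE yN scaler0.
Qed.

End Sl2Rep.

End Roots.

Lemma dim_le_inj (K : fieldType) (V V' : vectType K) (f : V -> V') (U : {vspace V}) (W : {vspace V'}) :
  linear f -> {in U, forall v, f v = 0 -> v = 0} -> {in U, forall v, f v \in W} ->
  (\dim U <= \dim W)%N.
Proof.
move=> fL fi fW.
pose F : {linear V -> V'} := HB.pack f (GRing.isLinear.Build _ _ _ _ _ fL).
have FE v : linfun F v = f v by rewrite lfunE.
have ker0 : (U :&: lker (linfun F) = 0)%VS.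
  apply/eqP; rewrite -subv0; apply/subvP => v /memv_capP[vU].
  by rewrite memv_ker FE memv0 => /eqP /(fi _ vU) ->.
rewrite -(limg_dim_eq ker0); apply: dimvS; apply/subvP => _ /memv_imgP[v vU ->].
by rewrite FE fW.
Qed.

(** [weight_space] with the field and the embedding of the real form left abstract. *)
Definition wspace (R : realType) (K : numFieldType) (g : lieAlgType K) (H : {vspace g})
    (r : nat) (rv : 'rV[R]_r -> g) (M : rep g) (mu : 'rV[R]_r) : {vspace 'cV[K]_(rdim M)} :=
  (\bigcap_(h <- vbasis H) lker (linfun (mulmx (M h - (killing (rv mu) h)%:M))))%VS.

(** * Reality of the Killing form on roots *)

Section RootReality.
Variables (R : realType) (K : numFieldType) (g : lieAlgType K) (H : {vspace g}).
Variables (r : nat) (a : r.-tuple g) (iota : {rmorphism R -> K}) (rv : 'rV[R]_r -> g).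
Hypothesis D : cartan_data H a iota rv.
Let sroots := cd_roots D.
Local Notation kil b c := (killing (rv b) (rv c)).
Local Notation root := (rootv H rv).
Local Notation wtv := (wt_vec H rv).

Let rvH b : rv b \in H := rvec_in D b.

Definition root_pair (al : 'rV[R]_r) (x y : g) :=
  [/\ in_root_space H (rv al) x, in_root_space H (rv (- al)) y & killing x y = 1].

Lemma root_pair_ex al : root al -> exists x y, root_pair al x y.
Proof.
move=> [_ _ [x x0 xa]]; have [y ya xy] := opposite_root_vec D xa x0.
by exists x, y.
Qed.

Lemma root_pairN al x y : root_pair al x y -> root_pair (- al) y x.
Proof. by case=> xa ya xy; split; rewrite ?opprK // killingC. Qed.

Lemma root_pair_lie al x y : root_pair al x y -> lie x y = rv al.
Proof. by case=> xa ya xy; rewrite (lie_opposite D xa) // xy scale1r. Qed.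

Section Sl2Weights.
Variables (M : rep g) (P : 'M[K]_(rdim M)) (mu : 'I_(rdim M) -> 'rV[R]_r).
Hypothesis Pmu : wt_basis H rv P mu.

Lemma weight_integralC b (v : 'cV[K]_(rdim M)) al : v != 0 -> wtv b v -> root al ->
  exists m : int, 2 * kil b al / kil al al = m%:~R.
Proof.
move=> v0 vb alr; have [x [y [xa ya xy]]] := root_pair_ex alr.
have [N yN] := root_vec_nilp D Pmu (rootv_neq0 D (rootvN D alr)) ya.
have [m mE _] := wt_vec_sl2 D Pmu alr xa ya xy v0 vb (yN v).
by exists m.
Qed.

End Sl2Weights.

Lemma trace_act_H (M : rep g) P mu h h' : wt_basis H rv (M := M) P mu -> h \in H -> h' \in H ->
  \tr (M h *m M h') = \sum_i killing (rv (mu i)) h * killing (rv (mu i)) h'.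
Proof.
move=> Pmu hH h'H; rewrite (conj_act_trace Pmu); apply: eq_bigr => i _.
rewrite mxE (bigD1 i) //= big1 ?addr0 => [|j ji].
  by rewrite !(conj_act_H Pmu) // eqxx !mul1r.
by rewrite (conj_act_H Pmu) // eq_sym (negPf ji) !mul0r.
Qed.

Lemma rootvec_ad_weight al : root al -> exists2 x, ccol x != 0 & wtv (M := ad_rep g) al (ccol x).
Proof.
move=> [_ _ [x x0 xa]]; exists x; last exact/in_root_space_ccol.
by apply: contraNN x0 => /eqP xx; rewrite -(ccolK x) xx ofcol0.
Qed.

(** Let [c = (al, al)]. The numbers [m = 2 (mu, al) / c] are integers for all weights [mu] of the
    adjoint representation, and [c] is the trace of [(ad al)^2], the sum of the [(mu, al)^2], that
    is [c^2 / 4] times the sum of the [m^2]. Hence [c] is 4 divided by the sum of the [m^2]. *)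
Lemma root_sqnorm_real al : root al -> exists2 c : R, kil al al = iota c & 0 < c.
Proof.
move=> alr; have [P [mu [Pmu _]]] := ad_wt_basis D; have [Pu Pw] := Pmu.
have c0 := root_sqnorm_neq0 D alr.
have ex i : exists m : int, 2 * kil (mu i) al / kil al al = m%:~R.
  exact: (weight_integralC Pmu (col_unit_neq0 i Pu) (Pw i) alr).
pose m i := xget 0 [set m : int | 2 * kil (mu i) al / kil al al = m%:~R].
have mE i : 2 * kil (mu i) al / kil al al = (m i)%:~R := xgetPex 0 (ex i).
have mE' i : kil (mu i) al = kil al al / 2 * (m i)%:~R.
  by rewrite -mE; field.
have : kil al al = (kil al al) ^+ 2 / 4 * \sum_i (m i)%:~R ^+ 2.
  rewrite {1}killingE (trace_act_H Pmu (rvH al) (rvH al)) mulr_sumr.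
  by apply: eq_bigr => i _; rewrite mE'; field.
move: c0; set c := kil al al => c0.
set S : K := \sum_i _ => cE.
have S1 : c * (S / 4) = 1 by apply: (mulfI c0); rewrite mulr1 [RHS]cE; field.
pose s : R := \sum_i ((m i)%:~R) ^+ 2.
have SE : S = iota s by rewrite rmorph_sum; apply: eq_bigr => i _; rewrite rmorphXn rmorph_int.
have S0 : S != 0 by apply: contra_eq_neq S1 => ->; rewrite mul0r mulr0 eq_sym oner_neq0.
exists (4 / s).
  have s0 : s != 0 by apply: contraNneq S0 => s0; rewrite SE s0 rmorph0.
  apply: (mulIf S0); rewrite [in RHS]SE -rmorphM divfK // rmorph_nat.
  by have := congr1 (fun x => x * 4) S1; rewrite mul1r -mulrA divfK ?pnatr_eq0.
rewrite divr_gt0 // lt_neqAle eq_sym sumr_ge0 ?andbT => [|i _]; last exact: sqr_ge0.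
by apply: contraNN S0; rewrite SE => /eqP ->; rewrite rmorph0.
Qed.

Lemma sroot_root i : root (sroot R i).
Proof. by rewrite /rootv (rvec_sroot D); have [_ + _] := sroots; apply. Qed.

Lemma killing_real b c : exists q, kil b c = iota q.
Proof.
have ij i j : exists q, kil (sroot R i) (sroot R j) = iota q.
  have [P [mu [Pmu _]]] := ad_wt_basis D.
  have [x x0 xb] := rootvec_ad_weight (sroot_root i).
  have [m mE] := weight_integralC Pmu x0 xb (sroot_root j).
  have [d dE d0] := root_sqnorm_real (sroot_root j).
  have dC : iota d != 0 by rewrite fmorph_eq0 gt_eqF.
  exists (m%:~R * d / 2); rewrite !rmorphM fmorphV rmorph_int rmorph_nat -mE dE.
  by field.
pose q i j := xget 0 [set q | kil (sroot R i) (sroot R j) = iota q].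
have qE i j : kil (sroot R i) (sroot R j) = iota (q i j) := xgetPex 0 (ij i j).
exists (\sum_i \sum_j b 0 i * (c 0 j * q i j)).
rewrite (rvecE D b) (rvecE D c) killing_suml rmorph_sum; apply: eq_bigr => i _.
rewrite killing_sumr rmorph_sum; apply: eq_bigr => j _.
by rewrite killingZl killingZr -!(rvec_sroot D) qE !rmorphM.
Qed.

End RootReality.

Section RealForm.
Variables (R : realType) (K : numFieldType) (g : lieAlgType K) (H : {vspace g}).
Variables (r : nat) (a : r.-tuple g) (iota : {rmorphism R -> K}) (rv : 'rV[R]_r -> g).
Hypothesis D : cartan_data H a iota rv.
Variable ip : 'rV[R]_r -> 'rV[R]_r -> R.
Hypothesis kilE : forall b c, killing (rv b) (rv c) = iota (ip b c).
Let simp := cd_simple D.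
Let cart := cd_cartan D.
Let sroots := cd_roots D.
Local Notation kil b c := (killing (rv b) (rv c)).
Local Notation root := (rootv H rv).
Local Notation wtv := (wt_vec H rv).

Let rvH b : rv b \in H := rvec_in D b.

Lemma ipC b c : ip b c = ip c b.
Proof. by apply: (fmorph_inj iota); rewrite -!kilE killingC. Qed.
Lemma ipDl b c d : ip (b + c) d = ip b d + ip c d.
Proof. by apply: (fmorph_inj iota); rewrite -kilE (rvecD D) killingDl !kilE rmorphD. Qed.
Lemma ipZl x b c : ip (x *: b) c = x * ip b c.
Proof. by apply: (fmorph_inj iota); rewrite -kilE (rvecZ D) killingZl !kilE rmorphM. Qed.
Lemma ipDr b c d : ip d (b + c) = ip d b + ip d c.
Proof. by rewrite ipC ipDl !(ipC d). Qed.
Lemma ipZr x b c : ip c (x *: b) = x * ip c b.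
Proof. by rewrite ipC ipZl ipC. Qed.
Lemma ipNl b c : ip (- b) c = - ip b c.
Proof. by rewrite -scaleN1r ipZl mulN1r. Qed.
Lemma ipNr b c : ip c (- b) = - ip c b.
Proof. by rewrite ipC ipNl ipC. Qed.
Lemma ip0l b : ip 0 b = 0.
Proof. by rewrite -(scale0r b) ipZl mul0r. Qed.
Lemma ip_suml I (s : seq I) (Q : pred I) F c :
  ip (\sum_(i <- s | Q i) F i) c = \sum_(i <- s | Q i) ip (F i) c.
Proof. by apply: (big_morph (fun u => ip u c)) => [u v|]; rewrite ?ipDl ?ip0l. Qed.
Lemma ip_sumr I (s : seq I) (Q : pred I) F c :
  ip c (\sum_(i <- s | Q i) F i) = \sum_(i <- s | Q i) ip c (F i).
Proof. by rewrite ipC ip_suml; apply: eq_bigr => i _; rewrite ipC. Qed.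

Lemma ip_ad_sum : exists k (mu : 'I_k -> 'rV[R]_r), forall b, ip b b = \sum_i (ip (mu i) b) ^+ 2.
Proof.
have [P [mu [Pmu _]]] := ad_wt_basis D.
exists (rdim (ad_rep g)), mu => b; apply: (fmorph_inj iota).
rewrite -kilE killingE (trace_act_H Pmu (rvH b) (rvH b)) rmorph_sum.
by apply: eq_bigr => i _; rewrite kilE rmorphXn.
Qed.

Lemma ip_ge0 b : 0 <= ip b b.
Proof.
by have [k [mu ->]] := ip_ad_sum; apply: sumr_ge0 => i _; exact: sqr_ge0.
Qed.

Lemma ip_gt0 b : b != 0 -> 0 < ip b b.
Proof.
move=> b0; rewrite lt_neqAle ip_ge0 andbT eq_sym; apply: contraNN b0 => /eqP bb.
have [P [mu [Pmu _]]] := ad_wt_basis D; have [Pu Pw] := Pmu.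
have : \sum_i (ip (mu i) b) ^+ 2 = 0.
  rewrite -[RHS]bb; apply: (fmorph_inj iota); rewrite -kilE killingE (trace_act_H Pmu (rvH b) (rvH b)).
  by rewrite rmorph_sum; apply: eq_bigr => i _; rewrite kilE rmorphXn.
move/eqP; rewrite psumr_eq0 => [/allP mb|i _]; last exact: sqr_ge0.
apply/eqP; apply: (rvec_inj D); rewrite (rvec0 D).
apply: (killing_nondeg simp cart sroots) => z.
rewrite killingE (_ : ad_mx (rv b) = 0) ?mul0mx ?mxtrace0 //.
rewrite -[LHS]mulmx1 -(mulmxV Pu) mulmxA (_ : ad_mx _ *m P = 0) ?mul0mx //.
apply/matrixP => i j; have := Pw j (rv b) (rvH _); rewrite kilE.
have /eqP -> : ip (mu j) b == 0 by rewrite -sqrf_eq0; apply: mb; rewrite mem_index_enum.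
by rewrite rmorph0 scale0r /= col_mul => /colP/(_ i); rewrite !mxE.
Qed.

Lemma root_ip_gt0 al : root al -> 0 < ip al al.
Proof. by move=> /(rootv_neq0 D) /ip_gt0. Qed.

Lemma gramE b c : ip b c = \sum_i \sum_j b 0 i * c 0 j * ip (sroot R i) (sroot R j).
Proof.
rewrite {1}[b]row_sum_delta ip_suml; apply: eq_bigr => i _.
rewrite {1}[c]row_sum_delta ip_sumr; apply: eq_bigr => j _.
by rewrite ipZl ipZr mulrA.
Qed.

Definition cpair (b al : 'rV[R]_r) : R := 2 * ip b al / ip al al.
Definition refl (al b : 'rV[R]_r) : 'rV[R]_r := b - cpair b al *: al.

Lemma cpairDl b c al : cpair (b + c) al = cpair b al + cpair c al.
Proof. by rewrite /cpair ipDl mulrDr mulrDl. Qed.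
Lemma cpairZl x b al : cpair (x *: b) al = x * cpair b al.
Proof. by rewrite /cpair ipZl; ring. Qed.
Lemma cpairxx al : al != 0 -> cpair al al = 2.
Proof. by move=> /ip_gt0 al0; rewrite /cpair mulfK // gt_eqF. Qed.
Lemma cpairN b al : cpair b (- al) = - cpair b al.
Proof. by rewrite /cpair !ipNr ipNl opprK mulrN mulNr. Qed.
Lemma cpairNl b al : cpair (- b) al = - cpair b al.
Proof. by rewrite -scaleN1r cpairZl mulN1r. Qed.

Lemma reflD al b c : refl al (b + c) = refl al b + refl al c.
Proof. by rewrite /refl cpairDl scalerDl opprD addrACA. Qed.
Lemma reflZ al x b : refl al (x *: b) = x *: refl al b.
Proof. by rewrite /refl cpairZl -scalerA scalerBr. Qed.
Lemma reflN al b : refl al (- b) = - refl al b.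
Proof. by rewrite -scaleN1r reflZ scaleN1r. Qed.
Lemma refl_sum al I (s : seq I) (Q : pred I) F :
  refl al (\sum_(i <- s | Q i) F i) = \sum_(i <- s | Q i) refl al (F i).
Proof.
apply: big_morph => [u v|]; first exact: reflD.
by rewrite -[X in refl al X](scale0r (0 : 'rV[R]_r)) reflZ scale0r.
Qed.
Lemma refl_self al : al != 0 -> refl al al = - al.
Proof. by move=> al0; rewrite /refl cpairxx // scaler_nat mulr2n opprD addrA subrr sub0r. Qed.
Lemma cpair_refl al b : al != 0 -> cpair (refl al b) al = - cpair b al.
Proof. by move=> al0; rewrite /refl cpairDl cpairNl cpairZl cpairxx //; ring. Qed.
Lemma refl_invol al : al != 0 -> involutive (refl al).
Proof.
by move=> al0 b; rewrite {1}/refl cpair_refl // scaleNr opprK subrK.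
Qed.
Lemma ip_refl al b c : al != 0 -> ip (refl al b) (refl al c) = ip b c.
Proof.
move=> /ip_gt0 al0; rewrite /refl !ipDl !ipDr !ipNl !ipNr !ipZl !ipZr /cpair.
by rewrite (ipC al c); field; rewrite gt_eqF.
Qed.
Lemma refl_adj al b c : al != 0 -> ip (refl al b) c = ip b (refl al c).
Proof. by move=> al0; rewrite -[in RHS](refl_invol al0 b) ip_refl. Qed.

Lemma cpairC b al : 2 * kil b al / kil al al = iota (cpair b al).
Proof. by rewrite !kilE /cpair rmorphM fmorphV rmorphM rmorph_nat. Qed.

Lemma reflE al b : refl al b = b - cpair b al *: al.
Proof. by []. Qed.
Lemma cpairE b al : cpair b al = 2 * ip b al / ip al al.
Proof. by []. Qed.
Opaque refl cpair.

Section WeightReflection.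
Variables (M : rep g) (P : 'M[K]_(rdim M)) (mu : 'I_(rdim M) -> 'rV[R]_r).
Hypothesis Pmu : wt_basis H rv P mu.

Lemma weight_integral b (v : 'cV[K]_(rdim M)) al : v != 0 -> wtv b v -> root al ->
  exists m : int, cpair b al = m%:~R.
Proof.
move=> v0 vb alr; have [m mE] := weight_integralC D Pmu v0 vb alr.
by exists m; apply: (fmorph_inj iota); rewrite -cpairC mE rmorph_int.
Qed.

Lemma weight_cpair_lt b (v : 'cV[K]_(rdim M)) al x y N : root al -> root_pair H rv al x y ->
  v != 0 -> wtv b v -> iter N (mulmx (M y)) v = 0 -> cpair b al < N%:R.
Proof.
move=> alr [xa ya xy] v0 vb yN.
have [m mE mN] := wt_vec_sl2 D Pmu alr xa ya xy v0 vb yN.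
have -> : cpair b al = m%:~R by apply: (fmorph_inj iota); rewrite -cpairC mE rmorph_int.
by rewrite (_ : N%:R = N%:Z%:~R) // ltr_int.
Qed.

(** If [y^k] killed [v], then [weight_cpair_lt] would give [k < k]. *)
Lemma refl_weight_iter b al x y (v : 'cV[K]_(rdim M)) : root al -> root_pair H rv al x y ->
  v != 0 -> wtv b v -> 0 <= cpair b al ->
  exists k, [/\ cpair b al = k%:R, iter k (mulmx (M y)) v != 0 & wtv (refl al b) (iter k (mulmx (M y)) v)].
Proof.
move=> alr xy v0 vb cb; have [m mE] := weight_integral v0 vb alr.
move: (cb); rewrite mE ler0z; case: m mE => // k kE _; exists k; split=> //.
  by apply/eqP => /(weight_cpair_lt alr xy v0 vb); rewrite kE ltxx.
rewrite reflE kE -pmulrn scaler_nat -mulNrn.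
by have [_ ya _] := xy; apply: (wt_vec_iter D).
Qed.

Lemma memv_wspace b v : v \in wspace H rv M b <-> wtv b v.
Proof.
have mE h : (v \in lker (linfun (mulmx (M h - (killing (rv b) h)%:M)))) =
    (M h *m v == killing (rv b) h *: v).
  by rewrite memv_ker lfunE /= mulmxBl mul_scalar_mx subr_eq0.
rewrite /wspace memvE big_tnth; split=> [/subv_bigcapP vw h hH|vw].
  rewrite (coord_vbasis hH) killing_sumr ract_sum mulmx_suml scaler_suml.
  apply: eq_bigr => i _; rewrite ractZ killingZr -scalemxAl -scalerA; congr (_ *: _).
  have /tnthP[j ->] : (vbasis H)`_i \in in_tuple (vbasis H) by rewrite mem_nth ?size_tuple.
  by apply/eqP; rewrite -mE memvE; exact: vw.
apply/subv_bigcapP => i _; rewrite -memvE mE; apply/eqP; apply: vw.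
by apply: vbasis_mem; apply: mem_tnth.
Qed.

Opaque wspace.

(** The exponent [k] depends on the weight alone, so [y^k] maps the whole weight space into that of
    the reflected weight, injectively by [refl_weight_iter]. *)
Lemma dim_wspace_refl_le b al : root al -> 0 <= cpair b al ->
  (\dim (wspace H rv M b) <= \dim (wspace H rv M (refl al b)))%N.
Proof.
move=> alr cb; have [x [y xy]] := root_pair_ex D alr.
have [->|] := eqVneq (wspace H rv M b) 0%VS; first by rewrite dimv0.
rewrite -vpick0 => v0.
have vb : wtv b (vpick (wspace H rv M b)) by apply/memv_wspace/memv_pick.
have [k [ck _ _]] := refl_weight_iter alr xy v0 vb cb.
apply: (@dim_le_inj _ _ _ (iter k (mulmx (M y)))).
- by move=> c u v; elim: k {ck} => //= k ->; rewrite mulmxDr scalemxAr.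
- move=> v /memv_wspace vw v0'; apply: contrapT => /eqP vn0.
  have [k' [ck' + _]] := refl_weight_iter alr xy vn0 vw cb.
  have -> : k' = k by apply/eqP; rewrite -(eqr_nat R) -ck' -ck.
  by rewrite v0' eqxx.
move=> v /memv_wspace vw; apply/memv_wspace.
have [->|vn0] := eqVneq v 0.
  rewrite (_ : iter k _ 0 = 0); first by move=> h _; rewrite mulmx0 scaler0.
  by elim: k {ck} => //= k ->; rewrite mulmx0.
have [k' [ck' _ +]] := refl_weight_iter alr xy vn0 vw cb.
by have -> : k' = k by apply/eqP; rewrite -(eqr_nat R) -ck' -ck.
Qed.

Lemma refl_opp al b : refl (- al) b = refl al b.
Proof. by rewrite reflE cpairN scalerN scaleNr opprK. Qed.

Lemma dim_wspace_refl b al : root al ->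
  \dim (wspace H rv M (refl al b)) = \dim (wspace H rv M b).
Proof.
move=> alr; wlog cb : al alr / 0 <= cpair b al.
  move=> hw; have [cb|cb] := leP 0 (cpair b al); first exact: hw.
  rewrite -refl_opp; apply: hw; first exact: rootvN D _ _.
  by rewrite cpairN oppr_ge0 ltW.
apply: anti_leq; apply/andP; split; last exact: dim_wspace_refl_le.
have alN := rootvN D alr; have al0 := rootv_neq0 D alr.
have := @dim_wspace_refl_le (refl al b) (- al) alN.
by rewrite refl_opp (refl_invol al0) cpairN (cpair_refl _ al0) opprK; apply.
Qed.

End WeightReflection.

Lemma refl_root al be : root al -> root be -> root (refl al be).
Proof.
move=> alr ber; have al0 := rootv_neq0 D alr.
have [P [mu [Pmu _]]] := ad_wt_basis D.
have [x x0 xb] := rootvec_ad_weight ber.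
have : wspace H rv (ad_rep g) (refl al be) != 0%VS.
  rewrite -dimv_eq0 (dim_wspace_refl Pmu) // dimv_eq0.
  apply: contraNN x0 => /eqP w0; rewrite -memv0 -w0; exact: ((memv_wspace (M := ad_rep g) _ _).2 xb).
rewrite -vpick0; set v := vpick _ => v0.
have vw : wtv (M := ad_rep g) (refl al be) v by exact: ((memv_wspace (M := ad_rep g) _ _).1 (memv_pick _)).
apply: (rootvP D (x := ofcol v)).
- have be0 := rootv_neq0 D ber; apply: contraNN be0 => /eqP r0.
  have : refl al (refl al be) = 0 by rewrite r0 -[X in refl al X](scale0r (0 : 'rV[R]_r)) reflZ scale0r.
  by rewrite (refl_invol al0) => /eqP.
- by apply: contraNN v0 => /eqP /ofcol_eq0 ->.
- by apply/in_root_space_ccol; rewrite ofcolK.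
Qed.

(** The difference [z] of the two sides pairs to 0 with [f], so [lie z f = 0]: it has weight [al]
    and is killed by the lowering operator. If it were nonzero, [weight_cpair_lt] with [N = 1] would
    put its Cartan number below 1, but that number is 2. *)
Lemma root_space_line al e f x : root al -> root_pair H rv al e f -> in_root_space H (rv al) x ->
  x = killing x f *: e.
Proof.
move=> alr ef xa; have [ea fa kef] := ef.
apply/eqP; rewrite -subr_eq0; apply: contrapT => /negP z0.
set z := x - _ in z0.
have za : in_root_space H (rv al) z.
  by apply: in_root_spaceD => //; rewrite -scaleNr; apply: in_root_spaceZ.
have zf : lie z f = 0.
  rewrite (lie_opposite D za fa) /z killingDl killingNl killingZl kef.
  by rewrite mulr1 subrr scale0r.
have [P [mu [Pmu _]]] := ad_wt_basis D.
have cz : ccol z != 0.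
  by apply: contraNN z0 => /eqP zz; rewrite -(ccolK z) zz ofcol0.
have := weight_cpair_lt Pmu (N := 1) alr ef cz ((in_root_space_ccol _ _ _ _).1 za).
rewrite cpairxx ?(rootv_neq0 D alr) //= ad_ccol lieC zf oppr0 => /(_ _).
have -> : ccol (0 : g) = 0 by rewrite -(ofcol0 g) ofcolK.
by move=> /(_ erefl); rewrite ltr_nat.
Qed.

(** The Cartan number of [al] at [k al] is [2 / k], an integer, so [k <= 2]. For [x] of weight
    [2 al], [lie e x] has weight [3 al] and vanishes, and [lie f x] is a multiple of [e]; Jacobi
    then gives [lie (lie e f) x = 0], whereas this is [2 (al, al) x]. *)
Lemma root_multiple al k : root al -> root (al *+ k) -> k = 1%N.
Proof.
move=> alr kr; have al0 := rootv_neq0 D alr; have ip0 := root_ip_gt0 alr.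
have k0 : (0 < k)%N by case: k kr => // /(rootv_neq0 D); rewrite mulr0n eqxx.
have [P [mu [Pmu _]]] := ad_wt_basis D.
have k_le2 j : root (al *+ j) -> (j <= 2)%N.
  move=> jr; have [x x0 xb] := rootvec_ad_weight alr.
  case: j jr => // j jr; have [m] := weight_integral Pmu x0 xb jr.
  rewrite cpairE -[al *+ j.+1]scaler_nat ipZl !ipZr => mE.
  have : 2 = m * j.+1%:Z.
    apply/eqP; rewrite -(eqr_int R) rmorphM /= -mE; apply/eqP.
    by field; rewrite gt_eqF //= pnatr_eq0.
  move=> e; have : (j.+1%:Z %| 2)%Z by apply/dvdzP; exists m.
  by rewrite dvdzE /= => /dvdn_leq; apply.
case: k k0 kr => // -[//|k] _ kr; have := k_le2 _ kr; case: k kr => // kr _.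
have [e [f ef]] := root_pair_ex D alr; have [ea fa kef] := ef.
have [_ _ [x x0 xa]] := kr.
have ex0 : lie e x = 0.
  apply: contrapT => /eqP ex.
  have /k_le2 // : root (al *+ 3).
  apply: (rootvP D _ ex); first by rewrite -scaler_nat scaler_eq0 pnatr_eq0.
  by rewrite mulrS; exact: (in_root_space_lie D ea xa).
have fx : in_root_space H (rv al) (lie f x).
  have -> : al = - al + al *+ 2 by rewrite mulr2n addKr.
  exact: (in_root_space_lie D fa xa).
have := lie_lie e f x; rewrite ex0 lie0r addr0 (root_pair_lie D ef).
rewrite (root_space_line alr ef fx) lieZr liexx scaler0 xa ?rvH // => /esym/eqP.
rewrite scaler_eq0 (negPf x0) orbF kilE fmorph_eq0 -[al *+ 2]scaler_nat ipZl.
by rewrite mulf_eq0 pnatr_eq0 (gt_eqF ip0).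
Qed.

End RealForm.

Lemma seq_argmax (R : realDomainType) (T : eqType) (f : T -> R) (s : seq T) : s != [::] ->
  exists2 x, x \in s & forall y, y \in s -> f y <= f x.
Proof.
elim: s => // x [|y s] IH _; first by exists x; rewrite ?mem_head // => z; rewrite mem_seq1 => /eqP ->.
have [z zs zmax] := IH isT; have [xz|zx] := leP (f x) (f z).
  exists z; first by rewrite inE zs orbT.
  by move=> w; rewrite inE => /orP[/eqP ->|/zmax].
exists x; first by rewrite inE eqxx.
move=> w; rewrite inE => /orP[/eqP -> //|/zmax wz]; exact: le_trans wz (ltW zx).
Qed.

(** * The Weyl group *)

Section WeylGroup.
Variables (R : realType) (K : numFieldType) (g : lieAlgType K) (H : {vspace g}).
Variables (r : nat) (a : r.-tuple g) (iota : {rmorphism R -> K}) (rv : 'rV[R]_r -> g).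
Hypothesis D : cartan_data H a iota rv.
Variable ip : 'rV[R]_r -> 'rV[R]_r -> R.
Hypothesis kilE : forall b c, killing (rv b) (rv c) = iota (ip b c).
Local Notation root := (rootv H rv).
Local Notation wtv := (wt_vec H rv).
Local Notation al := (sroot R).
Local Notation cp := (cpair ip).
Local Notation ref := (refl ip).
Definition pos_root : set 'rV[R]_r := [set b | root b /\ forall i, 0 <= b 0 i].

Section WeightCount.
Variables (M : rep g) (P : 'M[K]_(rdim M)) (mu : 'I_(rdim M) -> 'rV[R]_r).
Hypothesis Pmu : wt_basis H rv P mu.
Let Pu : P \in unitmx. Proof. by case: Pmu. Qed.

Lemma wt_coord b (v : 'cV[K]_(rdim M)) i : wtv b v -> (invmx P *m v) i 0 != 0 -> mu i = b.
Proof.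
move=> vb ci; apply: (killing_rv_eq D) => h hH.
apply: (mulIf ci).
have : (conj_act P h *m (invmx P *m v)) i 0 = (killing (rv b) h *: (invmx P *m v)) i 0.
  by rewrite /conj_act !mulmxA mulmxK // -mulmxA vb // scalemxAr.
rewrite [LHS]mxE [RHS]mxE => <-; rewrite (bigD1 i) //= (conj_act_H Pmu) // eqxx mul1r.
by rewrite big1 ?addr0 // => j ji; rewrite (conj_act_H Pmu) // eq_sym (negPf ji) !mul0r.
Qed.

Lemma wt_occurs b (v : 'cV[K]_(rdim M)) : v != 0 -> wtv b v -> exists i, mu i = b.
Proof.
move=> v0 vb; apply: contrapT => nb; case/eqP: v0.
rewrite [v](col_span _ Pu) big1 // => i _.
have [->|ci] := eqVneq ((invmx P *m v) i 0) 0; first by rewrite scale0r.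
by case: nb; exists i; apply: wt_coord ci.
Qed.

Lemma free_cols (p : pred 'I_(rdim M)) : free [seq col i P | i <- enum p].
Proof.
suff fr : free [tuple col i P | i < rdim M].
  have {}fr : free [seq col i P | i <- enum 'I_(rdim M)].
    by have -> : [seq col i P | i <- enum 'I_(rdim M)] = [tuple col i P | i < rdim M] by rewrite /= -val_ord_tuple.
  have E (q : pred 'I_(rdim M)) : enum q = seq.filter q (enum 'I_(rdim M)).
    by rewrite enumT /enum_mem; apply: eq_filter.
  have pe : perm_eq (enum 'I_(rdim M)) (enum p ++ enum (predC p)).
    by rewrite (E p) (E (predC p)) perm_sym perm_filterC.
  have := perm_map (fun i => col i P) pe; rewrite map_cat => /perm_free e.
  by move: fr; rewrite e; apply: catl_free.
apply/freeP => k k0 i.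
have {}k0 : \sum_j k j *: col j P = 0.
  by rewrite -[RHS]k0; apply: eq_bigr => j _; rewrite -tnth_nth tnth_mktuple.
have := congr1 (fun v => (invmx P *m v) i 0) k0; rewrite mulmx0 [RHS]mxE mulmx_sumr summxE.
rewrite (bigD1 i) //= big1 ?addr0 => [|j ji].
  by rewrite -scalemxAr mxE col_mul mulVmx // !mxE eqxx mulr1.
by rewrite -scalemxAr mxE col_mul mulVmx // !mxE eq_sym (negPf ji) mulr0.
Qed.

Lemma dim_wspace b : \dim (wspace H rv M b) = #|[pred i | mu i == b]|.
Proof.
have -> : wspace H rv M b = <<[seq col i P | i <- enum [pred i | mu i == b]]>>%VS.
  apply/vspaceP => v; apply/idP/idP => [/memv_wspace vb|].
    rewrite [v](col_span _ Pu) memv_suml // => i _.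
    have [->|ci] := eqVneq ((invmx P *m v) i 0) 0; first by rewrite scale0r mem0v.
    apply: memvZ; apply: memv_span; apply: map_f; rewrite mem_enum inE.
    by rewrite (wt_coord vb ci).
  apply/subvP: v; apply/span_subvP => _ /mapP[i + ->]; rewrite mem_enum inE => /eqP <-.
  by apply/memv_wspace; have [_] := Pmu; apply.
by have /eqP -> := free_cols [pred i | mu i == b]; rewrite size_map -cardE.
Qed.

End WeightCount.

Lemma finite_roots : finite_set [set b | root b].
Proof.
have [P [mu [Pmu _]]] := ad_wt_basis D.
apply: (sub_finite_set (B := [set mu i | i in [set: 'I_(rdim (ad_rep g))]])).
  move=> b /= rb; have [x x0 xb] := rootvec_ad_weight rb.
  by have [i ib] := wt_occurs Pmu x0 xb; exists i.
by apply: finite_image; apply: finite_finset.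
Qed.

Lemma root_nat b : root b -> exists k : 'I_r -> nat,
  (forall i, b 0 i = (k i)%:R) \/ (forall i, b 0 i = - (k i)%:R).
Proof.
move=> rb; have [c [/(rvec_inj D) -> [k [->|->]]]] := root_rvec D rb.
  by exists k; left => i; rewrite mxE.
by exists k; right => i; rewrite !mxE.
Qed.

Lemma finite_pos_root : finite_set (pos_root).
Proof. by apply: sub_finite_set finite_roots => b []. Qed.

Definition pos_roots_seq : seq 'rV[R]_r := finmap.enum_fset (fset_set pos_root).
Local Notation proots := pos_roots_seq.

Lemma mem_proots b : b \in proots <-> root b /\ forall i, 0 <= b 0 i.
Proof.
have E : (b \in proots) = (b \in pos_root) by rewrite -(in_fset_set finite_pos_root).
by rewrite E; split => [/set_mem//|h]; apply/mem_set.
Qed.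

Lemma proots_uniq : uniq proots. Proof. exact: finmap.fset_uniq. Qed.

Lemma sroot_pos i : al i \in proots.
Proof.
apply/mem_proots; split; first exact: sroot_root D i.
by move=> j; rewrite mxE ler0n.
Qed.

Lemma root_pos_or_neg b : root b -> b \in proots \/ - b \in proots.
Proof.
move=> rb; have [k [kb|kb]] := root_nat rb; [left|right]; apply/mem_proots; split=> //.
- by move=> i; rewrite kb ler0n.
- exact: rootvN D _ rb.
- by move=> i; rewrite mxE kb opprK ler0n.
Qed.

Lemma proot_neq0 b : b \in proots -> b != 0.
Proof. by move=> /mem_proots[/(rootv_neq0 D)]. Qed.

Lemma proot_notN b : b \in proots -> - b \notin proots.
Proof.
move=> bp; have b0 := proot_neq0 bp; apply/negP => /mem_proots[_ nb].
case/eqP: b0; apply/rowP => i; apply/eqP; rewrite mxE eq_le.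
move: (nb i); rewrite mxE oppr_ge0 => -> /=.
by have /mem_proots[_ ->] := bp.
Qed.

(** By [root_multiple] such a root has a positive coordinate other than the [i]-th. The reflection
    leaves it alone, and the coordinates of a root have one sign. *)
Lemma refl_sroot_proot i b : b \in proots -> b != al i -> ref (al i) b \in proots.
Proof.
move=> bp bi; have /mem_proots[rb b0] := bp.
have [k kE] : exists k : 'I_r -> nat, forall i, b 0 i = (k i)%:R.
  have [k [kE|kE]] := root_nat rb; first by exists k.
  exists k => j; apply: le_anti; rewrite kE; move: (b0 j); rewrite kE.
  by rewrite oppr_ge0 lern0 => /eqP ->; rewrite oppr0 lexx.
have [j ji kj] : exists2 j, j != i & k j != 0%N.
  apply: contrapT => nj; have bE : b = al i *+ k i.
    apply/rowP => j; rewrite kE mulmxnE !mxE eqxx /=; have [->|ji] := eqVneq j i; first by [].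
    rewrite mul0rn (_ : k j = 0%N) //; apply/eqP/negPn/negP => kj; apply: nj.
    by exists j.
  have ki : k i = 1%N.
    by apply: (root_multiple D kilE (sroot_root D i)); rewrite -bE.
  by move: bi; rewrite bE ki mulr1n eqxx.
have rr : root (ref (al i) b) by apply: (refl_root D kilE) => //; exact: sroot_root D i.
have bj : 0 < ref (al i) b 0 j.
  by rewrite reflE !mxE eqxx (negPf ji) mulr0 subr0 kE ltr0n lt0n.
have [//|/mem_proots[_ /(_ j)]] := root_pos_or_neg rr.
by rewrite mxE oppr_ge0 leNgt bj.
Qed.

Lemma sroot_neq0 i : al i != 0 :> 'rV[R]_r.
Proof. by apply: proot_neq0 (sroot_pos i). Qed.

Lemma perm_proots_refl i :
  perm_eq [seq ref (al i) b | b <- rem (al i) proots] (rem (al i) proots).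
Proof.
have inv := refl_invol D kilE (sroot_neq0 i).
have ru : uniq (rem (al i) proots) by apply: rem_uniq; exact: proots_uniq.
have um : uniq [seq ref (al i) b | b <- rem (al i) proots].
  by rewrite map_inj_uniq //; exact: inv_inj.
have sub : {subset [seq ref (al i) b | b <- rem (al i) proots] <= rem (al i) proots}.
  move=> _ /mapP[b + ->]; rewrite !(mem_rem_uniq _ proots_uniq) !inE => /andP[bi bp].
  rewrite refl_sroot_proot // andbT; apply: contraNneq (proot_notN (sroot_pos i)) => e.
  by have <- : b = - al i by rewrite -(refl_self D kilE (sroot_neq0 i)) -[X in _ = ref _ X]e inv.
apply: uniq_perm => //; have [] := uniq_min_size um sub; first by rewrite size_map.
by [].
Qed.

Lemma perm_proots_rem i : perm_eq proots (al i :: rem (al i) proots).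
Proof. exact: perm_to_rem (sroot_pos i). Qed.

Definition rho : 'rV[R]_r := 2^-1 *: \sum_(b <- proots) b.

Lemma refl_rho i : ref (al i) rho = rho - al i.
Proof.
rewrite /rho (reflZ D kilE) !(perm_big _ (perm_proots_rem i)) !big_cons.
rewrite (reflD D kilE) (refl_self D kilE (sroot_neq0 i)).
rewrite (refl_sum D kilE) -[X in - _ + X](big_map (ref (al i)) predT id).
rewrite (perm_big _ (perm_proots_refl i)) /=; set S := \sum_(_ <- _) _.
rewrite !scalerDr scalerN [RHS]addrAC; congr (_ + _).
by rewrite -[X in _ = _ - X]scale1r -scalerBl -scaleNr; congr (_ *: _); field.
Qed.

Lemma cpair_rho i : cp rho (al i) = 1.
Proof.
have := refl_rho i; rewrite reflE => /addrI/oppr_inj/eqP.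
rewrite -subr_eq0 -[X in _ - X]scale1r -scalerBl scaler_eq0 (negPf (sroot_neq0 i)) orbF.
by rewrite subr_eq0 => /eqP.
Qed.

Lemma mul_rV_lin1_fun (f : 'rV[R]_r -> 'rV[R]_r) b : linear f -> b *m lin1_mx f = f b.
Proof.
move=> fL; pose F : {linear 'rV[R]_r -> 'rV[R]_r} := HB.pack f (GRing.isLinear.Build _ _ _ _ _ fL).
exact: (mul_rV_lin1 F).
Qed.

(** As [srefl], [weyl_word] and [weyl_group], with the form as a parameter. *)
Definition sreflm i : 'M[R]_r := lin1_mx (fun b => b - (2 * ip b (al i) / ip (al i) (al i)) *: al i).
Definition wword (s : seq 'I_r) : 'M[R]_r := \big[mulmx/1%:M]_(i <- s) sreflm i.
Definition wgroup : set 'M[R]_r := range wword.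

Lemma mul_sreflm b i : b *m sreflm i = ref (al i) b.
Proof.
rewrite mul_rV_lin1_fun ?reflE ?cpairE // => c u v.
have := reflD D kilE (al i) (c *: u) v; rewrite (reflZ D kilE) !reflE !cpairE.
by [].
Qed.

Lemma wword_cons i s : wword (i :: s) = sreflm i *m wword s.
Proof. by rewrite /wword big_cons. Qed.
Lemma wword_nil : wword [::] = 1%:M. Proof. by rewrite /wword big_nil. Qed.
Lemma wword_cat s t : wword (s ++ t) = wword s *m wword t.
Proof.
elim: s => [|i s IH]; first by rewrite wword_nil mul1mx.
by rewrite cat_cons !wword_cons IH mulmxA.
Qed.

Lemma mxrow_ext m n (A B : 'M[R]_(m, n)) : (forall b : 'rV[R]_m, b *m A = b *m B) -> A = B.
Proof. by move=> AB; apply/row_matrixP => i; rewrite !rowE AB. Qed.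

Lemma sreflmK i : sreflm i *m sreflm i = 1%:M.
Proof.
by apply: mxrow_ext => b; rewrite mulmxA !mul_sreflm mulmx1 (refl_invol D kilE (sroot_neq0 i)).
Qed.

Lemma wword_rev s : wword s *m wword (rev s) = 1%:M.
Proof.
elim: s => [|i s IH]; first by rewrite wword_nil mul1mx.
rewrite rev_cons -cats1 wword_cat wword_cons -mulmxA (mulmxA (wword s)) IH mul1mx.
by rewrite wword_cons wword_nil mulmx1 sreflmK.
Qed.

Lemma wgroup1 : wgroup 1%:M.
Proof. by exists [::] => //; rewrite wword_nil. Qed.
Lemma wgroupM w w' : wgroup w -> wgroup w' -> wgroup (w *m w').
Proof. by move=> [s _ <-] [t _ <-]; exists (s ++ t) => //; rewrite wword_cat. Qed.
Lemma wgroup_sreflm i : wgroup (sreflm i).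
Proof. by exists [:: i] => //; rewrite wword_cons wword_nil mulmx1. Qed.
Lemma wgroupV w : wgroup w -> exists2 w', wgroup w' & w *m w' = 1%:M /\ w' *m w = 1%:M.
Proof.
move=> [s _ <-]; exists (wword (rev s)); first by exists (rev s).
by split; [|rewrite -{2}(revK s)]; apply: wword_rev.
Qed.

Lemma ip_wgroup w b c : wgroup w -> ip (b *m w) (c *m w) = ip b c.
Proof.
move=> [s _ <-]; elim: s b c => [|i s IH] b c; first by rewrite wword_nil !mulmx1.
by rewrite wword_cons !mulmxA IH !mul_sreflm (ip_refl D kilE _ _ (sroot_neq0 i)).
Qed.

Lemma root_wgroup w b : wgroup w -> root b -> root (b *m w).
Proof.
move=> [s _ <-]; elim: s b => [|i s IH] b rb; first by rewrite wword_nil mulmx1.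
rewrite wword_cons mulmxA mul_sreflm; apply: IH.
by apply: (refl_root D kilE) => //; exact: sroot_root D i.
Qed.

(** The rows of a Weyl group matrix are images of simple roots, hence roots, and there are finitely
    many roots. *)
Lemma finite_wgroup : finite_set wgroup.
Proof.
pose T := {ffun 'I_r -> seq_sub (finmap.enum_fset (fset_set [set b | root b]))}.
apply: (sub_finite_set (B := (fun f : T => \matrix_i ssval (f i)) @` setT)); last first.
  by apply: finite_image; apply: finite_finset.
move=> w ww.
have rw i : row i w \in finmap.enum_fset (fset_set [set b | root b]).
  have -> : (row i w \in finmap.enum_fset (fset_set [set b | root b])) = (row i w \in [set b | root b]).
    by rewrite -(in_fset_set finite_roots).
  apply/mem_set => /=.
  by rewrite rowE; apply: root_wgroup => //; exact: sroot_root D i.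
exists [ffun i => SeqSub (rw i)] => //.
by apply/row_matrixP => i; rewrite rowK ffunE.
Qed.

Definition wseq : seq 'M[R]_r := finmap.enum_fset (fset_set wgroup).

Lemma mem_wseq w : w \in wseq <-> wgroup w.
Proof.
have E : (w \in wseq) = (w \in wgroup) by rewrite -(in_fset_set finite_wgroup).
by rewrite E; split => [/set_mem//|h]; apply/mem_set.
Qed.

Lemma wseq_uniq : uniq wseq. Proof. exact: finmap.fset_uniq. Qed.

Lemma perm_wseq_mul w : wgroup w -> perm_eq [seq w' *m w | w' <- wseq] wseq.
Proof.
move=> ww; have [w' ww' [wK w'K]] := wgroupV ww.
have um : uniq [seq w' *m w | w' <- wseq].
  rewrite map_inj_uniq ?wseq_uniq // => x y /(congr1 (mulmx^~ w')).
  by rewrite -!mulmxA wK !mulmx1.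
apply: uniq_perm => //; first exact: wseq_uniq.
have sub : {subset [seq w' *m w | w' <- wseq] <= wseq}.
  by move=> _ /mapP[x /mem_wseq xw ->]; apply/mem_wseq; apply: wgroupM.
by have [] := uniq_min_size um sub; rewrite ?size_map.
Qed.

Lemma perm_wseq_mull w : wgroup w -> perm_eq [seq w *m w' | w' <- wseq] wseq.
Proof.
move=> ww; have [w' ww' [wK w'K]] := wgroupV ww.
have um : uniq [seq w *m w' | w' <- wseq].
  rewrite map_inj_uniq ?wseq_uniq // => x y /(congr1 (mulmx w')).
  by rewrite !mulmxA w'K !mul1mx.
apply: uniq_perm => //; first exact: wseq_uniq.
have sub : {subset [seq w *m w' | w' <- wseq] <= wseq}.
  by move=> _ /mapP[x /mem_wseq xw ->]; apply/mem_wseq; apply: wgroupM.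
by have [] := uniq_min_size um sub; rewrite ?size_map.
Qed.

(** Row [i] is minus a unit vector, and deleting row and column [i] leaves the identity. *)
Lemma det_sreflm i : \det (sreflm i) = -1.
Proof.
have E k j : sreflm i k j = (k == j)%:R - cp (al k) (al i) * (i == j)%:R.
  have -> : sreflm i k j = (al k *m sreflm i) 0 j by rewrite /sroot -rowE [RHS]mxE.
  by rewrite mul_sreflm reflE !mxE !eqxx /= eq_sym (eq_sym j i).
rewrite (expand_det_row _ i) (bigD1 i) //= big1 ?addr0 => [|j ji]; last first.
  by rewrite E !(eq_sym i j) (negPf ji) mulr0 subrr mul0r.
rewrite E eqxx mulr1 (cpairxx D kilE (sroot_neq0 i)) /cofactor -signr_odd oddD addbb expr0 mul1r.
rewrite (_ : row' i (col' i (sreflm i)) = 1%:M) ?det1; first by rewrite -[true%:R]/(1 : R); ring.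
apply/matrixP => k j; rewrite [LHS]mxE [LHS]mxE E [RHS]mxE (inj_eq lift_inj) (negPf (neq_lift i j)).
by rewrite mulr0 subr0.
Qed.

Lemma det_wword s : \det (wword s) = (-1) ^+ size s.
Proof.
elim: s => [|i s IH]; first by rewrite wword_nil det1.
by rewrite wword_cons det_mulmx det_sreflm IH exprS.
Qed.

Lemma det_wgroup w : wgroup w -> \det w = 1 \/ \det w = -1.
Proof.
move=> [s _ <-]; rewrite det_wword -signr_odd; case: odd; [right|left];
by rewrite ?expr1 ?expr0.
Qed.

Lemma det_wgroup_sqr w : wgroup w -> \det w * \det w = 1.
Proof. by move=> /det_wgroup[] ->; ring. Qed.

Definition reduced s := forall t, wword t = wword s -> (size s <= size t)%N.

Lemma reduced_ex w : wgroup w -> exists2 s, wword s = w & reduced s.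
Proof.
move=> [s0 _ <-].
have ex : exists n, `[< exists2 s, wword s = wword s0 & size s = n >].
  by exists (size s0); apply/asboolP; exists s0.
have [n /asboolP[s sE sn] nmin] := ex_minnP ex.
by exists s => // t tE; rewrite sn nmin //; apply/asboolP; exists t; rewrite ?tE.
Qed.

Lemma reduced_behead i s : reduced (i :: s) -> reduced s.
Proof.
move=> red t tE; have := red (i :: t); rewrite !wword_cons tE => /(_ erefl).
by rewrite ltnS.
Qed.

Lemma sreflm_conj i j p : wgroup p -> al i *m p = al j -> sreflm i *m p = p *m sreflm j.
Proof.
move=> pw ip_j; apply: mxrow_ext => b; rewrite !mulmxA !mul_sreflm !reflE mulmxBl -scalemxAl ip_j.
by congr (_ - _ *: _); rewrite !cpairE -ip_j !ip_wgroup.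
Qed.

(* Exchange condition: where the images of alpha_i along the word change sign, two
   letters can be cancelled. *)
Lemma reduced_pos i s : reduced (i :: s) -> al i *m wword s \in proots.
Proof.
move=> red; apply: contrapT => /negP neg.
have ex : exists n, al i *m wword (take n s) \notin proots.
  by exists (size s); rewrite take_size.
have [[|k] kN kmin] := ex_minnP ex.
  by move: kN; rewrite take0 wword_nil mulmx1 sroot_pos.
have ks : (k < size s)%N.
  rewrite ltnNge; apply/negP => sk; have := kmin k.
  rewrite ltnn; move: kN; rewrite (take_oversize sk) take_oversize ?(leqW sk) // => -> h.
  by have := h isT.
have kp : al i *m wword (take k s) \in proots.
  by apply: contrapT => /negP /kmin; rewrite ltnn.
case: s red neg ex ks kN kmin kp => // i0 s0; set s := i0 :: s0 => red _ _ ks kN _ kp.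
set j := nth i0 s k.
have kE : al i *m wword (take k s) = al j.
  apply: contrapT => /eqP ne; move/negP: kN; apply.
  rewrite (take_nth i0 ks) -cats1 wword_cat wword_cons wword_nil mulmx1 mulmxA mul_sreflm.
  exact: refl_sroot_proot.
(* Moved past the prefix, the reflection in [al i] becomes the one in [al j] and cancels against
   letter [k] of [s]; the resulting word is two letters shorter than [i :: s]. *)
have := red (take k s ++ drop k.+1 s).
have pk : wgroup (wword (take k s)) by exists (take k s).
rewrite wword_cons -{3}(cat_take_drop k s) (drop_nth i0 ks) !wword_cat wword_cons !mulmxA.
rewrite (sreflm_conj pk kE) -(mulmxA _ (sreflm j) (sreflm j)) sreflmK mulmx1 => /(_ erefl).
by rewrite size_cat size_take size_drop ks -[size (i :: s)]/((size s).+1); move: (size s) ks => q ks; lia.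
Qed.

Definition dom : set 'rV[R]_r := [set b | forall i, 0 <= ip b (al i)].

Lemma cpair_ge0 b i : (0 <= cp b (al i)) = (0 <= ip b (al i)).
Proof.
have i0 := ip_gt0 D kilE (sroot_neq0 i).
by rewrite cpairE pmulr_lge0 ?invr_gt0 // pmulr_rge0.
Qed.

Lemma cpair_gt0 b i : (0 < cp b (al i)) = (0 < ip b (al i)).
Proof.
have i0 := ip_gt0 D kilE (sroot_neq0 i).
by rewrite cpairE pmulr_lgt0 ?invr_gt0 // pmulr_rgt0.
Qed.

(** Along a reduced word, prefixing the letter [j] subtracts a nonnegative multiple of
    [al j *m wword s], a positive root by [reduced_pos]. *)
Lemma dom_wgroup_le b w : dom b -> wgroup w -> forall i, (b *m w) 0 i <= b 0 i.
Proof.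
move=> db /reduced_ex[s <-]; elim: s => [|j s IH] red i; first by rewrite wword_nil mulmx1.
rewrite wword_cons mulmxA mul_sreflm reflE mulmxBl -scalemxAl !mxE.
have := IH (reduced_behead red) i; rewrite mxE => h; apply: le_trans h.
rewrite lerBlDr lerDl mulr_ge0 // ?cpair_ge0 ?db //.
by have /mem_proots[_ /(_ i)] := reduced_pos red; rewrite mxE.
Qed.

Lemma dom_wgroup_eq b w : dom b -> wgroup w -> dom (b *m w) -> b *m w = b.
Proof.
move=> db ww dw; have [w' ww' [wK _]] := wgroupV ww; apply/rowP => i; apply: le_anti.
rewrite dom_wgroup_le //=.
by have := dom_wgroup_le dw ww' i; rewrite -mulmxA wK mulmx1.
Qed.

(** For a nonempty reduced word a strictly positive multiple of a positive root is subtracted from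
    something below [b], so the image cannot be [b] again. *)
Lemma strict_dom_stab b w : (forall i, 0 < ip b (al i)) -> wgroup w -> b *m w = b -> w = 1%:M.
Proof.
move=> sb /reduced_ex[[|j s] <- red]; first by rewrite wword_nil.
rewrite wword_cons mulmxA mul_sreflm reflE mulmxBl -scalemxAl => bE; exfalso.
have db : dom b by move=> i; exact: ltW.
have := proot_neq0 (reduced_pos red) => /negP; apply; apply/eqP/rowP => i.
have ws : wgroup (wword s) by exists s.
have /mem_proots[_ /(_ i) p0] := reduced_pos red.
have le := dom_wgroup_le db ws i.
have cj : 0 < cp b (al j) by rewrite cpair_gt0.
move/rowP/(_ i): bE; rewrite [in LHS]mxE [in X in _ + X]mxE [X in - X]mxE => bE.
rewrite [RHS]mxE; apply: le_anti; rewrite p0 andbT -(pmulr_rle0 _ cj).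
by rewrite -(lerD2l ((b *m wword s) 0 i)) -subr_ge0; move: bE le; lra.
Qed.

(** A point of the orbit with maximal coordinate sum is dominant: a negative pairing with [al i]
    would let the reflection raise the sum. *)
Lemma dom_ex b : exists2 w, wgroup w & dom (b *m w).
Proof.
have ne : wseq != [::] by apply/eqP => e; have /mem_wseq := wgroup1; rewrite e.
have [w /mem_wseq ww wmax] := seq_argmax (fun w => \sum_i (b *m w) 0 i) ne.
exists w => // i; rewrite leNgt; apply/negP => lt0.
have /mem_wseq/wmax : wgroup (w *m sreflm i) by apply: wgroupM => //; apply: wgroup_sreflm.
rewrite mulmxA mul_sreflm reflE leNgt => /negP; apply.
have -> : \sum_j (b *m w - cp (b *m w) (al i) *: al i) 0 j =
    \sum_j ((b *m w) 0 j - cp (b *m w) (al i) * al i 0 j).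
  by apply: eq_bigr => j _; rewrite mxE; congr (_ + _); rewrite mxE; congr (- _); rewrite mxE.
rewrite sumrB ltrDl oppr_gt0 -mulr_sumr (bigD1 i) //= big1 => [|j ji].
  rewrite addr0 mxE !eqxx mulr1 cpairE pmulr_llt0 ?invr_gt0 ?(ip_gt0 D kilE (sroot_neq0 i)) //.
  by rewrite pmulr_rlt0.
by rewrite mxE (negPf ji) andbF.
Qed.

End WeylGroup.

(** * Casimir elements *)

Section CasimirFamilies.
Variables (K : fieldType) (g : lieAlgType K).
Hypothesis nondeg : forall x : g, (forall y, killing x y = 0) -> x = 0.

(** The pairs of such a family sum to the tensor inverse to the Killing form. [cas] does not depend
    on the family, so the basis in the definition of the Casimir element can be traded for root
    vectors. *)
Definition reproducing (s : seq (g * g)) :=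
  forall z, \sum_(p <- s) killing z p.2 *: p.1 = z.

Definition cas (M : rep g) (s : seq (g * g)) : 'M[K]_(rdim M) :=
  \sum_(p <- s) M p.1 *m M p.2.

Lemma reproducing_sym s : reproducing s -> forall z, \sum_(p <- s) killing p.1 z *: p.2 = z.
Proof.
move=> rs z; apply/eqP; rewrite -subr_eq0; apply/eqP; apply: nondeg => w.
rewrite killingDl killingNl killing_suml -{2}(rs w) killing_sumr; apply/eqP.
rewrite subr_eq0; apply/eqP/eq_bigr => p _.
by rewrite killingZl killingZr (killingC z) (killingC p.2) mulrC.
Qed.

Lemma cas_swap (M : rep g) s t : reproducing s -> reproducing t ->
  cas M s = cas M [seq (p.2, p.1) | p <- t].
Proof.
move=> rs rt; rewrite /cas big_map /=.
transitivity (\sum_(p <- s) \sum_(q <- t) killing p.2 q.2 *: (M p.1 *m M q.1)).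
  apply: eq_bigr => p _; rewrite -{1}(rt p.2) ract_sum mulmx_sumr.
  by apply: eq_bigr => q _; rewrite ractZ scalemxAr.
rewrite exchange_big; apply: eq_bigr => q _ /=.
rewrite -[in RHS](rs q.2) ract_sum mulmx_suml; apply: eq_bigr => p _.
by rewrite ractZ -scalemxAl killingC.
Qed.

Lemma cas_indep (M : rep g) s t : reproducing s -> reproducing t -> cas M s = cas M t.
Proof. by move=> rs rt; rewrite (cas_swap M rs rs) (cas_swap M rt rs). Qed.

Lemma cas_comm (M : rep g) s z : reproducing s -> M z *m cas M s = cas M s *m M z.
Proof.
move=> rs; apply/eqP; rewrite -subr_eq0 mulmx_sumr mulmx_suml -sumrB.
have E p : M z *m (M p.1 *m M p.2) - M p.1 *m M p.2 *m M z =
    M (lie z p.1) *m M p.2 + M p.1 *m M (lie z p.2).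
  by rewrite !ract_lie mulmxBl mulmxBr !mulmxA addrA subrK.
rewrite (eq_bigr _ (fun p _ => E p)) big_split /= addr_eq0 -sumrN; apply/eqP.
transitivity (\sum_(p <- s) \sum_(q <- s) killing (lie z p.1) q.2 *: (M q.1 *m M p.2)).
  apply: eq_bigr => p _; rewrite -{1}(rs (lie z p.1)) ract_sum mulmx_suml.
  by apply: eq_bigr => q _; rewrite ractZ scalemxAl.
rewrite exchange_big; apply: eq_bigr => q _ /=.
rewrite -mulmxN -ractN -[in RHS](reproducing_sym rs (- lie z q.2)) ract_sum mulmx_sumr.
apply: eq_bigr => p _; rewrite ractZ -scalemxAr; congr (_ *: _).
by rewrite killingNr -killing_inv (lieC p.1) killingNl opprK.
Qed.

Definition vb_family : seq (g * g) :=
  let e := vbasis {:g} in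
  let Q := \matrix_(i, j) killing e`_i e`_j : 'M[K]_(\dim {:g}) in
  [seq (e`_i, \sum_j invmx Q i j *: e`_j) | i : 'I_(\dim {:g}) <- enum 'I_(\dim {:g})].

Lemma casimir_mxE (M : rep g) : casimir_mx M = cas M vb_family.
Proof.
rewrite /cas big_map /= big_enum /=; apply: eq_bigr => i _.
by rewrite ract_sum mulmx_sumr; apply: eq_bigr => j _; rewrite ractZ -scalemxAr.
Qed.

Lemma vb_reproducing : reproducing vb_family.
Proof.
move=> z; rewrite big_map /= big_enum /=; set e := vbasis _.
set Q : 'M[K]_(\dim {:g}) := \matrix_(i, j) killing e`_i e`_j.
have zE := coord_vbasis (memvf z).
have Qs : Q^T = Q by apply/matrixP => i j; rewrite !mxE killingC.
have Qu : Q \in unitmx.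
  rewrite -row_free_unit -kermx_eq0; apply/rowV0P => v /sub_kermxP vQ.
  have v0 : \sum_i v 0 i *: e`_i = 0.
    apply: nondeg => y; rewrite (coord_vbasis (memvf y)) killing_sumr big1 // => j _.
    rewrite killingZr killing_suml; move/rowP/(_ j): vQ; rewrite !mxE => vj.
    rewrite (_ : \sum_i _ = 0) ?mulr0 // -[RHS]vj.
    by apply: eq_bigr => i _; rewrite mxE killingZl.
  apply/rowP => i; have /freeP := basis_free (vbasisP {:g}).
  by rewrite mxE; apply; exact: v0.
have cE : \row_i killing z e`_i = \row_i coord e i z *m Q.
  apply/rowP => j; rewrite !mxE {1}zE killing_suml.
  by apply: eq_bigr => i _; rewrite killingZl !mxE.
rewrite [RHS]zE; apply: eq_bigr => i _; congr (_ *: _).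
have : (\row_i killing z e`_i) *m invmx Q = \row_i coord e i z by rewrite cE mulmxK.
move/rowP/(_ i); rewrite [RHS]mxE => <-; rewrite !mxE killing_sumr.
have Qi : (invmx Q)^T = invmx Q by rewrite trmx_inv Qs.
apply: eq_bigr => j _; rewrite killingZr mxE mulrC; congr (_ * _).
by rewrite -[in RHS]Qi mxE.
Qed.

End CasimirFamilies.

Section CasimirRoots.
Variables (R : realType) (K : numFieldType) (g : lieAlgType K) (H : {vspace g}).
Variables (r : nat) (a : r.-tuple g) (iota : {rmorphism R -> K}) (rv : 'rV[R]_r -> g).
Hypothesis D : cartan_data H a iota rv.
Variable ip : 'rV[R]_r -> 'rV[R]_r -> R.
Hypothesis kilE : forall b c, killing (rv b) (rv c) = iota (ip b c).
Let cart := cd_cartan D.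
Let sroots := cd_roots D.
Local Notation kil b c := (killing (rv b) (rv c)).
Local Notation root := (rootv H rv).
Local Notation wtv := (wt_vec H rv).
Local Notation proots := (pos_roots_seq H rv).
Local Notation rho := (rho H rv).

Lemma choose_root_pairs : exists e f : 'rV[R]_r -> g, forall b, root b -> root_pair H rv b (e b) (f b).
Proof.
pose p b := xget (0, 0) [set p : g * g | root_pair H rv b p.1 p.2].
exists (fun b => (p b).1), (fun b => (p b).2) => b rb.
have [x [y xy]] := root_pair_ex D rb.
by apply: (xgetPex (0, 0) (P := fun p : g * g => root_pair H rv b p.1 p.2)); exists (x, y).
Qed.

Lemma killing_rootspaces b c x y : in_root_space H (rv b) x -> in_root_space H (rv c) y ->
  b + c != 0 -> killing x y = 0.
Proof.
move=> xb yc bc; apply: contrapT => /eqP /(killing_root_orth D xb yc) cb.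
by move: bc; rewrite cb subrr eqxx.
Qed.

Lemma cartan_family : exists s : seq (g * g), (forall p, p \in s -> p.1 \in H /\ p.2 \in H) /\
  forall h, h \in H -> \sum_(p <- s) killing h p.2 *: p.1 = h.
Proof.
pose G := invmx (gram_aC a).
have Gs : (gram_aC a)^T = gram_aC a by apply/matrixP => i j; rewrite !mxE killingC.
have aH i : tnth a i \in H by rewrite -(rvec_sroot D) (rvec_in D).
exists [seq (tnth a i, \sum_j G i j *: tnth a j) | i : 'I_r <- enum 'I_r]; split.
  by move=> _ /mapP[i _ ->]; split => //=; apply: memv_suml => j _; apply: memvZ.
move=> _ /(cartan_coord sroots)[c ->]; rewrite big_map big_enum /=; apply: eq_bigr => i _.
congr (_ *: _); set z := \sum_i0 _.
have cE : \row_i killing z (tnth a i) = \row_i c i *m gram_aC a.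
  apply/rowP => j; rewrite !mxE killing_suml.
  by apply: eq_bigr => k _; rewrite killingZl !mxE.
have : (\row_i killing z (tnth a i)) *m G = \row_i c i by rewrite cE mulmxK ?(gram_aC_unit D).
move/rowP/(_ i); rewrite [RHS]mxE => <-; rewrite !mxE killing_sumr.
have Gi : G^T = G by rewrite /G trmx_inv Gs.
apply: eq_bigr => j _; rewrite killingZr mxE mulrC; congr (_ * _).
by rewrite -[in RHS]Gi mxE.
Qed.

(** It suffices to test a weight basis of the adjoint representation: a vector of weight 0 lies in
    [H] and sees only [s], and a root vector sees only the pair of its own root, where
    [root_space_line] applies. *)
Lemma root_family e f s : (forall b, root b -> root_pair H rv b (e b) (f b)) ->
  (forall p, p \in s -> p.1 \in H /\ p.2 \in H) ->
  (forall h, h \in H -> \sum_(p <- s) killing h p.2 *: p.1 = h) ->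
  reproducing (s ++ [seq (e b, f b) | b <- proots] ++ [seq (f b, e b) | b <- proots]).
Proof.
move=> ef sH srep z.
have [P [mu [Pmu mur]]] := ad_wt_basis D; have [Pu Pw] := Pmu.
rewrite -[z]ccolK [ccol z](col_span _ Pu) ofcol_sum.
under eq_bigr do rewrite killing_suml scaler_suml.
rewrite exchange_big; apply: eq_bigr => i _ /=.
rewrite ofcolZ; under eq_bigr do rewrite killingZl -scalerA.
rewrite -scaler_sumr; congr (_ *: _); set y := ofcol _.
have yw : in_root_space H (rv (mu i)) y by apply/in_root_space_ccol; rewrite ofcolK.
rewrite !big_cat !big_map /=.
have hw p : p \in s -> in_root_space H (rv 0) p.2.
  by move=> /sH[_ pH] h hH; case: cart => -> // _ _; rewrite (rvec0 D) killing0l scale0r.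
have fb b : b \in proots -> in_root_space H (rv (- b)) (f b).
  by move=> /(mem_proots D)[/ef[_ + _] _].
have eb b : b \in proots -> in_root_space H (rv b) (e b).
  by move=> /(mem_proots D)[/ef[+ _ _] _].
have [mu0|mu0] := eqVneq (mu i) 0.
  rewrite mu0 in yw; have yH := in_root_space0 D yw.
  rewrite srep // !big_seq big1 => [|b bp]; last first.
    rewrite (killing_rootspaces yw (fb b bp)) ?scale0r // add0r oppr_eq0.
    exact: (proot_neq0 D bp).
  rewrite big1_seq ?addr0 // => b /andP[_ bp].
  by rewrite (killing_rootspaces yw (eb b bp)) ?scale0r // add0r (proot_neq0 D bp).
have sum0 : \sum_(p <- s) killing y p.2 *: p.1 = 0.
  rewrite big_seq big1 // => p ps.
  by rewrite (killing_rootspaces yw (hw p ps)) ?scale0r // addr0.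
rewrite sum0 add0r.
have [mp|mp] := root_pos_or_neg D (mur i mu0).
  rewrite [X in _ + X]big_seq [X in _ + X]big1 => [|b bp]; last first.
    rewrite (killing_rootspaces yw (eb b bp)) ?scale0r // addr_eq0.
    by apply: contraTneq mp => ->; exact: (proot_notN D bp).
  rewrite addr0 (bigD1_seq (mu i)) ?proots_uniq //=.
  rewrite -(root_space_line D kilE (mur i mu0) (ef _ (mur i mu0)) yw) big_seq_cond big1 ?addr0 // => b.
  move=> /andP[bp bm]; rewrite (killing_rootspaces yw (fb b bp)) ?scale0r // subr_eq0.
  by rewrite eq_sym.
rewrite [X in X + _]big_seq [X in X + _]big1 => [|b bp]; last first.
  rewrite (killing_rootspaces yw (fb b bp)) ?scale0r // subr_eq0.
  by apply: contraTneq mp => ->; exact: (proot_notN D bp).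
rewrite add0r (bigD1_seq (- mu i)) ?proots_uniq //=.
have rn : root (- mu i) := rootvN D (mur i mu0).
have pn := root_pairN (ef _ rn); rewrite opprK in pn.
rewrite -(root_space_line D kilE (mur i mu0) pn yw) big_seq_cond big1 ?addr0 // => b.
move=> /andP[bp bm]; rewrite (killing_rootspaces yw (eb b bp)) ?scale0r // addr_eq0.
by apply: contraNneq bm => ->; rewrite opprK.
Qed.

Definition singular (M : rep g) lam (v : 'cV[K]_(rdim M)) :=
  [/\ v != 0, wtv lam v &
      forall b x, b \in proots -> in_root_space H (rv b) x -> M x *m v = 0].

(** In the root family the part from [H] gives [(lam, lam)]. The terms [f e] kill [v], and [e f]
    acts on [v] as [lie e f], which gives [(lam, b)] for each positive root [b], in total
    [(lam, 2 rho)]. *)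
Lemma cas_singular (M : rep g) lam (v : 'cV[K]_(rdim M)) s : reproducing s -> singular lam v ->
  cas M s *m v = iota (ip lam (lam + 2 *: rho)) *: v.
Proof.
move=> rs [v0 vl vs]; have [e [f ef]] := choose_root_pairs.
have [t [tH trep]] := cartan_family.
rewrite (cas_indep M rs (root_family ef tH trep)) /cas !big_cat !big_map /= !mulmxDl.
rewrite !mulmx_suml.
have -> : \sum_(p <- t) M p.1 *m M p.2 *m v = kil lam lam *: v.
  rewrite -{1}(trep (rv lam)) ?(rvec_in D) // killing_suml scaler_suml.
  rewrite !big_seq; apply: eq_bigr => p /tH[p1 p2].
  by rewrite -mulmxA (vl _ p2) -scalemxAr (vl _ p1) scalerA killingZl (killingC p.1).
have -> : \sum_(b <- proots) M (e b) *m M (f b) *m v = kil lam (2 *: rho) *: v.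
  rewrite /rho scalerA mulfV ?pnatr_eq0 // scale1r (rvec_sum D) killing_sumr scaler_suml.
  rewrite !big_seq; apply: eq_bigr => b bp; have /(mem_proots D)[rb _] := bp.
  have [eb fb _] := ef b rb.
  have := congr1 (fun A => A *m v) (ract_lie M (e b) (f b)).
  rewrite (root_pair_lie D (ef b rb)) mulmxBl -(mulmxA (M (f b))) (vs b) // mulmx0 subr0 => <-.
  by rewrite vl ?(rvec_in D).
have -> : \sum_(b <- proots) M (f b) *m M (e b) *m v = 0.
  rewrite big_seq big1 // => b bp; have /(mem_proots D)[rb _] := bp.
  by have [eb _ _] := ef b rb; rewrite -mulmxA (vs b) // mulmx0.
by rewrite addr0 -scalerDl -killingDr -(rvecD D) kilE.
Qed.

End CasimirRoots.

Lemma free_subset_span (K : fieldType) (V : vectType K) (s : seq V) :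
  exists t, [/\ free t, (<< t >> = << s >>)%VS & {subset t <= s}].
Proof.
elim: s => [|v s [t [ft ts sub]]]; first by exists [::]; split=> //; exact: nil_free.
have [vs|vs] := boolP (v \in << s >>%VS).
  exists t; split=> // [|w /sub ws]; last by rewrite inE ws orbT.
  by rewrite span_cons ts; apply/esym/addv_idPr; rewrite -memvE.
exists (v :: t); split; first by rewrite free_cons ts vs.
  by rewrite !span_cons ts.
by move=> w; rewrite !inE => /orP[->//|/sub ->]; rewrite orbT.
Qed.

(** Generated submodules are obtained in this way, and a property of all their vectors is proved by
    exhibiting another subspace that satisfies [P]. *)
Lemma minimal_vspace (K : fieldType) (V : vectType K) (P : {vspace V} -> Prop) :
  P fullv -> (forall U W, P U -> P W -> P (U :&: W)%VS) ->
  exists2 U, P U & forall W, P W -> (U <= W)%VS.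
Proof.
move=> Pf PI.
have ex : exists n, `[< exists2 U, P U & \dim U = n >].
  by exists (\dim {:V}); apply/asboolP; exists fullv.
have [n /asboolP[U PU Un] nmin] := ex_minnP ex.
exists U => // W PW; have : `[< exists2 U', P U' & \dim U' = \dim (U :&: W) >].
  by apply/asboolP; exists (U :&: W)%VS => //; apply: PI.
move=> /nmin; rewrite -Un => dle.
have /eqP <- : (U :&: W == U)%VS by rewrite eqEdim capvSl.
exact: capvSr.
Qed.

Lemma perp_dim (K : fieldType) (n : nat) (U : {vspace 'cV[K]_n}) :
  exists2 W : {vspace 'cV[K]_n}, (forall w, w \in W <-> forall u, u \in U -> u^T *m w = 0) &
  (n <= \dim W + \dim U)%N.
Proof.
pose A : 'M[K]_(\dim U, n) := \matrix_i ((vbasis U)`_i)^T.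
exists (lker (linfun (mulmx A))).
  move=> w; rewrite memv_ker lfunE /=; split=> [/eqP Aw u uU|wU].
    rewrite (coord_vbasis uU) linear_sum mulmx_suml big1 // => i _.
    rewrite linearZ -scalemxAl /=.
    have -> : ((vbasis U)`_i)^T *m w = row i (A *m w) by rewrite row_mul rowK.
    by rewrite Aw row0 scaler0.
  apply/eqP/row_matrixP => i; rewrite row_mul rowK row0; apply: wU.
  by rewrite vbasis_mem // mem_nth ?size_tuple.
have := limg_ker_dim (linfun (mulmx A) : 'Hom('cV[K]_n, 'cV[K]_(\dim U))) fullv.
rewrite capfv => E.
have nE : \dim {: 'cV[K]_n} = n by rewrite dimvf /dim /= muln1.
have := dimvS (subvf (limg (linfun (mulmx A) : 'Hom('cV[K]_n, 'cV[K]_(\dim U))))).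
have -> : \dim {: 'cV[K]_(\dim U)} = \dim U by rewrite dimvf /dim /= muln1.
by move=> le; apply: (@leq_trans (\dim {: 'cV[K]_n})); [rewrite nE|rewrite -E leq_add2l].
Qed.

Section RepConstructions.
Variables (K : fieldType) (g : lieAlgType K).
Implicit Types M N X Y : rep g.

Definition gstable M (U : {vspace 'cV[K]_(rdim M)}) := forall x v, v \in U -> M x *m v \in U.

Lemma rep_iso_refl M : rep_iso M M.
Proof. by exists 1%:M, 1%:M; split; rewrite ?mulmx1 // => x; rewrite mulmx1 mul1mx. Qed.

Lemma rep_iso_sym M N : rep_iso M N -> rep_iso N M.
Proof.
move=> [P [Q [PQ QP E]]]; exists Q, P; split=> // x.
by rewrite -[N x *m Q]mul1mx -QP -!mulmxA (mulmxA P) -E -!mulmxA PQ mulmx1.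
Qed.

Lemma rep_iso_trans M N X : rep_iso M N -> rep_iso N X -> rep_iso M X.
Proof.
move=> [P [Q [PQ QP E]]] [P' [Q' [PQ' QP' E']]]; exists (P *m P'), (Q' *m Q); split.
- by rewrite mulmxA -(mulmxA P) PQ' mulmx1.
- by rewrite mulmxA -(mulmxA Q') QP mulmx1.
- by move=> x; rewrite mulmxA E -!mulmxA E'.
Qed.

Lemma rep_iso_dsum M M' N N' : rep_iso M M' -> rep_iso N N' ->
  rep_iso (dsum_rep M N) (dsum_rep M' N').
Proof.
move=> [P [Q [PQ QP E]]] [P' [Q' [PQ' QP' E']]].
exists (block_mx P 0 0 P'), (block_mx Q 0 0 Q'); split=> [||x /=];
  rewrite ?/dsum_act !mulmx_block !mulmx0 !mul0mx !addr0 !add0r ?PQ ?PQ' ?QP ?QP' ?E ?E' //;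
  by rewrite -scalar_mx_block.
Qed.

Definition dual_act M x : 'M[K]_(rdim M) := - (M x)^T.

Lemma dual_act_linear M c x y : dual_act M (c *: x + y) = c *: dual_act M x + dual_act M y.
Proof. by rewrite /dual_act ract_linear linearP opprD scalerN. Qed.

Lemma dual_act_lie M x y :
  dual_act M (lie x y) = dual_act M x *m dual_act M y - dual_act M y *m dual_act M x.
Proof.
rewrite /dual_act ract_lie linearB /= !trmx_mul !mulNmx !mulmxN !opprK opprB.
by [].
Qed.

Definition dual_rep M : rep g := Rep (dual_act_linear M) (dual_act_lie M).

(* The action in the coordinates of the columns of [B], which has left inverse [L]. *)
Definition sub_act M k (B : 'M[K]_(rdim M, k)) (L : 'M[K]_(k, rdim M)) x := L *m M x *m B.

(** [B] is the inclusion of the submodule in coordinates and [L] a linear retraction, in general not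
    equivariant. *)
Lemma subrep_ex M (U : {vspace 'cV[K]_(rdim M)}) : gstable U ->
  exists (X : rep g) (B : 'M[K]_(rdim M, rdim X)) (L : 'M[K]_(rdim X, rdim M)),
    [/\ L *m B = 1%:M, (forall x, M x *m B = B *m X x), (forall v, B *m v \in U),
        (forall u, u \in U -> B *m (L *m u) = u) & rdim X = \dim U].
Proof.
move=> gU; set k := \dim U.
pose B : 'M[K]_(rdim M, k) := \matrix_(i, j) (vbasis U)`_j i 0.
have colB j : col j B = (vbasis U)`_j by apply/colP => i; rewrite !mxE.
have BE v : B *m v = \sum_j v j 0 *: (vbasis U)`_j.
  transitivity (\sum_j v j 0 *: col j B); last by apply: eq_bigr => j _; rewrite colB.
  by apply/colP => i; rewrite mxE summxE; apply: eq_bigr => j _; rewrite !mxE mulrC.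
have BU v : B *m v \in U.
  rewrite BE; apply: memv_suml => j _; apply: memvZ.
  by rewrite vbasis_mem // mem_nth ?size_tuple.
have Binj (v : 'cV[K]_k) : B *m v = 0 -> v = 0.
  rewrite BE => v0; apply/colP => j; rewrite mxE.
  by have /freeP F := basis_free (vbasisP U); exact: (F (fun j => v j 0) v0 j).
have [L LB] : exists L : 'M[K]_(k, rdim M), L *m B = 1%:M.
  have : row_free B^T.
    rewrite -kermx_eq0; apply/rowV0P => v /sub_kermxP vB.
    apply: (can_inj (@trmxK _ _ _)); rewrite trmx0; apply: Binj.
    by apply: (can_inj (@trmxK _ _ _)); rewrite trmx_mul trmxK vB trmx0.
  move=> /row_freeP[C CB]; exists C^T.
  by apply: (can_inj (@trmxK _ _ _)); rewrite trmx_mul trmxK CB trmx1.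
have BL u : u \in U -> B *m (L *m u) = u.
  move=> uU; have [v ->] : exists v, u = B *m v.
    exists (\col_j coord (vbasis U) j u); rewrite BE [LHS](coord_vbasis uU).
    by apply: eq_bigr => j _; rewrite mxE.
  by rewrite (mulmxA L) LB mul1mx.
have colext m n (A C : 'M[K]_(m, n)) : (forall j, col j A = col j C) -> A = C.
  by move=> AC; apply/matrixP => i j; have /colP/(_ i) := AC j; rewrite !mxE.
have act x : M x *m B = B *m sub_act B L x.
  apply: colext => j; rewrite /sub_act !mulmxA -!col_mul -!mulmxA BL //.
  by apply: gU; rewrite colB vbasis_mem // mem_nth ?size_tuple.
have Xlin c x y : sub_act B L (c *: x + y) = c *: sub_act B L x + sub_act B L y.
  by rewrite /sub_act ract_linear mulmxDr mulmxDl -scalemxAr -scalemxAl.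
have Xlie x y : sub_act B L (lie x y) =
    sub_act B L x *m sub_act B L y - sub_act B L y *m sub_act B L x.
  have E z w : sub_act B L z *m sub_act B L w = L *m (M z *m M w) *m B.
    by rewrite {1}/sub_act -!mulmxA -act !mulmxA.
  by rewrite !E {1}/sub_act ract_lie mulmxBr mulmxBl.
by exists (Rep Xlin Xlie), B, L.
Qed.

Lemma gstable_capv M (U W : {vspace 'cV[K]_(rdim M)}) : gstable U -> gstable W ->
  gstable (U :&: W)%VS.
Proof. by move=> gU gW x v /memv_capP[vU vW]; apply/memv_capP; split; [apply: gU|apply: gW]. Qed.

Lemma split_rep_iso M (U W : {vspace 'cV[K]_(rdim M)}) X Y
    (B : 'M[K]_(rdim M, rdim X)) (L : 'M[K]_(rdim X, rdim M))
    (C : 'M[K]_(rdim M, rdim Y)) (L' : 'M[K]_(rdim Y, rdim M)) :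
  (U :&: W = 0)%VS -> (\dim U + \dim W = rdim M)%N ->
  rdim X = \dim U -> rdim Y = \dim W ->
  L *m B = 1%:M -> L' *m C = 1%:M ->
  (forall v, B *m v \in U) -> (forall v, C *m v \in W) ->
  (forall x, M x *m B = B *m X x) -> (forall x, M x *m C = C *m Y x) ->
  exists Q : 'M[K]_(rdim X + rdim Y, rdim M),
    [/\ row_mx B C *m Q = 1%:M, Q *m row_mx B C = 1%:M &
        forall x, M x *m row_mx B C = row_mx B C *m dsum_rep X Y x].
Proof.
move=> UW0 dUW dX dY LB LC BU CW BX CY.
have eXY : (rdim X + rdim Y = rdim M)%N by rewrite dX dY.
have inj (v : 'cV[K]_(rdim X + rdim Y)) : row_mx B C *m v = 0 -> v = 0.
  rewrite -[v]vsubmxK mul_row_col => /eqP; rewrite addr_eq0 => /eqP e.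
  have : B *m usubmx v \in (U :&: W)%VS.
    by apply/memv_capP; split=> //; rewrite e memvN.
  rewrite UW0 memv0 => /eqP B0; move: e; rewrite B0 => /esym/eqP; rewrite oppr_eq0 => /eqP C0.
  have := congr1 (mulmx L) B0; rewrite mulmxA LB mul1mx mulmx0 => ->.
  have := congr1 (mulmx L') C0; rewrite mulmxA LC mul1mx mulmx0 => ->.
  by rewrite col_mx0.
have rf : row_free (row_mx B C)^T.
  rewrite -kermx_eq0; apply/rowV0P => v /sub_kermxP vB.
  apply: (can_inj (@trmxK _ _ _)); rewrite trmx0; apply: inj.
  by apply: (can_inj (@trmxK _ _ _)); rewrite trmx_mul trmxK vB trmx0.
have [Q QP] : exists Q : 'M[K]_(rdim X + rdim Y, rdim M), Q *m row_mx B C = 1%:M.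
  have /row_freeP[Q QE] := rf; exists Q^T.
  by apply: (can_inj (@trmxK _ _ _)); rewrite trmx_mul trmxK QE trmx1.
exists Q; split=> [||x] //.
  have full : row_full (row_mx B C)^T by rewrite /row_full (eqP rf) eXY.
  have /row_fullP[Q' Q'E] := full.
  have E : row_mx B C *m Q'^T = 1%:M.
    by apply: (can_inj (@trmxK _ _ _)); rewrite trmx_mul trmxK Q'E trmx1.
  by rewrite -[Q]mulmx1 -E (mulmxA Q) QP mul1mx.
by rewrite /= /dsum_act mul_mx_row mul_row_block !mulmx0 addr0 add0r BX CY.
Qed.

End RepConstructions.

(** * Highest weight modules and complete reducibility *)

Section WeightModules.
Variables (R : realType) (K : numFieldType) (g : lieAlgType K) (H : {vspace g}).
Variables (r : nat) (a : r.-tuple g) (iota : {rmorphism R -> K}) (rv : 'rV[R]_r -> g).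
Hypothesis D : cartan_data H a iota rv.
Variable ip : 'rV[R]_r -> 'rV[R]_r -> R.
Hypothesis kilE : forall b c, killing (rv b) (rv c) = iota (ip b c).
Local Notation wtv := (wt_vec H rv).
Local Notation al := (sroot R).
Local Notation cp := (cpair ip).
Local Notation proots := (pos_roots_seq H rv).
Local Notation rho := (rho H rv).
(** Having a basis of weight vectors with real weights. The property passes to images, sums and
    tensor products, and it is all that complete reducibility asks of a module. *)
Definition wtmod (M : rep g) := exists P mu, wt_basis H rv (M := M) P mu.

Lemma wtmod_span (M : rep g) (s : seq 'cV[K]_(rdim M)) : (<< s >> = fullv)%VS ->
  {in s, forall v, exists mu, wtv mu v} -> wtmod M.
Proof.
move=> sf sw; have [t [ft ts sub]] := free_subset_span s.
have size_t : size t = rdim M.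
  by move/eqP: ft => <-; rewrite ts sf dimvf /dim /= muln1.
pose P : 'M[K]_(rdim M) := \matrix_(i, j) t`_j i 0.
have colP' j : col j P = t`_j by apply/colP => i; rewrite !mxE.
have wj (j : 'I_(rdim M)) : exists mu, wtv mu t`_j.
  by apply: sw; apply: sub; rewrite mem_nth // size_t.
exists P, (fun j => xget 0 [set mu | wtv mu t`_j]); split; last first.
  by move=> i; rewrite colP'; exact: (xgetPex 0 (wj i)).
rewrite -unitmx_tr -row_free_unit -kermx_eq0; apply/rowV0P => v /sub_kermxP vP.
have /freeP F : free (in_tuple t) by [].
apply/rowP => j; rewrite [RHS]mxE.
have := F (fun k => v 0 (cast_ord size_t k)) _ (cast_ord (esym size_t) j).
rewrite cast_ordKV; apply.
have -> : \sum_(i < size t) v 0 (cast_ord size_t i) *: (in_tuple t)`_i = P *m v^T.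
  rewrite (reindex (cast_ord (esym size_t))) /=; last first.
    by exists (cast_ord size_t) => ? _; rewrite ?cast_ordK ?cast_ordKV.
  apply/colP => i; rewrite summxE mxE; apply: eq_bigr => k _.
  by rewrite cast_ordKV !mxE mulrC.
by rewrite -[P]trmxK -trmx_mul vP trmx0.
Qed.

Lemma wtmod_image (M N : rep g) (F : 'M[K]_(rdim N, rdim M)) (G : 'M[K]_(rdim M, rdim N)) :
  (forall x, F *m M x = N x *m F) -> F *m G = 1%:M -> wtmod M -> wtmod N.
Proof.
move=> FM FG [P [mu [Pu Pw]]].
apply: (@wtmod_span _ [seq F *m col i P | i <- enum 'I_(rdim M)]).
  apply/vspaceP => v; rewrite memvf -[v]mul1mx -FG -mulmxA [G *m v](col_span _ Pu) mulmx_sumr.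
  apply: memv_suml => i _; rewrite -scalemxAr; apply: memvZ; apply: memv_span.
  by apply: map_f; rewrite mem_enum.
move=> _ /mapP[i _ ->]; exists (mu i) => h hH.
by rewrite mulmxA -FM -mulmxA (Pw i h hH) scalemxAr.
Qed.

Lemma wtmod_iso M N : rep_iso M N -> wtmod M -> wtmod N.
Proof.
by move=> /rep_iso_sym[P [Q [PQ QP E]]];  apply: (wtmod_image (F := P) (G := Q)).
Qed.

Lemma wtmod_dsuml M N : wtmod (dsum_rep M N) -> wtmod M.
Proof.
apply: (wtmod_image (M := dsum_rep M N) (F := row_mx 1%:M 0) (G := col_mx 1%:M 0)).
  by move=> x /=; rewrite /dsum_act mul_row_block mul_mx_row !mulmx0 !mul0mx !addr0 mul1mx mulmx1.
by rewrite mul_row_col mulmx1 mul0mx addr0.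
Qed.

Lemma wtmod_dsumr M N : wtmod (dsum_rep M N) -> wtmod N.
Proof.
apply: (wtmod_image (M := dsum_rep M N) (F := row_mx 0 1%:M) (G := col_mx 0 1%:M)).
  by move=> x /=; rewrite /dsum_act mul_row_block mul_mx_row !mulmx0 !mul0mx !add0r mul1mx mulmx1.
by rewrite mul_row_col mulmx1 mul0mx add0r.
Qed.

Lemma wt_basis_dsum M N P mu Q nu : wt_basis H rv (M := M) P mu -> wt_basis H rv (M := N) Q nu ->
  wt_basis H rv (M := dsum_rep M N) (block_mx P 0 0 Q)
    (fun i => match fintype.split i with inl j => mu j | inr j => nu j end).
Proof.
move=> [Pu Pw] [Qu Qw]; split.
  rewrite unitmxE det_ublock unitrM -!unitmxE.
  by apply/andP; split.
move=> i h hH; rewrite /= /dsum_act; case: (fintype.splitP i) => j ij.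
  have -> : i = lshift _ j by apply: val_inj.
  have -> : col (lshift _ j) (block_mx P 0 0 Q) = col_mx (col j P) (0 : 'cV[K]_(rdim N)).
    apply/colP => k; rewrite -[k]splitK; case: (fintype.split k) => l /=; rewrite mxE.
      by rewrite block_mxEul col_mxEu mxE.
    by rewrite block_mxEdl col_mxEd !mxE.
  by rewrite mul_block_col !mul0mx !mulmx0 !addr0 Pw // scale_col_mx scaler0.
have -> : i = rshift _ j by apply: val_inj.
have -> : col (rshift _ j) (block_mx P 0 0 Q) = col_mx (0 : 'cV[K]_(rdim M)) (col j Q).
  apply/colP => k; rewrite -[k]splitK; case: (fintype.split k) => l /=; rewrite mxE.
    by rewrite block_mxEur col_mxEu !mxE.
  by rewrite block_mxEdr col_mxEd mxE.
by rewrite mul_block_col !mul0mx !mulmx0 !add0r Qw // scale_col_mx scaler0.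
Qed.

Lemma wtmod_dsum M N : wtmod M -> wtmod N -> wtmod (dsum_rep M N).
Proof. by move=> [P [mu Pmu]] [Q [nu Qnu]]; eexists; eexists; exact: wt_basis_dsum Pmu Qnu. Qed.

Section HighestWeight.
Variables (M : rep g) (P : 'M[K]_(rdim M)) (mu : 'I_(rdim M) -> 'rV[R]_r).
Hypothesis Pmu : wt_basis H rv P mu.
Let Pu : P \in unitmx. Proof. by case: Pmu. Qed.
Local Notation sing := (singular H rv).
Local Notation coordP v i := ((invmx P *m v) i 0).

Lemma coord_act_H h (v : 'cV[K]_(rdim M)) i : h \in H ->
  coordP (M h *m v) i = killing (rv (mu i)) h * coordP v i.
Proof.
move=> hH; have -> : invmx P *m (M h *m v) = conj_act P h *m (invmx P *m v).
  by rewrite /conj_act !mulmxA mulmxK.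
rewrite [LHS]mxE (bigD1 i) //= (conj_act_H Pmu) // eqxx mul1r.
by rewrite big1 ?addr0 // => j ji; rewrite (conj_act_H Pmu) // eq_sym (negPf ji) !mul0r.
Qed.

Lemma coord_eq0 (v : 'cV[K]_(rdim M)) : (forall i, coordP v i = 0) -> v = 0.
Proof. by move=> v0; rewrite [v](col_span _ Pu) big1 // => i _; rewrite v0 scale0r. Qed.

(** Take a nonzero vector of [U] with as few nonzero coordinates as possible in the weight basis. If
    two weights occurred in it, some [h] would separate them, and applying [h] minus one eigenvalue
    would leave a nonzero vector with fewer coordinates. *)
Lemma weight_vector_in (U : {vspace 'cV[K]_(rdim M)}) : gstable U -> U != 0%VS ->
  exists i u, [/\ u \in U, u != 0 & wtv (mu i) u].
Proof.
move=> gU; rewrite -vpick0 => U0.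
pose supp (u : 'cV[K]_(rdim M)) := #|[pred i | coordP u i != 0]|.
have ex : exists n, `[< exists u, [/\ u \in U, u != 0 & supp u = n] >].
  by exists (supp (vpick U)); apply/asboolP; exists (vpick U); split=> //; exact: memv_pick.
have [n /asboolP[u [uU u0 un]] nmin] := ex_minnP ex.
have [i ci] : exists i, coordP u i != 0.
  by apply: contrapT => nc; case/eqP: u0; apply: coord_eq0 => i; apply: contrapT => /eqP ci; apply: nc; exists i.
exists i, u; split=> //.
have same j : coordP u j != 0 -> mu j = mu i.
  move=> cj; apply: contrapT => /eqP ji.
  have [h hH hij] : exists2 h, h \in H & killing (rv (mu j)) h != killing (rv (mu i)) h.
    apply: contrapT => nh; case/eqP: ji; apply: (killing_rv_eq D) => h hH.
    by apply: contrapT => /eqP hne; apply: nh; exists h.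
  pose u' := M h *m u - killing (rv (mu i)) h *: u.
  have cu' k : coordP u' k = (killing (rv (mu k)) h - killing (rv (mu i)) h) * coordP u k.
    by rewrite mulmxBr mxE coord_act_H // -scalemxAr [X in _ + X]mxE [X in - X]mxE mulrBl.
  have u'U : u' \in U by rewrite memvB ?memvZ ?gU.
  have u'0 : u' != 0.
    apply/eqP => u'0; have := cu' j; rewrite u'0 mulmx0 mxE => /esym/eqP.
    by rewrite mulf_eq0 (negPf cj) orbF subr_eq0 (negPf hij).
  have : `[< exists w, [/\ w \in U, w != 0 & supp w = supp u'] >] by apply/asboolP; exists u'.
  move=> /nmin; rewrite -un leqNgt => /negP; apply; apply: proper_card.
  apply/properP; split.
    by apply/fintype.subsetP => k; rewrite !inE cu' mulf_eq0 negb_or => /andP[].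
  by exists i; rewrite !inE // cu' subrr mul0r eqxx.
move=> h hH; apply/eqP; rewrite -subr_eq0; apply/eqP; apply: coord_eq0 => k.
rewrite mulmxBr mxE coord_act_H // -scalemxAr [X in _ + X]mxE [X in - X]mxE -mulrBl.
have [->|ck] := eqVneq (coordP u k) 0; first by rewrite mulr0.
by rewrite (same k ck) subrr mul0r.
Qed.

Lemma proot_height_gt0 b : b \in proots -> 0 < \sum_i b 0 i.
Proof.
move=> bp; have b0 := proot_neq0 D bp; have /(mem_proots D)[_ bge] := bp.
rewrite lt_neqAle sumr_ge0 ?andbT // eq_sym psumr_eq0 //.
by apply: contraNN b0 => /allP b0; apply/eqP/rowP => i; rewrite mxE; apply/eqP/b0; rewrite mem_index_enum.
Qed.

(** A weight of [U] with maximal coordinate sum cannot be raised by a positive root. *)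
Lemma singular_in (U : {vspace 'cV[K]_(rdim M)}) : gstable U -> U != 0%VS ->
  exists i u, u \in U /\ sing (mu i) u.
Proof.
move=> gU U0; have [i0 [u0 [u0U u00 u0w]]] := weight_vector_in gU U0.
pose s := [seq i : 'I_(rdim M) <- enum 'I_(rdim M) | `[< exists u, [/\ u \in U, u != 0 & wtv (mu i) u] >]].
have i0s : i0 \in s by rewrite mem_filter mem_enum andbT; apply/asboolP; exists u0.
have s0 : s != [::] by apply/eqP => se; rewrite se in i0s.
have [i + imax] := seq_argmax (fun i => \sum_k mu i 0 k) s0.
rewrite mem_filter => /andP[/asboolP[u [uU un uw]] _].
exists i, u; split=> //; split=> // b x bp xb; apply: contrapT => /eqP xu.
have xw := wt_vec_root D xb uw.
have [j mj] := wt_occurs D Pmu xu xw.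
have /imax : j \in s by rewrite mem_filter mem_enum andbT; apply/asboolP; exists (M x *m u); rewrite mj; split=> //; exact: gU.
rewrite leNgt mj => /negP; apply.
under [X in _ < X]eq_bigr do rewrite mxE.
by rewrite big_split ltrDl proot_height_gt0.
Qed.

Lemma singular_dominant lam (v : 'cV[K]_(rdim M)) b : sing lam v -> b \in proots ->
  exists k : nat, cp lam b = k%:R.
Proof.
move=> [v0 vw vs] bp; have /(mem_proots D)[rb _] := bp.
have [m mE] := weight_integral D kilE Pmu v0 vw rb.
have [x [y xy]] := root_pair_ex D rb; have [xa _ _] := xy.
(* For the root [- b] the vector [x] is the lowering one and kills [v], so the Cartan number at
   [- b] is below 1; being an integer it is at most 0. *)
have := weight_cpair_lt D kilE Pmu (N := 1) (rootvN D rb) (root_pairN xy) v0 vw.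
rewrite /= (vs b x bp xa) => /(_ erefl); rewrite (cpairN D kilE) mE.
rewrite -mulrNz -[1%:R]/(1%:~R) ltr_int; case: m mE => [k kE _|k _]; last by lia.
by exists k.
Qed.

Lemma rho_pos i : 0 < ip rho (al i).
Proof. by rewrite -(cpair_gt0 D kilE) (cpair_rho D kilE) ltr01. Qed.

Lemma ip_nonneg_sroots (b d : 'rV[R]_r) : (forall i, 0 <= ip b (al i)) -> (forall i, 0 <= d 0 i) -> 0 <= ip b d.
Proof.
move=> bi di; rewrite [d]row_sum_delta (ip_sumr D kilE) sumr_ge0 // => i _.
rewrite (ipZr D kilE) mulr_ge0 //; exact: bi.
Qed.

(** With [d = lam - nu], equality of the Casimir values reads [(lam + nu, d) + 2 (rho, d) = 0]. Both
    terms are nonnegative, and [(rho, d) = 0] forces [d = 0] because [rho] is strictly dominant. *)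
Lemma casimir_order (lam nu : 'rV[R]_r) : dom ip lam -> dom ip nu -> (forall i, nu 0 i <= lam 0 i) ->
  ip lam (lam + 2 *: rho) = ip nu (nu + 2 *: rho) -> nu = lam.
Proof.
move=> dl dn le E; pose d := lam - nu.
have d0 i : 0 <= d 0 i by rewrite !mxE subr_ge0.
have Ed : ip (lam + nu) d + 2 * ip rho d = 0.
  rewrite /d; move: (rho : 'rV[R]_r) E => h.
  rewrite !(ipDl D kilE) !(ipDr D kilE) !(ipNr D kilE) !(ipZr D kilE).
  by rewrite (ipC kilE h lam) (ipC kilE h nu) (ipC kilE nu lam); lra.
have p1 : 0 <= ip (lam + nu) d.
  by apply: ip_nonneg_sroots => // i; rewrite (ipDl D kilE) addr_ge0.
have p2 : 0 <= ip rho d by apply: ip_nonneg_sroots => // i; exact: ltW (rho_pos i).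
have rd : ip rho d = 0 by move: Ed p1 p2; lra.
have dz : d = 0.
  move: rd; rewrite [X in ip rho X]row_sum_delta (ip_sumr D kilE) => /eqP.
  rewrite psumr_eq0 => [/allP dd|i _]; last by rewrite (ipZr D kilE) mulr_ge0 ?d0 // ltW //; exact: rho_pos.
  apply/rowP => i; rewrite [RHS]mxE; have := dd i (mem_index_enum _).
  by rewrite (ipZr D kilE) mulf_eq0 (gt_eqF (rho_pos i : 0 < ip rho 'e_i)) orbF => /eqP.
by apply/esym/eqP; rewrite -subr_eq0; apply/eqP.
Qed.

Lemma singular_dom lam (v : 'cV[K]_(rdim M)) : sing lam v -> dom ip lam.
Proof.
move=> sv i; rewrite -(cpair_ge0 D kilE).
by have [k ->] := singular_dominant sv (sroot_pos D i).
Qed.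

End HighestWeight.

End WeightModules.

(** * Modules generated by a highest weight vector *)

Section HighestWeightModules.
Variables (R : realType) (K : numFieldType) (g : lieAlgType K) (H : {vspace g}).
Variables (r : nat) (a : r.-tuple g) (iota : {rmorphism R -> K}) (rv : 'rV[R]_r -> g).
Hypothesis D : cartan_data H a iota rv.
Variable ip : 'rV[R]_r -> 'rV[R]_r -> R.
Hypothesis kilE : forall b c, killing (rv b) (rv c) = iota (ip b c).
Let simp := cd_simple D.
Let cart := cd_cartan D.
Let sroots := cd_roots D.
Local Notation root := (rootv H rv).
Local Notation wtv := (wt_vec H rv).
Local Notation cp := (cpair ip).
Local Notation proots := (pos_roots_seq H rv).
Local Notation rho := (rho H rv).
Local Notation sing := (singular H rv).
Local Notation wtmod := (wtmod H rv).

Definition coord_le (nu lam : 'rV[R]_r) := forall k, nu 0 k <= lam 0 k.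

Lemma root_span (M : rep g) (U : {vspace 'cV[K]_(rdim M)}) w :
  (forall h, h \in H -> M h *m w \in U) ->
  (forall b y, root b -> in_root_space H (rv b) y -> M y *m w \in U) ->
  forall z, M z *m w \in U.
Proof.
move=> Hw rw z.
have [e [f ef]] := choose_root_pairs D; have [t [tH trep]] := cartan_family D.
rewrite -(root_family D kilE ef tH trep z) ract_sum mulmx_suml big_seq.
apply: memv_suml => p; rewrite !mem_cat ractZ -scalemxAl => pin; apply: memvZ.
case/or3P: pin => [/tH[pH _]|/mapP[b /(mem_proots D)[rb _] ->]|/mapP[b /(mem_proots D)[rb _] ->]] /=.
- exact: Hw.
- by have [eb _ _] := ef b rb; apply: rw eb.
- by have [_ fb _] := ef b rb; apply: rw fb; exact: (rootvN D).
Qed.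

Section Cyclic.
Variables (M : rep g) (P : 'M[K]_(rdim M)) (mu : 'I_(rdim M) -> 'rV[R]_r).
Hypothesis Pmu : wt_basis H rv P mu.
Variables (lam : 'rV[R]_r) (v : 'cV[K]_(rdim M)).
Hypothesis vsing : sing lam v.

Let lower (U : {vspace 'cV[K]_(rdim M)}) := v \in U /\
  forall b y w, b \in proots -> in_root_space H (rv (- b)) y -> w \in U -> M y *m w \in U.

(* [U] is the span of the products of negative root vectors applied to [v]; it is
   stable under the Borel subalgebra because [w | borel w <= U] is again a subspace
   containing [v] and stable under the negative root vectors. *)
Lemma cyclic_module : exists U : {vspace 'cV[K]_(rdim M)},
  [/\ v \in U, gstable U,
      (forall W, gstable W -> W != 0%VS -> (W <= U)%VS -> v \in W /\ (U <= W)%VS),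
      (forall w, w \in U -> wtv lam w -> exists c, w = c *: v) &
      forall nu w, w \in U -> w != 0 -> wtv nu w -> coord_le nu lam].
Proof.
have [v0 vw vs] := vsing; have [Pu Pw] := Pmu.
have [U [vU lowU] Umin] : exists2 U, lower U & forall W, lower W -> (U <= W)%VS.
  apply: minimal_vspace; first by split=> [|? ? ? _ _ _]; rewrite memvf.
  move=> U W [vU lU] [vW lW]; split; first by apply/memv_capP.
  by move=> b y w bp yb /memv_capP[wU wW]; apply/memv_capP; split; [apply: lU yb wU|apply: lW yb wW].
have gU : gstable U.
  have [T TP] : exists T : {vspace 'cV[K]_(rdim M)}, forall w, w \in T <->
     [/\ w \in U, forall h, h \in H -> M h *m w \in U &
         forall b y, b \in proots -> in_root_space H (rv b) y -> M y *m w \in U].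
    apply: vspace_of_predicate.
      by split; rewrite ?mem0v // => *; rewrite mulmx0 mem0v.
    move=> c u w [uU uH ub] [wU wH wb]; split; first by rewrite memvD ?memvZ.
      by move=> h hH; rewrite mulmxDr -scalemxAr memvD ?memvZ ?uH ?wH.
    by move=> b y bp yb; rewrite mulmxDr -scalemxAr memvD ?memvZ ?(ub b y) ?(wb b y).
  have lowT : lower T.
    split.
      apply/TP; split=> // [h hH|b y bp yb]; first by rewrite vw // memvZ.
      by rewrite (vs b y) // mem0v.
    move=> b y w bp yb /TP[wU wH wb]; have ywU : M y *m w \in U := lowU b y w bp yb wU.
    apply/TP; split=> // [h hH|c x cp xc].
      have -> : M h *m (M y *m w) = M (lie h y) *m w + M y *m (M h *m w).
        by rewrite ract_lie mulmxBl !mulmxA subrK.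
      by rewrite yb // ractZ -scalemxAl memvD ?memvZ // (lowU b y _ bp yb) // wH.
    have -> : M x *m (M y *m w) = M (lie x y) *m w + M y *m (M x *m w).
      by rewrite ract_lie mulmxBl !mulmxA subrK.
    apply: memvD; last by apply: (lowU b y _ bp yb); apply: wb xc.
    have xy := in_root_space_lie D xc yb.
    have [l0|l0] := eqVneq (lie x y) 0; first by rewrite l0 ract0 mul0mx mem0v.
    have [cb|cb] := eqVneq (c - b) 0; first by apply: wH; apply: (in_root_space0 D); rewrite -cb.
    have [cbp|cbn] := root_pos_or_neg D (rootvP D cb l0 xy); first exact: wb cbp xy.
    by apply: (lowU _ _ w cbn) => //; rewrite opprK.
  have UT := Umin _ lowT.
  move=> x w wU; have /TP[_ wH wb] := subvP UT _ wU.
  apply: root_span => // b y rb yb; have [bp|bn] := root_pos_or_neg D rb; first exact: wb yb.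
  by apply: (lowU _ _ w bn) => //; rewrite opprK.
(* Vectors all of whose weights lie strictly below [lam]. The line of [v] plus these vectors is
   stable under lowering, hence contains [U]; this gives the last two properties. *)
pose small (w : 'cV[K]_(rdim M)) := forall i, (invmx P *m w) i 0 != 0 -> mu i != lam /\ coord_le (mu i) lam.
have small0 : small 0 by move=> i; rewrite mulmx0 mxE eqxx.
have smallL c u w : small u -> small w -> small (c *: u + w).
  move=> su sw i; rewrite mulmxDr mxE -scalemxAr [X in X + _]mxE.
  have [->|u0] := eqVneq ((invmx P *m u) i 0) 0; last by move=> _; apply: su.
  by rewrite mulr0 add0r; apply: sw.
have [T2 T2P] : exists T2 : {vspace 'cV[K]_(rdim M)}, forall w, w \in T2 <-> exists c, small (w - c *: v).
  apply: vspace_of_predicate; first by exists 0; rewrite scale0r subr0.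
  move=> c u w [cu su] [cw sw]; exists (c * cu + cw).
  have -> : c *: u + w - (c * cu + cw) *: v = c *: (u - cu *: v) + (w - cw *: v).
    by rewrite scalerBr scalerDl scalerA opprD addrACA.
  exact: smallL.
have lowT2 : lower T2.
  split; first by apply/T2P; exists 1; rewrite scale1r subrr.
  move=> b y w bp yb /T2P[c sw]; apply/T2P; exists 0; rewrite scale0r subr0.
  have -> : M y *m w = c *: (M y *m v) + M y *m (w - c *: v).
    by rewrite mulmxBr -scalemxAr addrC subrK.
  have /(mem_proots D)[_ bge] := bp.
  apply: smallL.
    move=> i ci; rewrite (wt_coord D Pmu (wt_vec_root D yb vw) ci); split.
      by rewrite eq_sym addrC -subr_eq subrr eq_sym oppr_eq0 (proot_neq0 D bp).
    by move=> k; rewrite !mxE gerBl bge.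
  move=> i; have -> : (invmx P *m (M y *m (w - c *: v))) = conj_act P y *m (invmx P *m (w - c *: v)).
    by rewrite /conj_act !mulmxA mulmxK.
  rewrite mxE => s0; have [j] : exists j, conj_act P y i j * (invmx P *m (w - c *: v)) j 0 != 0.
    apply: contrapT => nj; case/eqP: s0; apply: big1 => j _.
    by apply: contrapT => /eqP nz; apply: nj; exists j.
  rewrite mulf_eq0 negb_or => /andP[yij /sw[mjl mjle]].
  have mi := conj_act_root D Pmu yb yij.
  have le : coord_le (mu i) lam.
    by move=> k; rewrite mi !mxE (le_trans _ (mjle k)) // gerBl bge.
  split=> //; apply/eqP => mil; case/eqP: mjl; apply/rowP => k; apply: le_anti.
  by rewrite mjle /= -mil mi !mxE gerBl bge.
have UT2 := Umin _ lowT2.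
have lamU w : w \in U -> wtv lam w -> exists c, w = c *: v.
  move=> /(subvP UT2)/T2P[c sw] wl; exists c; apply/eqP; rewrite -subr_eq0; apply/eqP.
  apply: (coord_eq0 Pmu) => i; apply: contrapT => /eqP ci; have [+ _] := sw i ci.
  have wcv : wtv lam (w - c *: v) by rewrite -scaleNr; apply: wt_vecD => //; apply: wt_vecZ.
  by rewrite (wt_coord D Pmu wcv ci) eqxx.
have leU nu w : w \in U -> w != 0 -> wtv nu w -> coord_le nu lam.
  move=> /(subvP UT2)/T2P[c sw] w0 wn.
  have [->|nl] := eqVneq nu lam; first by move=> k.
  have [i ci] : exists i, (invmx P *m w) i 0 != 0.
    by apply: contrapT => nc; case/eqP: w0; apply: (coord_eq0 Pmu) => i; apply: contrapT => /eqP ci; apply: nc; exists i.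
  have min_ := wt_coord D Pmu wn ci.
  have vi : (invmx P *m v) i 0 = 0.
    apply: contrapT => /eqP vi; have := wt_coord D Pmu vw vi.
    by rewrite min_ => e; rewrite e eqxx in nl.
  have [|_ +] := sw i; last by rewrite min_.
  by rewrite mulmxBr -scalemxAr mxE [X in _ + X]mxE [X in - X]mxE vi mulr0 subr0.
exists U; split=> // W gW W0 WU.
have [i [u [uW us]]] := singular_in D Pmu gW W0.
have [s rs] : exists s, reproducing (g := g) s.
  by exists (vb_family g); apply: (vb_reproducing (killing_nondeg simp cart sroots)).
set c := iota (ip lam (lam + 2 *: rho)).
(* The Casimir eigenspace of [v] contains [U]. A singular vector of [W] therefore has the same
   Casimir value as [v], [casimir_order] identifies its weight with [lam], and so it is a multiple
   of [v]. *)
have [C CP] : exists C : {vspace 'cV[K]_(rdim M)}, forall w, w \in C <-> cas M s *m w = c *: w.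
  apply: vspace_of_predicate; first by rewrite mulmx0 scaler0.
  move=> x w1 w2 e1 e2; rewrite mulmxDr -scalemxAr e1 e2 scalerDr !scalerA.
  by rewrite mulrC.
have lowC : lower C.
  split; first by apply/CP; rewrite (cas_singular D kilE rs vsing).
  move=> b y w bp yb /CP wC; apply/CP.
  by rewrite mulmxA -(cas_comm (killing_nondeg simp cart sroots) M y rs) -mulmxA wC -scalemxAr.
have /CP uc := subvP (Umin _ lowC) _ (subvP WU _ uW).
have [u0 uw _] := us.
have cE : ip lam (lam + 2 *: rho) = ip (mu i) (mu i + 2 *: rho).
  move: uc; rewrite (cas_singular D kilE rs us) => /eqP.
  by rewrite -subr_eq0 -scalerBl scaler_eq0 (negPf u0) orbF subr_eq0 => /eqP/(fmorph_inj iota).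
have uU := subvP WU _ uW.
have ml := casimir_order D kilE (singular_dom D kilE Pmu vsing) (singular_dom D kilE Pmu us) (leU _ _ uU u0 uw) cE.
rewrite ml in uw; have [d ud] := lamU u uU uw.
have d0 : d != 0 by apply: contraNneq u0 => d0; rewrite ud d0 scale0r.
have vW : v \in W by rewrite -[v](scalerK d0) -ud memvZ.
by split=> //; apply: Umin; split=> // b y w bp yb wW; apply: gW.
Qed.

End Cyclic.

End HighestWeightModules.

Section OppositeData.
Variables (R : realType) (K : numFieldType) (g : lieAlgType K) (H : {vspace g}).
Variables (r : nat) (a : r.-tuple g) (iota : {rmorphism R -> K}) (rv : 'rV[R]_r -> g).
Hypothesis D : cartan_data H a iota rv.
Variable ip : 'rV[R]_r -> 'rV[R]_r -> R.
Hypothesis kilE : forall b c, killing (rv b) (rv c) = iota (ip b c).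
Let sroots := cd_roots D.
Local Notation root := (rootv H rv).
Local Notation proots := (pos_roots_seq H rv).
Local Notation rho := (rho H rv).

(** The dual of a module has the opposite weights. Changing the signs of the simple roots and of
    [rv] together restores the original weight coordinates, so that results on highest weight
    vectors apply to the dual module. *)
Lemma opposite_cartan_data : cartan_data H [tuple - tnth a i | i < r] iota (fun b => - rv b).
Proof.
have g_simple := cd_simple D; have H_cartan := cd_cartan D.
have tE i : tnth [tuple - tnth a i | i < r] i = - tnth a i by rewrite tnth_mktuple.
have sumE (k : 'I_r -> nat) : \sum_i tnth [tuple - tnth a i | i < r] i *+ k i = - \sum_i tnth a i *+ k i.
  by rewrite -sumrN; apply: eq_bigr => i _; rewrite tE mulNrn.
split=> //.
- have [ab ar arall] := sroots; split.
  + rewrite basisEdim; apply/andP; split; last by rewrite size_tuple -(size_basis ab).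
    rewrite -(span_basis ab); apply/span_subvP => _ /tnthP[i ->].
    rewrite -[tnth a i]opprK memvN memv_span //.
    by apply/tnthP; exists i; rewrite tE.
  + move=> i; rewrite tE -(rvec_sroot D) -(rvecN D).
    exact: (rootvN D (sroot_root D i)).
  + by move=> b /arall[k [->|->]]; exists k; rewrite sumE ?opprK; [right|left].
- by move=> b c; rewrite (rvecD D) opprD.
- by move=> x b; rewrite (rvecZ D) scalerN.
- by move=> i; rewrite tE (rvec_sroot D).
Qed.

Lemma opposite_kilE b c : killing (- rv b) (- rv c) = iota (ip b c).
Proof. by rewrite killingNl killingNr opprK kilE. Qed.

Lemma opposite_proots b : b \in pos_roots_seq H (fun b => - rv b) <-> b \in proots.
Proof.
have E c : rootv H (fun b => - rv b) c <-> root c.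
  rewrite /rootv -(rvecN D); split=> rc; last exact: (rootvN D rc).
  by have := rootvN D rc; rewrite opprK.
split=> /mem_proots h.
  by have [/E rb b0] := h _ _ opposite_cartan_data; apply/(mem_proots D).
by have [/E rb b0] := h _ _ D; apply/(mem_proots opposite_cartan_data).
Qed.

End OppositeData.

(** * Complete reducibility *)

Section CompleteReducibility.
Variables (R : realType) (K : numFieldType) (g : lieAlgType K) (H : {vspace g}).
Variables (r : nat) (a : r.-tuple g) (iota : {rmorphism R -> K}) (rv : 'rV[R]_r -> g).
Hypothesis D : cartan_data H a iota rv.
Variable ip : 'rV[R]_r -> 'rV[R]_r -> R.
Hypothesis kilE : forall b c, killing (rv b) (rv c) = iota (ip b c).
Local Notation wtv := (wt_vec H rv).
Local Notation proots := (pos_roots_seq H rv).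
Local Notation rho := (rho H rv).
Local Notation sing := (singular H rv).
Local Notation wtmod := (wtmod H rv).

Definition hwrep (X : rep g) (lam : 'rV[R]_r) :=
  [/\ irreducible_rep X, wtmod X & exists v, sing (M := X) lam v].

Lemma irreducible_subrep (M X : rep g) (U : {vspace 'cV[K]_(rdim M)})
    (B : 'M[K]_(rdim M, rdim X)) (L : 'M[K]_(rdim X, rdim M)) v :
  v \in U -> v != 0 ->
  (forall W, gstable W -> W != 0%VS -> (W <= U)%VS -> v \in W /\ (U <= W)%VS) ->
  L *m B = 1%:M -> (forall x, M x *m B = B *m X x) -> (forall v, B *m v \in U) ->
  (forall u, u \in U -> B *m (L *m u) = u) -> irreducible_rep X.
Proof.
move=> vU v0 irr LB MB BU BL; split.
  rewrite lt0n; apply/eqP => X0; case/eqP: v0; rewrite -(BL v vU).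
  by apply/colP => i; rewrite !mxE big1 // => j _; move: (ltn_ord j); rewrite {2}X0.
move=> U1 U1s; have [->|U10] := eqVneq U1 0%VS; [by left|right].
pose W := (linfun (mulmx B) @: U1)%VS.
have [_ UW] : v \in W /\ (U <= W)%VS.
  apply: irr.
  - move=> x _ /memv_imgP[w wU1 ->]; rewrite lfunE /= mulmxA MB -mulmxA.
    have -> : B *m (X x *m w) = linfun (mulmx B) (X x *m w) by rewrite lfunE.
    by rewrite memv_img // U1s.
  - apply: contraNneq U10 => W0; rewrite -subv0; apply/subvP => w wU1; rewrite memv0.
    have := memv_img (linfun (mulmx B)) wU1; rewrite -/W W0 memv0 lfunE /= => /eqP Bw.
    by rewrite -[w]mul1mx -LB -mulmxA Bw mulmx0.
  - by apply/subvP => _ /memv_imgP[w _ ->]; rewrite lfunE /=.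
apply/vspaceP => w; rewrite memvf.
have /memv_imgP[w' w'U1] : B *m w \in W by apply: (subvP UW).
rewrite lfunE /= => /(congr1 (mulmx L)); rewrite !mulmxA LB !mul1mx => ->.
by [].
Qed.

Lemma subrep_singular (M X : rep g) (U : {vspace 'cV[K]_(rdim M)}) lam
    (B : 'M[K]_(rdim M, rdim X)) (L : 'M[K]_(rdim X, rdim M)) v :
  v \in U -> sing lam v -> L *m B = 1%:M -> (forall x, M x *m B = B *m X x) ->
  (forall u, u \in U -> B *m (L *m u) = u) -> sing (M := X) lam (L *m v).
Proof.
move=> vU [v0 vw vs] LB MB BL.
have XE x : X x *m (L *m v) = L *m (M x *m v).
  rewrite -[LHS]mul1mx -LB -!mulmxA (mulmxA B) -MB -(mulmxA (M x)) BL //.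
split; first by apply: contraNneq v0 => Lv; rewrite -(BL v vU) Lv mulmx0.
  by move=> h hH; rewrite XE vw // scalemxAr.
by move=> b x bp xb; rewrite XE (vs b x) // mulmx0.
Qed.

(* The complement of the cyclic module generated by a vector of maximal weight is the
   annihilator of the module generated by the dual vector in the dual representation. *)
Lemma highest_summand (M : rep g) P mu : wt_basis H rv (M := M) P mu -> (0 < rdim M)%N ->
  exists lam (v : 'cV[K]_(rdim M)) (U W : {vspace 'cV[K]_(rdim M)}),
    [/\ v \in U /\ sing lam v, gstable U, gstable W,
      (U :&: W = 0)%VS /\ (\dim U + \dim W = rdim M)%N &
      forall W, gstable W -> W != 0%VS -> (W <= U)%VS -> v \in W /\ (U <= W)%VS].
Proof.
move=> Pmu M0; have [Pu Pw] := Pmu.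
have D' := opposite_cartan_data D; have kilE' := opposite_kilE kilE.
have [i0 _ imax] : exists2 i, i \in enum 'I_(rdim M) &
    forall j, j \in enum 'I_(rdim M) -> \sum_k mu j 0 k <= \sum_k mu i 0 k.
  apply: seq_argmax; apply/eqP => e; have := mem_enum predT (Ordinal M0).
  by rewrite e.
have top b : b \in proots -> forall j, mu j != mu i0 + b.
  move=> bp j; apply/eqP => mj; have := imax j (mem_enum _ _); rewrite mj.
  by under eq_bigr do rewrite mxE; rewrite big_split /= gerDl leNgt (proot_height_gt0 D).
pose lam := mu i0; pose v := col i0 P.
have vs : sing lam v.
  split; [exact: col_unit_neq0|exact: Pw|move=> b x bp xb].
  apply: contrapT => /eqP nz; have [j mj] := wt_occurs D Pmu nz (wt_vec_root D xb (Pw i0)).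
  by have := top b bp j; rewrite mj eqxx.
pose Md := dual_rep M; pose Pd : 'M[K]_(rdim Md) := (invmx P)^T.
have Pdmu : wt_basis H (fun b => - rv b) (M := Md) Pd mu.
  split; first by rewrite unitmx_tr unitmx_inv.
  move=> i h hH; rewrite /= /dual_act /Pd -tr_row mulNmx -trmx_mul.
  have -> : row i (invmx P) *m M h = killing (rv (mu i)) h *: row i (invmx P).
    rewrite -[M h]mulmx1 -(mulmxV Pu) !mulmxA -row_mul.
    rewrite -row_mul -row_mul -/(conj_act P h).
    apply/rowP => k; rewrite !mxE (bigD1 i) //= big1 ?addr0 => [|j ji].
      by rewrite (conj_act_H Pmu) // eqxx mul1r.
    by rewrite (conj_act_H Pmu) // eq_sym (negPf ji) !mul0r.
  by rewrite linearZ /= killingNl scaleNr.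
have dvs : singular H (fun b => - rv b) (M := Md) lam (col i0 Pd).
  have [Pdu Pdw] := Pdmu.
  split; [exact: col_unit_neq0|exact: Pdw|move=> b x /(opposite_proots D) bp xb].
  apply: contrapT => /eqP nz; have [j mj] := wt_occurs D' Pdmu nz (wt_vec_root D' xb (Pdw i0)).
  by have := top b bp j; rewrite mj eqxx.
have [U [vU gU irrU _ _]] := cyclic_module D kilE Pmu vs.
have [U' [vU' gU' irrU' _ _]] := cyclic_module D' kilE' Pdmu dvs.
have vv : (col i0 Pd)^T *m v = 1%:M.
  rewrite /Pd tr_col trmxK /v col_mul -row_mul.
  by rewrite mulVmx //; apply/matrixP => k l; rewrite !mxE !ord1 eqxx.
have [W WP dW] := perp_dim (U' : {vspace 'cV[K]_(rdim M)}).
have [W' WP' dW'] := perp_dim U.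
have v10 : (1%:M : 'M[K]_1) != 0 by apply/eqP => /matrixP/(_ 0 0)/eqP; rewrite !mxE oner_eq0.
have gW : gstable W.
  move=> x w /WP wW; apply/WP => u uU; rewrite mulmxA.
  have -> : u^T *m M x = (- (Md x *m u))^T by rewrite /= /dual_act mulNmx opprK trmx_mul trmxK.
  by rewrite linearN mulNmx wW ?oppr0 //; apply: gU'.
have gW' : gstable (M := Md) W'.
  move=> x w /WP' wW; apply/WP' => u uU; rewrite mulmxA.
  have -> : u^T *m Md x = (- (M x *m u))^T by rewrite /= /dual_act mulmxN [RHS]linearN /= trmx_mul.
  by rewrite linearN mulNmx wW ?oppr0 //; apply: gU.
(* A nonzero intersection would contain [v], on which the dual vector in [U'] takes the value 1. *)
have UW0 : (U :&: W = 0)%VS.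
  apply/eqP; apply: contrapT => /negP UW.
  have [/memv_capP[_ /WP /(_ _ vU')]] := irrU _ (gstable_capv gU gW) UW (capvSl _ _).
  by rewrite vv => /eqP; rewrite (negPf v10).
have UW0' : (U' :&: W' = 0)%VS.
  apply/eqP; apply: contrapT => /negP UW.
  have [/memv_capP[_ /WP' /(_ _ vU)]] := irrU' _ (gstable_capv gU' gW') UW (capvSl _ _).
  by rewrite -[_ *m _]trmxK trmx_mul trmxK vv trmx1 => /eqP; rewrite (negPf v10).
exists lam, v, U, W; split=> //; split=> //.
have nE : \dim {: 'cV[K]_(rdim M)} = rdim M by rewrite dimvf /dim /= muln1.
have := dimvS (subvf (U + W)%VS); rewrite (dimv_disjoint_sum UW0) nE => le1.
have := dimvS (subvf (U' + W')%VS); rewrite (dimv_disjoint_sum UW0').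
have -> : \dim {: 'cV[K]_(rdim Md)} = rdim M by rewrite dimvf /dim /= muln1.
(* Each annihilator has at least the complementary dimension, and the two direct sums have dimension
   at most [rdim M]; adding up, all four bounds are equalities. *)
have arith (p q p' q' d : nat) : (d <= q + p')%N -> (d <= q' + p)%N -> (p + q <= d)%N ->
    (p' + q' <= d)%N -> (p + q = d)%N by lia.
exact: arith dW dW' le1.
Qed.

Lemma complete_reducibility (M : rep g) : wtmod M -> exists s : seq (rep g),
  all (fun X => `[< exists lam, hwrep X lam >]) s /\
  rep_iso M (\big[@dsum_rep K g/trivial_rep 0]_(X <- s) X).
Proof.
have [n] := ubnP (rdim M); elim: n M => // n IH M ltn wM.
have [M0|M0] := posnP (rdim M).
  exists [::]; split=> //; rewrite big_nil.
  exists (0 : 'M[K]_(rdim M, 0)), (0 : 'M[K]_(0, rdim M)); split.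
  - by apply/matrixP => i j; move: (ltn_ord i); rewrite {2}M0.
  - by apply/matrixP => -[].
  - by move=> x; rewrite mulmx0 mul0mx.
have [P [mu Pmu]] := wM.
have [lam [v [U [W [[vU vs] gU gW [UW dUW] irr]]]]] := highest_summand Pmu M0.
have [v0 _ _] := vs.
have [X [B [L [LB MB BU BL dX]]]] := subrep_ex gU.
have [Y [C [L' [LC MC CW CL dY]]]] := subrep_ex gW.
have [Q [BQ QB act]] := split_rep_iso UW dUW dX dY LB LC BU CW MB MC.
have iso : rep_iso M (dsum_rep X Y) by exists (row_mx B C), Q.
have U0 : (0 < \dim U)%N.
  rewrite lt0n dimv_eq0; apply: contraNneq v0 => U0; move: vU.
  by rewrite U0 memv0.
have wXY := wtmod_iso iso wM.
have wX := wtmod_dsuml wXY; have wY := wtmod_dsumr wXY.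
have [|s [sall siso]] := IH Y _ wY.
  rewrite dY; have ar (p q d k : nat) : (p + q = d -> 0 < p -> d < k.+1 -> q < k)%N by lia.
  exact: ar dUW U0 ltn.
exists (X :: s); split; last first.
  rewrite big_cons; apply: rep_iso_trans iso _; apply: rep_iso_dsum siso; exact: rep_iso_refl.
rewrite /= sall andbT; apply/asboolP; exists lam; split=> //.
  exact: irreducible_subrep vU v0 irr LB MB BU BL.
by exists (L *m v); apply: subrep_singular vU vs LB MB BL.
Qed.

Lemma hwrep_ex (X : rep g) : irreducible_rep X -> wtmod X -> exists lam, hwrep X lam.
Proof.
move=> irr wX; have [P [mu Pmu]] := wX; have [X0 _] := irr.
have [||i [u [_ us]]] := singular_in D Pmu (U := fullv).
- by move=> x v _; rewrite memvf.
- by rewrite -dimv_eq0 dimvf /dim /= muln1 -lt0n.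
by exists (mu i); split=> //; exists u.
Qed.

Lemma hwrep_iso_hw X Y lam : rep_iso X Y -> hwrep X lam -> wtmod Y -> irreducible_rep Y -> hwrep Y lam.
Proof.
move=> [P [Q [PQ QP E]]] [irr wX [v [v0 vw vs]]] wY irrY; split=> //.
have QE x : Q *m X x = Y x *m Q.
  by rewrite -[LHS]mulmx1 -PQ -!mulmxA (mulmxA (X x)) E !mulmxA QP mul1mx.
exists (Q *m v); split.
- by apply: contraNneq v0 => Qv; rewrite -[v]mul1mx -PQ -mulmxA Qv mulmx0.
- by move=> h hH; rewrite mulmxA -QE -mulmxA vw // scalemxAr.
- by move=> b x bp xb; rewrite mulmxA -QE -mulmxA (vs b x) // mulmx0.
Qed.

Lemma hwrep_full X lam (P : 'M[K]_(rdim X)) mu v : wt_basis H rv P mu -> hwrep X lam -> sing (M := X) lam v ->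
  (forall w, wtv lam w -> exists c, w = c *: v) /\
  (forall nu w, w != 0 -> wtv (M := X) nu w -> coord_le nu lam).
Proof.
move=> Pmu [[_ irr] _ _] vs; have [v0 _ _] := vs.
have [U [vU gU _ UL Ule]] := cyclic_module D kilE Pmu vs.
have UF : U = fullv.
  have [U0|//] := irr U gU; move: v0; by rewrite -memv0 -U0 vU.
by split=> [w|nu w]; [apply: UL|apply: Ule]; rewrite UF memvf.
Qed.

Lemma hwrep_uniq X lam nu : hwrep X lam -> hwrep X nu -> lam = nu.
Proof.
move=> Xl Xn; have [_ [P [mu Pmu]] [v vs]] := Xl; have [_ _ [w ws]] := Xn.
have [_ le1] := hwrep_full Pmu Xl vs; have [_ le2] := hwrep_full Pmu Xn ws.
have [v0 vw _] := vs; have [w0 ww _] := ws.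
by apply/rowP => i; apply: le_anti; rewrite (le2 _ _ v0 vw) (le1 _ _ w0 ww).
Qed.

(** The submodule of the sum generated by [(x, y)] projects onto both factors. A nonzero kernel of a
    projection would be a submodule containing [(x, y)], which has nonzero projections; so both
    projections are isomorphisms. *)
Lemma hwrep_iso X Y lam : hwrep X lam -> hwrep Y lam -> rep_iso X Y.
Proof.
move=> Xl Yl; have [[_ irrX] wX [x xs]] := Xl; have [[_ irrY] wY [y ys]] := Yl.
pose N := dsum_rep X Y; pose v : 'cV[K]_(rdim N) := col_mx x y.
have [P [mu Pmu]] : wtmod N := wtmod_dsum wX wY.
have [x0 xw xv] := xs; have [y0 yw yv] := ys.
have vs : sing (M := N) lam v.
  split.
  - by apply: contraNneq x0 => /(congr1 usubmx); rewrite col_mxKu => ->; apply/eqP/colP => i; rewrite !mxE.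
  - by move=> h hH; rewrite /= /dsum_act mul_block_col !mul0mx addr0 add0r xw // yw // scale_col_mx.
  - by move=> b z bp zb; rewrite /= /dsum_act mul_block_col !mul0mx addr0 add0r (xv b z) // (yv b z) // col_mx0.
have [U [vU gU irr _ _]] := cyclic_module D kilE Pmu vs.
have [Z [B [L [LB MB BU BL dZ]]]] := subrep_ex gU.
have iso (A : rep g) (p : 'M[K]_(rdim A, rdim N)) : (forall x, p *m N x = A x *m p) ->
    (forall U : {vspace 'cV[K]_(rdim A)}, (forall x v, v \in U -> A x *m v \in U) -> U = 0%VS \/ U = fullv) ->
    p *m v != 0 -> rep_iso Z A.
  move=> pA irrA pv.
  have inj (w : 'cV[K]_(rdim Z)) : p *m B *m w = 0 -> w = 0.
    move=> pBw; pose C := (U :&: lker (linfun (mulmx p)))%VS.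
    have gC : gstable C.
      move=> z u /memv_capP[uU]; rewrite memv_ker lfunE /= => /eqP pu.
      by apply/memv_capP; split; [apply: gU|rewrite memv_ker lfunE /= mulmxA pA -mulmxA pu mulmx0].
    have C0 : C = 0%VS.
      apply/eqP; apply: contrapT => /negP C0.
      have [/memv_capP[_]] := irr C gC C0 (capvSl _ _).
      by rewrite memv_ker lfunE /= (negPf pv).
    have : B *m w \in C by apply/memv_capP; split=> //; rewrite memv_ker lfunE /= mulmxA pBw.
    by rewrite C0 memv0 => /eqP Bw; rewrite -[w]mul1mx -LB -mulmxA Bw mulmx0.
  pose F : 'Hom('cV[K]_(rdim Z), 'cV[K]_(rdim A)) := linfun (mulmx (p *m B)).
  have FE w : F w = p *m B *m w by rewrite lfunE.
  have sur : limg F = fullv.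
    have [||//] := irrA (limg F).
      move=> z _ /memv_imgP[w _ ->]; rewrite FE !mulmxA -pA -(mulmxA p) MB.
      by rewrite (mulmxA p) -(mulmxA (p *m B)) -FE memv_img ?memvf.
    move=> l0; case/eqP: pv; apply/eqP; rewrite -memv0 -l0.
    have -> : p *m v = F (L *m v) by rewrite FE -mulmxA BL.
    by rewrite memv_img ?memvf.
  have rf : row_free (p *m B)^T.
    rewrite -kermx_eq0; apply/rowV0P => w /sub_kermxP wB.
    apply: (can_inj (@trmxK _ _ _)); rewrite trmx0; apply: inj.
    by apply: (can_inj (@trmxK _ _ _)); rewrite trmx_mul trmxK wB trmx0.
  have [S SP] : exists S : 'M[K]_(rdim Z, rdim A), S *m (p *m B) = 1%:M.
    have /row_freeP[S SE] := rf; exists S^T.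
    by apply: (can_inj (@trmxK _ _ _)); rewrite trmx_mul trmxK SE trmx1.
  have PS : (p *m B) *m S = 1%:M.
    apply/matrixP => i j; pose dj : 'cV[K]_(rdim A) := delta_mx j 0; have : dj \in limg F by rewrite sur memvf.
    move=> /memv_imgP[w _]; rewrite FE => jw.
    have : p *m B *m S *m dj = dj by rewrite jw -[LHS]mulmxA (mulmxA S) SP mul1mx.
    by rewrite /dj -colE => /colP/(_ i); rewrite mxE => ->; rewrite !mxE eqxx andbT.
  apply: rep_iso_sym; exists (p *m B), S; split=> // z.
  by rewrite -mulmxA -MB !mulmxA pA.
have isoX : rep_iso Z X.
  apply: (iso X (row_mx 1%:M 0)) => //.
  - by move=> z /=; rewrite /dsum_act mul_row_block mul_mx_row !mulmx0 !mul0mx !addr0 mul1mx mulmx1.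
  - by rewrite mul_row_col mul1mx mul0mx addr0.
have isoY : rep_iso Z Y.
  apply: (iso Y (row_mx 0 1%:M)) => //.
  - by move=> z /=; rewrite /dsum_act mul_row_block mul_mx_row !mulmx0 !mul0mx !add0r mul1mx mulmx1.
  - by rewrite mul_row_col mul1mx mul0mx add0r.
exact: rep_iso_trans (rep_iso_sym isoX) isoY.
Qed.

End CompleteReducibility.

(* Central differences with the steps in [s]: for the positive roots they multiply an
   exponential by the Weyl denominator. *)
Fixpoint Dop (R : realFieldType) (r : nat) (T : zmodType) (s : seq 'rV[R]_r) (f : 'rV[R]_r -> T)
    (x : 'rV[R]_r) : T :=
  if s is b :: s' then Dop s' f (x + 2^-1 *: b) - Dop s' f (x - 2^-1 *: b) else f x.

Lemma add_halves (R : realFieldType) (V : lmodType R) (u : V) : 2^-1 *: u + 2^-1 *: u = u.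
Proof. by rewrite -scalerDl (_ : 2^-1 + 2^-1 = 1) ?scale1r //; field. Qed.

(** * Characters *)

Section DifferenceOperators.
Variables (R : realFieldType) (r : nat) (K : comNzRingType).
Implicit Types (s : seq 'rV[R]_r) (f : 'rV[R]_r -> K) (x : 'rV[R]_r).

Lemma eq_Dop s f f' x : f =1 f' -> Dop s f x = Dop s f' x.
Proof. by move=> ff; elim: s x => [|b s IH] x /=; rewrite ?ff ?IH. Qed.

Lemma DopZ s c f x : Dop s (fun y => c * f y) x = c * Dop s f x.
Proof. by elim: s x => [//|b s IH] x /=; rewrite !IH mulrBr. Qed.

Lemma Dop_shift s f c x : Dop s (fun y => f (y + c)) x = Dop s f (x + c).
Proof. by elim: s x => [//|b s IH] x /=; rewrite !IH !(addrAC x _ c). Qed.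

Lemma Dop_cat s t f x : Dop (s ++ t) f x = Dop s (Dop t f) x.
Proof. by elim: s x => [//|b s IH] x /=; rewrite !IH. Qed.

Lemma Dop_cons_swap b c s f x : Dop (b :: c :: s) f x = Dop (c :: b :: s) f x.
Proof.
rewrite /= !(addrAC x (2^-1 *: c)) !(addrAC x (- (2^-1 *: c))).
ring.
Qed.

Lemma Dop_comm b s f x : Dop (b :: s) f x = Dop s (Dop [:: b] f) x.
Proof.
elim: s x => [//|c s IH] x; rewrite Dop_cons_swap.
have E y : Dop (c :: s) (Dop [:: b] f) y = Dop s (Dop [:: b] f) (y + 2^-1 *: c) - Dop s (Dop [:: b] f) (y - 2^-1 *: c) by [].
by rewrite E -!IH.
Qed.

Lemma Dop_mid t1 b t2 f x : Dop (t1 ++ b :: t2) f x = Dop (b :: t1 ++ t2) f x.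
Proof.
have -> : Dop (t1 ++ b :: t2) f x = Dop t1 (Dop [:: b] (Dop t2 f)) x by rewrite Dop_cat.
by rewrite -Dop_comm /= !Dop_cat.
Qed.

Lemma Dop_perm s t f x : perm_eq s t -> Dop s f x = Dop t f x.
Proof.
elim: s t x => [|b s IH] t x.
  by move=> /perm_size/esym/eqP; rewrite size_eq0 => /eqP ->.
move=> pst; have bt : b \in t by rewrite -(perm_mem pst) mem_head.
case/splitPr: bt pst => t1 t2; rewrite -(cat1s b t2) perm_sym perm_catCA /= perm_cons perm_sym => ps.
by rewrite Dop_mid /= !(IH _ _ ps).
Qed.

Lemma Dop_opp b s f x : Dop (- b :: s) f x = - Dop (b :: s) f x.
Proof. by rewrite /= scalerN opprK opprB. Qed.

Definition Eop (b : 'rV[R]_r) f x := f (x + 2^-1 *: b) + f (x - 2^-1 *: b).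

Lemma Eop_Dop b c s f x : Eop b (Dop s f) (x + 2^-1 *: c) - Eop b (Dop s f) (x - 2^-1 *: c) =
  Eop b (Dop (c :: s) f) x.
Proof.
by rewrite /Eop /= opprD addrACA !(addrAC x _ (2^-1 *: b)) !(addrAC x _ (- (2^-1 *: b))).
Qed.

(** A Leibniz rule: differencing the product with an additive [L] produces, besides [L] times the
    difference, half of [L b] times the symmetric sum [Eop b], once for every step [b]. The factor 2
    clears the halves. *)
Lemma Dop_linear_mul s f (L : 'rV[R]_r -> K) x : uniq s -> {morph L : u v / u + v} ->
  Dop s (fun y => 2 * L y * f y) x =
  2 * L x * Dop s f x + \sum_(b <- s) L b * Eop b (Dop (rem b s) f) x.
Proof.
move=> us LD; elim: s us x => [|c s IH] us x; first by rewrite big_nil addr0.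
have [cs us'] := andP us.
have L0 : L 0 = 0 by have := LD 0 0; rewrite addr0 => /eqP; rewrite addrC -subr_eq subrr => /eqP.
have LN u : L (- u) = - L u by apply/eqP; rewrite -addr_eq0 -LD addNr L0.
have L2 u : L u = 2 * L (2^-1 *: u).
  by rewrite mulr_natl mulr2n -LD add_halves.
have -> : Dop (c :: s) (fun y => 2 * L y * f y) x =
    Dop s (fun y => 2 * L y * f y) (x + 2^-1 *: c) - Dop s (fun y => 2 * L y * f y) (x - 2^-1 *: c) by [].
rewrite !IH // big_cons /= eqxx.
have -> : \sum_(b <- s) L b * Eop b (Dop (rem b (c :: s)) f) x =
    \sum_(b <- s) L b * Eop b (Dop (rem b s) f) (x + 2^-1 *: c) -
    \sum_(b <- s) L b * Eop b (Dop (rem b s) f) (x - 2^-1 *: c).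
  rewrite -sumrB !big_seq; apply: eq_bigr => b bs; rewrite -mulrBr Eop_Dop.
  by rewrite /= (_ : (c == b) = false) //; apply: contraNF cs => /eqP ->.
rewrite {1}(LD x) {1}(LD x) LN (L2 c) /Eop.
set A := Dop s f _; set B := Dop s f _; set S := \sum_(_ <- _) _; set T := \sum_(_ <- _) _.
ring.
Qed.

End DifferenceOperators.

Section FiniteFunctionals.
Variables (T : choiceType) (K : comNzRingType).

(** Such functionals stand in for formal exponential sums: a combination of point evaluations is
    determined by its values on indicators of points. *)
Definition finfunctional (phi : (T -> K) -> K) :=
  exists l : seq (K * T), forall f, phi f = \sum_(p <- l) p.1 * f p.2.

Lemma finfunctional_eval x : finfunctional (fun f => f x).
Proof. by exists [:: (1, x)] => f; rewrite big_seq1 mul1r. Qed.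

Lemma finfunctional_add phi psi : finfunctional phi -> finfunctional psi ->
  finfunctional (fun f => phi f + psi f).
Proof. by move=> [l lE] [l' lE']; exists (l ++ l') => f; rewrite lE lE' big_cat. Qed.

Lemma finfunctional_scale c phi : finfunctional phi -> finfunctional (fun f => c * phi f).
Proof.
move=> [l lE]; exists [seq (c * p.1, p.2) | p <- l] => f; rewrite lE big_map mulr_sumr.
by apply: eq_bigr => p _; rewrite mulrA.
Qed.

Lemma finfunctional_sub phi psi : finfunctional phi -> finfunctional psi ->
  finfunctional (fun f => phi f - psi f).
Proof.
move=> fp fq; have [l lE] := finfunctional_add fp (finfunctional_scale (-1) fq).
by exists l => f; rewrite -lE mulN1r.
Qed.

Lemma finfunctional_sum I (s : seq I) (phi : I -> (T -> K) -> K) :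
  (forall i, finfunctional (phi i)) -> finfunctional (fun f => \sum_(i <- s) phi i f).
Proof.
move=> fp; elim: s => [|i s IH]; first by exists [::] => f; rewrite !big_nil.
have [l lE] := finfunctional_add (fp i) IH.
by exists l => f; rewrite big_cons lE.
Qed.

Definition ind (x y : T) : K := (y == x)%:R.

Lemma finfunctional0 phi : finfunctional phi -> (forall x, phi (ind x) = 0) -> forall f, phi f = 0.
Proof.
move=> [l lE] p0 f; rewrite lE.
transitivity (\sum_(x <- undup [seq p.2 | p <- l]) f x * phi (ind x)); last first.
  by apply: big1 => x _; rewrite p0 mulr0.
under [RHS]eq_bigr do rewrite lE mulr_sumr.
rewrite exchange_big big_seq [RHS]big_seq; apply: eq_bigr => p pl /=.
have pu : p.2 \in undup [seq p.2 | p <- l] by rewrite mem_undup map_f.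
rewrite (bigD1_seq p.2) ?undup_uniq //= /ind eqxx mulr1 big1 ?addr0 => [|x xp]; first by rewrite mulrC.
by rewrite eq_sym (negPf xp) !mulr0.
Qed.

End FiniteFunctionals.

Lemma finfunctional_Dop (R : realFieldType) (r : nat) (K : comNzRingType) (s : seq 'rV[R]_r) x :
  finfunctional (fun f : 'rV[R]_r -> K => Dop s f x).
Proof.
elim: s x => [|b s IH] x /=; first exact: finfunctional_eval.
exact: finfunctional_sub.
Qed.

Section DifferenceSupport.
Variables (R : realFieldType) (r : nat) (K : comNzRingType).
Implicit Types (s : seq 'rV[R]_r) (x nu : 'rV[R]_r).
Local Notation ind := (@ind 'rV[R]_r K).
Local Notation half s := (2^-1 *: \sum_(b <- s) b).

(** Expanding the differences, each step contributes plus or minus its half; the steps taken with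
    the minus sign form [t]. *)
Lemma Dop_ind_support s nu x : Dop s (ind nu) x != 0 ->
  exists2 t, subseq t s & nu = x + half s - \sum_(b <- t) b.
Proof.
elim: s x => [|b s IH] x /=.
  rewrite /ind; have [-> _|_] := eqVneq x nu; last by rewrite eqxx.
  by exists [::]; rewrite ?big_nil // scaler0 addr0 subr0.
have [s1|] := eqVneq (Dop s (ind nu) (x + 2^-1 *: b)) 0; last first.
  move=> /IH[t ts ->] _; exists t; first exact: subseq_trans ts (subseq_cons _ _).
  by rewrite big_cons scalerDr addrA.
rewrite s1 sub0r oppr_eq0 => /IH[t ts ->].
exists (b :: t); first by rewrite /= eqxx.
rewrite !big_cons scalerDr opprD -{3}[b]add_halves opprD !addrA; congr (_ - _).
by rewrite (addrAC x (2^-1 *: b) (half s)) addrK addrAC.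
Qed.

(** Only the choice of all plus signs reaches the top point; any other choice loses positive
    height. *)
Lemma Dop_ind_top (ht : 'rV[R]_r -> R) s x : {morph ht : u v / u + v} ->
  (forall b, b \in s -> 0 < ht b) -> Dop s (ind (x + half s)) x = 1.
Proof.
move=> hD; have h0 : ht 0 = 0 by have := hD 0 0; rewrite addr0 => /eqP; rewrite addrC -subr_eq subrr => /eqP.
elim: s x => [|b s IH] x sp /=; first by rewrite big_nil scaler0 addr0 /ind eqxx.
have E : x + half (b :: s) = (x + 2^-1 *: b) + half s by rewrite big_cons scalerDr addrA.
rewrite {1}E IH; last by move=> c cs; apply: sp; rewrite inE cs orbT.
have [->|] := eqVneq (Dop s (ind (x + half (b :: s))) (x - 2^-1 *: b)) 0; first by rewrite subr0.
move=> /Dop_ind_support[t ts]; rewrite E => e; exfalso.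
have hN u : ht (- u) = - ht u by apply/eqP; rewrite -addr_eq0 -hD addNr h0.
have hb : ht b = ht (2^-1 *: b) + ht (2^-1 *: b) by rewrite -hD add_halves.
have := congr1 ht e; rewrite !hD !hN (big_morph ht hD h0) => he.
have b0 : 0 < ht b by rewrite sp ?mem_head.
have t0 : 0 <= \sum_(c <- t) ht c.
  rewrite big_seq sumr_ge0 // => c ct; apply/ltW/sp.
  by rewrite inE (mem_subseq ts ct) orbT.
by move: hb he b0 t0; lra.
Qed.

End DifferenceSupport.

(** * Weyl's character formula *)

Section CharacterFormula.
Variables (R : realType) (K : numFieldType) (g : lieAlgType K) (H : {vspace g}).
Variables (r : nat) (a : r.-tuple g) (iota : {rmorphism R -> K}) (rv : 'rV[R]_r -> g).
Hypothesis D : cartan_data H a iota rv.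
Variable ip : 'rV[R]_r -> 'rV[R]_r -> R.
Hypothesis kilE : forall b c, killing (rv b) (rv c) = iota (ip b c).
Let simp := cd_simple D.
Let cart := cd_cartan D.
Let sroots := cd_roots D.
Local Notation kil b c := (killing (rv b) (rv c)).
Local Notation root := (rootv H rv).
Local Notation al := (sroot R).
Local Notation cp := (cpair ip).
Local Notation ref := (refl ip).
Local Notation proots := (pos_roots_seq H rv).
Local Notation rho := (rho H rv).
Local Notation wtmod := (wtmod H rv).
Local Notation hwrep := (hwrep H rv).
Local Notation ws := (wseq ip).
Local Notation wg := (wgroup ip).
Local Notation Df := (Dop proots).
Local Notation indK := (@ind 'rV[R]_r K).
Implicit Types f : 'rV[R]_r -> K.

Definition strict (nu : 'rV[R]_r) := forall i, 0 < ip nu (al i).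

Lemma strict_rho : strict rho. Proof. exact: (rho_pos D kilE). Qed.

Lemma strict_dom nu : strict nu -> dom ip nu. Proof. by move=> sn i; exact: ltW. Qed.

(** On indicators, a point can be moved into the dominant chamber at the cost of a sign. On a wall
    antisymmetry makes the coefficient vanish, and strictly inside only [nu0] is left. *)
Lemma antisym_functional (phi : ('rV[R]_r -> K) -> K) nu0 : finfunctional phi ->
  (forall i f, phi (f \o ref (al i)) = - phi f) -> strict nu0 ->
  (forall nu, strict nu -> phi (indK nu) != 0 -> nu = nu0) ->
  (forall f f', f =1 f' -> phi f = phi f') ->
  forall f, phi f = phi (indK nu0) * \sum_(w <- ws) iota (\det w) * f (nu0 *m w).
Proof.
move=> fphi anti s0 only ext f; apply/eqP; rewrite -subr_eq0; apply/eqP.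
move: f; apply: finfunctional0.
  apply: finfunctional_sub => //; apply: finfunctional_scale; apply: finfunctional_sum => w.
  exact/finfunctional_scale/finfunctional_eval.
move=> nu; apply/eqP; rewrite subr_eq0; apply/eqP.
have antiw w : wg w -> forall nu, phi (indK (nu *m w)) = iota (\det w) * phi (indK nu).
  move=> [s _ <-]; elim: s => [|i s IH] nu'; first by rewrite wword_nil mulmx1 det1 rmorph1 mul1r.
  rewrite wword_cons mulmxA IH det_mulmx rmorphM (det_sreflm D kilE) rmorphN rmorph1 mulN1r mulNr -mulrN.
  congr (_ * _); rewrite -(anti i); apply: ext => y; rewrite /= /ind (mul_sreflm D kilE).
  congr (_%:R); apply: congr1; apply/eqP/eqP => [->|<-];
  by rewrite (refl_invol D kilE (sroot_neq0 D i)).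
have [w ww dw] := dom_ex D kilE nu; have [w' ww' [wK w'K]] := wgroupV D kilE ww.
have [e|ne] := eqVneq (nu *m w) nu0.
  have nuE : nu = nu0 *m w' by rewrite -e -mulmxA wK mulmx1.
  rewrite nuE antiw // mulrC; congr (_ * _).
  have w'in : w' \in ws by apply/(mem_wseq D kilE).
  rewrite (bigD1_seq w') ?wseq_uniq //= /ind eqxx mulr1 big_seq_cond big1 ?addr0 // => v.
  move=> /andP[/(mem_wseq D kilE) wv vw']; case: eqP => [ev|_]; last by rewrite mulr0.
  case/eqP: vw'; have : v *m w = 1%:M.
    apply: (strict_dom_stab D kilE s0); first exact: wgroupM.
    by rewrite mulmxA ev -mulmxA w'K mulmx1.
  by move=> /(congr1 (mulmx^~ w')); rewrite -mulmxA wK mulmx1 mul1mx.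
have p0 : phi (indK (nu *m w)) = 0.
  have [st|nst] := pselect (strict (nu *m w)).
    by apply: contrapT => /eqP/(only _ st) e; rewrite e eqxx in ne.
  have [i ii] : exists i, ip (nu *m w) (al i) = 0.
    apply: contrapT => ni; apply: nst => i; rewrite lt_neqAle dw andbT eq_sym.
    by apply/eqP => e; apply: ni; exists i.
  have := antiw _ (wgroup_sreflm ip i) (nu *m w).
  rewrite (mul_sreflm D kilE) reflE cpairE ii mulr0 mul0r scale0r subr0 (det_sreflm D kilE).
  move/eqP; rewrite rmorphN rmorph1 mulN1r -subr_eq0 opprK -mulr2n mulrn_eq0 /=.
  by move/eqP.
have -> : phi (indK nu) = 0.
  by rewrite -[nu]mulmx1 -wK mulmxA antiw // p0 mulr0.
rewrite big_seq big1 ?mulr0 // => v /(mem_wseq D kilE) wv; rewrite /ind.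
case: eqP => [ev|_]; last by rewrite mulr0.
case/eqP: ne; rewrite -ev -mulmxA; apply: (dom_wgroup_eq D kilE); first exact: strict_dom.
  exact: wgroupM.
by rewrite mulmxA ev.
Qed.

Lemma Dop_refl i s f x : Dop s (f \o ref (al i)) x = Dop [seq ref (al i) b | b <- s] f (ref (al i) x).
Proof.
elim: s x => [//|b s IH] x /=.
rewrite !IH !(reflD D kilE) (reflN D kilE) !(reflZ D kilE).
by [].
Qed.

(** The reflection permutes the positive roots other than [al i] and reverses [al i], which changes
    the sign of one difference. *)
Lemma Df_refl i f x : Df (f \o ref (al i)) x = - Df f (ref (al i) x).
Proof.
rewrite Dop_refl; set y := ref _ x.
have ps : perm_eq [seq ref (al i) b | b <- proots] (- al i :: rem (al i) proots).
  rewrite (perm_trans (perm_map _ (perm_proots_rem D i))) //= (refl_self D kilE (sroot_neq0 D i)).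
  by rewrite perm_cons (perm_proots_refl D kilE).
by rewrite (Dop_perm _ _ ps) Dop_opp -(Dop_perm _ _ (perm_proots_rem D i)).
Qed.

Lemma root_cpair_int b i : root b -> exists m : int, cp b (al i) = m%:~R.
Proof.
move=> rb; have [P [mu [Pmu _]]] := ad_wt_basis D.
have [x x0 xb] := rootvec_ad_weight rb.
exact: (weight_integral D kilE Pmu x0 xb (sroot_root D i)).
Qed.

Lemma sum_roots_cpair_int (t : seq 'rV[R]_r) i : subseq t proots ->
  exists m : int, cp (\sum_(b <- t) b) (al i) = m%:~R.
Proof.
move=> /mem_subseq; elim: t => [|b t IH] sub.
  by exists 0; rewrite big_nil cpairE (ip0l D kilE) mulr0 mul0r.
have [m mE] : exists m : int, cp (\sum_(b <- t) b) (al i) = m%:~R.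
  by apply: IH => c ct; apply: sub; rewrite inE ct orbT.
have /(mem_proots D)[rb _] := sub b (mem_head _ _).
have [k kE] := root_cpair_int i rb.
by exists (k + m); rewrite big_cons (cpairDl D kilE) kE mE rmorphD.
Qed.

Lemma sum_roots_ge0 (t : seq 'rV[R]_r) i : subseq t proots -> 0 <= (\sum_(b <- t) b) 0 i.
Proof.
move=> /mem_subseq sub; rewrite summxE big_seq sumr_ge0 // => b bt.
by have /(mem_proots D)[_ ->] := sub b bt.
Qed.

Lemma strict_sub_rho nu : strict nu -> (forall i, exists m : int, cp nu (al i) = m%:~R) ->
  dom ip (nu - rho).
Proof.
move=> sn int i; rewrite -(cpair_ge0 D kilE) (cpairDl D kilE) (cpairNl D kilE) (cpair_rho D kilE).
have := sn i; rewrite -(cpair_gt0 D kilE); have [m ->] := int i.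
by rewrite subr_ge0 ltr0z -[1]/(1%:~R) ler_int; lia.
Qed.

Lemma rho_half : 2^-1 *: \sum_(b <- proots) b = rho. Proof. by []. Qed.

Lemma sumr_rV_morph : {morph (fun u : 'rV[R]_r => \sum_i u 0 i) : u v / u + v}.
Proof. by move=> u v; rewrite -big_split; apply: eq_bigr => i _; rewrite mxE. Qed.

(** At the origin, a point of the support has the form [rho - d] with [d] a sum of positive roots.
    If it is strictly dominant, integrality makes [- d] dominant, so [(d, d) <= 0] and only [rho]
    remains. *)
Lemma weyl_denominator f x : Df f x = \sum_(w <- ws) iota (\det w) * f (x + rho *m w).
Proof.
have := antisym_functional (phi := fun f => Df f 0) (nu0 := rho).
have top : Df (indK rho) 0 = 1.
  have := @Dop_ind_top R r K _ proots 0 sumr_rV_morph (fun b bp => proot_height_gt0 D bp).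
  by rewrite add0r rho_half.
rewrite top => h; have {}h : forall f, Df f 0 = 1 * \sum_(w <- ws) iota (\det w) * f (rho *m w).
  apply: h; first exact: finfunctional_Dop.
  - move=> i f'; rewrite Df_refl; congr (- Dop _ _ _).
    by rewrite -(scale0r (0 : 'rV[R]_r)) (reflZ D kilE) !scale0r.
  - exact: strict_rho.
  - move=> nu sn /Dop_ind_support[t ts]; rewrite rho_half add0r => nuE.
    have tint i : exists m : int, cp nu (al i) = m%:~R.
      have [m mE] := sum_roots_cpair_int i ts; exists (1 - m).
      by rewrite nuE (cpairDl D kilE) (cpairNl D kilE) (cpair_rho D kilE) mE rmorphB.
    have dn := strict_sub_rho sn tint; rewrite nuE addrAC subrr add0r in dn.
    set d := \sum_(b <- t) b in nuE dn.
    have : 0 <= ip (- d) d by apply: (ip_nonneg_sroots D kilE) => // i; apply: sum_roots_ge0.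
    rewrite (ipNl D kilE) oppr_ge0 => dd.
    have d0 : d = 0 by apply: contrapT => /eqP/(ip_gt0 D kilE); rewrite ltNge dd.
    by rewrite nuE d0 subr0.
  - by move=> f1 f2 ff; apply: eq_Dop.
have -> : Df f x = Df (fun y => f (y + x)) 0 by rewrite Dop_shift add0r.
by rewrite h mul1r; apply: eq_bigr => w _; rewrite addrC.
Qed.

Section Weights.
Variables (X : rep g) (lam : 'rV[R]_r) (P : 'M[K]_(rdim X)) (mu : 'I_(rdim X) -> 'rV[R]_r).
Hypotheses (hX : hwrep X lam) (Pmu : wt_basis H rv P mu).
Local Notation m f := (\sum_i f (mu i)).

Let nondeg : forall x : g, (forall y, killing x y = 0) -> x = 0.
Proof. exact: (killing_nondeg simp cart sroots). Qed.

Lemma hwrep_cas s : reproducing s -> cas X s = (iota (ip lam (lam + 2 *: rho)))%:M.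
Proof.
move=> rs; have [[_ irr] _ [v vs]] := hX; set c := iota _.
have [C CP] : exists C : {vspace 'cV[K]_(rdim X)}, forall w, w \in C <-> cas X s *m w = c *: w.
  apply: vspace_of_predicate; first by rewrite mulmx0 scaler0.
  move=> x w1 w2 e1 e2; rewrite mulmxDr -scalemxAr e1 e2 scalerDr !scalerA.
  by rewrite mulrC.
have gC : gstable C.
  move=> x w /CP wC; apply/CP.
  by rewrite mulmxA -(cas_comm nondeg X x rs) -mulmxA wC -scalemxAr.
have [v0 _ _] := vs.
have CF : C = fullv.
  have [C0|//] := irr C gC; case/eqP: v0; apply/eqP; rewrite -memv0 -C0; apply/CP.
  exact: (cas_singular D kilE rs vs).
apply/matrixP => i j; have /CP : delta_mx j 0 \in C by rewrite CF memvf.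
rewrite -colE => /colP/(_ i); rewrite !mxE => ->.
by rewrite eqxx andbT mulr_natr.
Qed.

(** The weighted trace of the Casimir operator in two ways: as that of a scalar, and through the
    root family, where cyclicity turns the terms [f' e] into terms [e f'] with shifted argument. *)
Lemma casimir_weight_sum (e f' : 'rV[R]_r -> g) F : (forall b, root b -> root_pair H rv b (e b) (f' b)) ->
  iota (ip lam (lam + 2 *: rho)) * m F = \sum_i iota (ip (mu i) (mu i)) * F (mu i) +
    \sum_(b <- proots) (wtrace P mu (e b) (f' b) F + wtrace P mu (e b) (f' b) (fun y => F (y - b))).
Proof.
move=> ef; have [t [tH trep]] := cartan_family D.
have rs := root_family D kilE ef tH trep; have [Pu _] := Pmu.
have := hwrep_cas rs; set c := iota _ => casE.
have cE : \sum_(p <- t ++ [seq (e b, f' b) | b <- proots] ++ [seq (f' b, e b) | b <- proots])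
    wtrace P mu p.1 p.2 F = c * m F.
  rewrite /wtrace exchange_big mulr_sumr; apply: eq_bigr => i _ /=.
  rewrite -mulr_suml; congr (_ * _).
  have : (invmx P *m cas X (t ++ [seq (e b, f' b) | b <- proots] ++ [seq (f' b, e b) | b <- proots]) *m P) i i = c.
    by rewrite casE -scalemx1 -scalemxAr -scalemxAl mulmx1 mulVmx // !mxE eqxx mulr1.
  rewrite /cas mulmx_sumr mulmx_suml summxE => <-; apply: eq_bigr => p _.
  by rewrite (conj_actM Pmu).
rewrite -cE !big_cat !big_map /= -big_split /=; congr (_ + _).
  rewrite /wtrace exchange_big /=; apply: eq_bigr => i _.
  rewrite -mulr_suml; congr (_ * _).
  rewrite -kilE -{1}(trep (rv (mu i)) (rvec_in D _)) killing_suml !big_seq.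
  apply: eq_bigr => p /tH[p1 p2].
  rewrite mxE (bigD1 i) //= big1 ?addr0 => [|j ji].
    by rewrite !(conj_act_H Pmu) // eqxx !mul1r killingZl (killingC p.1) mulrC.
  by rewrite (conj_act_H Pmu) // eq_sym (negPf ji) !mul0r.
rewrite !big_seq; apply: eq_bigr => b /(mem_proots D)[rb _]; congr (_ + _).
by have [eb _ _] := ef b rb; exact: (wtrace_shift D Pmu _ _ eb).
Qed.

Lemma wtraceDl x y F F' : wtrace P mu x y (fun z => F z + F' z) = wtrace P mu x y F + wtrace P mu x y F'.
Proof. by rewrite -big_split; apply: eq_bigr => i _; rewrite mulrDr. Qed.

Lemma wtraceBl x y F F' : wtrace P mu x y (fun z => F z - F' z) = wtrace P mu x y F - wtrace P mu x y F'.
Proof. by rewrite -sumrB; apply: eq_bigr => i _; rewrite mulrBr. Qed.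

(** By the denominator formula the argument runs over the points [x + rho w], of squared norm
    [(x, x) + 2 (x, rho w) + (rho, rho)]. The middle term is handled by the Leibniz rule for a
    linear factor. *)
Lemma Df_sqnorm f x : Df (fun y => iota (ip y y) * f y) x =
  iota (ip x x) * Df f x +
  \sum_(b <- proots) iota (ip b x) * Eop b (Dop (rem b proots) f) x + iota (ip rho rho) * Df f x.
Proof.
have LD : {morph (fun y => iota (ip y x)) : u v / u + v}.
  by move=> u v; rewrite (ipDl D kilE) rmorphD.
have := Dop_linear_mul f x (@proots_uniq _ _ _ H _ rv) LD.
move=> /eqP; rewrite addrC -subr_eq => /eqP <-.
rewrite !weyl_denominator !mulr_sumr -sumrB -!big_split /= big_seq [RHS]big_seq.
apply: eq_bigr => w /(mem_wseq D kilE) ww.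
have -> : ip (x + rho *m w) (x + rho *m w) = ip x x + 2 * ip x (rho *m w) + ip rho rho.
  rewrite (ipDl D kilE) !(ipDr D kilE) (ip_wgroup D kilE _ _ ww) (ipC kilE _ x).
  by ring.
rewrite (ipDl D kilE) (ipC kilE (rho *m w) x) !rmorphD rmorphM rmorph_nat.
ring.
Qed.

(** Freudenthal's recursion summed against [f]: multiplied by the denominator, the character is
    supported on the sphere of squared radius [(lam + rho, lam + rho)]. Each positive root
    contributes one term through [casimir_weight_sum] and one through [Df_sqnorm], and [wtrace_comm]
    matches them. *)
Lemma freudenthal f : m (Df (fun y => iota (ip y y) * f y)) = iota (ip (lam + rho) (lam + rho)) * m (Df f).
Proof.
have [e [f' ef]] := choose_root_pairs D.
have cE := casimir_weight_sum (Df f) ef.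
have -> : ip (lam + rho) (lam + rho) = ip lam (lam + 2 *: rho) + ip rho rho.
  move: (rho : 'rV[R]_r) => h.
  by rewrite !(ipDl D kilE) !(ipDr D kilE) (ipZr D kilE) (ipC kilE h lam); ring.
rewrite rmorphD mulrDl cE.
under eq_bigr do rewrite Df_sqnorm.
rewrite !big_split /= -mulr_sumr; congr (_ + _ + _).
rewrite -big_split exchange_big /= big_seq [RHS]big_seq; apply: eq_bigr => b bp.
have /(mem_proots D)[rb _] := bp; have [eb _ _] := ef b rb.
have efb := root_pair_lie D (ef b rb).
set h := Eop b (Dop (rem b proots) f).
have := wtrace_comm D Pmu h eb efb.
have -> : \sum_i kil (mu i) b * h (mu i) = \sum_i iota (ip b (mu i)) * h (mu i).
  by apply: eq_bigr => i _; rewrite kilE (ipC kilE).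
move=> <-; rewrite -wtraceBl -wtraceDl; apply: eq_bigr => i _; congr (_ * _).
have pr : perm_eq proots (b :: rem b proots) by apply: perm_to_rem.
rewrite !(Dop_perm _ _ pr) /h /Eop /=.
have -> : mu i - b + 2^-1 *: b = mu i - 2^-1 *: b.
  by rewrite -{1}[b]add_halves opprD addrA addrNK.
set A := Dop _ _ _; set B := Dop _ _ _; set C := Dop _ _ _.
ring.
Qed.

Lemma weights_perm_refl i : perm_eq [seq ref (al i) (mu j) | j <- enum 'I_(rdim X)] [seq mu j | j <- enum 'I_(rdim X)].
Proof.
have inv := refl_invol D kilE (sroot_neq0 D i).
have cE b : count_mem b [seq mu j | j <- enum 'I_(rdim X)] = \dim (wspace H rv X b).
  rewrite (dim_wspace D Pmu) count_map cardE -size_filter; congr (size _).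
  by rewrite enumT /enum_mem; apply: eq_filter => j.
apply/allP => b _; rewrite /= cE -(dim_wspace_refl D kilE Pmu b (sroot_root D i)) -cE.
rewrite !count_map; apply/eqP/eq_count => j /=.
by apply/eqP/eqP => [<-|->]; rewrite inv.
Qed.

Lemma sum_weights_refl i (F : 'rV[R]_r -> K) : m (F \o ref (al i)) = m F.
Proof.
have E G : m G = \sum_(x <- [seq mu j | j <- enum 'I_(rdim X)]) G x by rewrite big_map enumT.
rewrite (E _ F) -(perm_big _ (weights_perm_refl i)) [LHS](E K (F \o ref (al i))) !big_map.
by [].
Qed.

Lemma weight_le_lam i : coord_le (mu i) lam.
Proof.
have [_ _ [v vs]] := hX; have [Pu Pw] := Pmu.
have [_ le] := hwrep_full D kilE Pmu hX vs.
exact: le (col_unit_neq0 i Pu) (Pw i).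
Qed.

Lemma highest_weight_mult1 : exists2 i0, mu i0 = lam & forall i, mu i = lam -> i = i0.
Proof.
have [_ _ [v vs]] := hX; have [Pu Pw] := Pmu; have [v0 vw _] := vs.
have [line _] := hwrep_full D kilE Pmu hX vs.
have [i0 i0E] := wt_occurs D Pmu v0 vw; exists i0 => // i iE.
have [c cE] : exists c : K, col i P = c *: v by apply: line; rewrite -iE; exact: Pw.
have [d dE] : exists d : K, col i0 P = d *: v by apply: line; rewrite -i0E; exact: Pw.
apply: contrapT => /eqP ii0.
have := congr1 (fun u => (invmx P *m u) i 0) cE; have := congr1 (fun u => (invmx P *m u) i0 0) dE.
have := congr1 (fun u => (invmx P *m u) i 0) dE.
have kc j k : (invmx P *m col j P) k 0 = (k == j)%:R.
  by rewrite col_mul mulVmx // !mxE.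
have ks q k : (invmx P *m (q *: v)) k 0 = q * (invmx P *m v) k 0 by rewrite -scalemxAr [LHS]mxE.
rewrite !kc !ks !eqxx (negPf ii0) => /esym/eqP; rewrite mulf_eq0 => /orP[/eqP ->|/eqP ->].
  by rewrite mul0r => /eqP; rewrite oner_eq0.
by rewrite mulr0 => _ /eqP; rewrite oner_eq0.
Qed.

Lemma rho_wgroup_le w : wg w -> coord_le (rho *m w) rho.
Proof. by move=> ww i; apply: (dom_wgroup_le D kilE) => //; apply: strict_dom; exact: strict_rho. Qed.

Lemma weight_cpair_int j i : exists k : int, cp (mu j) (al i) = k%:~R.
Proof.
have [Pu Pw] := Pmu.
exact: (weight_integral D kilE Pmu (col_unit_neq0 j Pu) (Pw j) (sroot_root D i)).
Qed.

Lemma hwrep_dom : dom ip lam.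
Proof. by have [_ _ [v vs]] := hX; exact: (singular_dom D kilE Pmu vs). Qed.

(** By antisymmetry only strictly dominant points [nu] matter. Such a [nu] in the support has the
    norm of [lam + rho] by Freudenthal, and [nu - rho] is dominant and at most [lam]; so
    [casimir_order] leaves only [lam + rho], whose coefficient is 1. *)
Lemma weyl_character f : m (Df f) = \sum_(w <- ws) iota (\det w) * f ((lam + rho) *m w).
Proof.
have sl : strict (lam + rho).
  by move=> i; rewrite (ipDl D kilE) ltr_wpDl ?hwrep_dom ?strict_rho.
have top : m (Df (indK (lam + rho))) = 1.
  have [i0 i0E i0u] := highest_weight_mult1.
  rewrite (bigD1 i0) //= big1 => [|i ii0].
    rewrite addr0 weyl_denominator i0E.
    have w1 : 1%:M \in ws by apply/(mem_wseq D kilE); exact: wgroup1.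
    rewrite (bigD1_seq 1%:M) ?wseq_uniq //= mulmx1 /ind eqxx det1 rmorph1 mulr1 big_seq_cond.
    rewrite big1 ?addr0 // => w /andP[/(mem_wseq D kilE) ww w1'].
    case: eqP => [/addrI e|_]; last by rewrite mulr0.
    by rewrite (strict_dom_stab D kilE strict_rho ww e) eqxx in w1'.
  rewrite weyl_denominator big_seq big1 // => w /(mem_wseq D kilE) ww; rewrite /ind.
  case: eqP => [e|_]; last by rewrite mulr0.
  case/eqP: ii0; apply: i0u; apply/rowP => k; apply: le_anti; rewrite (weight_le_lam i k) /=.
  have := congr1 (fun u : 'rV[R]_r => u 0 k) e; rewrite [LHS]mxE [RHS]mxE.
  by have := rho_wgroup_le ww k; lra.
have := @antisym_functional (fun f => m (Df f)) (lam + rho).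
rewrite top => h; rewrite -[RHS]mul1r; apply: h => //.
- by apply: finfunctional_sum => i; exact: finfunctional_Dop.
- move=> i F; under eq_bigr do rewrite Df_refl.
  rewrite sumrN; congr (- _).
  exact: (sum_weights_refl i (Df F)).
- move=> nu sn; rewrite -[X in X != 0]mul1r => nz.
  have [j] : exists j, Df (indK nu) (mu j) != 0.
    apply: contrapT => nj; case/eqP: nz; rewrite mul1r; apply: big1 => j _.
    by apply: contrapT => /eqP jn; apply: nj; exists j.
  move=> /Dop_ind_support[t ts]; rewrite rho_half => nuE.
  have tint i : exists k : int, cp nu (al i) = k%:~R.
    have [k kE] := sum_roots_cpair_int i ts; have [q qE] := weight_cpair_int j i.
    exists (q + 1 - k); rewrite nuE !(cpairDl D kilE) (cpairNl D kilE) (cpair_rho D kilE) kE qE.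
    by rewrite rmorphB rmorphD.
  have dn := strict_sub_rho sn tint.
  have le : coord_le (nu - rho) lam.
    move=> i; rewrite nuE; have := sum_roots_ge0 i ts; have := weight_le_lam j i.
    move: (\sum_(b <- t) b) (rho) => S h; rewrite !mxE; lra.
  have nn : ip nu nu = ip (lam + rho) (lam + rho).
    have := freudenthal (indK nu).
    (* On the indicator of [nu] the factor [(y, y)] is the constant [(nu, nu)]. *)
    have -> : m (Df (fun y => iota (ip y y) * indK nu y)) = iota (ip nu nu) * m (Df (indK nu)).
      rewrite mulr_sumr; apply: eq_bigr => i _; rewrite -DopZ; apply: eq_Dop => y.
      by rewrite /ind; case: eqP => [->|_] //; rewrite !mulr0.
    by rewrite mul1r in nz; move=> /(mulIf nz)/(fmorph_inj iota).
  have cE : ip lam (lam + 2 *: rho) = ip (nu - rho) (nu - rho + 2 *: rho).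
    move: nn dn le; move: (rho : 'rV[R]_r) => h nn _ _; move: nn.
    rewrite !(ipDl D kilE) !(ipDr D kilE) !(ipNl D kilE) !(ipNr D kilE) !(ipZr D kilE).
    by rewrite (ipC kilE h lam) (ipC kilE h nu); lra.
  by rewrite -(casimir_order D kilE hwrep_dom dn le cE) subrK.
- by move=> f1 f2 ff; apply: eq_bigr => i _; apply: eq_Dop.
Qed.

End Weights.

End CharacterFormula.

Lemma Dop_morph (R : realFieldType) (r : nat) (T T' : zmodType) (phi : {additive T -> T'}) (s : seq 'rV[R]_r)
  (f : 'rV[R]_r -> T) x : Dop s (phi \o f) x = phi (Dop s f x).
Proof. by elim: s x => [//|b s IH] x /=; rewrite !IH raddfB. Qed.

Section WeightSums.
Variables (R : realType) (K : numFieldType) (g : lieAlgType K) (H : {vspace g}).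
Variables (r : nat) (a : r.-tuple g) (iota : {rmorphism R -> K}) (rv : 'rV[R]_r -> g).
Hypothesis D : cartan_data H a iota rv.
Variable ip : 'rV[R]_r -> 'rV[R]_r -> R.
Hypothesis kilE : forall b c, killing (rv b) (rv c) = iota (ip b c).
Local Notation wtv := (wt_vec H rv).
Local Notation rho := (rho H rv).
Local Notation sing := (singular H rv).
Local Notation wtmod := (wtmod H rv).
Local Notation hwrep := (hwrep H rv).
Implicit Types F : 'rV[R]_r -> R.

(** Stated with dimensions of weight spaces so that for an exponential [F] it is [rchar]; [charsumE]
    rewrites it over a weight basis. *)
Definition charsum (M : rep g) F : R :=
  \sum_(b \in [set: 'rV[R]_r]) (\dim (wspace H rv M b))%:R * F b.

Lemma charsumE M P mu F : wt_basis H rv (M := M) P mu -> charsum M F = \sum_i F (mu i).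
Proof.
move=> Pmu; pose s := undup [seq mu i | i <- enum 'I_(rdim M)].
have ms i : mu i \in s by rewrite mem_undup map_f ?mem_enum.
rewrite /charsum -(@fsbig_widen _ _ _ _ [set` s]) => [|//|b [_ /= bs]]; last first.
  rewrite (dim_wspace D Pmu) (_ : #|_| = 0%N) ?mul0r //; apply: eq_card0 => i.
  by rewrite !inE; apply/eqP => ib; apply: bs; rewrite -ib.
rewrite -fsbig_seq ?undup_uniq //=.
transitivity (\sum_(b <- s) \sum_i (mu i == b)%:R * F (mu i)).
  apply: eq_bigr => b _; rewrite (dim_wspace D Pmu) -sum1_card natr_sum mulr_suml big_mkcond /=.
  by apply: eq_bigr => i _; rewrite inE; case: eqP => [->|_]; rewrite ?mul0r.
rewrite exchange_big; apply: eq_bigr => i _ /=.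
rewrite (bigD1_seq (mu i)) ?undup_uniq //= eqxx mul1r big1 ?addr0 // => b bi.
by rewrite eq_sym (negPf bi) mul0r.
Qed.

Lemma dim_wspace_iso_le M N b : rep_iso M N -> (\dim (wspace H rv M b) <= \dim (wspace H rv N b))%N.
Proof.
move=> [P [Q [PQ QP E]]]; apply: (@dim_le_inj _ _ _ (mulmx Q)).
- by move=> c x y; rewrite mulmxDr scalemxAr.
- by move=> v _ Qv; rewrite -[v]mul1mx -PQ -mulmxA Qv mulmx0.
- move=> v /memv_wspace vw; apply/memv_wspace => h hH.
  have QE : Q *m M h = N h *m Q.
    by rewrite -[LHS]mulmx1 -PQ -!mulmxA (mulmxA (M h)) E !mulmxA QP mul1mx.
  by rewrite mulmxA -QE -mulmxA (vw h hH) scalemxAr.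
Qed.

Lemma charsum_iso M N F : rep_iso M N -> charsum M F = charsum N F.
Proof.
move=> iso; apply: eq_fsbigr => b _; congr (_%:R * _); apply: anti_leq.
by rewrite !dim_wspace_iso_le //; exact: rep_iso_sym.
Qed.

Lemma wt_basis_trivial n : wt_basis H rv (M := trivial_rep n) 1%:M (fun=> 0).
Proof.
split=> [|i h hH]; first exact: unitmx1.
by rewrite /= mul0mx (rvec0 D) killing0l scale0r.
Qed.

Lemma wtmod_trivial n : wtmod (trivial_rep n).
Proof. by exists 1%:M, (fun=> 0); exact: wt_basis_trivial. Qed.

Lemma charsum_trivial n F : charsum (trivial_rep n) F = n%:R * F 0.
Proof. by rewrite (charsumE _ (wt_basis_trivial n)) sumr_const card_ord mulr_natl. Qed.

Lemma charsum_dsum M N F : wtmod M -> wtmod N -> charsum (dsum_rep M N) F = charsum M F + charsum N F.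
Proof.
move=> [P [mu Pmu]] [Q [nu Qnu]].
rewrite (charsumE _ (wt_basis_dsum Pmu Qnu)) (charsumE _ Pmu) (charsumE _ Qnu) big_split_ord /=.
by congr (_ + _); apply: eq_bigr => i _;
   rewrite ?(unsplitK (inl i)) ?(unsplitK (inr i)).
Qed.

Lemma wt_basis_tens M N P mu Q nu : wt_basis H rv (M := M) P mu -> wt_basis H rv (M := N) Q nu ->
  wt_basis H rv (M := tens_rep M N) (tensmx P Q)
    (fun k => mu (mxtens_unindex k).1 + nu (mxtens_unindex k).2).
Proof.
move=> [Pu Pw] [Qu Qw]; split.
  have [M0|M0] := posnP (rdim M).
    have MN0 : (rdim M * rdim N = 0)%N by rewrite M0.
    rewrite -row_free_unit -kermx_eq0; apply/rowV0P => v _; apply/rowP => i.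
    by move: (ltn_ord i); rewrite /= {2}MN0.
  have [N0|N0] := posnP (rdim N).
    have MN0 : (rdim M * rdim N = 0)%N by rewrite N0 muln0.
    rewrite -row_free_unit -kermx_eq0; apply/rowV0P => v _; apply/rowP => i.
    by move: (ltn_ord i); rewrite /= {2}MN0.
  by apply: tensmx_unit => //; rewrite -lt0n.
move=> k h hH; set i := (mxtens_unindex k).1; set j := (mxtens_unindex k).2.
have cE : col k (tensmx P Q) = tensmx (col i P) (col j Q).
  by apply/matrixP => p q; rewrite !mxE.
have tE (A : 'M[K]_(rdim M)) (B : 'M[K]_(rdim N)) :
    tensmx A B *m col k (tensmx P Q) = tensmx (A *m col i P) (B *m col j Q).
  by rewrite cE; exact: (@tensmx_mul K _ _ _ _ 1 1 A B (col i P) (col j Q)).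
rewrite /= /tens_act mulmxDl !tE !mul1mx (Pw i h hH) (Qw j h hH) cE.
rewrite (rvecD D) killingDl scalerDl; congr (_ + _); apply/matrixP => p q; rewrite !mxE.
  by rewrite mulrA.
by rewrite mulrCA.
Qed.

Lemma wtmod_tens M N : wtmod M -> wtmod N -> wtmod (tens_rep M N).
Proof. by move=> [P [mu Pmu]] [Q [nu Qnu]]; eexists; eexists; exact: wt_basis_tens Pmu Qnu. Qed.

Lemma charsum_tens M N F : wtmod M -> wtmod N ->
  charsum (tens_rep M N) F = charsum M (fun x => charsum N (fun y => F (x + y))).
Proof.
move=> [P [mu Pmu]] [Q [nu Qnu]].
rewrite (charsumE _ (wt_basis_tens Pmu Qnu)) (charsumE _ Pmu).
under [RHS]eq_bigr do rewrite (charsumE _ Qnu).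
rewrite pair_big (reindex (@mxtens_index (rdim M) (rdim N))); last first.
  by exists (@mxtens_unindex (rdim M) (rdim N)) => ? _; rewrite ?mxtens_indexK ?mxtens_unindexK.
by apply: eq_bigr => p _; rewrite -[p in RHS]mxtens_indexK.
Qed.

Lemma charsum_exp_tens M N y : wtmod M -> wtmod N ->
  charsum (tens_rep M N) (fun b => expR (ip b y)) =
  charsum M (fun b => expR (ip b y)) * charsum N (fun b => expR (ip b y)).
Proof.
move=> wM wN; rewrite charsum_tens //; have [P [mu Pmu]] := wM; have [Q [nu Qnu]] := wN.
rewrite !(charsumE _ Pmu) mulr_suml; apply: eq_bigr => i _.
rewrite !(charsumE _ Qnu) mulr_sumr; apply: eq_bigr => j _.
by rewrite (ipDl D kilE) expRD.
Qed.

Lemma wtmod_tens_pow M n : wtmod M -> wtmod (tens_pow M n).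
Proof. by move=> wM; elim: n => [|n IH]; [exact: wtmod_trivial|exact: wtmod_tens]. Qed.

Lemma charsum_exp_tens_pow M n y : wtmod M ->
  charsum (tens_pow M n) (fun b => expR (ip b y)) = charsum M (fun b => expR (ip b y)) ^+ n.
Proof.
move=> wM; elim: n => [|n IH].
  by rewrite charsum_trivial mul1r (ip0l D kilE) expR0.
by rewrite /= charsum_exp_tens ?IH ?exprS //; exact: wtmod_tens_pow.
Qed.

Lemma wtmod_bigtens I (s : seq I) (M : I -> rep g) : (forall i, wtmod (M i)) ->
  wtmod (\big[@tens_rep _ g/trivial_rep 1]_(i <- s) M i).
Proof.
move=> wM; elim: s => [|i s IH]; first by rewrite big_nil; exact: wtmod_trivial.
by rewrite big_cons; exact: wtmod_tens.
Qed.

Lemma charsum_exp_bigtens I (s : seq I) (M : I -> rep g) y : (forall i, wtmod (M i)) ->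
  charsum (\big[@tens_rep _ g/trivial_rep 1]_(i <- s) M i) (fun b => expR (ip b y)) =
  \prod_(i <- s) charsum (M i) (fun b => expR (ip b y)).
Proof.
move=> wM; elim: s => [|i s IH].
  by rewrite !big_nil charsum_trivial mul1r (ip0l D kilE) expR0.
by rewrite !big_cons charsum_exp_tens ?IH //; exact: wtmod_bigtens.
Qed.

(** [irreducible_hw] does not say that [H] acts diagonalizably. The span of the weight vectors is a
    nonzero submodule, since root vectors shift weights, and irreducibility makes it everything. *)
Lemma singular_wtmod X lam v : irreducible_rep X -> sing (M := X) lam v -> wtmod X.
Proof.
move=> [_ irr] [v0 vw _].
pose wfree n := `[< exists t : seq 'cV[K]_(rdim X),
  [/\ free t, {in t, forall w, exists mu, wtv mu w} & size t = n] >].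
have ex : exists n, wfree n by exists 0%N; apply/asboolP; exists [::]; rewrite nil_free.
have bound n : wfree n -> (n <= rdim X)%N.
  move=> /asboolP[t [/eqP ft _ <-]]; rewrite -ft.
  by have := dimvS (subvf <<t>>%VS); rewrite dimvf /dim /= muln1.
have [n /asboolP[t [ft tw tn]] nmax] := ex_maxnP ex bound.
have wt w mu : wtv mu w -> w \in << t >>%VS.
  move=> ww; apply: contrapT => /negP wt; have := nmax n.+1; rewrite ltnn => nw; apply/notF/nw.
  apply/asboolP; exists (w :: t); split; rewrite /= ?tn //; first by rewrite free_cons wt.
  by move=> u; rewrite inE => /orP[/eqP ->|/tw//]; exists mu.
have gt : gstable (M := X) << t >>%VS.
  move=> x w wt'; rewrite (coord_span (X := in_tuple t) wt') mulmx_sumr; apply: memv_suml => i _.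
  rewrite -scalemxAr; apply: memvZ; set u := _`_i.
  have [mu um] : exists mu, wtv mu u by apply: tw; rewrite mem_nth.
  apply: (root_span D kilE) => [h hH|b y rb yb]; first by rewrite (um h hH) memvZ //; exact: wt um.
  exact: wt (wt_vec_root D yb um).
have [t0|tf] := irr _ gt; last exact: wtmod_span tf tw.
by case/eqP: v0; apply/eqP; rewrite -memv0 -t0; exact: wt vw.
Qed.

End WeightSums.

Section TraceForm.
Variables (K : fieldType) (g : lieAlgType K).
Hypothesis simp : simple_lie g.
Hypothesis nondeg : forall x : g, (forall y, killing x y = 0) -> x = 0.

(** The sum is the trace of the identity, written as a sum of rank-one maps. *)
Lemma reproducing_trace (s : seq (g * g)) : reproducing s ->
  \sum_(p <- s) killing p.1 p.2 = (\dim {:g})%:R.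
Proof.
move=> rs; pose e := vbasis {:g}.
have -> : (\dim {:g})%:R = \tr (\sum_(p <- s) ccol p.1 *m (\row_j killing e`_j p.2)).
  rewrite -[LHS]mxtrace1; congr (\tr _); apply/matrixP => i j.
  rewrite summxE; transitivity (ccol e`_j i 0).
    by rewrite [RHS]mxE coord_free ?(basis_free (vbasisP _)) // mxE eq_sym.
  rewrite -{1}(rs e`_j) mxE linear_sum; apply: eq_bigr => p _.
  by rewrite linearZ /= mxE big_ord1 !mxE mulrC.
rewrite raddf_sum; apply: eq_bigr => p _; rewrite /= mxtrace_mulC.
rewrite /mxtrace big_ord1 mxE -{1}(ccolK p.1) /ofcol killing_suml; apply: eq_bigr => i _.
by rewrite !mxE killingZl mulrC.
Qed.

(* The linear map representing the trace form with respect to the Killing form commutes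
   with the adjoint representation, so its eigenspaces are ideals. *)
Lemma trace_form_proportional (M : rep g) (s : seq (g * g)) : reproducing s ->
  (forall n (A : 'M[K]_n), (0 < n)%N -> exists c, eigenvalue A c) ->
  exists k, forall x y, \tr (M x *m M y) = k * killing x y.
Proof.
move=> rs eig; pose beta x y := \tr (M x *m M y).
have betaC x y : beta x y = beta y x by rewrite /beta mxtrace_mulC.
have betaDl c x y z : beta (c *: x + y) z = c * beta x z + beta y z.
  by rewrite /beta ract_linear mulmxDl -scalemxAl linearD linearZ.
have beta0 z : beta 0 z = 0 by rewrite /beta ract0 mul0mx raddf0.
have [[x0 [y0 xy0]] ideals] := simp.
pose T x := \sum_(p <- s) beta x p.2 *: p.1.
have TL c x y : T (c *: x + y) = c *: T x + T y.
  rewrite /T scaler_sumr -big_split; apply: eq_bigr => p _.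
  by rewrite betaDl scalerDl scalerA.
have TE x y : killing (T x) y = beta x y.
  rewrite /T killing_suml -[in RHS](reproducing_sym nondeg rs y) betaC.
  rewrite /beta ract_sum mulmx_suml raddf_sum; apply: eq_bigr => p _ /=.
  by rewrite killingZl ractZ -scalemxAl linearZ /= mulrC -/(beta p.2 x) betaC.
pose A := \matrix_(i < \dim {:g}) (ccol (T (vbasis {:g})`_i))^T.
have g0 : (0 < \dim {:g})%N.
  rewrite lt0n dimv_eq0; apply: contraNneq xy0 => gz.
  by rewrite -memv0 -gz memvf.
have [k /eigenvalueP[v /eqP vA v0]] := eig _ A g0.
pose z := ofcol v^T.
have Tz : T z = k *: z.
  apply: ccol_inj; rewrite ccolZ ofcolK; apply: (can_inj (@trmxK _ _ _)).
  have TL' : {morph T : x y / x + y} by move=> x y; have := TL 1 x y; rewrite !scale1r.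
  have T0 : T 0 = 0 by rewrite /T big1 // => p _; rewrite beta0 scale0r.
  have TZ c x : T (c *: x) = c *: T x by have := TL c x 0; rewrite T0 !addr0.
  have cT : {morph (@ccol K g) : x y / x + y} by move=> x y; rewrite ccolD.
  have c0 : ccol 0 = 0 :> 'cV[K]_(\dim {:g}) by rewrite -(scale0r (0 : g)) ccolZ scale0r.
  have -> : (ccol (T z))^T = v *m A.
    rewrite /z /ofcol (big_morph T TL' T0) (big_morph _ cT c0) linear_sum /= mulmx_sum_row.
    by apply: eq_bigr => i _; rewrite TZ ccolZ linearZ /= mxE rowK.
  by rewrite (eqP vA) linearZ /= trmxK.
have z0 : z != 0.
  apply: contra v0 => /eqP /(congr1 (@ccol K g)); rewrite ofcolK => vz.
  apply/eqP/(can_inj (@trmxK _ _ _)); rewrite vz trmx0.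
  by rewrite -(scale0r (0 : g)) ccolZ scale0r.
have [I IP] : exists I : {vspace g}, forall x, x \in I <-> forall y, beta x y = k * killing x y.
  apply: vspace_of_predicate; first by move=> y; rewrite beta0 killing0l mulr0.
  move=> c x y xk yk w; rewrite betaDl xk yk killingDl killingZl; ring.
have II x y : y \in I -> lie x y \in I.
  move=> /IP yI; apply/IP => w; rewrite lieC killingNl.
  have -> : beta (- lie y x) w = - beta (lie y x) w.
    by rewrite /beta ractN mulNmx linearN.
  by rewrite {1}/beta trace_form_inv -/(beta _ _) yI killing_inv mulrN.
exists k => x y; apply/IP: y => //; have [I0|->] := ideals I II; last exact: memvf.
by case/eqP: z0; apply/eqP; rewrite -memv0 -I0; apply/IP => w; rewrite -TE Tz killingZl.
Qed.

End TraceForm.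

Opaque charsum.

(** * Multiplicities and moments of weights *)

Section Multiplicities.
Variables (R : realType) (K : numFieldType) (g : lieAlgType K) (H : {vspace g}).
Variables (r : nat) (a : r.-tuple g) (iota : {rmorphism R -> K}) (rv : 'rV[R]_r -> g).
Hypothesis D : cartan_data H a iota rv.
Variable ip : 'rV[R]_r -> 'rV[R]_r -> R.
Hypothesis kilE : forall b c, killing (rv b) (rv c) = iota (ip b c).
Let simp := cd_simple D.
Let cart := cd_cartan D.
Let sroots := cd_roots D.
Local Notation al := (sroot R).
Local Notation cp := (cpair ip).
Local Notation ref := (refl ip).
Local Notation proots := (pos_roots_seq H rv).
Local Notation rho := (rho H rv).
Local Notation wtmod := (wtmod H rv).
Local Notation hwrep := (hwrep H rv).
Local Notation ws := (wseq ip).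
Local Notation Df := (Dop proots).
Local Notation indR := (@ind 'rV[R]_r R).
Local Notation charsum := (charsum H rv).
Local Notation strict := (strict ip).
Implicit Types F : 'rV[R]_r -> R.

Definition altsum F lam : R := \sum_(w <- ws) \det w * F (lam *m w).

(** Distinct strictly dominant points have disjoint orbits, on which the group acts freely; the
    indicator of [nu] therefore detects a single alternating sum. *)
Lemma altsum_ind lam nu : strict lam -> strict nu -> altsum (indR nu) lam = (lam == nu)%:R.
Proof.
move=> sl sn; rewrite /altsum; have [<-|ne] := eqVneq lam nu.
  have w1 : 1%:M \in ws by apply/(mem_wseq D kilE); exact: wgroup1.
  rewrite (bigD1_seq 1%:M) ?wseq_uniq //= mulmx1 /ind eqxx det1 mulr1 big_seq_cond.
  rewrite big1 ?addr0 // => w /andP[/(mem_wseq D kilE) ww w1'].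
  case: eqP => [e|_]; last by rewrite mulr0.
  by rewrite (strict_dom_stab D kilE sl ww e) eqxx in w1'.
rewrite big_seq big1 // => w /(mem_wseq D kilE) ww; rewrite /ind.
case: eqP => [e|_]; last by rewrite mulr0.
case/eqP: ne; rewrite -e; apply/esym/(dom_wgroup_eq D kilE) => //; first exact: strict_dom.
by rewrite e; exact: strict_dom.
Qed.

Lemma charsum_Dop X lam F : hwrep X lam -> charsum X (Df F) = altsum F (lam + rho).
Proof.
move=> hX; have [_ [P [mu Pmu]] _] := hX; apply: (fmorph_inj iota).
rewrite (charsumE D _ Pmu) /altsum !raddf_sum.
have := weyl_character D kilE hX Pmu (iota \o F); rewrite /= => E.
transitivity (\sum_i Df (iota \o F) (mu i)).
  by apply: eq_bigr => i _; rewrite Dop_morph.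
by rewrite E; apply: eq_bigr => w _; rewrite rmorphM.
Qed.

Definition dominant_int (lam : 'rV[R]_r) := forall i, exists k : nat, cp lam (al i) = k%:R.

Lemma dominant_int_dom lam : dominant_int lam -> dom ip lam.
Proof. by move=> dl i; rewrite -(cpair_ge0 D kilE); have [k ->] := dl i; rewrite ler0n. Qed.

Lemma strict_rhoD lam : dom ip lam -> strict (lam + rho).
Proof. by move=> dl i; rewrite (ipDl D kilE) ltr_wpDl ?dl ?(strict_rho D kilE). Qed.

Lemma hwrep_dominant_int X lam : hwrep X lam -> dominant_int lam.
Proof.
move=> [_ [P [mu Pmu]] [v vs]] i.
by have [k kE] := singular_dominant D kilE Pmu vs (sroot_pos D i); exists k.
Qed.

Definition hwreps (s : seq (rep g)) := all (fun X => `[< exists lam, hwrep X lam >]) s.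

Lemma hwreps_wtmod s : hwreps s -> wtmod (\big[@dsum_rep K g/trivial_rep 0]_(X <- s) X).
Proof.
elim: s => [|X s IH] /=; first by move=> _; rewrite big_nil; exact: (wtmod_trivial D).
move=> /andP[/asboolP[lam [_ wX _]] /IH ws']; rewrite big_cons.
exact: wtmod_dsum wX ws'.
Qed.

Lemma charsum_bigdsum s F : hwreps s ->
  charsum (\big[@dsum_rep K g/trivial_rep 0]_(X <- s) X) F = \sum_(X <- s) charsum X F.
Proof.
elim: s => [|X s IH] /=; first by move=> _; rewrite !big_nil (charsum_trivial D) mul0r.
move=> /andP[/asboolP[lam [_ wX _]] hs]; rewrite !big_cons (charsum_dsum D) ?IH //.
exact: hwreps_wtmod.
Qed.

Lemma irreducibles_hwreps s : all (fun X => `[< irreducible_rep X >]) s ->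
  wtmod (\big[@dsum_rep K g/trivial_rep 0]_(X <- s) X) -> hwreps s.
Proof.
elim: s => [//|X s IH] /= /andP[/asboolP iX is']; rewrite big_cons => wXs.
apply/andP; split; last exact: IH (wtmod_dsumr wXs).
apply/asboolP; exact: (hwrep_ex D iX (wtmod_dsuml wXs)).
Qed.

Definition hweight X := xget 0 [set lam | hwrep X lam].

Lemma hweightP X lam : hwrep X lam -> hwrep X (hweight X).
Proof. by move=> hX; apply: (xgetPex 0 (P := [set lam | hwrep X lam])); exists lam. Qed.

Lemma charsum_hwreps M s F : hwreps s ->
  rep_iso M (\big[@dsum_rep K g/trivial_rep 0]_(X <- s) X) ->
  charsum M (Df F) = \sum_(lam <- [seq hweight X | X <- s]) altsum F (lam + rho).
Proof.
move=> hs iso; rewrite (charsum_iso _ _ _ iso) charsum_bigdsum // big_map.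
elim: s hs {iso} => [|X s IH] /=; first by rewrite !big_nil.
by move=> /andP[/asboolP[lam hX] hs]; rewrite !big_cons IH // (charsum_Dop _ (hweightP hX)).
Qed.

Lemma hwreps_dominant_int s : hwreps s -> {in [seq hweight X | X <- s], forall lam, dominant_int lam}.
Proof.
elim: s => [//|X s IH] /= /andP[/asboolP[lam hX] /IH hs] nu; rewrite inE => /orP[/eqP ->|/hs//].
exact: hwrep_dominant_int (hweightP hX).
Qed.

(** The left side of the equality depends on the module alone, so the number of components with a
    given highest weight is the same in all decompositions. *)
Lemma count_hweight s M lam : hwreps s -> rep_iso M (\big[@dsum_rep K g/trivial_rep 0]_(X <- s) X) ->
  dominant_int lam -> charsum M (Df (indR (lam + rho))) = (count_mem lam [seq hweight X | X <- s])%:R.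
Proof.
move=> hs iso dl; rewrite (charsum_hwreps _ hs iso) -sum1_count natr_sum [RHS]big_mkcond /=.
rewrite big_seq [RHS]big_seq; apply: eq_bigr => nu /(hwreps_dominant_int hs) dn.
rewrite altsum_ind ?(inj_eq (addIr _)) /=; last 2 first.
  by apply/strict_rhoD/dominant_int_dom.
  by apply/strict_rhoD/dominant_int_dom.
by case: eqP.
Qed.

Section Decomposition.
Variable V : 'rV[R]_r -> rep g.
Hypothesis hV : forall lam, dominant_int lam -> hwrep (V lam) lam.

Lemma count_iso s lam : hwreps s -> dominant_int lam ->
  count (fun X => `[< rep_iso X (V lam) >]) s = count_mem lam [seq hweight X | X <- s].
Proof.
move=> hs dl; elim: s hs => [//|X s IH] /= /andP[/asboolP[nu hX] hs].
rewrite IH //; congr ((nat_of_bool _) + _)%N; have hw := hweightP hX.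
apply/asboolP/eqP => [iso|<-]; last by apply: (hwrep_iso D kilE hw); apply: hV; exact: hwrep_dominant_int hw.
have [irr wV _] := hV dl.
exact: (hwrep_uniq D kilE (hwrep_iso_hw iso hw wV irr) (hV dl)).
Qed.

(** [multiplicity] picks the count of some decomposition; by [count_hweight] it agrees with that of
    the one at hand. [L] lists the highest weights with repetition. *)
Lemma multiplicity_list M : wtmod M -> exists L : seq 'rV[R]_r,
  [/\ {in L, forall lam, dominant_int lam},
      forall lam, dominant_int lam -> multiplicity (V lam) M = count_mem lam L &
      forall F, charsum M (Df F) = \sum_(lam <- L) altsum F (lam + rho)].
Proof.
move=> wM; have [s [hs iso]] := complete_reducibility D kilE wM.
exists [seq hweight X | X <- s]; split.
- exact: hwreps_dominant_int.
- move=> lam dl.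
  have : is_multiplicity (V lam) M (multiplicity (V lam) M).
    apply: (xgetPex 0%N (P := [set k | is_multiplicity (V lam) M k])).
    exists (count (fun X => `[< rep_iso X (V lam) >]) s); exists s; split=> //.
    by apply: sub_all hs => X /asboolP[nu [irr _ _]]; apply/asboolP.
  move=> [s' [is' iso' <-]].
  have hs' : hwreps s' by apply: irreducibles_hwreps => //; exact: wtmod_iso iso' wM.
  rewrite (count_iso hs' dl); apply/eqP; rewrite -(eqr_nat R).
  by rewrite -(count_hweight hs' iso' dl) -(count_hweight hs iso dl).
- by move=> F; exact: charsum_hwreps.
Qed.

End Decomposition.

Lemma Dop_exp (s : seq 'rV[R]_r) x y : Dop s (fun b => expR (ip b y)) x =
  expR (ip x y) * \prod_(b <- s) (expR (2^-1 * ip b y) - expR (- (2^-1 * ip b y))).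
Proof.
elim: s x => [|b s IH] x; first by rewrite big_nil mulr1.
rewrite /= !IH big_cons !(ipDl D kilE) (ipNl D kilE) (ipZl D kilE) !expRD mulrBl.
by rewrite mulrBr -!mulrA.
Qed.

Definition weyl_prod y := \prod_(b <- proots) (expR (2^-1 * ip b y) - expR (- (2^-1 * ip b y))).

Lemma charsum_Dop_exp M y : wtmod M -> charsum M (Df (fun b => expR (ip b y))) =
  charsum M (fun b => expR (ip b y)) * weyl_prod y.
Proof.
move=> [P [mu Pmu]]; rewrite !(charsumE D _ Pmu) mulr_suml; apply: eq_bigr => i _.
exact: Dop_exp.
Qed.

Lemma weyl_prod_altsum y : weyl_prod y = altsum (fun b => expR (ip b y)) rho.
Proof.
have := Dop_exp proots 0 y; rewrite (ip0l D kilE) expR0 mul1r -/(weyl_prod y) => <-.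
apply: (fmorph_inj iota); rewrite -Dop_morph (weyl_denominator D kilE) /altsum raddf_sum.
by apply: eq_bigr => w _; rewrite /= add0r rmorphM.
Qed.

Section Moments.
Hypothesis eig : forall n (A : 'M[K]_n), (0 < n)%N -> exists c, eigenvalue A c.
Variables (X : rep g) (lam : 'rV[R]_r).
Hypothesis hX : hwrep X lam.
Let c := ip lam (lam + 2 *: rho).

Let nondeg : forall x : g, (forall y, killing x y = 0) -> x = 0.
Proof. exact: (killing_nondeg simp cart sroots). Qed.

Lemma hwrep_casimir : casimir_mx X = (iota c)%:M.
Proof. by rewrite casimir_mxE; exact: (hwrep_cas D kilE hX (vb_reproducing nondeg)). Qed.

Lemma charsum_trace y : iota (charsum X (fun b => ip b y ^+ 2)) = \tr (X (rv y) *m X (rv y)).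
Proof.
have [_ [P [mu Pmu]] _] := hX; have yH := rvec_in D y.
rewrite (charsumE D _ Pmu) raddf_sum (conj_act_trace Pmu); apply: eq_bigr => i _.
rewrite [RHS]mxE (bigD1 i) //= big1 ?addr0 => [|j ji].
  by rewrite !(conj_act_H Pmu) // eqxx !mul1r rmorphXn /= kilE.
by rewrite (conj_act_H Pmu) // eq_sym (negPf ji) !mul0r.
Qed.

(** The trace form of the module is [k] times the Killing form. Summing over a reproducing family
    gives [k] times the dimension of the Lie algebra on one side and the trace of the Casimir
    operator on the other. *)
Lemma weights_second_moment y :
  charsum X (fun b => ip b y ^+ 2) * (\dim {:g})%:R = c * ip y y * (rdim X)%:R.
Proof.
have rs := vb_reproducing nondeg.
have [k kE] := trace_form_proportional simp nondeg X rs eig.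
have kD : k * (\dim {:g})%:R = iota c * (rdim X)%:R.
  rewrite -(reproducing_trace rs) mulr_sumr.
  under eq_bigr do rewrite -kE.
  by rewrite -raddf_sum /= -/(cas X _) -casimir_mxE hwrep_casimir mxtrace_scalar mulr_natr.
apply: (fmorph_inj iota); rewrite !rmorphM /= charsum_trace kE kilE !rmorph_nat.
by rewrite mulrAC kD mulrAC.
Qed.

(** The sum of the weights is fixed by all simple reflections, hence orthogonal to all simple
    roots. *)
Lemma weights_first_moment y : charsum X (fun b => ip b y) = 0.
Proof.
have [_ [P [mu Pmu]] _] := hX; rewrite (charsumE D _ Pmu) -(ip_suml D kilE).
suff -> : \sum_i mu i = 0 by rewrite (ip0l D kilE).
apply: contrapT => /eqP s0; have := ip_gt0 D kilE s0.
have inv i : ref (al i) (\sum_j mu j) = \sum_j mu j.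
  have refM : {morph ref (al i) : x y / x + y} by exact: (reflD D kilE _).
  have ref0 : ref (al i) 0 = 0.
    by rewrite -(scale0r (0 : 'rV[R]_r)) (reflZ D kilE) !scale0r.
  rewrite (big_morph _ refM ref0); apply/rowP => k; rewrite !summxE.
  apply: (fmorph_inj iota); rewrite !raddf_sum.
  exact: (sum_weights_refl D kilE Pmu i (fun u => iota (u 0 k))).
have z i : ip (\sum_j mu j) (al i) = 0.
  have := inv i; rewrite reflE => /eqP; rewrite subr_eq addrC -subr_eq subrr eq_sym.
  rewrite scaler_eq0 (negPf (sroot_neq0 D i)) orbF cpairE => /eqP.
  have := ip_gt0 D kilE (sroot_neq0 D i); set q := ip (al i) (al i) => q0.
  move=> /eqP; rewrite mulf_eq0 invr_eq0 (gt_eqF q0) orbF mulf_eq0 pnatr_eq0 /=.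
  by move=> /eqP.
have -> : ip (\sum_j mu j) (\sum_j mu j) = 0.
  rewrite {2}(row_sum_delta (\sum_j mu j)) (ip_sumr D kilE) big1 // => i _.
  by rewrite (ipZr D kilE) z mulr0.
by rewrite ltxx.
Qed.

Lemma casimir_ge0 : 0 <= c.
Proof.
have dl := dominant_int_dom (hwrep_dominant_int hX).
rewrite /c (ipDr D kilE) (ipZr D kilE) addr_ge0 ?(ip_ge0 D kilE) // mulr_ge0 //.
apply: (ip_nonneg_sroots D kilE) => // i.
by rewrite mxE mulr_ge0 ?invr_ge0 // summxE big_seq sumr_ge0 // => b /(mem_proots D)[].
Qed.

Lemma casimir_gt0 : lam != 0 -> 0 < c.
Proof.
move=> l0; have dl := dominant_int_dom (hwrep_dominant_int hX).
rewrite /c (ipDr D kilE) (ipZr D kilE) ltr_wpDr ?(ip_gt0 D kilE) // mulr_ge0 //.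
apply: (ip_nonneg_sroots D kilE) => // i.
by rewrite mxE mulr_ge0 ?invr_ge0 // summxE big_seq sumr_ge0 // => b /(mem_proots D)[].
Qed.

End Moments.

End Multiplicities.

(** * Iterated integrals and Gaussian integrals *)

Section ProductMeasure.
Context d d' (T : measurableType d) (T' : measurableType d') (R : realType).
Variables (m1 : {sigma_finite_measure set T -> \bar R}) (m2 : {sigma_finite_measure set T' -> \bar R}).

Lemma sigma_finite_prod : sigma_finite setT (m1 \x m2)%E.
Proof.
have /sigma_finiteP[F [TF ndF Foo]] := sigma_finiteT m1.
have /sigma_finiteP[G [TG ndG Goo]] := sigma_finiteT m2.
exists (fun n => F n `*` G n) => [|k].
  rewrite -setXTT TF TG predeqE => -[x y]; split.
    move=> [/= [n _ Fnx] [k _ Gky]]; exists (maxn n k) => //; split.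
    - by move: x Fnx; exact/subsetPset/ndF/leq_maxl.
    - by move: y Gky; exact/subsetPset/ndG/leq_maxr.
  by move=> [n _ []/= ? ?]; split; exists n.
have [? ?] := Foo k; have [? ?] := Goo k; split; first exact: measurableX.
by rewrite product_measure1E // lte_mul_pinfty // ge0_fin_numE.
Qed.

Definition prod_measure : {sigma_finite_measure set (T * T')%type -> \bar R} :=
  HB.pack_for {sigma_finite_measure set (T * T')%type -> \bar R} (m1 \x m2)%E
    (Measure_isSigmaFinite.Build _ _ _ (m1 \x m2)%E sigma_finite_prod).

End ProductMeasure.

Section IteratedLebesgue.
Variable R : realType.

(** The iterated product of lines that matches [integral_rV]. A dependent pair is used because the
    display of a product changes with [r]. *)
Fixpoint Rn (r : nat) : {d & measurableType d} :=
  if r is r'.+1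
  then existT (fun d => measurableType d) _ (measurableTypeR R * projT2 (Rn r'))%type
  else existT (fun d => measurableType d) _ unit.

Fixpoint mur (r : nat) : {sigma_finite_measure set (projT2 (Rn r)) -> \bar R} :=
  match r return {sigma_finite_measure set (projT2 (Rn r)) -> \bar R} with
  | 0 => @dirac _ unit tt R
  | r'.+1 => prod_measure (@lebesgue_measure R) (mur r')
  end.

Fixpoint vec (r : nat) : projT2 (Rn r) -> 'rV[R]_r :=
  match r return projT2 (Rn r) -> 'rV[R]_r with
  | 0 => fun=> 0
  | r'.+1 => fun p => row_mx (p.1%:M : 'M[R]_1) (vec p.2)
  end.

Lemma row_mx0E r (x : R) (b : 'rV[R]_r) : row_mx (x%:M : 'M[R]_1) b 0 ord0 = x.
Proof.
rewrite (_ : ord0 = lshift r (ord0 : 'I_1)); last exact: val_inj.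
by rewrite row_mxEl mxE eqxx.
Qed.

Lemma row_mxSE r (x : R) (b : 'rV[R]_r) i : row_mx (x%:M : 'M[R]_1) b 0 (lift ord0 i) = b 0 i.
Proof.
rewrite (_ : lift ord0 i = rshift 1 i); last exact: val_inj.
by rewrite row_mxEr.
Qed.

Lemma measurable_vec r i : measurable_fun setT (fun p : projT2 (Rn r) => vec p 0 i).
Proof.
elim: r i => [[]//|r IH] i; case: (unliftP ord0 i) => [j ->|->].
  rewrite (_ : (fun _ => _) = (fun q : projT2 (Rn r) => vec q 0 j) \o snd); last first.
    by apply/funext => p; rewrite /= row_mxSE.
  by apply: measurableT_comp => //; exact: IH.
rewrite (_ : (fun _ => _) = fst); last by apply/funext => p; rewrite /= row_mx0E.
exact: measurable_fst.
Qed.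

Definition rmeas r (f : 'rV[R]_r -> \bar R) :=
  measurable_fun [set: projT2 (Rn r)] (fun p => f (vec p)).

Lemma rmeas_section r (f : 'rV[R]_r.+1 -> \bar R) x : rmeas f ->
  rmeas (fun b : 'rV[R]_r => f (row_mx x%:M b)).
Proof.
move=> mf; rewrite /rmeas.
have mx : measurable_fun setT (fun q : projT2 (Rn r) => (x : measurableTypeR R, q)).
  exact: measurable_pair1.
exact: measurableT_comp mf mx.
Qed.

Local Open Scope ereal_scope.

Lemma integral_murS r (f : 'rV[R]_r.+1 -> \bar R) : rmeas f -> (forall b, 0 <= f b) ->
  \int[mur r.+1]_p f (vec p) = \int[lebesgue_measure]_x \int[mur r]_q f (row_mx x%:M (vec q)).
Proof. by move=> mf f0; exact: (@fubini_tonelli1 _ _ _ _ _ (@lebesgue_measure R) (mur r) (fun p => f (@vec r.+1 p)) mf (fun p => f0 _)). Qed.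

Lemma integral_murS_swap r (f : 'rV[R]_r.+1 -> \bar R) : rmeas f -> (forall b, 0 <= f b) ->
  \int[mur r.+1]_p f (vec p) = \int[mur r]_q \int[lebesgue_measure]_x f (row_mx x%:M (vec q)).
Proof. by move=> mf f0; exact: (@fubini_tonelli2 _ _ _ _ _ (@lebesgue_measure R) (mur r) (fun p => f (@vec r.+1 p)) mf (fun p => f0 _)). Qed.

(** The iterated integral evaluates inner integrals at every [x], so identifying it with the product
    integral by induction asks for integrability of all sections, not of almost all. *)
Fixpoint sections_integrable (r : nat) : ('rV[R]_r -> \bar R) -> Prop :=
  match r return ('rV[R]_r -> \bar R) -> Prop with
  | 0 => fun f => (mur 0).-integrable setT (f \o @vec 0)
  | r'.+1 => fun f => (mur r'.+1).-integrable setT (f \o @vec r'.+1) /\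
      forall x, sections_integrable (fun b : 'rV[R]_r' => f (row_mx x%:M b))
  end.

Lemma sections_integrable_int r (f : 'rV[R]_r -> \bar R) : sections_integrable f ->
  (mur r).-integrable setT (f \o @vec r).
Proof. by case: r f => [|r] f // []. Qed.

Lemma integral_rV_mur r (f : 'rV[R]_r -> \bar R) : sections_integrable f ->
  integral_rV f = \int[mur r]_p f (vec p).
Proof.
elim: r f => [|r IH] f /= intf.
  by rewrite integral_dirac //= ?diracT ?mul1e //; case/integrableP: intf.
have [intf1 sec] := intf.
rewrite -[RHS](integral12_prod_meas1 (m2 := mur r) intf1); apply: eq_integral => x _.
by rewrite IH.
Qed.

Lemma sections_integrable_le r (f g : 'rV[R]_r -> \bar R) : rmeas f ->
  (forall b, `|f b| <= g b) -> sections_integrable g -> sections_integrable f.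
Proof.
elim: r f g => [|r IH] f g mf fg /=.
  by move=> ig; apply: le_integrable ig => // p _ /=; rewrite (le_trans (fg _)) // lee_abs.
move=> [ig sec]; split; last first.
  by move=> x; apply: (IH _ (fun b => g (row_mx x%:M b))) => //; exact: rmeas_section.
by apply: le_integrable ig => // p _ /=; rewrite (le_trans (fg _)) // lee_abs.
Qed.

Lemma sections_integrableD r (f g : 'rV[R]_r -> \bar R) :
  sections_integrable f -> sections_integrable g -> sections_integrable (fun b => f b + g b).
Proof.
elim: r f g => [|r IH] f g /=; first by move=> fi gi; exact: integrableD.
move=> [fi fs] [gi gs]; split; first exact: integrableD.
by move=> x; exact: IH.
Qed.

Lemma sections_integrableZ r (c : R) (f : 'rV[R]_r -> \bar R) :
  sections_integrable f -> sections_integrable (fun b => c%:E * f b).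
Proof.
elim: r f => [|r IH] f /=; first by move=> fi; exact: integrableZl.
move=> [fi fs]; split; first exact: integrableZl.
by move=> x; exact: IH.
Qed.

Lemma lebesgue_reflection (c : R) (A : set R) : measurable A ->
  pushforward lebesgue_measure ((fun x => c - x)%R : measurableTypeR R -> measurableTypeR R) A =
  lebesgue_measure A.
Proof.
pose phi0 : measurableTypeR R -> measurableTypeR R := fun x => (c - x)%R.
have mc : measurable_fun setT phi0 by apply: measurable_funB => //; exact: measurable_id.
pose mix := isMeasurableFun.Build _ _ _ _ phi0 mc.
pose phi : {mfun _ >-> _} := HB.pack phi0 mix.
move=> mA; apply/esym. apply: (lebesgue_measure_unique (mu := pushforward lebesgue_measure phi)) => //= _ [[a b]] _ <-.
rewrite /pushforward /= (_ : _ @^-1` _ = [set` `[c - b, c - a[%R]); last first.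
  by apply/seteqP; split => x; rewrite /phi0 /= !in_itv /= => /andP[? ?]; apply/andP; split; lra.
rewrite !lebesgue_measure_itv /= !lte_fin ltrD2l ltrN2; case: ifP => // _.
by rewrite -!EFinB; congr EFin; lra.
Qed.

Lemma integral_reflection (c : R) (f : R -> \bar R) : measurable_fun setT f -> (forall x, 0 <= f x) ->
  \int[lebesgue_measure]_x f (c - x)%R = \int[lebesgue_measure]_x f x.
Proof.
move=> mf f0.
have mc : measurable_fun setT ((fun x => c - x)%R : measurableTypeR R -> measurableTypeR R).
  by apply: measurable_funB => //; exact: measurable_id.
have := @ge0_integral_pushforward _ _ _ _ _ _ mc lebesgue_measure setT f measurableT mf (fun x _ => f0 x).
rewrite preimage_setT => <-.
by apply: eq_measure_integral => A mA _; exact: lebesgue_reflection.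
Qed.

End IteratedLebesgue.

Section CoordinateReflection.
Variable R : realType.
Local Open Scope ereal_scope.

(* Reflection of the coordinate [i] in a point that depends on the other coordinates. *)
Definition coord_refl r (i : 'I_r) (c : 'rV[R]_r -> R) (b : 'rV[R]_r) : 'rV[R]_r :=
  (b + (c b - 2 * b 0%R i) *: delta_mx 0%R i)%R.

Lemma addZ_deltaE r (b : 'rV[R]_r) t (i k : 'I_r) :
  (b + t *: delta_mx 0 i)%R 0%R k = (b 0%R k + t * (k == i)%:R)%R.
Proof. by rewrite !mxE eqxx. Qed.

(** The inverse of [vec] carries [phi] back to the product space, where measurability can be checked
    coordinate by coordinate. *)
Lemma rmeas_coords r s (phi : 'rV[R]_r -> 'rV[R]_s) (f : 'rV[R]_s -> \bar R) :
  (forall i, measurable_fun [set: projT2 (Rn R r)] (fun p => phi (vec p) 0%R i)) ->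
  rmeas f -> rmeas (f \o phi).
Proof.
move=> mphi mf.
pose inv := fix inv s : 'rV[R]_s -> projT2 (Rn R s) :=
  match s return 'rV[R]_s -> projT2 (Rn R s) with
  | 0%N => fun=> tt
  | s'.+1 => fun b => (b 0%R ord0, inv s' (\row_j b 0%R (lift ord0 j)))
  end.
have invK t (b : 'rV[R]_t) : vec (inv t b) = b.
  elim: t b => [|t IH] b; apply/rowP; first by case.
  move=> i; case: (unliftP ord0 i) => [j ->|->] /=; first by rewrite row_mxSE IH mxE.
  by rewrite row_mx0E.
have minv t (psi : projT2 (Rn R r) -> 'rV[R]_t) :
    (forall i, measurable_fun setT (fun p => psi p 0%R i)) ->
    measurable_fun setT (fun p => inv t (psi p)).
  elim: t psi => [|t IH] psi mpsi /=; first exact: measurable_cst.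
  apply/measurable_fun_pairP; split; first exact: mpsi.
  apply: IH => i; rewrite (_ : (fun p => _) = (fun p => psi p 0%R (lift ord0 i))) //.
  by apply/funext => p; rewrite mxE.
have := measurableT_comp mf (minv _ (fun p => phi (vec p)) mphi).
by apply: eq_measurable_fun => p _ /=; rewrite invK.
Qed.

(** If the first coordinate moves, Tonelli lets it be integrated first with the others fixed, and
    the one-dimensional reflection applies; for a later coordinate the induction hypothesis is used
    inside the outer integral. *)
Lemma integral_coord_refl r (i : 'I_r) (c : 'rV[R]_r -> R) (f : 'rV[R]_r -> \bar R) :
  (forall b t, c (b + t *: delta_mx 0 i)%R = c b) ->
  measurable_fun [set: projT2 (Rn R r)] (fun p => c (vec p)) ->
  rmeas f -> (forall b, 0 <= f b) ->
  \int[mur R r]_p f (coord_refl i c (vec p)) = \int[mur R r]_p f (vec p).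
Proof.
elim: r i c f => [[]//|r IH] i c f cE mc mf f0.
have mr : rmeas (f \o coord_refl i c).
  apply: rmeas_coords => // j.
  rewrite (_ : (fun p => _) = (fun p => vec p 0 j + (c (vec p) - 2 * vec p 0 i) * (j == i)%:R)%R); last first.
    by apply/funext => p; rewrite [LHS]addZ_deltaE.
  apply: measurable_funD; first exact: measurable_vec.
  apply: measurable_funM; last exact: measurable_cst.
  apply: measurable_funB => //; apply: measurable_funM; first exact: measurable_cst.
  exact: measurable_vec.
case: (unliftP ord0 i) => [j ij|i0].
  apply: etrans (integral_murS mr (fun b => f0 _)) _.
  apply: etrans _ (esym (integral_murS mf f0)); apply: eq_integral => x _ /=.
  rewrite -(IH j (fun b => c (row_mx x%:M b)) (fun b => f (row_mx x%:M b))) //.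
  - apply: eq_integral => q _; congr f; apply/rowP => k; rewrite [LHS]addZ_deltaE.
    case: (unliftP ord0 k) => [l ->|->].
      by rewrite !row_mxSE [RHS]addZ_deltaE ij row_mxSE (inj_eq lift_inj).
    by rewrite !row_mx0E ij (_ : (ord0 == lift ord0 j) = false) ?mulr0 ?addr0.
  - move=> b t; rewrite -[RHS](cE _ t); congr c; apply/rowP => k; rewrite [RHS]addZ_deltaE.
    case: (unliftP ord0 k) => [l ->|->].
      by rewrite !row_mxSE [LHS]addZ_deltaE ij (inj_eq lift_inj).
    by rewrite !row_mx0E ij (_ : (ord0 == lift ord0 j) = false) ?mulr0 ?addr0.
  - have mx : measurable_fun setT (fun q : projT2 (Rn R r) => (x : measurableTypeR R, q)).
      exact: measurable_pair1.
    exact: measurableT_comp mc mx.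
  - exact: rmeas_section.
apply: etrans (integral_murS_swap mr (fun b => f0 _)) _.
apply: etrans _ (esym (integral_murS_swap mf f0)); apply: eq_integral => q _ /=.
pose f1 (x : R) := f (row_mx x%:M (vec q)).
have mf1 : measurable_fun setT f1.
  have mx : measurable_fun setT (fun x : measurableTypeR R => (x, q)) by exact: measurable_pair2.
  exact: measurableT_comp mf mx.
rewrite -[RHS](integral_reflection (c (row_mx 0%R%:M (vec q))) mf1 (fun x => f0 _)).
apply: eq_integral => x _; rewrite /f1; congr f; apply/rowP => k.
rewrite [LHS]addZ_deltaE.
have -> : c (row_mx x%:M (vec q)) = c (row_mx 0%:M (vec q)).
  rewrite -[RHS](cE _ x); congr c; apply/rowP => l; rewrite [RHS]addZ_deltaE.
  case: (unliftP ord0 l) => [m ->|->].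
    by rewrite !row_mxSE i0 (_ : (lift ord0 m == ord0) = false) ?mulr0 ?addr0.
  by rewrite !row_mx0E i0 eqxx mulr1 add0r.
case: (unliftP ord0 k) => [l ->|->].
  by rewrite !row_mxSE i0 (_ : (lift ord0 l == ord0) = false) ?mulr0 ?addr0.
rewrite i0 !row_mx0E eqxx mulr1.
lra.
Qed.

Lemma integral_coord_refl_any r (i : 'I_r) (c : 'rV[R]_r -> R) (f : 'rV[R]_r -> \bar R) :
  (forall b t, c (b + t *: delta_mx 0 i)%R = c b) ->
  measurable_fun [set: projT2 (Rn R r)] (fun p => c (vec p)) -> rmeas f ->
  \int[mur R r]_p f (coord_refl i c (vec p)) = \int[mur R r]_p f (vec p).
Proof.
move=> cE mc mf; rewrite integralE [RHS]integralE.
have mp : rmeas (f^\+)%E.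
  by apply: eq_measurable_fun (measurable_funepos mf) => p _; rewrite !funeposE.
have mn : rmeas (f^\-)%E.
  by apply: eq_measurable_fun (measurable_funeneg mf) => p _; rewrite !funenegE.
congr (_ - _).
  apply: etrans (etrans _ (integral_coord_refl cE mc mp (fun b => funepos_ge0 f b))) _;
  by apply: eq_integral => p _; rewrite !funeposE.
apply: etrans (etrans _ (integral_coord_refl cE mc mn (fun b => funeneg_ge0 f b))) _;
by apply: eq_integral => p _; rewrite !funenegE.
Qed.

End CoordinateReflection.

(** * Gaussian integrals *)

Section GaussianIntegral.
Variable R : realType.

Definition qform r (B : 'M[R]_r) (s b : 'rV[R]_r) : R := (s *m B *m b^T) 0 0.

Lemma qformDl r (B : 'M[R]_r) s t b : qform B (s + t) b = qform B s b + qform B t b.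
Proof. by rewrite /qform !mulmxDl mxE. Qed.
Lemma qformZl r (B : 'M[R]_r) x s b : qform B (x *: s) b = x * qform B s b.
Proof. by rewrite /qform -!scalemxAl mxE. Qed.
Lemma qformC r (B : 'M[R]_r) s b : B^T = B -> qform B s b = qform B b s.
Proof.
move=> Bs; transitivity ((s *m B *m b^T)^T 0 0); first by rewrite [RHS]mxE.
by rewrite !trmx_mul trmxK Bs mulmxA.
Qed.
Lemma qformDr r (B : 'M[R]_r) s t b : B^T = B -> qform B b (s + t) = qform B b s + qform B b t.
Proof. by move=> Bs; rewrite !(qformC b) // qformDl. Qed.
Lemma qformZr r (B : 'M[R]_r) x s b : B^T = B -> qform B b (x *: s) = x * qform B b s.
Proof. by move=> Bs; rewrite !(qformC b) // qformZl. Qed.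

Definition posdef r (B : 'M[R]_r) := B^T = B /\ forall b, b != 0 -> 0 < qform B b b.

Lemma measurable_gauss_1d (S m : R) :
  measurable_fun setT (fun x : R => (expR (- (S * (x - m) ^+ 2 / 2)))%:E).
Proof.
apply/measurable_EFinP; apply: measurableT_comp => //; apply: measurableT_comp => //.
apply: measurable_funM => //; apply: measurable_funM => //; apply: measurable_funX.
exact: measurable_funB.
Qed.

Lemma integral_gauss_1d (S m : R) : 0 < S ->
  (\int[lebesgue_measure]_x (expR (- (S * (x - m) ^+ 2 / 2)))%:E = (Num.sqrt (2 * pi / S))%:E)%E.
Proof.
move=> S0; pose sg : R := Num.sqrt S^-1.
have sg2 : sg ^+ 2 = S^-1 by rewrite sqr_sqrtr // invr_ge0 ltW.
have sg0 : sg != 0 by rewrite gt_eqF // sqrtr_gt0 invr_gt0.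
rewrite -[RHS](_ : ((normal_peak sg)^-1)%:E = _); last first.
  by rewrite /normal_peak invrK sg2; congr (Num.sqrt _)%:E; rewrite mulrC -mulr_natl mulrA.
set I := (LHS).
have k0 : 0 < normal_peak sg := normal_peak_gt0 sg0.
have : ((normal_peak sg)%:E * I = 1)%E.
  rewrite -(integral_normal_pdf m sg) /normal_pdf (negPf sg0) -ge0_integralZl_EFin ?ltW //; last first.
    exact: measurable_gauss_1d.
  apply: eq_integral => x _; rewrite -EFinM /normal_fun; congr (_ * expR _)%:E.
  by rewrite sg2; field; lra.
move=> kI; rewrite -[I]mul1e -(mulVf (lt0r_neq0 k0)) EFinM -muleA kI mule1.
by [].
Qed.

Lemma mx11Z (x : R) (A : 'M[R]_1) : (x *: A) 0 0 = x * A 0 0.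
Proof. by rewrite mxE. Qed.

Lemma qform_block r (x11 : R) (c : 'rV[R]_r) (B : 'M[R]_r) x y (b e : 'rV[R]_r) :
  qform (block_mx x11%:M c c^T B : 'M[R]_(1 + r)) (row_mx x%:M b) (row_mx y%:M e) =
  x * y * x11 + y * (c *m b^T) 0 0 + x * (c *m e^T) 0 0 + qform B b e.
Proof.
rewrite /qform mul_row_block tr_row_mx mul_row_col tr_scalar_mx !mulmxDl !mul_scalar_mx.
rewrite -!scalemxAl !mul_mx_scalar [LHS]mxE [X in X + _]mxE [X in _ + X]mxE.
have -> : (b *m c^T) = (c *m b^T)^T by rewrite trmx_mul trmxK.
rewrite !mx11Z [(_^T) 0 0]mxE [x11%:M 0 0]mxE eqxx mulr1n; ring.
Qed.

Lemma posdef_block r (B : 'M[R]_(1 + r)) : posdef B -> exists x11 (c : 'rV[R]_r) (B' : 'M[R]_r),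
  B = block_mx x11%:M c c^T B' /\ posdef B'.
Proof.
move=> [Bs Bp]; exists (B 0 0), (ursubmx B), (drsubmx B).
have BE : B = block_mx (B 0 0)%:M (ursubmx B) (ursubmx B)^T (drsubmx B).
  rewrite -[LHS]submxK; congr block_mx; last by rewrite -[LHS]trmxK trmx_dlsub Bs.
  by apply/matrixP => i j; rewrite !ord1 !mxE eqxx; congr (B _ _); apply: val_inj.
split=> //; split; first by rewrite trmx_drsub Bs.
move=> b b0; have := Bp (row_mx (0%:M : 'M[R]_1) b) _; rewrite {1}BE qform_block.
rewrite !mul0r !add0r; apply.
apply: contraNneq b0 => /(congr1 rsubmx); rewrite row_mxKr => ->.
by apply/eqP/rowP => i; rewrite !mxE.
Qed.

Lemma rmeas_qexp r (B : 'M[R]_r) s :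
  rmeas (fun b => (expR (qform B s b - qform B b b / 2))%:E).
Proof.
have mq (s' : projT2 (Rn R r) -> 'rV[R]_r) : (forall i, measurable_fun setT (fun p => s' p 0 i)) ->
    measurable_fun setT (fun p => qform B (s' p) (vec p)).
  move=> ms; rewrite (_ : (fun p => _) = (fun p => \sum_i (\sum_j s' p 0 j * B j i) * vec p 0 i)); last first.
    by apply/funext => p; rewrite /qform mxE; apply: eq_bigr => i _; rewrite !mxE.
  apply: measurable_sum => i; apply: measurable_funM; last exact: measurable_vec.
  by apply: measurable_sum => j; apply: measurable_funM => //; exact: measurable_cst.
apply/measurable_EFinP; apply: measurableT_comp => //; apply: measurable_funB.
  by apply: mq => i; exact: measurable_cst.
apply: measurable_funM; last exact: measurable_cst.
by apply: mq => i; exact: measurable_vec.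
Qed.

(** Induction by Schur complement. With the first coordinate [x] fixed, the others carry a Gaussian
    for [B'] with parameter [s' + (s1 - x) d]; its value leaves a Gaussian in [x] with mean [s1] and
    precision [S], and [det B = S det B']. Positivity of the determinant is carried along because it
    makes [B'] invertible. *)
Lemma integral_gauss r (B : 'M[R]_r) s : posdef B -> 0 < \det B /\
  (\int[mur R r]_p (expR (qform B s (vec p) - qform B (vec p) (vec p) / 2))%:E =
   (Num.sqrt ((2 * pi) ^+ r / \det B) * expR (qform B s s / 2))%:E)%E.
Proof.
elim: r B s => [|r IH] B s Bp.
  split; first by rewrite det_mx00.
  have q0 (t b : 'rV[R]_0) : qform B t b = 0 by rewrite /qform mxE big_ord0.
  rewrite integral_dirac // diracT mul1e !q0 det_mx00 expr0 invr1 mulr1 sqrtr1 mul1r.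
  by rewrite mul0r subrr.
have [x11 [c [B' [BE Bp']]]] := posdef_block Bp.
have [dB' _] := IH B' 0 Bp'; have [Bs' _] := Bp'.
have uB' : B' \in unitmx by rewrite unitmxE unitfE gt_eqF.
pose d := c *m invmx B'; have dB : d *m B' = c by rewrite mulmxKV.
have qd b : qform B' d b = (c *m b^T) 0 0 by rewrite /qform dB.
pose S := x11 - (c *m d^T) 0 0.
have S0 : 0 < S.
  (* [S] is the value of the quadratic form at [(1, - d)]. *)
  have [_ Bpp] := Bp; have nz : row_mx (1%:M : 'M[R]_1) (- d) != 0.
    by apply/eqP => /rowP/(_ ord0); rewrite row_mx0E mxE => /eqP; rewrite oner_eq0.
  have := Bpp _ nz; rewrite {1}BE qform_block -[- d]scaleN1r qformZl qformZr // qd.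
  by rewrite linearZ /= -!scalemxAr !mx11Z /S; lra.
have detB : \det B = S * \det B'.
  have -> : B = block_mx 1%:M d 0 1%:M *m (block_mx S%:M 0 c^T B' : 'M[R]_(1 + r)).
    have e : S%:M + d *m c^T = x11%:M :> 'M[R]_1.
      apply/matrixP => i j; rewrite !ord1 [LHS]mxE [X in X + _]mxE [RHS]mxE eqxx !mulr1n.
      have -> : (d *m c^T) 0 0 = (c *m d^T) 0 0.
        by rewrite -[c in RHS]trmxK -trmx_mul [RHS]mxE.
      by rewrite subrK.
    by rewrite mulmx_block !mul1mx !mul0mx !add0r dB e.
  have := det_mulmx (block_mx 1%:M d 0 1%:M : 'M[R]_(1 + r)) (block_mx S%:M 0 c^T B').
  by rewrite (@det_ublock _ 1 r) (@det_lblock _ 1 r) !det1 !mul1r det_scalar1.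
split; first by rewrite detB mulr_gt0.
have f0 b : (0 <= (expR (qform B s b - qform B b b / 2))%:E)%E by rewrite lee_fin expR_ge0.
apply: etrans (integral_murS (rmeas_qexp B s) f0) _.
have [s1 [s' sE]] : exists s1 (s' : 'rV[R]_r), s = row_mx (s1%:M : 'M[R]_1) s'.
  exists (s 0 ord0), (\row_j s 0 (lift ord0 j)); apply/rowP => i.
  by case: (unliftP ord0 i) => [j ->|->]; rewrite ?row_mxSE ?row_mx0E ?mxE.
transitivity (\int[lebesgue_measure]_x ((Num.sqrt ((2 * pi) ^+ r / \det B') * expR (qform B s s / 2)) *
    expR (- (S * (x - s1) ^+ 2 / 2)))%:E)%E.
  apply: eq_integral => x _.
  pose k := s1 * x * x11 + x * (c *m s'^T) 0 0 - x * x * x11 / 2.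
  transitivity (\int[mur R r]_q ((expR k)%:E *
      (expR (qform B' (s' + (s1 - x) *: d) (vec q) - qform B' (vec q) (vec q) / 2))%:E))%E.
    apply: eq_integral => q _; rewrite -EFinM -expRD; congr (expR _)%:E.
    rewrite sE BE !qform_block qformDl qformZl qd /k {k}.
    move: (x : R) (qform B' s' _) ((c *m _) 0 0) (qform B' (vec q) _) ((c *m _) 0 0) => y t1 t2 t3 t4.
    by field.
  rewrite ge0_integralZl_EFin //; last by [exact: expR_ge0|exact: rmeas_qexp|move=> ? _; rewrite lee_fin expR_ge0].
  have [_ ->] := IH B' (s' + (s1 - x) *: d) Bp'; rewrite -EFinM; congr (_%:E).
  rewrite mulrCA -[RHS]mulrA; congr (_ * _); rewrite -!expRD; congr expR.
  rewrite sE BE qform_block !qformDl !qformDr // !qformZl !qformZr // !qd (qformC s' d Bs') qd /k /S {k}.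
  move: (x : R) (qform B' s' s') ((c *m s'^T) 0 0) ((c *m d^T) 0 0) => y t1 t2 t3.
  by field.
under eq_integral do rewrite EFinM.
rewrite ge0_integralZl_EFin ?mulr_ge0 ?expR_ge0 ?sqrtr_ge0 //; last exact: measurable_gauss_1d.
rewrite integral_gauss_1d // -EFinM; congr (_%:E).
rewrite mulrAC; congr (_ * _); rewrite -sqrtrM; last first.
  by rewrite divr_ge0 ?exprn_ge0 ?mulr_ge0 ?pi_ge0 // ltW.
congr Num.sqrt; rewrite detB exprS; field.
by rewrite !gt_eqF.
Qed.

End GaussianIntegral.

(** * Convergence from exponential moments *)

Section ScalarAnalysis.
Variable R : realType.
Implicit Types (x y z : R) (u v : R^nat).

Lemma series_exp_coeff_le z n : 0 <= z -> series (exp_coeff z) n <= expR z.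
Proof.
move=> z0; apply: nondecreasing_cvgn_le; last exact: is_cvg_series_exp_coeff.
by apply: nondecreasing_series => k _ _; exact: exp_coeff_ge0.
Qed.

(** A crude remainder bound, dominating the tail by an exponential series; in the Taylor estimates
    drawn from it only the order and an exponential growth matter. *)
Lemma series_tail_le u (l C z : R) n : 0 <= C -> 0 <= z ->
  (forall k, `|u (n + k)%N| <= C * exp_coeff z k) ->
  series u m @[m --> \oo] --> l -> `|l - series u n| <= C * expR z.
Proof.
move=> C0 z0 uC ul.
have tail m : `|series u (n + m)%N - series u n| <= C * expR z.
  have -> : series u (n + m)%N - series u n = \sum_(0 <= k < m) u (n + k)%N.
    rewrite /series /= (big_cat_nat (leq0n n) (leq_addr m n)) /= addrAC subrr add0r.
    by rewrite -{1}(add0n n) big_addn addnC addnK; apply: eq_big_nat => k _; rewrite addnC.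
  apply: le_trans (ler_norm_sum _ _ _) _.
  apply: le_trans (ler_sum _ (fun k _ => uC k)) _.
  by rewrite -mulr_sumr ler_wpM2l // (series_exp_coeff_le m).
have : (fun m => `|series u (m + n)%N - series u n|) @ \oo --> `|l - series u n|.
  apply: cvg_norm; apply: cvgB; last exact: cvg_cst.
  by rewrite (cvg_shiftn n (series u)).
move=> c; apply: (cvgr_to_le c); near=> m.
by rewrite addnC tail.
Unshelve. all: by end_near.
Qed.

Lemma exp_taylor x n : `|expR x - series (exp_coeff x) n| <= `|x| ^+ n * expR `|x|.
Proof.
apply: (series_tail_le (exprn_ge0 _ (normr_ge0 _)) (normr_ge0 _)).
  move=> k; rewrite /exp_coeff /= normrM normrX exprD normfV (ger0_norm (ler0n _ _)) -mulrA.
  rewrite ler_wpM2l ?exprn_ge0 // ler_wpM2l ?exprn_ge0 // lef_pV2 ?posrE ?ltr0n ?fact_gt0 //.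
  by rewrite ler_nat leq_fact // leq_addl.
exact: is_cvg_series_exp_coeff.
Qed.

Lemma exp_taylor2 x : `|expR x - 1 - x| <= x ^+ 2 * expR `|x|.
Proof.
have := exp_taylor x 2; rewrite /series /= big_nat_recr //= big_nat1 /exp_coeff /= expr0 divr1 expr1 divr1.
by rewrite opprD addrA real_normK ?num_real.
Qed.

Lemma exp_taylor3 x : `|expR x - 1 - x - x ^+ 2 / 2| <= `|x| ^+ 3 * expR `|x|.
Proof.
have := exp_taylor x 3; rewrite /series /= !big_nat_recr //= big_geq // add0r /exp_coeff /= expr0 divr1 expr1 divr1.
by rewrite !opprD !addrA.
Qed.

Lemma expR_cosh_le x : expR `|x| <= expR x + expR (- x).
Proof.
by case: (ger0P x) => _; rewrite ?lerDl ?lerDr expR_ge0.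
Qed.

Lemma sqr_le_expR x : x ^+ 2 <= 2 * expR `|x|.
Proof.
have := series_exp_coeff_le 3 (normr_ge0 x); rewrite /series /= !big_nat_recr //= big_geq // add0r.
rewrite /exp_coeff /= expr0 expr1 !divr1 -(real_normK (num_real x)) (_ : 2`!%:R = 2) //.
have := normr_ge0 x; set t := `|x|; nra.
Qed.

Lemma norm_le_expR x : `|x| <= expR `|x|.
Proof. by apply: le_trans (expR_ge1Dx _); rewrite lerDr. Qed.

Definition sin_poly n (x : R) := series (sin_coeff x) n.

Lemma fact_leM n k : (n`! * k`! <= (n + k)`!)%N.
Proof.
by rewrite -(@bin_fact (n + k) n) ?leq_addr // addKn leq_pmull // bin_gt0 leq_addr.
Qed.

Lemma sin_taylor_coeff x n : `|sin x - sin_poly n x| <= exp_coeff `|x| n * expR `|x|.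
Proof.
have nx := normr_ge0 x.
apply: series_tail_le => //; first exact: exp_coeff_ge0.
  move=> k; rewrite /sin_coeff /exp_coeff /= 3!normrM normfV (ger0_norm (ler0n _ (n + k)`!)).
  apply: (@le_trans _ _ (`|x| ^+ (n + k) / (n + k)`!%:R)).
    rewrite ler_pM2r ?invr_gt0 ?ltr0n ?fact_gt0 // !normrX normrN1 expr1n mulr1.
    by rewrite ler_piMl ?exprn_ge0 //; case: (odd _); rewrite ?normr1 ?normr0.
  rewrite exprD mulrACA -invfM -natrM ler_wpM2l ?mulr_ge0 ?exprn_ge0 //.
  by rewrite lef_pV2 ?posrE ?ltr0n ?muln_gt0 ?fact_gt0 // ler_nat fact_leM.
by rewrite unlock; exact: is_cvg_series_sin_coeff.
Qed.

Lemma sin_taylor2 x : `|sin x - x| <= x ^+ 2 * expR `|x|.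
Proof.
have := sin_taylor_coeff x 2; rewrite /sin_poly /series /= !big_nat_recr //= big_geq // !add0r.
rewrite /sin_coeff /exp_coeff /= expr0 expr1 !mul0r add0r !mul1r divr1 real_normK ?num_real //.
move=> /le_trans; apply; rewrite ler_wpM2r ?expR_ge0 // ler_piMr ?sqr_ge0 // invf_le1 //.
by rewrite ler1n.
Qed.

(** Writing [|x|^n / n!] as [2^-n] times [(2 |x|)^n / n!] gives a remainder that is geometrically
    small relative to an exponential, which exponential moments can absorb. *)
Lemma sin_taylor x n : `|sin x - sin_poly n x| <= 2^-1 ^+ n * expR (3 * `|x|).
Proof.
have nx := normr_ge0 x.
apply: le_trans (sin_taylor_coeff x n) _; rewrite (_ : 3 * `|x| = 2 * `|x| + `|x|); last by ring.
rewrite expRD mulrA ler_wpM2r ?expR_ge0 //.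
have -> : exp_coeff `|x| n = 2^-1 ^+ n * exp_coeff (2 * `|x|) n.
  by rewrite /exp_coeff /= exprMn mulrA mulrA -exprMn mulVf // expr1n mul1r.
rewrite ler_wpM2l ?exprn_ge0 //.
apply: le_trans (series_exp_coeff_le n.+1 _); last by rewrite mulr_ge0.
rewrite seriesSr /= lerDr; apply: sumr_ge0 => k _; apply: exp_coeff_ge0.
by rewrite mulr_ge0.
Qed.

Lemma near_norm_lt u (e : R) : u n @[n --> \oo] --> 0 -> 0 < e -> \forall n \near \oo, `|u n| < e.
Proof. by move=> /cvgrPdist_lt u0 /u0; apply: filterS => n; rewrite sub0r normrN. Qed.

Lemma near_norm_le u (e : R) : u n @[n --> \oo] --> 0 -> 0 < e -> \forall n \near \oo, `|u n| <= e.
Proof. by move=> u0 /(near_norm_lt u0); apply: filterS => n /ltW. Qed.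

Lemma cvg_expR u (l : R) : u n @[n --> \oo] --> l -> expR (u n) @[n --> \oo] --> expR l.
Proof. by move=> ul; exact: (cvg_comp _ _ ul (@continuous_expR R l)). Qed.

Lemma cvg_dist_le (u v : R^nat) (l : R) : (\forall n \near \oo, `|u n - l| <= v n) ->
  v n @[n --> \oo] --> 0 -> u n @[n --> \oo] --> l.
Proof.
move=> uv v0; apply/cvgrPdist_lt => e e0; near=> n.
rewrite distrC; apply: (@le_lt_trans _ _ (v n)); first by near: n.
apply: le_lt_trans (ler_norm _) _; near: n.
exact: near_norm_lt v0 e0.
Unshelve. all: by end_near.
Qed.

(** Squeezed by [exp (N z / (1 + z)) <= (1 + z)^N <= exp (N z)], both from [1 + y <= exp y]. *)
Lemma cvg_pow_expR (z : R^nat) (N : nat -> nat) (c : R) : (forall n, 0 <= z n) ->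
  z n @[n --> \oo] --> 0 -> (N n)%:R * z n @[n --> \oo] --> c ->
  (1 + z n) ^+ N n @[n --> \oo] --> expR c.
Proof.
move=> z0 zc Nz.
have p n : 0 < 1 + z n by have := z0 n; lra.
apply: (@squeeze_cvgr _ _ _ _ (fun n => expR ((N n)%:R * z n / (1 + z n))) (fun n => expR ((N n)%:R * z n))).
- near=> n; apply/andP; split.
    rewrite -mulrA mulrC expRM_natr lerXn2r ?nnegrE ?expR_ge0 ?(ltW (p n)) //.
    rewrite -[leRHS]invrK -[leLHS]invrK -expRN lef_pV2 ?posrE ?invr_gt0 ?expR_gt0 //.
    apply: le_trans (expR_ge1Dx _); rewrite le_eqVlt; apply/orP; left; apply/eqP.
    by field; rewrite gt_eqF.
  by rewrite mulrC expRM_natr lerXn2r ?nnegrE ?expR_ge0 ?(ltW (p n)) // expR_ge1Dx.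
- apply: cvg_expR.
  have c1 : 1 + z n @[n --> \oo] --> (1 : R).
    by rewrite -[X in _ --> X]addr0; apply: cvgD => //; exact: cvg_cst.
  by have := cvgM Nz (cvgV (oner_neq0 R) c1); rewrite invr1 mulr1; apply.
- exact: cvg_expR.
Unshelve. all: by end_near.
Qed.

(** A central limit theorem for the Laplace transform of the uniform law on [d] centred points. The
    mean of the exponentials is [1 + z], where [z] is nonnegative by centring and equals [delta^2]
    times half the variance up to order [delta^3]. *)
Lemma cvg_mean_exp_pow d (a : 'I_d -> R) (delta : R^nat) (N : nat -> nat) (tau : R) : (0 < d)%N ->
  \sum_i a i = 0 -> delta n @[n --> \oo] --> 0 ->
  (N n)%:R * delta n ^+ 2 @[n --> \oo] --> tau ->
  ((\sum_i expR (delta n * a i)) / d%:R) ^+ N n @[n --> \oo] -->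
  expR (tau * (\sum_i a i ^+ 2) / (2 * d%:R)).
Proof.
move=> d0 a0 dc Nd; have dR : 0 < d%:R :> R by rewrite ltr0n.
pose z n := (\sum_i (expR (delta n * a i) - 1 - delta n * a i)) / d%:R.
have zE n : (\sum_i expR (delta n * a i)) / d%:R = 1 + z n.
  rewrite /z !sumrB -mulr_sumr a0 mulr0 subr0 sumr_const card_ord; field.
  by rewrite gt_eqF.
have z0 n : 0 <= z n.
  apply: divr_ge0; last exact: ltW.
  by apply: sumr_ge0 => i _; have := expR_ge1Dx (delta n * a i); lra.
rewrite (_ : (fun _ => _) = (fun n => (1 + z n) ^+ N n)); last by apply/funext => n; rewrite zE.
pose C := (\sum_i `|a i| ^+ 3 * expR `|a i|) / d%:R.
pose q := (\sum_i a i ^+ 2) / (2 * d%:R).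
have zq n : `|delta n| <= 1 -> `|z n - delta n ^+ 2 * q| <= `|delta n| ^+ 3 * C.
  move=> d1; rewrite /z /q /C.
  have -> : (\sum_i (expR (delta n * a i) - 1 - delta n * a i)) / d%:R -
      delta n ^+ 2 * ((\sum_i a i ^+ 2) / (2 * d%:R)) =
      (\sum_i (expR (delta n * a i) - 1 - delta n * a i - (delta n * a i) ^+ 2 / 2)) / d%:R.
    rewrite [in RHS]sumrB -[in RHS]mulr_suml.
    under [X in _ = (_ - X / 2) / _]eq_bigr do rewrite exprMn.
    by rewrite -mulr_sumr; field; rewrite gt_eqF.
  rewrite normrM normfV (gtr0_norm dR) mulrA ler_wpM2r ?invr_ge0 ?(ltW dR) //.
  apply: le_trans (ler_norm_sum _ _ _) _; rewrite mulr_sumr; apply: ler_sum => i _.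
  apply: le_trans (exp_taylor3 _) _; rewrite normrM exprMn -mulrA ler_wpM2l ?exprn_ge0 //.
  by rewrite ler_wpM2l ?exprn_ge0 // ler_expR ler_piMl.
have dn1 : \forall n \near \oo, `|delta n| <= 1.
  exact: near_norm_le dc ltr01.
have nd : `|delta n| @[n --> \oo] --> 0 by rewrite -[X in _ --> X](@normr0 R R); exact: cvg_norm.
have dX (v : R^nat) k : v n @[n --> \oo] --> 0 -> v n ^+ k.+1 @[n --> \oo] --> 0.
  move=> v0; elim: k => [|k IH]; first by under eq_fun do rewrite expr1.
  rewrite -[X in _ --> X](mulr0 0); under eq_fun do rewrite exprS.
  exact: cvgM.
have z2 : (N n)%:R * z n @[n --> \oo] --> tau * q.
  have e1 : (N n)%:R * delta n ^+ 2 * (`|delta n| * C) @[n --> \oo] --> 0.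
    rewrite -[X in _ --> X](mulr0 tau); apply: cvgM => //.
    by rewrite -[X in _ --> X](mul0r C); apply: cvgM => //; exact: cvg_cst.
  have e2 : (N n)%:R * (z n - delta n ^+ 2 * q) @[n --> \oo] --> 0.
    apply: norm_cvg0; apply: (@squeeze_cvgr _ _ _ _ (fun=> 0) (fun n => (N n)%:R * delta n ^+ 2 * (`|delta n| * C))) => //; last exact: cvg_cst.
    near=> n; rewrite normr_ge0 /= normrM (ger0_norm (ler0n _ _)) -mulrA ler_wpM2l ?ler0n //.
    have -> : delta n ^+ 2 * (`|delta n| * C) = `|delta n| ^+ 3 * C.
      by rewrite -(real_normK (num_real (delta n))); ring.
    apply: zq; near: n.
    exact: dn1.
  rewrite -[X in _ --> X]add0r.
  rewrite (_ : (fun n => _) = (fun n => (N n)%:R * (z n - delta n ^+ 2 * q) + (N n)%:R * delta n ^+ 2 * q)); last first.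
    by apply/funext => n; ring.
  by apply: cvgD => //; apply: cvgM => //; exact: cvg_cst.
rewrite -mulrA -/q; apply: cvg_pow_expR => //.
have e3 : delta n ^+ 2 * q + `|delta n| ^+ 3 * C @[n --> \oo] --> 0.
  rewrite -[X in _ --> X](addr0 0); apply: cvgD.
    by rewrite -[X in _ --> X](mul0r q); apply: cvgM; [exact: (dX _ 1%N dc)|exact: cvg_cst].
  rewrite -[X in _ --> X](mul0r C); apply: cvgM; last exact: cvg_cst.
  exact: (dX _ 2%N nd).
apply: (@squeeze_cvgr _ _ _ _ (fun=> 0) (fun n => delta n ^+ 2 * q + `|delta n| ^+ 3 * C)) => //; last exact: cvg_cst.
near=> n; rewrite z0 /= addrC -lerBlDr; apply: le_trans (ler_norm _) _; apply: zq; near: n.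
exact: dn1.
Unshelve. all: by end_near.
Qed.

Lemma sinh_ratio_le (delta c : R) : 0 < delta -> delta <= 1 ->
  `|(expR (2^-1 * (delta * c)) - expR (- (2^-1 * (delta * c)))) / delta - c| <= delta * (c ^+ 2 * expR `|c|).
Proof.
move=> dp d1; set x := 2^-1 * (delta * c).
have h1 := exp_taylor2 x; have h2 := exp_taylor2 (- x); rewrite normrN sqrrN in h2.
have e : (expR x - expR (- x)) / delta - c = ((expR x - 1 - x) - (expR (- x) - 1 - - x)) / delta.
  by rewrite /x; field; rewrite gt_eqF.
rewrite e normrM normfV (gtr0_norm dp) ler_pdivrMr //.
apply: le_trans (ler_normB _ _) _; apply: le_trans (lerD h1 h2) _.
have ex : expR `|x| <= expR `|c|.
  rewrite ler_expR /x !normrM (gtr0_norm dp) gtr0_norm ?invr_gt0 //.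
  by have := normr_ge0 c; nra.
have := expR_ge0 `|c|; have := sqr_ge0 (delta * c); have := sqr_ge0 x.
rewrite (_ : x ^+ 2 = (delta * c) ^+ 2 / 4); last by rewrite /x; field.
rewrite (_ : delta * _ * _ = (delta * c) ^+ 2 * expR `|c|); last by ring.
by move: ex; set A := (_ ^+ 2); nra.
Qed.

End ScalarAnalysis.

(** * Trigonometric approximation *)

Section TrigApproximation.
Variables (R : realType) (r : nat).
Local Notation rV := 'rV[R]_r.
Implicit Types (F G f : rV -> R) (x t : rV).

(** This algebra contains the polynomials in the functions [L sin (x_i / L)], bounded substitutes
    for the coordinates. *)
Inductive trig : (rV -> R) -> Prop :=
| trig_cst c : trig (fun=> c)
| trig_sin c i : trig (fun x => sin (c * x 0 i))
| trigD F G : trig F -> trig G -> trig (fun x => F x + G x)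
| trigM F G : trig F -> trig G -> trig (fun x => F x * G x).

Lemma trig_sum I (s : seq I) (P : pred I) (F : I -> rV -> R) : (forall i, trig (F i)) ->
  trig (fun x => \sum_(i <- s | P i) F i x).
Proof.
move=> tF; elim: s => [|i s IH].
  rewrite (_ : (fun _ => _) = fun=> 0); first exact: trig_cst.
  by apply/funext => x; rewrite big_nil.
rewrite (_ : (fun _ => _) = fun x => (if P i then F i x else 0) + \sum_(j <- s | P j) F j x); last first.
  by apply/funext => x; rewrite big_cons; case: (P i); rewrite ?add0r.
by apply: trigD => //; case: (P i) => //; exact: trig_cst.
Qed.

Lemma trig_prod I (s : seq I) (F : I -> rV -> R) : (forall i, trig (F i)) ->
  trig (fun x => \prod_(i <- s) F i x).
Proof.
move=> tF; elim: s => [|i s IH].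
  rewrite (_ : (fun _ => _) = fun=> 1); first exact: trig_cst.
  by apply/funext => x; rewrite big_nil.
rewrite (_ : (fun _ => _) = fun x => F i x * \prod_(j <- s) F j x); last first.
  by apply/funext => x; rewrite big_cons.
exact: trigM.
Qed.

Lemma trigX F n : trig F -> trig (fun x => F x ^+ n).
Proof.
move=> tF; elim: n => [|n IH].
  by rewrite (_ : (fun _ => _) = fun=> 1); [exact: trig_cst|apply/funext => x; rewrite expr0].
rewrite (_ : (fun _ => _) = fun x => F x * F x ^+ n); first exact: trigM.
by apply/funext => x; rewrite exprS.
Qed.

Definition bern n (y : R) (k : nat) : R := ('C(n, k))%:R * y ^+ k * (1 - y) ^+ (n - k).

Lemma bern_ge0 n y k : 0 <= y <= 1 -> 0 <= bern n y k.
Proof. by move=> /andP[y0 y1]; rewrite !mulr_ge0 ?exprn_ge0 ?subr_ge0. Qed.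

Lemma sum_bern n y : \sum_(k < n.+1) bern n y k = 1.
Proof.
rewrite -[RHS](expr1n R n) -[in RHS](subrK y 1) exprDn; apply: eq_bigr => k _.
by rewrite /bern -mulr_natl; ring.
Qed.

Lemma sum_bern1 n y : \sum_(k < n.+1) k%:R * bern n y k = n%:R * y.
Proof.
case: n => [|n]; first by rewrite big_ord1 !mul0r.
rewrite big_ord_recl mul0r add0r.
transitivity (n.+1%:R * y * \sum_(k < n.+1) bern n y k); last by rewrite sum_bern mulr1.
rewrite mulr_sumr; apply: eq_bigr => k _.
rewrite /bern /= /bump /= add1n subSS !mulrA -natrM -mul_bin_diag natrM exprS.
ring.
Qed.

Lemma sum_bern2 n y : \sum_(k < n.+1) (k * k.-1)%:R * bern n y k = (n * n.-1)%:R * y ^+ 2.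
Proof.
case: n => [|[|n]]; first by rewrite big_ord1 !mul0r.
  by rewrite big_ord_recl big_ord1 /= muln0 !mul0r add0r.
rewrite 2!big_ord_recl mul0r add0r mul0r add0r.
transitivity ((n.+2 * n.+1)%:R * y ^+ 2 * \sum_(k < n.+1) bern n y k); last by rewrite sum_bern mulr1.
rewrite mulr_sumr; apply: eq_bigr => k _.
rewrite /bern !lift0 !subSS succnK.
have -> : y ^+ k.+2 = y ^+ 2 * y ^+ k by rewrite -exprD.
have /(congr1 (fun m : nat => m%:R : R)) : (k.+2 * k.+1 * 'C(n.+2, k.+2) = n.+2 * n.+1 * 'C(n, k))%N.
  by rewrite -mulnA mulnCA -[(k.+2 * _)%N]mul_bin_diag mulnCA -mul_bin_diag mulnA.
rewrite !(natrM _ (_ * _)%N); move: (y ^+ 2) (y ^+ k) ((1 - y) ^+ (n - k)) => p q s E.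
transitivity ((k.+2 * k.+1)%:R * ('C(n.+2, k.+2))%:R * (p * q * s)); first by ring.
by rewrite E; ring.
Qed.

(** The sum is the variance [(y - y^2) / n], computed from the first two factorial moments. *)
Lemma bern_variance n y : (0 < n)%N -> 0 <= y <= 1 ->
  \sum_(k < n.+1) (k%:R / n%:R - y) ^+ 2 * bern n y k <= n%:R^-1.
Proof.
move=> n0 /andP[y0 y1]; have nR : n%:R != 0 :> R by rewrite pnatr_eq0 -lt0n.
have -> : \sum_(k < n.+1) (k%:R / n%:R - y) ^+ 2 * bern n y k =
   n%:R ^- 2 * (\sum_(k < n.+1) (k * k.-1)%:R * bern n y k + \sum_(k < n.+1) k%:R * bern n y k)
   - 2 * y / n%:R * \sum_(k < n.+1) k%:R * bern n y k + y ^+ 2 * \sum_(k < n.+1) bern n y k.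
  rewrite -big_split !mulr_sumr -sumrN -!big_split; apply: eq_bigr => k _ /=.
  have -> : (k * k.-1)%:R = k%:R * k%:R - k%:R :> R.
    case: (nat_of_ord k) => [|j]; first by rewrite mul0n mul0r subr0.
    by rewrite /= natrM -(natr1 j); ring.
  by field.
rewrite sum_bern2 sum_bern1 sum_bern.
have -> : (n * n.-1)%:R = n%:R * n%:R - n%:R :> R.
  by case: n n0 nR => // j _ _; rewrite /= natrM -(natr1 j); ring.
have -> : n%:R ^- 2 * ((n%:R * n%:R - n%:R) * y ^+ 2 + n%:R * y) - 2 * y / n%:R * (n%:R * y) + y ^+ 2 * 1
   = (y - y ^+ 2) / n%:R :> R by field.
rewrite -[leRHS]mul1r ler_wpM2r ?invr_ge0 ?ler0n //.
by nra.
Qed.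

(* The law of independent binomial variables. *)
Definition mbern (n : nat) (y : rV) (k : {ffun 'I_r -> 'I_n.+1}) : R := \prod_i bern n (y 0 i) (k i).

Definition cube (y : rV) := forall i, 0 <= y 0 i <= 1.

Lemma mbern_ge0 n (y : rV) (k : {ffun 'I_r -> 'I_n.+1}) : cube y -> 0 <= mbern y k.
Proof. by move=> cy; apply: prodr_ge0 => i _; apply: bern_ge0. Qed.

Lemma sum_mbern n y : \sum_(k : {ffun 'I_r -> 'I_n.+1}) mbern y k = 1.
Proof.
rewrite -(bigA_distr_bigA (fun i (k : 'I_n.+1) => bern n (y 0 i) k)) big1 // => i _.
exact: sum_bern.
Qed.

Lemma sum_mbern_coord n y i (h : 'I_n.+1 -> R) :
  \sum_(k : {ffun 'I_r -> 'I_n.+1}) h (k i) * mbern y k = \sum_(j < n.+1) h j * bern n (y 0 i) j.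
Proof.
have -> : \sum_(k : {ffun 'I_r -> 'I_n.+1}) h (k i) * mbern y k =
    \sum_(k : {ffun 'I_r -> 'I_n.+1}) \prod_l ((if l == i then h (k l) else 1) * bern n (y 0 l) (k l)).
  apply: eq_bigr => k _; rewrite big_split /=; congr (_ * _).
  by rewrite (bigD1 i) //= eqxx big1 ?mulr1 // => l /negPf ->.
rewrite -(bigA_distr_bigA (fun l (k : 'I_n.+1) => (if l == i then h k else 1) * bern n (y 0 l) k)).
rewrite (bigD1 i) //= eqxx [X in _ * X]big1 ?mulr1 // => l /negPf ->.
under eq_bigr do rewrite mul1r.
exact: sum_bern.
Qed.

(** The quadratic bound on [f] is averaged over the binomial law, whose variance is at most [1 / n]
    in each coordinate. *)
Lemma mbern_approx (f : rV -> R) (e K : R) n y : (0 < n)%N -> cube y ->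
  (forall z, cube z -> `|f z - f y| <= e + K * \sum_i (z 0 i - y 0 i) ^+ 2) -> 0 <= K ->
  `|\sum_(k : {ffun 'I_r -> 'I_n.+1}) f (\row_i ((k i)%:R / n%:R)) * mbern y k - f y| <= e + K * r%:R / n%:R.
Proof.
move=> n0 cy fy K0.
have -> : \sum_(k : {ffun 'I_r -> 'I_n.+1}) f (\row_i ((k i)%:R / n%:R)) * mbern y k - f y =
    \sum_(k : {ffun 'I_r -> 'I_n.+1}) (f (\row_i ((k i)%:R / n%:R)) - f y) * mbern y k.
  transitivity (\sum_(k : {ffun 'I_r -> 'I_n.+1}) f (\row_i ((k i)%:R / n%:R)) * mbern y k -
      f y * \sum_(k : {ffun 'I_r -> 'I_n.+1}) mbern y k); first by rewrite sum_mbern mulr1.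
  rewrite mulr_sumr -sumrB.
  by apply: eq_bigr => k _; rewrite mulrBl.
apply: le_trans (ler_norm_sum _ _ _) _.
apply: (@le_trans _ _ (\sum_(k : {ffun 'I_r -> 'I_n.+1})
    (e + K * \sum_i ((k i)%:R / n%:R - y 0 i) ^+ 2) * mbern y k)).
  apply: ler_sum => k _; rewrite normrM (ger0_norm (mbern_ge0 _ cy)) ler_wpM2r ?mbern_ge0 //.
  have cz : cube (\row_i ((k i)%:R / n%:R)).
    move=> i; rewrite mxE divr_ge0 ?ler0n //= ler_pdivrMr ?ltr0n // mul1r ler_nat.
    by rewrite -ltnS ltn_ord.
  have := fy _ cz; under eq_bigr do rewrite mxE.
  by [].
under eq_bigr do rewrite mulrDl -mulrA mulr_suml.
rewrite big_split /= -mulr_sumr sum_mbern mulr1 lerD2l -mulr_sumr -mulrA ler_wpM2l //.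
rewrite exchange_big /=.
apply: (@le_trans _ _ (\sum_(i < r) n%:R^-1)).
  apply: ler_sum => i _.
  rewrite (sum_mbern_coord y i (fun j : 'I_n.+1 => (j%:R / n%:R - y 0 i) ^+ 2)).
  exact: bern_variance.
by rewrite sumr_const card_ord mulr_natl.
Qed.

Definition coord_near (d : R) x (y : rV) := forall i, `|x 0 i - y 0 i| <= d.
Definition ccont f := forall x e, 0 < e -> exists2 d, 0 < d & forall y, coord_near d x y -> `|f x - f y| <= e.
Definition box (L : R) x := forall i, `|x 0 i| <= L.
(** The growth function for errors: at least 1, large outside boxes, and a sum of exponentials, so
    that its expectations converge. *)
Definition coshs x : R := 1 + \sum_i (expR (x 0 i) + expR (- x 0 i)).

End TrigApproximation.

Section UniformApproximation.
Variables (R : realType) (r : nat).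
Local Notation rV := 'rV[R]_r.
Implicit Types (F G f : rV -> R) (x y t : rV) (C L M e : R).

Lemma box_uniform f L e : ccont f -> 0 < e ->
  exists2 d, 0 < d & forall x y, box L x -> coord_near d x y -> `|f x - f y| <= e.
Proof.
move=> cf e0; have e2 : 0 < e / 2 by rewrite divr_gt0.
have cb : compact [set x : rV | box L x].
  rewrite (_ : mkset _ = [set v : rV | forall i, `[- L, L]%classic (v ord0 i)]); last first.
    by apply/seteqP; split=> v /= vb i; have := vb i; rewrite /= in_itv /= ler_norml.
  by apply: (@rV_compact R r (fun=> `[- L, L]%classic)) => i; exact: segment_compact.
pose P (d : R) x := forall y, coord_near d x y -> `|f x - f y| <= e.
have /(_ R (0^'+) P _) h := (compact_near_coveringP _).1 cb.
have {h} hP : \forall d \near 0^'+, [set x : rV | box L x] `<=` P d.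
  apply: h => x _; have [d d0 dP] := cf x _ e2.
  have d2 : 0 < d / 2 by rewrite divr_gt0.
  exists (ball x (d / 2), [set b : R | b < d / 2]).
    split; first exact: nbhsx_ballx.
    by apply: nbhs_right_lt.
  move=> [z b] /= [[_ zx] bd] y zy.
  have xz : coord_near d x z.
    by move=> i; have := zx 0 i; rewrite /ball /= => /ltW /le_trans; apply; rewrite ler_piMr ?ltW //; lra.
  have xy : coord_near d x y.
    move=> i; have := zx 0 i; rewrite /ball /= => /ltW h1; have h2 := zy i.
    by have := ler_distD (z 0 i) (x 0 i) (y 0 i); move: h1 h2 bd => /=; lra.
  have := dP z xz; have := dP y xy; rewrite distrC => h1 h2.
  by have := ler_distD (f x) (f z) (f y); rewrite (distrC (f z) (f x)) (distrC (f x) (f y)); lra.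
have [d [dP d0]] : exists d, ([set x : rV | box L x] `<=` P d) /\ 0 < d.
  apply: (@filter_ex _ (0^'+)); apply: filterI => //.
  exact: nbhs_right_gt.
by exists d => // x y bx; exact: dP.
Qed.

(** Uniform continuity covers close points; for distant ones [2 C] is at most a multiple of the
    squared distance. *)
Lemma box_quadratic f C L e : ccont f -> (forall x, `|f x| <= C) -> 0 < e ->
  exists2 K, 0 <= K & forall x y, box L x -> `|f x - f y| <= e + K * \sum_i (x 0 i - y 0 i) ^+ 2.
Proof.
move=> cf fC e0; have [d d0 dP] := box_uniform L cf e0.
have C0 : 0 <= C by apply: le_trans (fC 0).
have K0 : 0 <= 2 * C / d ^+ 2 by rewrite !mulr_ge0 ?invr_ge0 ?exprn_ge0 ?(ltW d0).
exists (2 * C / d ^+ 2) => //.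
move=> x y bx; have s0 : 0 <= \sum_i (x 0 i - y 0 i) ^+ 2 by apply: sumr_ge0 => i _; exact: sqr_ge0.
have [xy|] := pselect (coord_near d x y).
  apply: le_trans (dP _ _ bx xy) _; by rewrite lerDl mulr_ge0.
move=> /existsNP[i /negP]; rewrite -ltNge => di.
apply: (@le_trans _ _ (2 * C)).
  by apply: le_trans (ler_normB _ _) _; have := fC x; have := fC y; lra.
apply: (@le_trans _ _ (2 * C / d ^+ 2 * \sum_i (x 0 i - y 0 i) ^+ 2)); last by rewrite lerDr (ltW e0).
rewrite -mulrA ler_peMr ?mulr_ge0 // mulrC ler_pdivlMr ?exprn_gt0 // mul1r.
rewrite (bigD1 i) //= -[leLHS]addr0 lerD //; last by apply: sumr_ge0 => j _; exact: sqr_ge0.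
by rewrite -(real_normK (num_real (x 0 i - y 0 i))) lerXn2r ?nnegrE ?normr_ge0 ?(ltW d0) ?(ltW di).
Qed.

Lemma coshs_ge1 x : 1 <= coshs x.
Proof. by rewrite lerDl sumr_ge0 // => i _; rewrite addr_ge0 ?expR_ge0. Qed.

Lemma coshs_ge x i : expR `|x 0 i| <= coshs x.
Proof.
rewrite /coshs (bigD1 i) //= addrCA; apply: le_trans (expR_cosh_le _) _.
by rewrite lerDl addr_ge0 // sumr_ge0 // => j _; rewrite addr_ge0 ?expR_ge0.
Qed.

Lemma coshs_out M x : ~ box M x -> M <= coshs x.
Proof.
move=> /existsNP[i /negP]; rewrite -ltNge => Mi; apply: le_trans (ltW Mi) _.
by apply: le_trans (norm_le_expR _) _; exact: coshs_ge.
Qed.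

Lemma uniform_coshs f C e : ccont f -> (forall x, `|f x| <= C) -> 0 < e ->
  exists2 d, 0 < d & forall x y, coord_near d x y -> `|f x - f y| <= e * coshs x.
Proof.
move=> cf fC e0; have [d d0 dP] := box_uniform (2 * C / e) cf e0; exists d => // x y xy.
have [bx|/coshs_out cx] := pselect (box (2 * C / e) x).
  by apply: le_trans (dP _ _ bx xy) _; rewrite ler_peMr ?(ltW e0) ?coshs_ge1 //.
apply: (@le_trans _ _ (2 * C)).
  by apply: le_trans (ler_normB _ _) _; have := fC x; have := fC y; lra.
by rewrite [leRHS]mulrC -ler_pdivrMr.
Qed.

(** On a box of size [M] the map with coordinates [L sin (x_i / L)] is close to the identity, and it
    maps the whole space into the box of size [L], where [f] is approximated by Bernstein
    polynomials. Outside the first box only boundedness is used, against the growth of [coshs]. *)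
Lemma trig_approx f C e : ccont f -> (forall x, `|f x| <= C) -> 0 < e ->
  exists2 G, trig G & forall x, `|f x - G x| <= e * coshs x.
Proof.
move=> cf fC e0; have C0 : 0 <= C by apply: le_trans (fC 0).
(* Chosen so that [e M = 2 C + e], which dominates the trivial error outside the box. *)
pose M := 2 * C / e + 1; have M1 : 1 <= M by rewrite lerDr divr_ge0 ?mulr_ge0 ?(ltW e0).
have e2 : 0 < e / 2 by rewrite divr_gt0.
have e4 : 0 < e / 4 by rewrite divr_gt0.
have [d d0 dP] := box_uniform M cf e2.
(* The error of [L sin (x / L)] for [|x| <= M] is at most [M^2 exp M / L], hence at most [d]. *)
pose L := 1 + M ^+ 2 * expR M / d.
have L1 : 1 <= L by rewrite lerDl divr_ge0 ?mulr_ge0 ?exprn_ge0 ?expR_ge0 ?(ltW d0) //; lra.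
have L0 : 0 < L by lra.
pose S x : rV := \row_i (L * sin (L^-1 * x 0 i)).
have SM x : box M x -> coord_near d x (S x).
  move=> bx i; rewrite mxE; set y := L^-1 * x 0 i.
  have xE : x 0 i = L * y by rewrite /y mulrA mulfV ?mul1r ?gt_eqF.
  rewrite {1}xE -mulrBr normrM (gtr0_norm L0) distrC.
  apply: le_trans (ler_wpM2l (ltW L0) (sin_taylor2 y)) _.
  have yx : `|y| <= M.
    apply: le_trans (bx i); rewrite /y normrM ler_piMl ?normr_ge0 // normfV (gtr0_norm L0).
    by rewrite invf_le1.
  have y2 : L * y ^+ 2 <= M ^+ 2 / L.
    have -> : L * y ^+ 2 = x 0 i ^+ 2 / L by rewrite /y; field; rewrite gt_eqF.
    rewrite ler_wpM2r ?invr_ge0 ?(ltW L0) // -(real_normK (num_real (x 0 i))).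
    by rewrite lerXn2r ?nnegrE ?normr_ge0 //; lra.
  rewrite mulrA; apply: (@le_trans _ _ (M ^+ 2 / L * expR M)).
    by apply: ler_pM; [apply: mulr_ge0; [exact: ltW|exact: sqr_ge0]|exact: expR_ge0|exact: y2|rewrite ler_expR].
  rewrite mulrAC ler_pdivrMr // /L mulrDr mulr1 mulrCA mulfV ?gt_eqF // mulr1.
  by rewrite lerDr (ltW d0).
have SL x : box L (S x).
  move=> i; rewrite mxE normrM (gtr0_norm L0) ler_piMr ?(ltW L0) //.
  by rewrite ler_norml sin_geN1 sin_le1.
have [K K0 KP] := box_quadratic L cf fC e4.
pose aff y : rV := \row_i (L * (2 * y 0 i - 1)).
pose g y := f (aff y).
pose Y x : rV := \row_i (2^-1 * (1 + sin (L^-1 * x 0 i))).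
have YS x : aff (Y x) = S x by apply/rowP => i; rewrite !mxE; field.
have Yc x : cube (Y x).
  move=> i; rewrite mxE; have := sin_geN1 (L^-1 * x 0 i); have := sin_le1 (L^-1 * x 0 i).
  by move: (sin _) => s s1 s2; apply/andP; split; lra.
(* The affine map from the cube to the box stretches by [2 L], squared distances by [4 L^2]. *)
pose K' := K * (4 * L ^+ 2).
have K'0 : 0 <= K' by rewrite !mulr_ge0 ?exprn_ge0 ?(ltW L0).
have gq x z : cube z -> `|g z - g (Y x)| <= e / 4 + K' * \sum_i (z 0 i - Y x 0 i) ^+ 2.
  move=> cz; rewrite distrC /g YS; apply: le_trans (KP _ _ (SL x)) _.
  rewrite lerD2l /K' -mulrA ler_wpM2l // mulr_sumr; apply: ler_sum => i _.
  by rewrite -YS /aff !mxE; rewrite le_eqVlt; apply/orP; left; apply/eqP; ring.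
pose n := (Num.truncn (K' * r%:R / (e / 4))).+1.
have n0 : (0 < n)%N by [].
have nK : K' * r%:R / n%:R <= e / 4.
  rewrite ler_pdivrMr ?ltr0n // [leRHS]mulrC -ler_pdivrMr //; apply/ltW; exact: truncnS_gt.
pose G x := \sum_(k : {ffun 'I_r -> 'I_n.+1}) g (\row_i ((k i)%:R / n%:R)) * mbern (Y x) k.
have GS x : `|G x - f (S x)| <= e / 2.
  have := mbern_approx n0 (Yc x) (gq x) K'0; rewrite /g YS -/g => /le_trans; apply.
  by lra.
exists G.
  apply: trig_sum => k; apply: trigM; first exact: trig_cst.
  apply: trig_prod => i; rewrite /bern.
  have tY : trig (fun x => Y x 0 i).
    rewrite (_ : (fun _ => _) = fun x => 2^-1 * (1 + sin (L^-1 * x 0 i))); last first.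
      by apply/funext => x; rewrite mxE.
    apply: (@trigM _ _ (fun=> 2^-1) (fun x => 1 + sin (L^-1 * x 0 i))); first exact: trig_cst.
    apply: (@trigD _ _ (fun=> 1)); first exact: trig_cst.
    exact: trig_sin.
  apply: (@trigM _ _ (fun x => ('C(n, k i))%:R * Y x 0 i ^+ k i) (fun x => (1 - Y x 0 i) ^+ (n - k i))).
    by apply: (@trigM _ _ (fun=> ('C(n, k i))%:R)); [exact: trig_cst|exact: trigX].
  apply: (@trigX _ _ (fun x => 1 - Y x 0 i)).
  rewrite (_ : (fun _ => _) = fun x => 1 + (-1) * Y x 0 i); last by apply/funext => x; rewrite mulN1r.
  apply: (@trigD _ _ (fun=> 1)); first exact: trig_cst.
  by apply: (@trigM _ _ (fun=> -1)) => //; exact: trig_cst.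
move=> x; have [bx|/coshs_out cx] := pselect (box M x).
  apply: (@le_trans _ _ e); last by rewrite ler_peMr ?(ltW e0) ?coshs_ge1 //.
  have h1 := dP _ _ bx (SM x bx); have h2 := GS x.
  have := ler_distD (f (S x)) (f x) (G x); rewrite (distrC (f (S x)) (G x)); lra.
have h1 : `|G x| <= C + e / 2.
  have := ler_normD (G x - f (S x)) (f (S x)); rewrite subrK => /le_trans; apply.
  by have := GS x; have := fC (S x); lra.
have h2 := fC x; have h3 := ler_normB (f x) (G x).
have h4 : e * M <= e * coshs x by rewrite ler_wpM2l ?(ltW e0).
have h5 : e * M = 2 * C + e by rewrite /M; field; rewrite gt_eqF.
by move: h1 h2 h3 h4 h5; lra.
Qed.

End UniformApproximation.

(** * From exponentials to bounded continuous functions *)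

Section ExponentialConvergence.
Variables (R : realType) (r : nat).
Local Notation rV := 'rV[R]_r.
Implicit Types (F G f B : rV -> R) (x y t : rV) (c e : R).

Definition dot t x : R := \sum_i t 0 i * x 0 i.

Lemma dotD s t x : dot (s + t) x = dot s x + dot t x.
Proof. by rewrite -big_split; apply: eq_bigr => i _; rewrite mxE mulrDl. Qed.
Lemma dot0 x : dot 0 x = 0.
Proof. by apply: big1 => i _; rewrite mxE mul0r. Qed.
Lemma dot_delta c i x : dot (c *: delta_mx 0 i) x = c * x 0 i.
Proof.
rewrite /dot (bigD1 i) //= big1 => [|j ji]; first by rewrite !mxE !eqxx mulr1 addr0.
by rewrite !mxE (negPf ji) andbF mulr0 mul0r.
Qed.

Definition expdot t x := expR (dot t x).

(* [E] stands for integration against a signed density; [Ebar] bounds its total variation. *)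
Variables (ok : (rV -> R) -> Prop) (En : nat -> (rV -> R) -> R) (E Ebar : (rV -> R) -> R).
Hypotheses (ok_lin : forall c F G, ok F -> ok G -> ok (fun x => c * F x + G x))
  (okM : forall F G, ok F -> ok G -> ok (fun x => F x * G x))
  (ok_exp : forall t, ok (expdot t)) (ok_coord : forall i, ok (fun x => x 0 i))
  (ok_sin : forall c i, ok (fun x => sin (c * x 0 i))).
Hypotheses (En_lin : forall n c F G, En n (fun x => c * F x + G x) = c * En n F + En n G)
  (En_le : forall n F G, (forall x, F x <= G x) -> En n F <= En n G).
Hypotheses (E_lin : forall c F G, ok F -> ok G -> E (fun x => c * F x + G x) = c * E F + E G)
  (E_le : forall F B e, ok F -> ok B -> 0 <= e -> (forall x, `|F x| <= e * B x) -> `|E F| <= e * Ebar B).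
Hypothesis cvg_exp : forall t, En n (expdot t) @[n --> \oo] --> E (expdot t).

(** Asking for convergence against every exponential factor, and not for [F] alone, makes the class
    stable under multiplication by exponentials and hence under the difference quotients that
    produce polynomials. *)
Definition conv F := ok F /\
  forall t, En n (fun x => F x * expdot t x) @[n --> \oo] --> E (fun x => F x * expdot t x).

Lemma En_ext n F G : F =1 G -> En n F = En n G.
Proof. by move=> /funext ->. Qed.
Lemma E_ext F G : F =1 G -> E F = E G.
Proof. by move=> /funext ->. Qed.

Lemma conv_ext F G : F =1 G -> conv F -> conv G.
Proof. by move=> /funext ->. Qed.

Lemma conv_lin c F G : conv F -> conv G -> conv (fun x => c * F x + G x).
Proof.
move=> [oF cF] [oG cG]; split=> [|t]; first exact: ok_lin.
have e H : (forall x, (c * F x + G x) * H x = c * (F x * H x) + G x * H x) by move=> x; ring.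
rewrite (E_ext (e _)); under eq_fun do rewrite (En_ext _ (e _)) En_lin.
rewrite E_lin; [|exact: okM|exact: okM].
by apply: cvgD => //; apply: cvgM => //; exact: cvg_cst.
Qed.

Lemma conv_exp t : conv (expdot t).
Proof.
split=> // s; have -> : (fun x => expdot t x * expdot s x) = expdot (t + s).
  by apply/funext => x; rewrite /expdot dotD expRD.
exact: cvg_exp.
Qed.

Lemma conv1 : conv (fun=> 1).
Proof. by apply: conv_ext (conv_exp 0) => x; rewrite /expdot dot0 expR0. Qed.

Lemma conv_cst c : conv (fun=> c).
Proof.
apply: conv_ext (conv_lin (c - 1) conv1 conv1) => x.
by rewrite mulr1 subrK.
Qed.

Lemma convZ c F : conv F -> conv (fun x => c * F x).
Proof. by move=> cF; apply: conv_ext (conv_lin c cF (conv_cst 0)) => x; rewrite addr0. Qed.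

Lemma convD F G : conv F -> conv G -> conv (fun x => F x + G x).
Proof. by move=> cF cG; apply: conv_ext (conv_lin 1 cF cG) => x; rewrite mul1r. Qed.

Lemma conv_mul_exp t F : conv F -> conv (fun x => F x * expdot t x).
Proof.
move=> [oF cF]; split=> [|s]; first exact: okM.
have -> : (fun x => F x * expdot t x * expdot s x) = fun x => F x * expdot (t + s) x.
  by apply/funext => x; rewrite -mulrA /expdot dotD expRD.
exact: cF.
Qed.

Lemma conv_cosh c i F : conv F -> conv (fun x => F x * (expR (c * x 0 i) + expR (- (c * x 0 i)))).
Proof.
move=> cF.
apply: conv_ext (convD (conv_mul_exp (c *: delta_mx 0 i) cF) (conv_mul_exp ((- c) *: delta_mx 0 i) cF)) => x.
by rewrite /expdot !dot_delta mulNr mulrDr.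
Qed.

(** An exchange of limits: errors relative to a fixed [B] are uniform in [n], because the
    expectations of [B] times an exponential converge and so are eventually bounded. *)
Lemma conv_approx F B : ok F -> conv B ->
  (forall e, 0 < e -> exists2 G, conv G & forall x, `|F x - G x| <= e * B x) -> conv F.
Proof.
move=> oF cB ap; split=> // t.
pose h := expdot t; have h0 x : 0 <= h x := expR_ge0 _.
have [oB /(_ t) lB] := cB; have oh : ok h := ok_exp t.
pose b := `|E (fun x => B x * h x)| + 1; have b0 : 0 < b by rewrite ltr_wpDl.
pose b' := `|Ebar (fun x => B x * h x)| + 1; have b'0 : 0 < b' by rewrite ltr_wpDl.
apply/cvgrPdist_le => eta eta0.
pose e := eta / (3 * (b + b')).
have e0 : 0 < e by rewrite divr_gt0 // mulr_gt0 // addr_gt0.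
have [G [oG /(_ t) lG] FG] := ap e e0.
have eta3 : 0 < eta / 3 by rewrite divr_gt0.
have nb : \forall n \near \oo, En n (fun x => B x * h x) <= b.
  have /cvgrPdist_le/(_ 1 ltr01) := lB; apply: filterS => n.
  rewrite distrC => hn; have := ler_norm (En n (fun x => B x * h x) - E (fun x => B x * h x)).
  by have := ler_norm (E (fun x => B x * h x)); rewrite /b; move: hn; rewrite -/h; lra.
have nG : \forall n \near \oo, `|E (fun x => G x * h x) - En n (fun x => G x * h x)| <= eta / 3.
  by have /cvgrPdist_le/(_ _ eta3) := lG.
near=> n.
have d1 : `|E (fun x => F x * h x) - E (fun x => G x * h x)| <= e * b'.
  have eE : E (fun x => F x * h x - G x * h x) = E (fun x => F x * h x) - E (fun x => G x * h x).
    have := @E_lin (-1) (fun x => G x * h x) (fun x => F x * h x) (okM oG oh) (okM oF oh).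
    rewrite mulN1r addrC => <-; apply: E_ext => x; ring.
  rewrite -eE; apply: (@le_trans _ _ (e * Ebar (fun x => B x * h x))).
    apply: E_le; [|exact: okM|exact: ltW|].
      have := ok_lin (-1) (okM oG oh) (okM oF oh); congr ok; apply/funext => x; ring.
    move=> x; rewrite -mulrBl normrM (ger0_norm (h0 x)) mulrA ler_wpM2r //.
  by rewrite ler_wpM2l ?(ltW e0) // /b'; have := ler_norm (Ebar (fun x => B x * h x)); lra.
have d2 : `|En n (fun x => F x * h x) - En n (fun x => G x * h x)| <= e * b.
  have eE H H' : En n (fun x => H x - H' x) = En n H - En n H'.
    by rewrite -[- En n H']mulN1r addrC -En_lin; apply: En_ext => x; ring.
  have up : En n (fun x => e * (B x * h x)) <= e * b.
    have -> : En n (fun x => e * (B x * h x)) = e * En n (fun x => B x * h x).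
      have := En_lin n e (fun x => B x * h x) (fun=> 0).
      have -> : En n (fun=> 0) = 0.
        have := En_lin n 1 (fun=> 0) (fun=> 0); rewrite (_ : (fun _ => _) = fun=> 0); last by apply/funext => x; ring.
        by rewrite mul1r => /eqP; rewrite -subr_eq subrr => /eqP <-.
      rewrite addr0 => <-; apply: En_ext => x; by rewrite addr0.
    rewrite ler_wpM2l ?(ltW e0) //; near: n; exact: nb.
  have le x : `|F x * h x - G x * h x| <= e * (B x * h x).
    by rewrite -mulrBl normrM (ger0_norm (h0 x)) mulrA ler_wpM2r.
  rewrite ler_norml; apply/andP; split.
    rewrite -lerN2 opprK opprB -eE; apply: le_trans up; apply: En_le => x.
    by apply: le_trans (ler_norm _) _; rewrite distrC.
  rewrite -eE; apply: le_trans up; apply: En_le => x.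
  exact: le_trans (ler_norm _) (le x).
have d3 : `|E (fun x => G x * h x) - En n (fun x => G x * h x)| <= eta / 3 by near: n; exact: nG.
have sum : e * b' + e * b <= eta / 3.
  by rewrite -mulrDr /e (addrC b'); rewrite le_eqVlt; apply/orP; left; apply/eqP; field; lra.
have := ler_distD (E (fun x => G x * h x)) (E (fun x => F x * h x)) (En n (fun x => F x * h x)).
have := ler_distD (En n (fun x => G x * h x)) (E (fun x => G x * h x)) (En n (fun x => F x * h x)).
rewrite (distrC (En n (fun x => G x * h x)) (En n (fun x => F x * h x))).
by move: d1 d2 d3 sum; lra.
Unshelve. all: by end_near.
Qed.

(* Dominated by a function whose products with exponentials converge. *)
Definition cconv F := conv F /\ exists2 B, conv B & forall x, `|F x| <= B x.

Lemma cconv1 : cconv (fun=> 1).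
Proof. by split; [exact: conv1|exists (fun=> 1); [exact: conv1|move=> x; rewrite normr1]]. Qed.

(** Multiplication by a coordinate is the derivative of an exponential factor: the quotient
    [(exp (s x_i) - 1) / s] stays in the class and differs from [x_i] by at most a constant times
    [s] times a hyperbolic cosine. *)
Lemma cconv_coord i F : cconv F -> cconv (fun x => F x * x 0 i).
Proof.
move=> [cF [B cB FB]]; have [oF _] := cF; split; last first.
  exists (fun x => B x * (expR (1 * x 0 i) + expR (- (1 * x 0 i)))); first exact: conv_cosh.
  move=> x; rewrite normrM mul1r; apply: ler_pM => //.
  exact: le_trans (norm_le_expR _) (expR_cosh_le _).
apply: (conv_approx (B := fun x => B x * (expR (2 * x 0 i) + expR (- (2 * x 0 i))))); first exact: okM.
  exact: conv_cosh.
(* [s <= 1] lets [exp |s y|] be replaced by [exp |y|]; the other bound absorbs the factor 2 of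
   [sqr_le_expR]. *)
move=> e e0; pose s := Num.min 1 (e / 2).
have s0 : 0 < s by rewrite lt_min ltr01 divr_gt0.
have s1 : s <= 1 by rewrite ge_min lexx.
have se : s <= e / 2 by rewrite ge_min lexx orbT.
exists (fun x => s^-1 * (F x * expdot (s *: delta_mx 0 i) x + (-1) * F x)).
  by apply: convZ; apply: convD; [exact: conv_mul_exp|exact: convZ].
move=> x; rewrite /expdot dot_delta; set y := x 0 i.
have -> : F x * y - s^-1 * (F x * expR (s * y) + -1 * F x) = - (F x * ((expR (s * y) - 1 - s * y) / s)).
  by field; rewrite gt_eqF.
rewrite normrN normrM mulrCA; apply: ler_pM => //.
rewrite normrM normfV (gtr0_norm s0) ler_pdivrMr //.
apply: le_trans (exp_taylor2 _) _.
have h1 := sqr_le_expR y.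
have h2 : expR `|s * y| <= expR `|y| by rewrite ler_expR normrM (gtr0_norm s0) ler_piMl.
have h3 : expR `|y| * expR `|y| <= expR (2 * y) + expR (- (2 * y)).
  rewrite -expRD (_ : `|y| + `|y| = `|2 * y|); first exact: expR_cosh_le.
  by rewrite normrM ger0_norm //; ring.
have p1 := expR_gt0 `|y|; have p2 := expR_ge0 `|s * y|.
apply: (@le_trans _ _ (s ^+ 2 * (2 * (expR `|y| * expR `|y|)))).
  rewrite exprMn -mulrA ler_wpM2l ?sqr_ge0 // mulrA.
  by apply: ler_pM; rewrite ?sqr_ge0.
rewrite expr2; set q := (_ * expR _) in h3 *; set z := (_ + _) in h3 *.
have q0 : 0 <= q by rewrite mulr_ge0 ?expR_ge0.
have : s * q <= e / 2 * z by apply: ler_pM => //; exact: ltW.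
by move=> hh; rewrite (_ : s * s * (2 * q) = 2 * (s * q) * s); [rewrite ler_wpM2r ?(ltW s0) //; lra|ring].
Qed.

Lemma cconvZ c F : cconv F -> cconv (fun x => c * F x).
Proof.
move=> [cF [B cB FB]]; split; first exact: convZ.
by exists (fun x => `|c| * B x); [exact: convZ|move=> x; rewrite normrM ler_wpM2l].
Qed.

Lemma cconvD F G : cconv F -> cconv G -> cconv (fun x => F x + G x).
Proof.
move=> [cF [B cB FB]] [cG [B' cB' GB]]; split; first exact: convD.
exists (fun x => B x + B' x); first exact: convD.
by move=> x; apply: le_trans (ler_normD _ _) _; exact: lerD.
Qed.

Lemma cconv_coordX i n F : cconv F -> cconv (fun x => F x * x 0 i ^+ n).
Proof.
move=> cF; elim: n => [|n IH].
  by rewrite (_ : (fun _ => _) = F) //; apply/funext => x; rewrite mulr1.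
rewrite (_ : (fun _ => _) = fun x => F x * x 0 i ^+ n * x 0 i); first exact: cconv_coord.
by apply/funext => x; rewrite exprSr mulrA.
Qed.

(** Partial sums of the sine series are polynomials in a coordinate, and by [sin_taylor] the error
    is at most [2^-n] times a sum of two exponentials. As the sine is bounded by 1, the dominating
    function of [F] still serves. *)
Lemma cconv_sin c i F : cconv F -> cconv (fun x => F x * sin (c * x 0 i)).
Proof.
move=> cF; have [[oF _] [B cB FB]] := cF.
have B0 x : 0 <= B x by apply: le_trans (FB x).
split; last first.
  exists B => // x; rewrite normrM -[leRHS]mulr1; apply: ler_pM => //.
  by rewrite ler_norml sin_geN1 sin_le1.
apply: (conv_approx (B := fun x => B x * (expR (3 * c * x 0 i) + expR (- (3 * c * x 0 i))))).
- exact: okM.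
- exact: conv_cosh.
move=> e e0; have [n ne] : exists n, 2^-1 ^+ n <= e.
  have : (2^-1 : R) ^+ n @[n --> \oo] --> 0 by apply: cvg_expr; rewrite ger0_norm ?invr_ge0 // invf_lt1 // ltr1n.
  move=> /near_norm_le/(_ e0)[n _ /(_ n (leqnn n)) /= h]; exists n.
  exact: le_trans (ler_norm _) h.
exists (fun x => F x * sin_poly n (c * x 0 i)).
  have : cconv (fun x => \sum_(0 <= k < n) sin_coeff c k * (F x * x 0 i ^+ k)).
    elim: n {ne} => [|n IH].
      rewrite (_ : (fun _ => _) = fun x => 0 * 1); first exact: cconvZ cconv1.
      by apply/funext => x; rewrite big_geq // mul0r.
    rewrite (_ : (fun _ => _) = fun x => \sum_(0 <= k < n) sin_coeff c k * (F x * x 0 i ^+ k) +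
        sin_coeff c n * (F x * x 0 i ^+ n)); last by apply/funext => x; rewrite big_nat_recr.
    by apply: cconvD => //; apply: cconvZ; exact: cconv_coordX.
  move=> [+ _]; apply: conv_ext => x; rewrite /sin_poly /series /= mulr_sumr.
  by apply: eq_bigr => k _; rewrite /sin_coeff /= exprMn; ring.
move=> x; rewrite -mulrBr normrM mulrCA; apply: ler_pM => //.
apply: le_trans (sin_taylor _ _) _; apply: ler_pM; rewrite ?exprn_ge0 ?invr_ge0 ?expR_ge0 //.
have -> : 3 * `|c * x 0 i| = `|3 * c * x 0 i| by rewrite -mulrA [RHS]normrM ger0_norm.
exact: expR_cosh_le.
Qed.

Lemma cconv_trig G F : trig G -> cconv F -> cconv (fun x => F x * G x).
Proof.
move=> tG; elim: tG F => {G} [c|c i|G G' _ IH _ IH'|G G' _ IH _ IH'] F cF.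
- by rewrite (_ : (fun _ => _) = fun x => c * F x); [exact: cconvZ|apply/funext => x; rewrite mulrC].
- exact: cconv_sin.
- rewrite (_ : (fun _ => _) = fun x => F x * G x + F x * G' x); last by apply/funext => x; rewrite mulrDr.
  by apply: cconvD; [exact: IH|exact: IH'].
- rewrite (_ : (fun _ => _) = fun x => F x * G x * G' x); last by apply/funext => x; rewrite mulrA.
  by apply: IH'; exact: IH.
Qed.

Lemma conv_coshs : conv (@coshs R r).
Proof.
rewrite /coshs; apply: convD; first exact: conv1.
have : forall s : seq 'I_r, conv (fun x => \sum_(i <- s) (expR (x 0 i) + expR (- x 0 i))).
  elim=> [|i s IH].
    by apply: conv_ext (conv_cst 0) => x; rewrite big_nil.
  apply: conv_ext (convD (conv_cosh 1 i conv1) IH) => x.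
  by rewrite big_cons !mul1r.
by apply.
Qed.

Lemma conv_bounded_continuous f C : ccont f -> (forall x, `|f x| <= C) -> ok f -> conv f.
Proof.
move=> cf fC okf; apply: (conv_approx okf conv_coshs) => e e0.
have [G tG fG] := trig_approx cf fC e0; exists G => //.
have [+ _] := cconv_trig tG cconv1.
by apply: conv_ext => x; rewrite mul1r.
Qed.

Lemma conv_lim f : conv f -> En n f @[n --> \oo] --> E f.
Proof.
move=> [_ /(_ 0)]; have e x : f x * expdot 0 x = f x by rewrite /expdot dot0 expR0 mulr1.
by rewrite (E_ext e); under eq_fun do rewrite (En_ext _ e).
Qed.

End ExponentialConvergence.

Section GaussianFunctional.
Variables (R : realType).

(** Fixing one coordinate leaves a Gaussian of one dimension less, up to a constant factor; so all
    iterated sections of a Gaussian are integrable. *)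
Lemma gauss_section r (B : 'M[R]_(1 + r)) s x : posdef B -> exists k (B' : 'M[R]_r) s', posdef B' /\
  forall b, expR (qform B s (row_mx x%:M b) - qform B (row_mx x%:M b) (row_mx x%:M b) / 2) =
    expR k * expR (qform B' s' b - qform B' b b / 2).
Proof.
move=> Bp; have [x11 [c [B' [BE Bp']]]] := posdef_block Bp.
have [[dB' _] [Bs' _]] := (integral_gauss 0 Bp', Bp').
have uB' : B' \in unitmx by rewrite unitmxE unitfE gt_eqF.
pose d := c *m invmx B'.
have qd b : qform B' d b = (c *m b^T) 0 0 by rewrite /qform /d mulmxKV.
have [s1 [s' sE]] : exists s1 (s' : 'rV[R]_r), s = row_mx (s1%:M : 'M[R]_1) s'.
  exists (s 0 ord0), (\row_j s 0 (lift ord0 j)); apply/rowP => i.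
  by case: (unliftP ord0 i) => [j ->|->]; rewrite ?row_mxSE ?row_mx0E ?mxE.
exists (s1 * x * x11 + x * (c *m s'^T) 0 0 - x * x * x11 / 2), B', (s' + (s1 - x) *: d).
split=> // b; rewrite -expRD; congr expR.
rewrite sE BE !qform_block qformDl qformZl qd.
by field.
Qed.

Lemma sections_integrable_gauss r (B : 'M[R]_r) s : posdef B ->
  sections_integrable (fun b => (expR (qform B s b - qform B b b / 2))%:E).
Proof.
have int1 t (C : 'M[R]_t) v : posdef C ->
    (mur R t).-integrable setT ((fun b => (expR (qform C v b - qform C b b / 2))%:E) \o @vec R t).
  move=> Cp; apply/integrableP; split; first exact: rmeas_qexp.
  have [_ I] := integral_gauss v Cp.
  apply: (@le_lt_trans _ _ (\int[mur R t]_p (expR (qform C v (vec p) - qform C (vec p) (vec p) / 2))%:E)%E).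
    by rewrite le_eqVlt; apply/orP; left; apply/eqP/eq_integral => p _ /=; rewrite ger0_norm ?expR_ge0.
  by rewrite I ltry.
elim: r B s => [|r IH] B s Bp; first exact: int1.
split; first exact: int1.
move=> x; have [k [B' [s' [Bp' E]]]] := gauss_section s x Bp.
have := sections_integrableZ (expR k) (IH B' s' Bp').
congr sections_integrable; apply/funext => b; rewrite -EFinM.
by congr (_%:E); rewrite -E.
Qed.

Variable (r : nat).
Local Notation rV := 'rV[R]_r.
Implicit Types (F G : rV -> R) (t b : rV).

Definition fmeas F := measurable_fun [set: projT2 (Rn R r)] (fun p => F (vec p)).
Definition expsum (l : seq (R * rV)) b : R := \sum_(q <- l) q.1 * expdot q.2 b.
(** The class on which the Gaussian functional is linear and monotone: closed under products, since
    products of exponentials are exponentials, and integrable against the Gaussian. *)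
Definition tame F := fmeas F /\ exists l, forall b, `|F b| <= expsum l b.

Lemma fmeas_dot t : fmeas (dot t).
Proof. by apply: measurable_sum => i; apply: measurable_funM; [exact: measurable_cst|exact: measurable_vec]. Qed.

Lemma tame_exp t : tame (expdot t).
Proof.
split; first by apply: measurableT_comp => //; exact: fmeas_dot.
by exists [:: (1, t)] => b; rewrite /expsum big_seq1 mul1r ger0_norm ?expR_ge0.
Qed.

Lemma tame_lin c F G : tame F -> tame G -> tame (fun b => c * F b + G b).
Proof.
move=> [mF [l lF]] [mG [l' lG]]; split.
  by apply: measurable_funD => //; apply: measurable_funM => //; exact: measurable_cst.
exists ([seq (`|c| * q.1, q.2) | q <- l] ++ l') => b; rewrite /expsum big_cat big_map /=.
apply: le_trans (ler_normD _ _) _; apply: lerD; last exact: lG.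
rewrite normrM; under eq_bigr do rewrite -mulrA.
by rewrite -mulr_sumr ler_wpM2l.
Qed.

Lemma tameM F G : tame F -> tame G -> tame (fun b => F b * G b).
Proof.
move=> [mF [l lF]] [mG [l' lG]]; split; first exact: measurable_funM.
exists [seq (q.1 * q'.1, q.2 + q'.2) | q <- l, q' <- l'] => b.
rewrite /expsum big_allpairs_dep normrM; apply: le_trans (ler_pM _ _ (lF b) (lG b)) _ => //.
rewrite mulr_suml; apply: ler_sum => q _; rewrite mulr_sumr; apply: ler_sum => q' _ /=.
by rewrite /expdot dotD expRD mulrACA.
Qed.

Lemma tame_cst c : tame (fun=> c).
Proof.
split; first exact: measurable_cst.
by exists [:: (`|c|, 0)] => b; rewrite /expsum big_seq1 /expdot dot0 expR0 mulr1.
Qed.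

Lemma tame_le F G : fmeas F -> tame G -> (forall b, `|F b| <= G b) -> tame F.
Proof.
move=> mF [_ [l lG]] FG; split=> //; exists l => b.
apply: le_trans (FG b) _; apply: le_trans (lG b); exact: ler_norm.
Qed.

Lemma tameD F G : tame F -> tame G -> tame (fun b => F b + G b).
Proof.
move=> tF tG; rewrite (_ : (fun _ => _) = fun b => 1 * F b + G b); first exact: tame_lin.
by apply/funext => b; rewrite mul1r.
Qed.

Lemma tameZ c F : tame F -> tame (fun b => c * F b).
Proof.
move=> tF; rewrite (_ : (fun _ => _) = fun b => c * F b + 0); first exact: (tame_lin c tF (tame_cst 0)).
by apply/funext => b; rewrite addr0.
Qed.

Lemma tame_sum I (s : seq I) (F : I -> rV -> R) : (forall i, tame (F i)) ->
  tame (fun b => \sum_(i <- s) F i b).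
Proof.
move=> tF; elim: s => [|i s IH].
  by rewrite (_ : (fun _ => _) = fun=> 0); [exact: tame_cst|apply/funext => b; rewrite big_nil].
rewrite (_ : (fun _ => _) = fun b => F i b + \sum_(j <- s) F j b); first exact: tameD.
by apply/funext => b; rewrite big_cons.
Qed.

Lemma tame_prod I (s : seq I) (F : I -> rV -> R) : (forall i, tame (F i)) ->
  tame (fun b => \prod_(i <- s) F i b).
Proof.
move=> tF; elim: s => [|i s IH].
  by rewrite (_ : (fun _ => _) = fun=> 1); [exact: tame_cst|apply/funext => b; rewrite big_nil].
rewrite (_ : (fun _ => _) = fun b => F i b * \prod_(j <- s) F j b); first exact: tameM.
by apply/funext => b; rewrite big_cons.
Qed.

Lemma tame_cosh t : tame (fun b => expR (dot t b) + expR (- dot t b)).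
Proof.
apply: (tameD (tame_exp t)); rewrite (_ : (fun _ => _) = expdot (- t)); first exact: tame_exp.
apply/funext => b; rewrite /expdot; congr expR; rewrite /dot -sumrN.
by apply: eq_bigr => i _; rewrite mxE mulNr.
Qed.

Lemma tame_dot t : tame (dot t).
Proof.
apply: (tame_le (fmeas_dot t) (tame_cosh t)) => b.
exact: le_trans (norm_le_expR _) (expR_cosh_le _).
Qed.

Lemma tame_coord i : tame (fun b => b 0 i).
Proof.
rewrite (_ : (fun _ => _) = dot (1 *: delta_mx 0 i)); first exact: tame_dot.
by apply/funext => b; rewrite dot_delta mul1r.
Qed.

Lemma tame_bounded F c : fmeas F -> (forall b, `|F b| <= c) -> tame F.
Proof. by move=> mF Fc; apply: (tame_le mF (tame_cst c)). Qed.

Lemma tame_sin c i : tame (fun b => sin (c * b 0 i)).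
Proof.
apply: (tame_bounded (c := 1)) => [|b]; last by rewrite ler_norml sin_geN1 sin_le1.
apply: measurableT_comp; first by apply: continuous_measurable_fun; exact: continuous_sin.
by apply: measurable_funM; [exact: measurable_cst|exact: measurable_vec].
Qed.

Lemma tame_norm F : tame F -> tame (fun b => `|F b|).
Proof.
move=> [mF [l lF]]; split; first exact: measurableT_comp.
by exists l => b; rewrite normr_id.
Qed.

(** Measurability comes from trigonometric approximants with error [coshs / (n + 1)], which converge
    pointwise. *)
Lemma tame_continuous f c : ccont f -> (forall b, `|f b| <= c) -> tame f.
Proof.
move=> cf fc; apply: (tame_bounded _ fc).
have e0 n : 0 < n.+1%:R^-1 :> R by rewrite invr_gt0.
pose G n := projT1 (cid2 (trig_approx cf fc (e0 n))).
have tG n : trig (G n) by rewrite /G; case: cid2.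
have fG n b : `|f b - G n b| <= n.+1%:R^-1 * coshs b by rewrite /G; case: cid2.
have mG H : trig H -> fmeas H.
  elim=> {H} [a|a i|H H' _ mH _ mH'|H H' _ mH _ mH'].
  - exact: measurable_cst.
  - by have [] := tame_sin a i.
  - exact: measurable_funD.
  - exact: measurable_funM.
apply: (measurable_fun_cvg (h := fun n p => G n (vec p))) => [n|p _]; first exact: mG.
apply: (cvg_dist_le (v := fun n => n.+1%:R^-1 * coshs (vec p))).
  by apply: nearW => n; rewrite distrC.
rewrite -[X in _ --> X](mul0r (coshs (vec p))); apply: cvgM; last exact: cvg_cst.
exact: cvg_harmonic.
Qed.

Variable B : 'M[R]_r.
Hypothesis Bp : posdef B.

Lemma posdef_det_gt0 : 0 < \det B. Proof. by have [] := integral_gauss 0 Bp. Qed.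

Lemma posdef_unit : B \in unitmx.
Proof. by rewrite unitmxE unitfE gt_eqF // posdef_det_gt0. Qed.

Lemma qform_dot s b : qform B s b = dot (s *m B) b.
Proof. by rewrite /qform mxE; apply: eq_bigr => i _; rewrite [X in _ * X]mxE. Qed.

Lemma dot_qform t b : dot t b = qform B (t *m invmx B) b.
Proof. by rewrite qform_dot mulmxKV // posdef_unit. Qed.

Definition gauss b := expR (- (qform B b b / 2)).

Lemma tame_gauss_integrable F : tame F -> sections_integrable (fun b => (F b * gauss b)%:E).
Proof.
move=> [mF [l lF]].
have mg : fmeas gauss.
  have := rmeas_qexp B 0; move/measurable_EFinP; congr measurable_fun; apply/funext => p.
  by rewrite /gauss qform_dot mul0mx dot0 sub0r.
apply: (sections_integrable_le (g := fun b => (expsum l b * gauss b)%:E)).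
- by apply/measurable_EFinP; exact: measurable_funM.
- move=> b; rewrite lee_fin normrM (ger0_norm (expR_ge0 _)) ler_wpM2r ?expR_ge0 //.
elim: l {lF} => [|q l IH].
  have := sections_integrableZ 0 (sections_integrable_gauss 0 Bp).
  by congr sections_integrable; apply/funext => b; rewrite /expsum big_nil mul0r mul0e.
have := sections_integrableD (sections_integrableZ q.1 (sections_integrable_gauss (q.2 *m invmx B) Bp)) IH.
congr sections_integrable; apply/funext => b; rewrite /expsum big_cons mulrDl EFinD; congr (_ + _)%E.
by rewrite -EFinM -mulrA /expdot dot_qform /gauss -expRD.
Qed.

(** Gaussian expectation without normalization; its total mass is [Zg]. *)
Definition E0 F : R := \int[mur R r]_p (F (vec p) * gauss (vec p)).

Lemma tame_integrable F : tame F ->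
  (mur R r).-integrable setT (EFin \o (fun p => F (vec p) * gauss (vec p))).
Proof. by move=> /tame_gauss_integrable/sections_integrable_int. Qed.

Lemma E0_lin c F G : tame F -> tame G -> E0 (fun b => c * F b + G b) = c * E0 F + E0 G.
Proof.
move=> tF tG; rewrite /E0.
under eq_Rintegral do rewrite mulrDl -mulrA.
rewrite RintegralD //; last exact: tame_integrable.
  by rewrite RintegralZl //; exact: tame_integrable.
by have := tame_integrable (tameZ c tF); congr integrable; apply/funext => p /=; rewrite mulrA.
Qed.

Lemma E0_le F G e : tame F -> tame G -> 0 <= e -> (forall b, `|F b| <= e * G b) -> `|E0 F| <= e * E0 G.
Proof.
move=> tF tG e0 FG; rewrite /E0; apply: le_trans (le_normr_Rintegral _ (tame_integrable tF)) _ => //.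
rewrite -RintegralZl //; last exact: tame_integrable.
apply: le_Rintegral => //.
- have := tame_integrable (tame_norm tF); congr integrable; apply/funext => p /=.
  by rewrite normrM (ger0_norm (expR_ge0 _)).
- by have := tame_integrable (tameZ e tG); congr integrable; apply/funext => p /=; rewrite mulrA.
- by move=> p _; rewrite normrM (ger0_norm (expR_ge0 _)) mulrA ler_wpM2r ?expR_ge0.
Qed.

Definition Zg := Num.sqrt ((2 * pi) ^+ r / \det B).

Lemma Zg_gt0 : 0 < Zg.
Proof. by rewrite sqrtr_gt0 divr_gt0 ?exprn_gt0 ?mulr_gt0 ?pi_gt0 ?posdef_det_gt0. Qed.

Lemma E0_exp s : E0 (fun b => expR (qform B s b)) = Zg * expR (qform B s s / 2).
Proof.
have [_ I] := integral_gauss s Bp; rewrite /E0 /Rintegral.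
rewrite -[RHS]/(fine (Zg * expR (qform B s s / 2))%:E) -I; congr fine.
by apply: eq_integral => p _; rewrite /gauss -expRD.
Qed.

End GaussianFunctional.

(** * The limit density *)

Section WeylDensity.
Variables (R : realType) (K : numFieldType) (g : lieAlgType K) (H : {vspace g}).
Variables (r : nat) (a : r.-tuple g) (iota : {rmorphism R -> K}) (rv : 'rV[R]_r -> g).
Hypothesis D : cartan_data H a iota rv.
Variable ip : 'rV[R]_r -> 'rV[R]_r -> R.
Hypothesis kilE : forall b c, killing (rv b) (rv c) = iota (ip b c).
Local Notation rV := 'rV[R]_r.
Local Notation al := (sroot R).
Local Notation cp := (cpair ip).
Local Notation proots := (pos_roots_seq H rv).
Local Notation rho := (rho H rv).
Local Notation ws := (wseq ip).
Local Notation wg := (wgroup ip).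
Local Notation weyl_prod := (weyl_prod H rv ip).
Implicit Types (F G : rV -> R) (b s u v y : rV).

Definition gramR : 'M[R]_r := \matrix_(i, j) ip (al i) (al j).

Lemma qform_gram b c : qform gramR b c = ip b c.
Proof.
rewrite (gramE D kilE) /qform mxE exchange_big /=; apply: eq_bigr => j _.
rewrite mxE mulr_suml; apply: eq_bigr => i _; rewrite !mxE.
ring.
Qed.

Lemma gram_posdef : posdef gramR.
Proof.
split; first by apply/matrixP => i j; rewrite !mxE (ipC kilE).
by move=> b b0; rewrite qform_gram; exact: (ip_gt0 D kilE).
Qed.

Lemma ip_dot s b : ip s b = dot (s *m gramR) b.
Proof. by rewrite -qform_gram qform_dot. Qed.

Lemma dot_ip t b : dot t b = ip (t *m invmx gramR) b.
Proof. by rewrite (dot_qform gram_posdef) qform_gram. Qed.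

Lemma tame_ip s : tame (ip s).
Proof. by rewrite (_ : ip s = dot (s *m gramR)); [exact: tame_dot|apply/funext => b; rewrite ip_dot]. Qed.

Lemma tame_expip s : tame (fun b => expR (ip s b)).
Proof.
by rewrite (_ : (fun _ => _) = expdot (s *m gramR)); [exact: tame_exp|apply/funext => b; rewrite /expdot ip_dot].
Qed.

Definition root_prod y := \prod_(b <- proots) ip y b.

Lemma tame_root_prod : tame root_prod.
Proof.
apply: tame_prod => c.
by rewrite (_ : (fun _ => _) = ip c); [exact: tame_ip|apply/funext => b; rewrite (ipC kilE)].
Qed.

Lemma root_prod_wgroup y w : wg w -> root_prod (y *m w) = \det w * root_prod y.
Proof.
move=> [s _ <-]; elim: s y => [|i s IH] y; first by rewrite wword_nil mulmx1 det1 mul1r.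
rewrite wword_cons mulmxA IH det_mulmx (det_sreflm D kilE) mulN1r mulNr -mulrN; congr (_ * _).
rewrite (mul_sreflm D kilE) /root_prod !(perm_big _ (perm_proots_rem D i)) !big_cons /= -mulNr.
rewrite (refl_adj D kilE _ _ (sroot_neq0 D i)) (refl_self D kilE (sroot_neq0 D i)) (ipNr D kilE).
congr (_ * _); rewrite -[RHS](perm_big _ (perm_proots_refl D kilE i)) /= big_map.
by apply: eq_bigr => b _; rewrite (refl_adj D kilE _ _ (sroot_neq0 D i)).
Qed.

Lemma strict_root_gt0 y b : strict ip y -> b \in proots -> 0 < ip y b.
Proof.
move=> sy bp; have b0 := proot_neq0 D bp; have /(mem_proots D)[_ bge] := bp.
rewrite [b]row_sum_delta (ip_sumr D kilE) lt_neqAle; apply/andP; split; last first.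
  by apply: sumr_ge0 => i _; rewrite (ipZr D kilE) mulr_ge0 ?bge // ltW // sy.
rewrite eq_sym psumr_eq0; last first.
  by move=> i _; rewrite (ipZr D kilE) mulr_ge0 ?bge // ltW // sy.
apply: contraNN b0 => /allP b0; apply/eqP/rowP => i; rewrite mxE.
have := b0 i (mem_index_enum i); rewrite (ipZr D kilE) mulf_eq0 => /orP[/eqP //|].
by rewrite gt_eqF // sy.
Qed.

Lemma root_prod_gt0 y : strict ip y -> 0 < root_prod y.
Proof.
move=> sy; rewrite /root_prod big_seq; apply: (big_ind (fun x => 0 < x)) => //.
  by move=> x z; exact: mulr_gt0.
by move=> b bp; exact: strict_root_gt0.
Qed.

Lemma weyl_prod_gt0 y : strict ip y -> 0 < weyl_prod y.
Proof.
move=> sy; rewrite /weyl_prod big_seq; apply: (big_ind (fun x => 0 < x)) => //.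
  by move=> x z; exact: mulr_gt0.
move=> b bp; rewrite subr_gt0 ltr_expR.
by have := strict_root_gt0 sy bp; rewrite (ipC kilE); lra.
Qed.

(** Each factor is [d (b, c)] up to order [d^2]. The error bound is [tame], so it can be integrated
    against the Gaussian as well as evaluated at a point. *)
Lemma weyl_prod_approx : exists2 Bd, tame Bd & forall (d : R) b, 0 < d -> d <= 1 ->
  `|weyl_prod (d *: b) / d ^+ size proots - root_prod b| <= d * Bd b.
Proof.
rewrite /weyl_prod /root_prod; elim: (proots : seq rV) => [|c s [Bd tB BdP]].
  exists (fun=> 0); first exact: tame_cst.
  by move=> d b d0 d1; rewrite !big_nil expr0 divr1 subrr normr0 mulr0.
pose P b := \prod_(c <- s) ip b c.
pose ch b := expR (ip c b) + expR (- ip c b).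
have tc : tame (fun b => ip b c).
  by rewrite (_ : (fun _ => _) = ip c); [exact: tame_ip|apply/funext => b; rewrite (ipC kilE)].
have tP : tame P.
  apply: tame_prod => c'.
  by rewrite (_ : (fun _ => _) = ip c'); [exact: tame_ip|apply/funext => b; rewrite (ipC kilE)].
have tch : tame ch.
  apply: tameD; first exact: tame_expip.
  rewrite (_ : (fun _ => _) = fun b => expR (ip (- c) b)); first exact: tame_expip.
  by apply/funext => b; rewrite (ipNl D kilE).
exists (fun b => ip b c ^+ 2 * ch b * (`|P b| + Bd b) + `|ip b c| * Bd b).
  apply: tameD; last by apply: tameM => //; exact: tame_norm.
  apply: tameM; last by apply: tameD => //; exact: tame_norm.
  by apply: tameM => //; apply: tameM.
move=> d b d0 d1; have := BdP d b d0 d1; rewrite !big_cons (ipZr D kilE) (ipC kilE c b).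
set Pn := \prod_(_ <- s) (_ - _); rewrite -/(P b) /= => h.
have := sinh_ratio_le (ip b c) d0 d1; set S := (expR _ - expR _) => hS.
have -> : S * Pn / d ^+ (size s).+1 - ip b c * P b =
    (S / d - ip b c) * (Pn / d ^+ size s) + ip b c * (Pn / d ^+ size s - P b).
  by rewrite exprS; field; rewrite ?expf_neq0 ?gt_eqF.
apply: le_trans (ler_normD _ _) _; rewrite (normrM (S / d - _)) (normrM (ip b c)) mulrDr; apply: lerD; last first.
  by rewrite mulrCA ler_wpM2l.
rewrite (mulrA d); apply: ler_pM => //.
  apply: le_trans hS _; rewrite ler_wpM2l ?(ltW d0) // ler_wpM2l ?sqr_ge0 //.
  by rewrite (ipC kilE b c); exact: expR_cosh_le.
have Bd0 : 0 <= Bd b by rewrite -(pmulr_rge0 _ d0); apply: le_trans h.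
have := ler_normD (Pn / d ^+ size s - P b) (P b); rewrite subrK => /le_trans; apply.
by rewrite addrC lerD2l; apply: le_trans h _; rewrite ler_piMl.
Qed.

Let gp := gram_posdef.
Local Notation E0 := (E0 gramR).
Local Notation Zg := (Zg gramR).

Lemma E0_sum I (s : seq I) (c : I -> R) (F : I -> rV -> R) : (forall i, tame (F i)) ->
  E0 (fun b => \sum_(i <- s) c i * F i b) = \sum_(i <- s) c i * E0 (F i).
Proof.
move=> tF; have E00 : E0 (fun=> 0) = 0.
  have := E0_lin gp (-1) (tame_cst r 0) (tame_cst r 0).
  by rewrite (_ : (fun _ => _) = fun=> 0); [rewrite mulN1r addNr|apply/funext => b; rewrite mulr0 addr0].
elim: s => [|i s IH]; first by rewrite big_nil -[RHS]E00; congr E0; apply/funext => b; rewrite big_nil.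
rewrite big_cons -IH -(E0_lin gp) //; last by apply: tame_sum => j; exact: tameZ.
by congr E0; apply/funext => b; rewrite big_cons.
Qed.

Lemma E0_expip s : E0 (fun b => expR (ip s b)) = Zg * expR (ip s s / 2).
Proof.
have := E0_exp gp s; rewrite qform_gram => <-; congr E0; apply/funext => b.
by rewrite qform_gram.
Qed.

(** Replace [root_prod] by the rescaled denominator [weyl_prod (d b) / d^N]. This is an alternating
    sum of exponentials, whose Gaussian integrals are explicit and, as all [rho w] have equal norm,
    recombine to the same denominator at [v]; then let [d] tend to 0. *)
Lemma E0_root_prod v : E0 (fun b => root_prod b * expR (ip v b)) = Zg * (root_prod v * expR (ip v v / 2)).
Proof.
have [Bd tB BdP] := weyl_prod_approx.
pose d n : R := n.+1%:R^-1; have d0 n : 0 < d n by rewrite invr_gt0.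
have d1 n : d n <= 1 by rewrite invf_le1 // ler1n.
have dc : d n @[n --> \oo] --> 0 by exact: cvg_harmonic.
pose N := size proots.
pose Fn n b := weyl_prod (d n *: b) / d n ^+ N * expR (ip v b).
have FnE n : Fn n = fun b => \sum_(w <- ws) (\det w / d n ^+ N) * expR (ip (v + d n *: (rho *m w)) b).
  apply/funext => b; rewrite /Fn (weyl_prod_altsum D kilE) /altsum !mulr_suml; apply: eq_bigr => w _.
  by rewrite (ipDl D kilE) (ipZl D kilE) (ipZr D kilE) expRD; ring.
have tFn n : tame (Fn n).
  by rewrite FnE; apply: tame_sum => w; apply: tameZ; exact: tame_expip.
have E0Fn n : E0 (Fn n) = Zg * (weyl_prod (d n *: v) / d n ^+ N * (expR (ip v v / 2) * expR (d n ^+ 2 * ip rho rho / 2))).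
  rewrite FnE E0_sum; last by move=> w; exact: tame_expip.
  rewrite (weyl_prod_altsum D kilE) /altsum !mulr_suml mulr_sumr big_seq [RHS]big_seq.
  apply: eq_bigr => w /(mem_wseq D kilE) ww; rewrite E0_expip.
  have -> : ip (v + d n *: (rho *m w)) (v + d n *: (rho *m w)) / 2 =
      ip (rho *m w) (d n *: v) + ip v v / 2 + d n ^+ 2 * ip rho rho / 2.
    move: (ip_wgroup D kilE rho rho ww); move: (rho *m w) (ip rho rho) => y q yy.
    rewrite !(ipDl D kilE) !(ipDr D kilE) !(ipZl D kilE) !(ipZr D kilE) yy (ipC kilE v y).
    by field.
  by rewrite !expRD; ring.
have tF : tame (fun b => root_prod b * expR (ip v b)).
  by apply: tameM; [exact: tame_root_prod|exact: tame_expip].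
have lim1 : E0 (Fn n) @[n --> \oo] --> E0 (fun b => root_prod b * expR (ip v b)).
  have tBe : tame (fun b => Bd b * expR (ip v b)) by apply: tameM => //; exact: tame_expip.
  apply: (cvg_dist_le (v := fun n => d n * E0 (fun b => Bd b * expR (ip v b)))).
    apply: nearW => n.
    have -> : E0 (Fn n) - E0 (fun b => root_prod b * expR (ip v b)) =
        E0 (fun b => (-1) * (root_prod b * expR (ip v b)) + Fn n b).
      by rewrite (E0_lin gp) // mulN1r addrC.
    apply: (E0_le gp) => //; [exact: tame_lin|exact: ltW|move=> b].
    rewrite mulN1r addrC /Fn -mulrBl normrM (ger0_norm (expR_ge0 _)) mulrA ler_wpM2r ?expR_ge0 //.
    exact: BdP.
  rewrite -[X in _ --> X](mul0r (E0 (fun b => Bd b * expR (ip v b)))).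
  by apply: cvgM => //; exact: cvg_cst.
have lim2 : E0 (Fn n) @[n --> \oo] --> Zg * (root_prod v * (expR (ip v v / 2) * expR (0 * 0 * ip rho rho / 2))).
  rewrite (_ : (fun n => E0 (Fn n)) = fun n => Zg * (weyl_prod (d n *: v) / d n ^+ N *
      (expR (ip v v / 2) * expR (d n * d n * ip rho rho / 2)))); last first.
    by apply/funext => n; rewrite E0Fn expr2.
  apply: cvgM; first exact: cvg_cst.
  apply: cvgM; last first.
    apply: cvgM; first exact: cvg_cst.
    apply: cvg_expR; apply: cvgM; last exact: cvg_cst.
    by apply: cvgM; [apply: cvgM|exact: cvg_cst].
  apply: (cvg_dist_le (v := fun n => d n * Bd v)); first by apply: nearW => n; exact: BdP.
  by rewrite -[X in _ --> X](mul0r (Bd v)); apply: cvgM => //; exact: cvg_cst.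
by have := cvg_unique _ lim1 lim2 => /= ->; rewrite ?mul0r ?expR0 ?mulr1.
Qed.

Lemma fmeas_mulmx F (A : 'M[R]_r) : fmeas F -> fmeas (fun b => F (b *m A)).
Proof.
move=> mF; apply/measurable_EFinP; apply: (rmeas_coords (phi := fun b => b *m A) (f := fun b => (F b)%:E)).
  move=> i; rewrite (_ : (fun p => _) = fun p => dot (\row_j A j i) (vec p)); first exact: fmeas_dot.
  by apply/funext => p; rewrite mxE; apply: eq_bigr => j _; rewrite mxE mulrC.
exact/measurable_EFinP.
Qed.

Lemma gauss_wgroup b w : wg w -> gauss gramR (b *m w) = gauss gramR b.
Proof. by move=> ww; rewrite /gauss !qform_gram (ip_wgroup D kilE). Qed.

Lemma fmeas_gauss : fmeas (gauss gramR).
Proof.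
rewrite (_ : gauss gramR = fun b => expR (- (ip b b / 2))); last by apply/funext => b; rewrite /gauss qform_gram.
have mi : fmeas (fun b => ip b b).
  rewrite (_ : (fun _ => _) = fun b => \sum_i b 0 i * ip (al i) b).
    apply: measurable_sum => i; apply: measurable_funM; first exact: measurable_vec.
    by have [] := tame_ip (al i).
  apply/funext => b; rewrite {1}[b]row_sum_delta (ip_suml D kilE); apply: eq_bigr => i _.
  by rewrite (ipZl D kilE).
apply: measurableT_comp => //; apply: measurableT_comp => //.
by apply: measurable_funM => //; exact: measurable_cst.
Qed.

(** In coordinates along the simple roots the reflection changes coordinate [i] only, reflecting it
    in a point that depends on the other coordinates; so [integral_coord_refl_any] applies, and the
    Gaussian factor is invariant. *)
Lemma E0_sreflm i F : fmeas F -> E0 (fun b => F (b *m sreflm ip i)) = E0 F.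
Proof.
move=> mF; pose c b := 2 * b 0 i - cp b (al i).
have cE b : b *m sreflm ip i = coord_refl i c b.
  rewrite (mul_sreflm D kilE) reflE /coord_refl /c addrAC subrr add0r scaleNr.
  by [].
rewrite /E0 /Rintegral; congr fine.
pose f b := (F b * gauss gramR b)%:E.
have mf : rmeas f by apply/measurable_EFinP; apply: measurable_funM => //; exact: fmeas_gauss.
transitivity (\int[mur R r]_p f (coord_refl i c (vec p)))%E.
  apply: eq_integral => p _; rewrite /f -cE gauss_wgroup //; exact: wgroup_sreflm.
have cpE b : cp b (al i) = 2 / ip (al i) (al i) * ip (al i) b.
  by rewrite cpairE (ipC kilE b); ring.
have a0 : ip (al i) (al i) != 0 by rewrite gt_eqF // (ip_gt0 D kilE) // (sroot_neq0 D).
apply: integral_coord_refl_any => //.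
  move=> b t; rewrite /c !cpE (ipDr D kilE) (ipZr D kilE) addZ_deltaE eqxx mulr1.
  by field.
rewrite (_ : (fun p => _) = fun p => 2 * vec p 0 i - 2 / ip (al i) (al i) * ip (al i) (vec p)); last first.
  by apply/funext => p; rewrite /c cpE.
apply: measurable_funB; apply: measurable_funM; try exact: measurable_cst; first exact: measurable_vec.
by have [] := tame_ip (al i).
Qed.

Lemma E0_wgroup w F : wg w -> fmeas F -> E0 (fun b => F (b *m w)) = E0 F.
Proof.
move=> [s _ <-] mF; elim: s => [|i s IH].
  by congr E0; apply/funext => b; rewrite wword_nil mulmx1.
rewrite -IH -(E0_sreflm i (fmeas_mulmx (wword ip s) mF)).
by congr E0; apply/funext => b; rewrite wword_cons mulmxA.
Qed.

Definition altexp u b := \sum_(w <- ws) \det w * expR (ip b (u *m w)).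
(** The limit density stripped of constants and of the Gaussian factor. Both factors are
    antisymmetric in [b], so the product is invariant under the Weyl group. *)
Definition density u b := root_prod b * altexp u b.

Lemma altexp_wgroup u b w : wg w -> altexp u (b *m w) = \det w * altexp u b.
Proof.
move=> ww; rewrite /altexp -(perm_big _ (perm_wseq_mul D kilE ww)) big_map mulr_sumr.
by apply: eq_bigr => w' _; rewrite det_mulmx mulmxA (ip_wgroup D kilE) //; ring.
Qed.

Lemma density_wgroup u b w : wg w -> density u (b *m w) = density u b.
Proof.
move=> ww; rewrite /density altexp_wgroup // root_prod_wgroup // mulrACA.
by rewrite (det_wgroup_sqr D kilE ww) mul1r.
Qed.

Lemma tame_altexp u : tame (altexp u).
Proof.
apply: tame_sum => w; apply: tameZ.
rewrite (_ : (fun _ => _) = fun b => expR (ip (u *m w) b)); first exact: tame_expip.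
by apply/funext => b; rewrite (ipC kilE).
Qed.

Lemma tame_density u : tame (density u).
Proof. by apply: tameM; [exact: tame_root_prod|exact: tame_altexp]. Qed.

Lemma tame_dom : tame (\1_(dom ip) : rV -> R).
Proof.
rewrite (_ : \1_(dom ip) = fun b => \prod_i (\1_`[0, +oo[%classic (ip (al i) b) : R)); last first.
  apply/funext => b; rewrite indicE.
  have [db|ndb] := pselect (dom ip b).
    rewrite mem_set // big1 // => i _; rewrite indicE mem_set //=.
    by rewrite in_itv /= andbT (ipC kilE).
  rewrite memNset //; have /existsNP[i /negP ni] := ndb.
  rewrite (bigD1 i) //= indicE memNset ?mul0r //= in_itv /= andbT (ipC kilE).
  exact/negP.
apply: tame_prod => i; apply: (tame_bounded (c := 1)).
  by apply: measurableT_comp; [exact: measurable_indic|have [] := tame_ip (al i)].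
by move=> b; rewrite indicE; case: (_ \in _); rewrite ?normr1 ?normr0.
Qed.

(** The dominant image lies strictly inside the chamber because [root_prod] does not vanish, and
    strictly dominant points have trivial stabilizer. *)
Lemma count_chambers b : root_prod b != 0 -> \sum_(w <- ws) (\1_(dom ip) (b *m w) : R) = 1.
Proof.
move=> pb; have [w ww dw] := dom_ex D kilE b.
have sw : strict ip (b *m w).
  move=> i; rewrite lt_neqAle dw andbT eq_sym; apply: contraNneq pb => bi.
  have : root_prod (b *m w) = 0.
    by rewrite /root_prod (perm_big _ (perm_proots_rem D i)) big_cons; apply/eqP; rewrite mulf_eq0; apply/orP; left; exact/eqP.
  rewrite root_prod_wgroup // => /eqP; rewrite mulf_eq0 => /orP[/eqP d0|//].
  by have := det_wgroup_sqr D kilE ww; rewrite d0 mul0r => /eqP; rewrite eq_sym oner_eq0.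
have win : w \in ws by apply/(mem_wseq D kilE).
rewrite (bigD1_seq w) ?wseq_uniq //= indicE mem_set // big_seq_cond big1 ?addr0 // => w'.
move=> /andP[/(mem_wseq D kilE) ww' w'w]; rewrite indicE memNset // => dw'.
have [v wv [wK Kw]] := wgroupV D kilE ww.
have e : b *m w *m (v *m w') = b *m w' by rewrite mulmxA -(mulmxA b) wK mulmx1.
have bw' : b *m w *m (v *m w') = b *m w.
  by apply: (dom_wgroup_eq D kilE dw); [exact: wgroupM|rewrite e].
have := strict_dom_stab D kilE sw (wgroupM wv ww') bw' => /(congr1 (mulmx w)).
by rewrite mulmxA wK mul1mx mulmx1 => e'; rewrite e' eqxx in w'w.
Qed.

(** The walls are shared between chambers, but [density] contains [root_prod] and vanishes there, so
    the integrand splits exactly over the chambers. *)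
Lemma E0_chamber u F : tame F -> (forall b w, wg w -> F (b *m w) = F b) ->
  E0 (fun b => density u b * F b) = (size ws)%:R * E0 (fun b => density u b * F b * \1_(dom ip) b).
Proof.
move=> tF invF; pose G b := density u b * F b * \1_(dom ip) b.
have tG : tame G by apply: tameM; [apply: tameM => //; exact: tame_density|exact: tame_dom].
have -> : E0 (fun b => density u b * F b) = E0 (fun b => \sum_(w <- ws) 1 * G (b *m w)).
  congr E0; apply/funext => b.
  transitivity (density u b * F b * \sum_(w <- ws) (\1_(dom ip) (b *m w) : R)).
    have [p0|/count_chambers ->] := eqVneq (root_prod b) 0; last by rewrite mulr1.
    by rewrite /density p0 !mul0r.
  rewrite mulr_sumr big_seq [RHS]big_seq; apply: eq_bigr => w /(mem_wseq D kilE) ww.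
  by rewrite mul1r /G density_wgroup // invF.
have tGw w : w \in ws -> tame (fun b => G (b *m w)).
  move=> /(mem_wseq D kilE) ww; apply: tameM; last first.
    apply: (tame_bounded (c := 1)); first by apply: fmeas_mulmx; have [] := tame_dom.
    by move=> b; rewrite indicE; case: (_ \in _); rewrite ?normr1 ?normr0.
  rewrite (_ : (fun _ => _) = fun b => density u b * F b); first by apply: tameM => //; exact: tame_density.
  by apply/funext => b; rewrite density_wgroup // invF.
(* [E0_sum] asks for tame summands at every matrix, so those outside the group are set to 0. *)
pose Gw w : rV -> R := if w \in ws then fun b => G (b *m w) else fun=> 0.
have -> : E0 (fun b => \sum_(w <- ws) 1 * G (b *m w)) = E0 (fun b => \sum_(w <- ws) 1 * Gw w b).
  congr E0; apply/funext => b; rewrite big_seq [RHS]big_seq; apply: eq_bigr => w ww.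
  by rewrite /Gw ww.
rewrite E0_sum; last by move=> w; rewrite /Gw; case: ifP => [/tGw//|_]; exact: tame_cst.
transitivity (\sum_(w <- ws) E0 G).
  rewrite big_seq [RHS]big_seq; apply: eq_bigr => w win; rewrite mul1r /Gw win.
  by apply: E0_wgroup; [exact/(mem_wseq D kilE)|have [] := tG].
by rewrite big_const_seq count_predT iter_addr_0 mulr_natl.
Qed.

(** Each term is [E0_root_prod] at [u w + s], brought back to [u + s w^-1]; the two signs cancel.
    The result has the shape of the limit of [En_exp]. *)
Lemma E0_density_exp u s : E0 (fun b => density u b * expR (ip s b)) =
  Zg * \sum_(w <- ws) root_prod (u + s *m invmx w) * expR (ip (u + s *m invmx w) (u + s *m invmx w) / 2).
Proof.
have -> : (fun b => density u b * expR (ip s b)) =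
    fun b => \sum_(w <- ws) \det w * (root_prod b * expR (ip (u *m w + s) b)).
  apply/funext => b; rewrite /density /altexp mulrAC mulr_sumr; apply: eq_bigr => w _.
  by rewrite (ipDl D kilE) expRD (ipC kilE b); ring.
rewrite E0_sum; last by move=> w; apply: tameM; [exact: tame_root_prod|exact: tame_expip].
rewrite mulr_sumr big_seq [RHS]big_seq; apply: eq_bigr => w /(mem_wseq D kilE) ww.
rewrite E0_root_prod.
have wu : w \in unitmx.
  by rewrite unitmxE; have [->|->] := det_wgroup D kilE ww; rewrite ?unitr1 ?unitrN1.
have -> : u *m w + s = (u + s *m invmx w) *m w by rewrite mulmxDl mulmxKV.
rewrite root_prod_wgroup // (ip_wgroup D kilE) //.
have := det_wgroup_sqr D kilE ww; move: (\det w) (root_prod _) (expR _) => d p e dd.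
transitivity (d * d * (Zg * (p * e))); first by ring.
by rewrite dd mul1r.
Qed.

End WeylDensity.

Lemma cvg_bigsum (R : realType) I (s : seq I) (F : nat -> I -> R) (l : I -> R) :
  (forall i, F n i @[n --> \oo] --> l i) ->
  \sum_(i <- s) F n i @[n --> \oo] --> \sum_(i <- s) l i.
Proof.
move=> Fl; elim: s => [|i s IH].
  by rewrite big_nil (_ : (fun _ => _) = fun=> 0); [exact: cvg_cst|apply/funext => n; rewrite big_nil].
rewrite big_cons (_ : (fun _ => _) = fun n => F n i + \sum_(j <- s) F n j); first exact: cvgD.
by apply/funext => n; rewrite big_cons.
Qed.

Lemma cvg_bigprod (R : realType) I (s : seq I) (F : nat -> I -> R) (l : I -> R) :
  (forall i, F n i @[n --> \oo] --> l i) ->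
  \prod_(i <- s) F n i @[n --> \oo] --> \prod_(i <- s) l i.
Proof.
move=> Fl; elim: s => [|i s IH].
  by rewrite big_nil (_ : (fun _ => _) = fun=> 1); [exact: cvg_cst|apply/funext => n; rewrite big_nil].
rewrite big_cons (_ : (fun _ => _) = fun n => F n i * \prod_(j <- s) F n j); first exact: cvgM.
by apply/funext => n; rewrite big_cons.
Qed.

(** * The limit of the character measures *)

Section ChamberConvergence.
Variables (R : realType) (K : numFieldType) (g : lieAlgType K) (H : {vspace g}).
Variables (r : nat) (a : r.-tuple g) (iota : {rmorphism R -> K}) (rv : 'rV[R]_r -> g).
Hypothesis D : cartan_data H a iota rv.
Variable ip : 'rV[R]_r -> 'rV[R]_r -> R.
Hypothesis kilE : forall b c, killing (rv b) (rv c) = iota (ip b c).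
Local Notation rV := 'rV[R]_r.
Local Notation proots := (pos_roots_seq H rv).
Local Notation rho := (rho H rv).
Local Notation ws := (wseq ip).
Local Notation wg := (wgroup ip).
Local Notation weyl_prod := (weyl_prod H rv ip).
Local Notation root_prod := (root_prod H rv ip).
Local Notation density := (density H rv ip).
Local Notation hwrep := (hwrep H rv).
Local Notation wtmod := (wtmod H rv).
Local Notation charsum := (charsum H rv).
Local Notation altsum := (altsum ip).
Local Notation gramR := (gramR ip).
Let gp : posdef gramR := gram_posdef D kilE.
Implicit Types (F G : rV -> R) (b s u v y : rV).

(** The dominant representative of the orbit of [b]; composing with it extends [h] to an invariant
    function on the whole space. *)
Definition domv b := b *m xget 1%:M [set w | wg w /\ dom ip (b *m w)].

Lemma domvP b : exists w, [/\ wg w, domv b = b *m w & dom ip (domv b)].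
Proof.
have [w ww dw] := dom_ex D kilE b.
have [] := xgetPex 1%:M (P := [set w | wg w /\ dom ip (b *m w)]); first by exists w.
by move=> wx dx; exists (xget 1%:M [set w | wg w /\ dom ip (b *m w)]).
Qed.

Lemma domv_wgroup_le b w i : wg w -> (b *m w) 0 i <= domv b 0 i.
Proof.
move=> ww; have [w' [ww' -> dd]] := domvP b; have [v wv [wK Kw]] := wgroupV D kilE ww'.
have -> : b *m w = b *m w' *m (v *m w) by rewrite mulmxA -(mulmxA b) wK mulmx1.
by apply: (dom_wgroup_le D kilE); [move: dd|exact: wgroupM].
Qed.

Lemma domv_id b : dom ip b -> domv b = b.
Proof.
by move=> db; have [w [ww e dd]] := domvP b; rewrite e; apply: (dom_wgroup_eq D kilE) => //; rewrite -e.
Qed.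

Lemma domv_wgroup b w : wg w -> domv (b *m w) = domv b.
Proof.
move=> ww; apply/rowP => i; apply: le_anti; apply/andP; split.
  have [w' [ww' -> _]] := domvP (b *m w); rewrite -mulmxA; apply: domv_wgroup_le; exact: wgroupM.
have [w' [ww' -> _]] := domvP b; have [v wv [wK Kw]] := wgroupV D kilE ww.
have -> : b *m w' = b *m w *m (v *m w') by rewrite mulmxA -(mulmxA b) wK mulmx1.
apply: domv_wgroup_le; exact: wgroupM.
Qed.

Let wbound : R := \sum_(w <- ws) \sum_i \sum_j `|w j i|.

Lemma wgroup_near w d x y i : wg w -> coord_near d x y -> 0 <= d ->
  (x *m w) 0 i - (y *m w) 0 i <= wbound * d.
Proof.
move=> ww xy d0.
have <- : ((x - y) *m w) 0 i = (x *m w) 0 i - (y *m w) 0 i by rewrite mulmxBl !mxE.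
rewrite mxE; apply: le_trans (ler_norm _) _; apply: le_trans (ler_norm_sum _ _ _) _.
apply: (@le_trans _ _ (\sum_j `|w j i| * d)).
  by apply: ler_sum => j _; rewrite normrM mulrC ler_wpM2l // !mxE; exact: xy.
rewrite -mulr_suml ler_wpM2r // /wbound (bigD1_seq w) /= ?wseq_uniq //; last exact/(mem_wseq D kilE).
rewrite [X in _ <= X + _](bigD1 i) //= -addrA lerDl addr_ge0 // sumr_ge0 // => k _; rewrite sumr_ge0 // => j _.
by rewrite sumr_ge0.
Qed.

(** Each coordinate of [domv b] is the largest over the orbit, by [domv_wgroup_le], and a maximum of
    Lipschitz functions is Lipschitz. *)
Lemma domv_near d x y : coord_near d x y -> 0 <= d -> coord_near (wbound * d) (domv x) (domv y).
Proof.
move=> xy d0.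
have half x' y' i : coord_near d x' y' -> domv x' 0 i - domv y' 0 i <= wbound * d.
  move=> xy'; have [w [ww -> _]] := domvP x'; apply: le_trans (wgroup_near i ww xy' d0).
  by rewrite lerD2l lerN2; exact: domv_wgroup_le.
have yx : coord_near d y x by move=> i; rewrite distrC.
by move=> i; rewrite ler_norml half // andbT lerNl opprB half.
Qed.

Lemma wbound_ge0 : 0 <= wbound.
Proof. by rewrite /wbound sumr_ge0 // => w _; rewrite sumr_ge0 // => i _; rewrite sumr_ge0. Qed.

Lemma ccont_domv (h : rV -> R) :
  (forall x e, dom ip x -> 0 < e ->
    exists2 d, 0 < d & forall y, dom ip y -> coord_near d x y -> `|h x - h y| <= e) ->
  ccont (h \o domv).
Proof.
move=> hc x e e0; have [_ [_ _ dx]] := domvP x; have [d d0 dP] := hc _ _ dx e0.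
have w1 : 0 < wbound + 1 by rewrite ltr_wpDl ?wbound_ge0.
exists (d / (wbound + 1)); first by rewrite divr_gt0.
move=> y xy; have [_ [_ _ dy]] := domvP y; apply: dP => // i.
apply: le_trans (domv_near xy _ i) _; first by rewrite ltW ?divr_gt0.
by rewrite mulrCA ler_piMr ?(ltW d0) // ler_pdivrMr // mul1r lerDl.
Qed.

Lemma ip_wgroupV b z w : wg w -> ip (b *m w) z = ip b (z *m invmx w).
Proof.
move=> ww; have wu : w \in unitmx.
  by rewrite unitmxE; have [->|->] := det_wgroup D kilE ww; rewrite ?unitr1 ?unitrN1.
by rewrite -(ip_wgroup D kilE b (z *m invmx w) ww) mulmxKV.
Qed.

(** The symmetric sum runs over the whole group, so it can be reindexed relative to each element of
    the alternating sum. *)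
Lemma altsum_mul y z b :
  altsum (fun x => expR (ip x y)) b * \sum_(w <- ws) expR (ip (b *m w) z) =
  \sum_(v <- ws) altsum (fun x => expR (ip x (y + z *m invmx v))) b.
Proof.
rewrite /altsum mulr_suml exchange_big /= big_seq [RHS]big_seq.
apply: eq_bigr => w' /(mem_wseq D kilE) ww'.
rewrite -(perm_big _ (perm_wseq_mull D kilE ww')) big_map mulr_sumr big_seq [RHS]big_seq.
apply: eq_bigr => v /(mem_wseq D kilE) wv.
by rewrite (mulmxA b) (ip_wgroupV _ _ wv) (ipDr D kilE) expRD mulrA.
Qed.

Variables (V : rV -> rep g) (M : nat -> rep g) (delta c : R^nat) (u : rV).
Local Notation ch X y := (charsum X (fun b => expR (ip b y))).
Hypotheses (hV : forall lam, dominant_int ip lam -> hwrep (V lam) lam) (wM : forall n, wtmod (M n)).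
Hypotheses (delta_gt0 : forall n, 0 < delta n) (delta_cvg : delta n @[n --> \oo] --> 0).
Hypotheses (su : strict ip u) (c_neq0 : forall n, c n != 0).
Hypothesis clt : forall s, ch (M n) (delta n *: s) / c n @[n --> \oo] --> expR (ip s s / 2).

Lemma ch_gt0 X y : wtmod X -> (0 < rdim X)%N -> 0 < ch X y.
Proof.
move=> [P [mu Pmu]] X0; rewrite (charsumE D _ Pmu) (bigD1 (Ordinal X0)) //=.
by rewrite ltr_pwDl ?expR_gt0 // sumr_ge0 // => i _; exact: expR_ge0.
Qed.

Variable L : nat -> seq rV.
Hypothesis L_dom : forall n, {in L n, forall lam, dominant_int ip lam}.
Hypothesis L_charsum : forall n F,
  charsum (M n) (Dop proots F) = \sum_(lam <- L n) altsum F (lam + rho).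

(** The mass of one component in the character measure. In [En] the points are shifted by [rho] and
    spread over their orbits without division by the order of the group; [E] is normalized in the
    same way, and [cvg_chamber_sum] divides both. *)
Let q n lam := ch (V lam) (delta n *: u) / ch (M n) (delta n *: u).
Let En n F := \sum_(lam <- L n) q n lam * \sum_(w <- ws) F (delta n *: (lam + rho) *m w).
Let cE := Zg gramR * root_prod u * expR (ip u u / 2).
Let E F := cE^-1 * E0 gramR (fun b => density u b * F b).
Let Ebar F := cE^-1 * E0 gramR (fun b => `|density u b| * F b).

Lemma En_exp n s : En n (fun b => expR (ip s b)) =
  \sum_(v <- ws) (weyl_prod (delta n *: (u + s *m invmx v)) * ch (M n) (delta n *: (u + s *m invmx v))) /
    (weyl_prod (delta n *: u) * ch (M n) (delta n *: u)).
Proof.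
have wp0 : weyl_prod (delta n *: u) != 0.
  rewrite gt_eqF // (weyl_prod_gt0 D kilE) // => i.
  by rewrite (ipZl D kilE) mulr_gt0.
have wME y : weyl_prod y * ch (M n) y = \sum_(lam <- L n) altsum (fun x => expR (ip x y)) (lam + rho).
  by rewrite mulrC -(charsum_Dop_exp D kilE y (wM n)) L_charsum.
rewrite -mulr_suml; under eq_bigr do rewrite wME.
rewrite exchange_big mulr_suml /En big_seq [RHS]big_seq; apply: eq_bigr => lam lL.
have dl := L_dom lL; have hl := hV dl; have [_ wl _] := hl.
transitivity (weyl_prod (delta n *: u) * ch (V lam) (delta n *: u) *
    (\sum_(w <- ws) expR (ip s (delta n *: (lam + rho) *m w))) /
    (weyl_prod (delta n *: u) * ch (M n) (delta n *: u))).
  by rewrite invfM /q -[LHS]mul1r -(mulVf wp0); ring.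
congr (_ / _); rewrite mulrC (mulrC (weyl_prod _)) -(charsum_Dop_exp D kilE _ wl) (charsum_Dop D kilE _ hl) mulrC.
rewrite (_ : \sum_(w <- ws) _ = \sum_(w <- ws) expR (ip ((lam + rho) *m w) (delta n *: s))); last first.
  by apply: eq_bigr => w _; rewrite -scalemxAl (ipZr D kilE) (ipC kilE s) (ipZr D kilE).
rewrite altsum_mul; apply: eq_bigr => v _; apply: eq_bigr => w _.
by rewrite scalerDr -scalemxAl.
Qed.

Lemma cE_gt0 : 0 < cE.
Proof. by rewrite !mulr_gt0 ?expR_gt0 ?(Zg_gt0 gp) ?(root_prod_gt0 D kilE). Qed.

Lemma weyl_prod_ratio y :
  weyl_prod (delta n *: y) / delta n ^+ size proots @[n --> \oo] --> root_prod y.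
Proof.
have [Bd _ BdP] := weyl_prod_approx D kilE.
apply: (cvg_dist_le (v := fun n => delta n * Bd y)).
  apply: filterS (near_norm_le delta_cvg ltr01) => n; rewrite ger0_norm ?(ltW (delta_gt0 n)) // => d1.
  exact: BdP.
by rewrite -[X in _ --> X](mul0r (Bd y)); apply: cvgM => //; exact: cvg_cst.
Qed.

Lemma cvg_En_exp s : En n (fun b => expR (ip s b)) @[n --> \oo] --> E (fun b => expR (ip s b)).
Proof.
rewrite /E (E0_density_exp D kilE).
have -> : cE^-1 * (Zg gramR * \sum_(w <- ws) root_prod (u + s *m invmx w) *
      expR (ip (u + s *m invmx w) (u + s *m invmx w) / 2)) =
    \sum_(w <- ws) (root_prod (u + s *m invmx w) * expR (ip (u + s *m invmx w) (u + s *m invmx w) / 2)) /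
      (root_prod u * expR (ip u u / 2)).
  rewrite -mulr_suml; move: (\sum_(w <- ws) _) => T; rewrite /cE.
  have := root_prod_gt0 D kilE su; have := Zg_gt0 gp; have := expR_gt0 (ip u u / 2).
  move: (Zg gramR) (root_prod u) (expR _) => Z p x x0 Z0 p0.
  by field; rewrite !gt_eqF.
(* Numerator and denominator are divided by the common scales [delta^N] and [c n], so that each has
   a limit. *)
rewrite (_ : (fun n => En n _) = fun n => \sum_(v <- ws)
   ((weyl_prod (delta n *: (u + s *m invmx v)) / delta n ^+ size proots) *
    (ch (M n) (delta n *: (u + s *m invmx v)) / c n)) /
   ((weyl_prod (delta n *: u) / delta n ^+ size proots) * (ch (M n) (delta n *: u) / c n))); last first.
  apply/funext => n; rewrite En_exp; apply: eq_bigr => v _.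
  have : delta n ^+ size proots != 0 by rewrite expf_neq0 // gt_eqF.
  move: (delta n ^+ _) (c_neq0 n) => d; move: (c n) => e e0 d0.
  rewrite !invfM !invrK; transitivity (weyl_prod (delta n *: (u + s *m invmx v)) *
    ch (M n) (delta n *: (u + s *m invmx v)) *
    ((weyl_prod (delta n *: u))^-1 * (ch (M n) (delta n *: u))^-1) * (d^-1 * d) * (e^-1 * e)).
    by rewrite !mulVf ?mulr1.
  by ring.
apply: cvg_bigsum => v.
apply: cvgM; first by apply: cvgM; [exact: weyl_prod_ratio|exact: clt].
apply: cvgV; first by rewrite mulf_neq0 ?gt_eqF ?expR_gt0 ?(root_prod_gt0 D kilE).
by apply: cvgM; [exact: weyl_prod_ratio|exact: clt].
Qed.

Hypothesis M_gt0 : forall n, (0 < rdim (M n))%N.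

Lemma q_ge0 n lam : lam \in L n -> 0 <= q n lam.
Proof.
move=> lL; have [[X0 _] wl _] := hV (L_dom lL).
by rewrite divr_ge0 // ltW // ch_gt0.
Qed.

Lemma En_lin n e F G : En n (fun b => e * F b + G b) = e * En n F + En n G.
Proof.
rewrite /En mulr_sumr -big_split; apply: eq_bigr => lam _ /=.
by rewrite big_split /= -mulr_sumr mulrDr mulrCA.
Qed.

Lemma En_le n F G : (forall b, F b <= G b) -> En n F <= En n G.
Proof.
move=> FG; rewrite /En big_seq [leRHS]big_seq; apply: ler_sum => lam lL.
by rewrite ler_wpM2l ?q_ge0 //; apply: ler_sum.
Qed.

Lemma E_lin e F G : tame F -> tame G -> E (fun b => e * F b + G b) = e * E F + E G.
Proof.
move=> tF tG; have td := tame_density D kilE u.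
rewrite /E mulrCA -mulrDr -(E0_lin gp); [|exact: tameM|exact: tameM].
by congr (_ * E0 _ _); apply/funext => b; ring.
Qed.

Lemma E_le F G e : tame F -> tame G -> 0 <= e -> (forall b, `|F b| <= e * G b) -> `|E F| <= e * Ebar G.
Proof.
move=> tF tG e0 FG; have td := tame_density D kilE u.
have cE0 : 0 <= cE^-1 by rewrite invr_ge0 ltW // cE_gt0.
rewrite /E /Ebar normrM (ger0_norm cE0) mulrCA ler_wpM2l //.
apply: (E0_le gp) => //; [exact: tameM|apply: tameM => //; exact: tame_norm|move=> b].
by rewrite normrM mulrCA ler_wpM2l.
Qed.

Lemma cvg_En_expdot t : En n (expdot t) @[n --> \oo] --> E (expdot t).
Proof.
rewrite (_ : expdot t = fun b => expR (ip (t *m invmx gramR) b)); first exact: cvg_En_exp.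
by apply/funext => b; rewrite /expdot (dot_ip D kilE).
Qed.

Let lin_ok := @tame_lin R r.

Lemma cvg_En_ccont f C : ccont f -> (forall b, `|f b| <= C) -> En n f @[n --> \oo] --> E f.
Proof.
move=> cf fC; apply: (conv_lim (ok := @tame R r)).
apply: (conv_bounded_continuous lin_ok (@tameM R r) (@tame_exp R r) (@tame_coord R r) (@tame_sin R r)
  En_lin En_le E_lin E_le cvg_En_expdot cf fC); exact: tame_continuous cf fC.
Qed.

Lemma cvg_En_coshs : En n (@coshs R r) @[n --> \oo] --> E (@coshs R r).
Proof.
apply: (conv_lim (ok := @tame R r)).
exact: (conv_coshs lin_ok (@tameM R r) (@tame_exp R r) En_lin E_lin cvg_En_expdot).
Qed.

(** The convergence is applied to the invariant extension of [h]. What remains is the shift by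
    [rho]: it moves points by [delta rho], and [uniform_coshs] bounds the change by a small multiple
    of [coshs], whose expectations converge. *)
Lemma cvg_chamber_sum (h : rV -> R) C :
  (forall x e, dom ip x -> 0 < e ->
    exists2 d, 0 < d & forall y, dom ip y -> coord_near d x y -> `|h x - h y| <= e) ->
  (forall x, dom ip x -> `|h x| <= C) ->
  \sum_(lam <- L n) h (delta n *: lam) * q n lam @[n --> \oo] -->
  cE^-1 * E0 gramR (fun b => density u b * h (domv b) * \1_(dom ip) b).
Proof.
move=> hc hC; pose f := h \o domv.
have cf : ccont f by exact: ccont_domv.
have fC b : `|f b| <= C by apply: hC; have [_ [_ _ ?]] := domvP b.
have fw b w : wg w -> f (b *m w) = f b by move=> ww; rewrite /f /= domv_wgroup.
pose W : R := (size ws)%:R.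
have W0 : 0 < W.
  rewrite ltr0n lt0n size_eq0; apply/eqP => e.
  by have /(mem_wseq D kilE) := wgroup1 ip; rewrite e.
have -> : cE^-1 * E0 gramR (fun b => density u b * h (domv b) * \1_(dom ip) b) = E f / W.
  rewrite /E (E0_chamber D kilE _ (tame_continuous cf fC) fw) -/W.
  by rewrite mulrCA (mulrC W) mulfK // gt_eqF.
have EnE n : En n f / W = \sum_(lam <- L n) f (delta n *: (lam + rho)) * q n lam.
  rewrite /En mulr_suml; apply: eq_bigr => lam _.
  rewrite (_ : \sum_(w <- ws) _ = W * f (delta n *: (lam + rho))).
    by rewrite mulrCA mulrAC mulfV ?gt_eqF // mul1r mulrC.
  transitivity (\sum_(w <- ws) f (delta n *: (lam + rho))).
    by rewrite big_seq [RHS]big_seq; apply: eq_bigr => w /(mem_wseq D kilE) ww; rewrite fw.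
  by rewrite big_const_seq count_predT iter_addr_0 mulr_natl.
have cEn : En n f / W @[n --> \oo] --> E f / W.
  by apply: cvgM; [exact: cvg_En_ccont cf fC|exact: cvg_cst].
pose A n := \sum_(lam <- L n) h (delta n *: lam) * q n lam.
rewrite (_ : (fun n => _) = fun n => En n f / W + (A n - En n f / W)); last first.
  by apply/funext => n; rewrite addrC subrK.
rewrite -[X in _ --> X]addr0; apply: cvgD => //.
pose S : R := `|E (@coshs R r)| + 1; have S0 : 0 < S by rewrite ltr_wpDl.
apply/cvgrPdist_le => e e0.
have eS : 0 < e / S by rewrite divr_gt0.
have [d d0 dP] := uniform_coshs cf fC eS.
(* Bounds the coordinates of [rho]; the added 1 keeps it positive. *)
pose rb : R := \sum_i `|rho 0 i| + 1.
have rb0 : 0 < rb by rewrite ltr_wpDl // sumr_ge0.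
have nd := near_norm_le delta_cvg (divr_gt0 d0 rb0).
have nS : \forall n \near \oo, En n (@coshs R r) <= S.
  move/cvgrPdist_le: cvg_En_coshs => /(_ 1 ltr01); apply: filterS => n h1.
  have := le_trans (ler_norm _) (le_trans (ler_normD (En n (@coshs R r) - E (@coshs R r)) (E (@coshs R r))) _).
  by rewrite subrK; apply; rewrite /S addrC lerD2l distrC.
near=> n; rewrite sub0r normrN /A EnE -sumrB.
have hnd : delta n <= d / rb by rewrite -[leLHS]ger0_norm ?(ltW (delta_gt0 n)) //; near: n.
apply: le_trans (ler_norm_sum _ _ _) _.
apply: (@le_trans _ _ (\sum_(lam <- L n) e / S * (q n lam * coshs (delta n *: (lam + rho))))).
  rewrite big_seq [leRHS]big_seq; apply: ler_sum => lam lL.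
  have q0 := q_ge0 lL.
  rewrite -mulrBl normrM (ger0_norm q0) [leRHS]mulrCA [leLHS]mulrC ler_wpM2l //.
  have -> : h (delta n *: lam) = f (delta n *: lam).
    rewrite /f /= domv_id // => i; rewrite (ipZl D kilE) mulr_ge0 ?(ltW (delta_gt0 n)) //.
    exact: (dominant_int_dom D kilE (L_dom lL)).
  rewrite distrC; apply: dP => i; rewrite scalerDr !mxE addrAC subrr add0r normrM.
  rewrite (ger0_norm (ltW (delta_gt0 n))).
  apply: le_trans (ler_pM (ltW (delta_gt0 n)) (normr_ge0 _) hnd (_ : _ <= rb)) _; last first.
    by rewrite divfK // gt_eqF.
  rewrite /rb (bigD1 i) //= mxE -addrA lerDl addr_ge0 // sumr_ge0 //.
rewrite -mulr_sumr; apply: (@le_trans _ _ (e / S * En n (@coshs R r))); last first.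
  have : En n (@coshs R r) <= S by near: n.
  by move=> nSn; rewrite -ler_pdivlMl // invf_div divfK ?gt_eqF.
rewrite ler_wpM2l ?(ltW eS) // /En big_seq [leRHS]big_seq; apply: ler_sum => lam lL.
(* Of the orbit sum in [En] only the identity term is kept, the others being nonnegative. *)
rewrite ler_wpM2l ?q_ge0 // (bigD1_seq 1%:M) ?wseq_uniq //=; last first.
  by apply/(mem_wseq D kilE); exact: wgroup1.
rewrite mulmx1 lerDl sumr_ge0 // => w _; apply: le_trans ler01 _; exact: coshs_ge1.
Unshelve. all: by end_near.
Qed.

End ChamberConvergence.

Section TensorLimit.
Variables (R : realType) (K : numFieldType) (g : lieAlgType K) (H : {vspace g}).
Variables (r : nat) (a : r.-tuple g) (iota : {rmorphism R -> K}) (rv : 'rV[R]_r -> g).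
Hypothesis D : cartan_data H a iota rv.
Variable ip : 'rV[R]_r -> 'rV[R]_r -> R.
Hypothesis kilE : forall b c, killing (rv b) (rv c) = iota (ip b c).
Hypothesis eig : forall n (A : 'M[K]_n), (0 < n)%N -> exists c, eigenvalue A c.
Local Notation rV := 'rV[R]_r.
Local Notation al := (sroot R).
Local Notation proots := (pos_roots_seq H rv).
Local Notation rho := (rho H rv).
Local Notation ws := (wseq ip).
Local Notation wg := (wgroup ip).
Local Notation root_prod := (root_prod H rv ip).
Local Notation density := (density H rv ip).
Local Notation hwrep := (hwrep H rv).
Local Notation wtmod := (wtmod H rv).
Local Notation charsum := (charsum H rv).
Local Notation gramR := (gramR ip).
Local Notation ch X y := (charsum X (fun b => expR (ip b y))).
Let gp : posdef gramR := gram_posdef D kilE.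
Implicit Types (F G : rV -> R) (b s u v y : rV).

Definition wlen (w : 'M[R]_r) : nat :=
  xget 0%N [set n | (exists2 s, wword ip s = w & size s = n) /\
                    forall s : seq 'I_r, wword ip s = w -> (n <= size s)%N].

Lemma det_wlen w : wg w -> \det w = (-1) ^+ wlen w.
Proof.
move=> /reduced_ex[s sw rs].
have [] := xgetPex 0%N (P := [set n | (exists2 s, wword ip s = w & size s = n) /\
                    forall s : seq 'I_r, wword ip s = w -> (n <= size s)%N]).
  exists (size s); split; first by exists s.
  by move=> t tw; apply: rs; rewrite tw sw.
rewrite -/(wlen w) => -[t tw <-] _; by rewrite -tw (det_wword D kilE).
Qed.

(** If [(u, al i) = 0], the reflection in [al i] fixes [u], yet its determinant is -1. *)
Lemma regular_strict u : dom ip u -> (forall w, wg w -> u *m w = u -> w = 1%:M) -> strict ip u.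
Proof.
move=> du ru i; rewrite lt_neqAle du andbT eq_sym; apply/eqP => ui.
have := ru _ (wgroup_sreflm ip i); rewrite (mul_sreflm D kilE) reflE cpairE ui mulr0 mul0r scale0r subr0.
move=> /(_ erefl) /(congr1 determinant); rewrite (det_sreflm D kilE) det1 => e.
by move: e; lra.
Qed.

(** [limit_density] for abstract data. *)
Definition gauss_density u b : R :=
  Num.sqrt (\det gramR) / (2 * pi) `^ (r%:R / 2)
  * ((\big[*%R/1]_(al \in pos_root H rv) ip b al)
     / (\big[*%R/1]_(al \in pos_root H rv) ip u al))
  * (\sum_(w \in wg) (-1) ^+ wlen w * expR (ip b (u *m w)))
  * expR (- (ip b b / 2) - ip u u / 2).

Lemma gauss_densityE u b : gauss_density u b =
  (Zg gramR * root_prod u * expR (ip u u / 2))^-1 * density u b * gauss gramR b.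
Proof.
rewrite /gauss_density !(fsbig_finite _ _ (finite_pos_root D)) -!/(root_prod _).
rewrite (fsbig_finite _ _ (finite_wgroup D kilE)) -/(wseq ip).
have -> : \sum_(w <- ws) (-1) ^+ wlen w * expR (ip b (u *m w)) = altexp ip u b.
  by rewrite /altexp big_seq [RHS]big_seq; apply: eq_bigr => w /(mem_wseq D kilE) /det_wlen ->.
have -> : Num.sqrt (\det gramR) / (2 * pi) `^ (r%:R / 2) = (Zg gramR)^-1.
  have p0 : 0 <= 2 * pi :> R by rewrite mulr_ge0 ?pi_ge0.
  rewrite powRrM powR_mulrn // powR12_sqrt ?exprn_ge0 //.
  rewrite /Zg sqrtrM ?exprn_ge0 // sqrtrV ?(ltW (posdef_det_gt0 gp)) //.
  by rewrite invfM invrK mulrC.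
by rewrite expRD (expRN (ip u u / 2)) /gauss (qform_gram D kilE) /density !invfM; ring.
Qed.

Lemma integral_rV_E0 F : tame F -> integral_rV (fun b => (F b * gauss gramR b)%:E) = (E0 gramR F)%:E.
Proof.
move=> tF; rewrite (integral_rV_mur (tame_gauss_integrable gp tF)) /E0 /Rintegral fineK //.
exact/integrable_fin_num/(tame_integrable gp tF).
Qed.

Variables (V : rV -> rep g) (m : nat) (nu : 'I_m -> rV) (tau : 'I_m -> R) (eps : R^nat) (N : nat -> 'I_m -> nat).
Hypothesis hV : forall lam, dominant_int ip lam -> hwrep (V lam) lam.
Hypothesis nu_dom : forall k, dominant_int ip (nu k).
Hypotheses (eps_gt0 : forall n, 0 < eps n) (eps_cvg : eps n @[n --> \oo] --> 0).
Hypothesis NE : forall n k, tau k / eps n = (N n k)%:R.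
Let c k := ip (nu k) (nu k + 2 *: rho).
Variable x : R.
Hypotheses (x_gt0 : 0 < x) (xE : x = (\dim {:g})%:R^-1 * \sum_(k < m) tau k * c k).
Let delta n := Num.sqrt (eps n / x).
Definition bigtens (P : 'I_m -> nat) := \big[@tens_rep _ g/trivial_rep 1]_(k < m) tens_pow (V (nu k)) (P k).

Lemma delta_gt0 n : 0 < delta n.
Proof. by rewrite sqrtr_gt0 divr_gt0. Qed.

Lemma delta_cvg : delta n @[n --> \oo] --> 0.
Proof.
rewrite -[X in _ --> X](sqrtr0 R).
have e0 : eps n / x @[n --> \oo] --> 0.
  by rewrite -[X in _ --> X](mul0r x^-1); apply: cvgM => //; exact: cvg_cst.
exact: (cvg_comp _ _ e0 (@sqrt_continuous R 0)).
Qed.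

(** Here [N delta^2 = tau / x], and [weights_second_moment] supplies the variance in
    [cvg_mean_exp_pow]. *)
Lemma cvg_char_pow k s :
  (ch (V (nu k)) (delta n *: s) / (rdim (V (nu k)))%:R) ^+ N n k @[n --> \oo] -->
  expR (tau k * c k / (x * (\dim {:g})%:R) * (ip s s / 2)).
Proof.
have hX := hV (nu_dom k); have [[X0 _] [P [mu Pmu]] _] := hX.
have g0 : (\dim {:g})%:R != 0 :> R.
  by apply: contraTneq x_gt0 => g0; rewrite xE g0 invr0 mul0r ltxx.
have x0 : x != 0 by rewrite gt_eqF.
have d0 : (rdim (V (nu k)))%:R != 0 :> R by rewrite pnatr_eq0 -lt0n.
have := weights_second_moment D kilE eig hX s; rewrite (charsumE D _ Pmu) -/(c k) => m2.
rewrite (_ : _ * _ = tau k / x * (\sum_i ip (mu i) s ^+ 2) / (2 * (rdim (V (nu k)))%:R)); last first.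
  rewrite (_ : \sum_i _ = c k * ip s s * (rdim (V (nu k)))%:R / (\dim {:g})%:R); last by rewrite -m2 mulfK.
  by field; rewrite g0 x0 d0.
rewrite (_ : (fun n => _) = fun n => ((\sum_i expR (delta n * ip (mu i) s)) / (rdim (V (nu k)))%:R) ^+ N n k); last first.
  apply/funext => n; rewrite (charsumE D _ Pmu); congr ((_ / _) ^+ _).
  by apply: eq_bigr => i _; rewrite (ipZr D kilE).
apply: cvg_mean_exp_pow => //.
- by have := weights_first_moment D kilE hX s; rewrite (charsumE D _ Pmu).
- exact: delta_cvg.
rewrite (_ : (fun n => _) = fun=> tau k / x); first exact: cvg_cst.
apply/funext => n; rewrite sqr_sqrtr ?divr_ge0 ?(ltW x_gt0) ?(ltW (eps_gt0 n)) // -NE.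
by rewrite mulrA divfK // gt_eqF.
Qed.

Lemma bigtens_wtmod P : wtmod (bigtens P).
Proof.
apply: (wtmod_bigtens D) => k; apply: (wtmod_tens_pow D).
by have [] := hV (nu_dom k).
Qed.

Lemma bigtens_gt0 P : (0 < rdim (bigtens P))%N.
Proof.
rewrite /bigtens; elim: (index_enum _) => [|k l IH]; first by rewrite big_nil.
rewrite big_cons /= muln_gt0 IH andbT; elim: (P k) => [//|p IHp] /=.
by rewrite muln_gt0 IHp andbT; have [[]] := hV (nu_dom k).
Qed.

Lemma ch_bigtens P y : ch (bigtens P) y = \prod_(k < m) ch (V (nu k)) y ^+ P k.
Proof.
have wk k : wtmod (V (nu k)) by have [] := hV (nu_dom k).
rewrite (charsum_exp_bigtens D kilE) => [|k]; last exact: (wtmod_tens_pow D).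
by apply: eq_bigr => k _; rewrite (charsum_exp_tens_pow D kilE).
Qed.

(** The constant [x] is such that the exponents of the factors add up to [ip s s / 2]. Dividing by
    the dimensions keeps the limit finite; the same divisor occurs in numerator and denominator of
    the Laplace transform and cancels. *)
Lemma cvg_ch_bigtens s :
  ch (bigtens (N n)) (delta n *: s) / \prod_(k < m) (rdim (V (nu k)))%:R ^+ N n k @[n --> \oo] -->
  expR (ip s s / 2).
Proof.
have g0 : (\dim {:g})%:R != 0 :> R.
  by apply: contraTneq x_gt0 => g0; rewrite xE g0 invr0 mul0r ltxx.
rewrite (_ : (fun n => _) = fun n => \prod_(k < m) (ch (V (nu k)) (delta n *: s) / (rdim (V (nu k)))%:R) ^+ N n k);
  last first.
  apply/funext => n; rewrite ch_bigtens -prodf_div; apply: eq_bigr => k _.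
  by rewrite expr_div_n.
rewrite (_ : expR _ = \prod_(k < m) expR (tau k * c k / (x * (\dim {:g})%:R) * (ip s s / 2))).
  by apply: cvg_bigprod => k; exact: cvg_char_pow.
rewrite -expR_sum -mulr_suml -mulr_suml.
have -> : \sum_(k < m) tau k * c k = x * (\dim {:g})%:R by rewrite xE mulrC mulrA mulfV ?mul1r.
by rewrite mulfV ?mul1r // mulf_neq0 // gt_eqF.
Qed.

Theorem cvg_char_measure u (h : rV -> R) C : strict ip u ->
  (forall z e, dom ip z -> 0 < e ->
    exists2 d, 0 < d & forall y, dom ip y -> coord_near d z y -> `|h z - h y| <= e) ->
  (forall z, dom ip z -> `|h z| <= C) ->
  (\sum_(lam \in [set lam | dominant_int ip lam /\ multiplicity (V lam) (bigtens (N n)) != 0%N])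
      h (delta n *: lam) *
      ((multiplicity (V lam) (bigtens (N n)))%:R * ch (V lam) (delta n *: u) /
        \prod_(k < m) ch (V (nu k)) (delta n *: u) ^+ N n k))%:E
    @[n --> \oo] -->
  integral_rV (fun b => (h b * gauss_density u b * \1_(dom ip) b)%:E).
Proof.
move=> su hc hC.
pose L n := projT1 (cid (multiplicity_list D kilE hV (bigtens_wtmod (N n)))).
have LP n : [/\ {in L n, forall lam, dominant_int ip lam},
      forall lam, dominant_int ip lam -> multiplicity (V lam) (bigtens (N n)) = count_mem lam (L n) &
      forall F, charsum (bigtens (N n)) (Dop proots F) = \sum_(lam <- L n) altsum ip F (lam + rho)].
  by rewrite /L; case: cid.
have LD n : {in L n, forall lam, dominant_int ip lam} by have [] := LP n.
have LC n F : charsum (bigtens (N n)) (Dop proots F) = \sum_(lam <- L n) altsum ip F (lam + rho).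
  by have [] := LP n.
have c0 n : \prod_(k < m) (rdim (V (nu k)))%:R ^+ N n k != 0 :> R.
  apply/prodf_neq0 => k _; rewrite expf_neq0 // pnatr_eq0 -lt0n.
  by have [[]] := hV (nu_dom k).
have := cvg_chamber_sum D kilE hV (fun n => bigtens_wtmod (N n)) delta_gt0 delta_cvg su c0 cvg_ch_bigtens
  LD LC (fun n => bigtens_gt0 (N n)) hc hC.
set lim := (X in _ --> X -> _) => cv.
have -> : integral_rV (fun b => (h b * gauss_density u b * \1_(dom ip) b)%:E) = lim%:E.
  (* On the chamber [domv] is the identity and off it the indicator vanishes, so [h] may be replaced
     by its extension, which is continuous everywhere. *)
  pose F b := (Zg gramR * root_prod u * expR (ip u u / 2))^-1 *
    (density u b * h (domv ip b) * \1_(dom ip) b).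
  have tf : tame (h \o domv ip).
    apply: (tame_continuous (c := C)); first exact: (ccont_domv D kilE hc).
    by move=> b; apply: hC; have [_ [_ _ ?]] := domvP D kilE b.
  have tG : tame (fun b => density u b * h (domv ip b) * \1_(dom ip) b).
    apply: tameM; last exact: (tame_dom D kilE).
    by apply: tameM => //; exact: (tame_density D kilE).
  transitivity (integral_rV (fun b => (F b * gauss gramR b)%:E)).
    congr integral_rV; apply/funext => b; congr (_%:E); rewrite gauss_densityE /F.
    have [db|ndb] := pselect (dom ip b); first by rewrite (domv_id D kilE db); ring.
    by rewrite indicE memNset // !mulr0 mul0r.
  rewrite integral_rV_E0 /F; last exact: tameZ.
  congr (_%:E); rewrite /lim.
  have := E0_sum D kilE [:: tt] (fun=> (Zg gramR * root_prod u * expR (ip u u / 2))^-1) (fun=> tG).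
  rewrite big_seq1 => <-; congr E0; apply/funext => b; by rewrite big_seq1.
apply: cvg_EFin; first by apply: nearW.
rewrite (_ : _ \o _ = fun n => \sum_(lam <- L n) h (delta n *: lam) *
  (ch (V lam) (delta n *: u) / ch (bigtens (N n)) (delta n *: u))) //.
apply/funext => n /=; rewrite -ch_bigtens.
(* The list sum is grouped by weight, and the number of repetitions is the multiplicity. *)
rewrite -[RHS](big_undup_iterop_count _ (L n)) (fsbig_seq _ _ (undup_uniq _)).
rewrite (_ : [set lam | _] = [set` undup (L n)]); last first.
  apply/seteqP; split => lam /=; rewrite mem_undup.
    by move=> [dl]; have [_ -> // _] := LP n; rewrite -has_pred1 has_count lt0n.
  move=> lL; have dl := LD n _ lL; split=> //; have [_ -> // _] := LP n.
  by rewrite -lt0n -has_count has_pred1.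
apply: eq_fsbigr => lam; rewrite inE /= mem_undup => lL.
have [_ mult _] := LP n; rewrite (mult _ (LD n _ lL)).
by rewrite -[RHS]/(_ *+ count_mem lam (L n)) -mulr_natl; ring.
Qed.

End TensorLimit.

Lemma within_continuous_coord_near (R : realType) r (A : set 'rV[R]_r) (f : 'rV[R]_r -> R) :
  {within A, continuous f} -> forall x e, A x -> 0 < e ->
  exists2 d, 0 < d & forall y, A y -> coord_near d x y -> `|f x - f y| <= e.
Proof.
move=> /subspace_continuousP cf x e Ax e0.
have /cvgrPdist_le /(_ e e0) := cf x Ax.
move=> /nbhs_ballP[d /= d0 dP]; exists (d / 2); first by rewrite divr_gt0.
move=> y Ay xy; apply: dP => //; split=> // i j; rewrite (ord1 i).
rewrite /ball /= ; apply: le_lt_trans (xy j) _.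
by rewrite ltr_pdivrMr // ltr_pMr // ltr1n.
Qed.

Section ComplexInstance.
Variables (R : realType) (g : lieAlgType R[i]) (H : {vspace g}) (r : nat) (a : r.-tuple g).
Hypotheses (simp : simple_lie g) (cart : cartan_subalgebra H) (sroots : simple_roots H a).
Let iota : {rmorphism R -> R[i]} := real_complex R.
Let ip := ip a.

Lemma complex_cartan_data : cartan_data H a iota (rvec a).
Proof.
split=> //.
- move=> b c; rewrite /rvec -big_split; apply: eq_bigr => i _ /=.
  by rewrite mxE rmorphD scalerDl.
- move=> x b; rewrite /rvec scaler_sumr; apply: eq_bigr => i _ /=.
  by rewrite mxE rmorphM scalerA.
move=> i; rewrite /rvec (bigD1 i) //= big1 => [|j ji]; last first.
  by rewrite !mxE (negPf ji) andbF scale0r.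
by rewrite !mxE !eqxx scale1r addr0.
Qed.
Let D := complex_cartan_data.

(** Taking the real part loses nothing, by [killing_real]. *)
Lemma complex_killing b c : killing (rvec a b) (rvec a c) = iota (ip b c).
Proof. by rewrite /ip /Defs.ip; have [q ->] := killing_real D b c. Qed.
Let kilE := complex_killing.

Lemma complex_hwrep X lam : irreducible_hw H a X lam -> hwrep H (rvec a) X lam.
Proof.
move=> [irr [v [v0 vw vp]]].
have vs : singular H (rvec a) (M := X) lam v.
  split=> // b x /(mem_proots D) bp bx; exact: (vp b).
by split=> //; [exact: (singular_wtmod D kilE irr vs)|exists v].
Qed.

Lemma complex_casimir_scalar X lam : hwrep H (rvec a) X lam ->
  casimir_scalar X = ip lam (lam + 2 *: rho H (rvec a)).
Proof.
move=> hX; have [[X0 _] _ _] := hX.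
have cE := hwrep_casimir D kilE hX.
have := xgetPex 0 (P := [set c : R | casimir_mx X = (c%:C)%:M]) (ex_intro _ _ cE).
rewrite -/(casimir_scalar X) /= cE => /matrixP/(_ (Ordinal X0) (Ordinal X0)).
by rewrite !mxE eqxx !mulr1n => -[].
Qed.

End ComplexInstance.

Theorem theorem4 (R : realType) (g : lieAlgType R[i]) (H : {vspace g})
    (r : nat) (a : r.-tuple g)
    (V : 'rV[R]_r -> rep g)
    (m : nat) (nu : 'I_m -> 'rV[R]_r) (tau : 'I_m -> R)
    (u : 'rV[R]_r) (h : 'rV[R]_r -> R)
    (eps : nat -> R) (N : nat -> 'I_m -> nat) :
  simple_lie g ->
  cartan_subalgebra H ->
  simple_roots H a ->
  (forall lam, dominant_integral a lam -> irreducible_hw H a (V lam) lam) ->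
  (forall k, dominant_integral a (nu k)) ->
  (forall k, 0 <= tau k) ->
  (exists k, 0 < tau k /\ nu k != 0) ->
  dominant a u -> regular a u ->
  {within dominant a, continuous h} ->
  (exists C : R, forall b, dominant a b -> `|h b| <= C) ->
  (forall n, 0 < eps n) ->
  eps n @[n --> \oo] --> (0 : R) ->
  (forall n k, tau k / eps n = (N n k)%:R) ->
  let x := casimir_mean V nu tau in
  (\sum_(lam \in components a V nu (N n))
      h (Num.sqrt (eps n / x) *: lam)
      * char_measure H a V nu (N n) lam (Num.sqrt (eps n / x) *: u))%:E
    @[n --> \oo]
  --> integral_rV (fun b => (h b * limit_density H a b u
                              * \1_(dominant a) b)%:E).
Proof.
move=> simp cart sroots hirr nud tau0 [k0 [tk0 nk0]] du ru ch [C hC] eps0 epsc NE x.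
have D := complex_cartan_data simp cart sroots.
have kilE := complex_killing simp cart sroots.
have hV lam : dominant_int (ip a) lam -> hwrep H (rvec a) (V lam) lam.
  by move=> dl; exact: (complex_hwrep simp cart sroots (hirr lam dl)).
have eig := @eigenvalue_closed R[i].
pose c k := ip a (nu k) (nu k + 2 *: rho H (rvec a)).
have xE : x = (\dim {:g})%:R^-1 * \sum_(k < m) tau k * c k.
  rewrite /x /casimir_mean; congr (_ * _); apply: eq_bigr => k _; congr (_ * _).
  exact: (complex_casimir_scalar simp cart sroots (hV _ (nud k))).
(* Positivity comes from the index [k0], whose Casimir value is positive since [nu k0] is nonzero;
   the other terms are nonnegative. *)
have x0 : 0 < x.
  have [[y [z yz]] _] := simp.
  rewrite xE mulr_gt0 //.
    rewrite invr_gt0 ltr0n lt0n dimv_eq0; apply: contraNneq yz => g0.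
    have : y \in {:g}%VS by exact: memvf.
    by rewrite g0 memv0 => /eqP ->; rewrite lie0l.
  rewrite (bigD1 k0) //= ltr_pwDl //.
    by rewrite mulr_gt0 // (casimir_gt0 D kilE (hV _ (nud k0))).
  apply: sumr_ge0 => k _; rewrite mulr_ge0 //.
  exact: (casimir_ge0 D kilE (hV _ (nud k))).
have su : strict (ip a) u by apply: (regular_strict D kilE du) => w; exact: ru.
exact: (cvg_char_measure D kilE eig hV nud eps0 epsc NE x0 xE su (within_continuous_coord_near ch) hC).
Qed.
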